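(* There exists $p_0\in(1,2)$ such that for every $p$ with $p_0<p<\infty$ there exists a constant $C_p>0$, depending only on $p$ (and on the fixed bump function $\phi_0$ used to define $P_k$), such that for every measurable function $u:\mathbb{R}\to\mathbb{R}$ and every $k\in\mathbb{Z}$ the following two estimates hold: $$\left\|\mathcal{M}^u(P_k f)\right\|_{L^p(\mathbb{R}^2)}\le C_p\,\|f\|_{L^p(\mathbb{R}^2)}\quad\text{for all } f\in L^p(\mathbb{R}^2),$$ and $$\left\|\mathcal{H}^u(P_k f)\right\|_{L^p(\mathbb{R}^2)}\le C_p\,\|f\|_{L^p(\mathbb{R}^2)}\quad\text{for all Schwartz functions } f \text{ on }\mathbb{R}^2.$$ (By density, the second estimate says that $\mathcal{H}^u\circ P_k$ extends to a bounded operator on $L^p(\mathbb{R}^2)$ with norm at most $C_p$.)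
   Context: For a measurable function $u:\mathbb{R}\to\mathbb{R}$ (a function of the first variable $x$ only), the maximal operator and the Hilbert transform along the variable parabolas $(t,u(x)t^2)$ are defined, for functions $g$ on $\mathbb{R}^2$, by $$\mathcal{M}^u g(x,y):=\sup_{j\in\mathbb{Z}}\frac{1}{2^j}\left|\int_{-2^j}^{2^j} g\big(x-t,\;y-u(x)\,t^2\big)\,dt\right|,$$ $$\mathcal{H}^u g(x,y):=\mathrm{p.v.}\int_{\mathbb{R}} g\big(x-t,\;y-u(x)\,t^2\big)\,\frac{dt}{t},$$ where $\mathrm{p.v.}$ denotes the principal value at $t=0$ (the limit as $\varepsilon\to0^+$ of the integral over $|t|>\varepsilon$). Fix a smooth function $\phi_0:\mathbb{R}\to\mathbb{R}$ supported on $[-5/2,-1/2]\cup[1/2,5/2]$ with $\phi_0(t)=1$ for all $t\in[-2,-1]\cup[1,2]$. For $k\in\mathbb{Z}$, $P_k$ denotes the Littlewood-Paley projection in the second variable, i.e. the Fourier multiplier operator acting in $y$ with multiplier $\eta\mapsto\phi_0(2^{-k}\eta)$: $$P_k f(x,y):=\int_{\mathbb{R}} f(x,y-t)\,K_k(t)\,dt,\qquad K_k(t):=\frac{1}{2\pi}\int_{\mathbb{R}}\phi_0(2^{-k}\eta)\,e^{i\eta t}\,d\eta .$$ *)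

(* Defs.v *)
From HB Require Import structures.
From mathcomp Require Import all_boot all_order all_algebra complex.
From mathcomp Require Import all_classical all_reals all_analysis.
From mathcomp Require Import measurable_realfun.

Set Implicit Arguments.
Unset Strict Implicit.
Unset Printing Implicit Defensive.

Import Order.TTheory GRing.Theory Num.Theory.
Import numFieldNormedType.Exports.

Local Open Scope classical_set_scope.
Local Open Scope ring_scope.
Local Open Scope complex_scope.

(* Functions on the plane are complex-valued: as phi0 is not assumed to be
   even, the kernel K_k need not be real-valued. *)

Notation leb1 R := (@lebesgue_measure R).
Notation leb2 R := (@lebesgue_measure R \x @lebesgue_measure R)%E.

(* lebesgue_measure lives on the Borel sigma-algebra; Lebesgue measurability is
   measurability for the completion. The library integral, being a supremum over
   simple functions below the integrand, agrees with the Lebesgue integral on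
   such functions. *)
Definition lebesgue_measurable d (T : measurableType d) (R : realType)
    (mu : {measure set T -> \bar R}) (f : T -> R) : Prop :=
  measurable_fun [set: g_sigma_algebraType (completed_algebra_gen mu)]
    (f : g_sigma_algebraType (completed_algebra_gen mu) -> R).

Definition cabs (R : realType) (z : R[i]) : R := ComplexField.Normc.normc z.

Definition cintegral (R : realType) (D : set R) (f : R -> R[i]) : R[i] :=
  Rintegral (leb1 R) D (fun t => complex.Re (f t))
  +i* Rintegral (leb1 R) D (fun t => complex.Im (f t)).

Definition expi (R : realType) (t : R) : R[i] := cos t +i* sin t.

Definition Lpnorm2 (R : realType) (p : R) (f : R * R -> R[i]) : \bar R :=
  'N[leb2 R]_(p%:E)[EFin \o (@cabs R \o f)]%E.

Definition in_Lp2 (R : realType) (p : R) (f : R * R -> R[i]) : Prop :=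
  [/\ lebesgue_measurable (leb2 R) (fun z => complex.Re (f z)),
      lebesgue_measurable (leb2 R) (fun z => complex.Im (f z)) &
      (Lpnorm2 p f < +oo)%E].

Definition smooth1 (R : realType) (f : R -> R) : Prop :=
  forall n x, derivable (derive1n n f) x 1.

(* partial derivative: in the first variable if b = false, in the second if
   b = true *)
Definition partial (R : realType) (b : bool) (f : R * R -> R) : R * R -> R :=
  fun z => derive f z (if b then (0, 1) else (1, 0)).

Definition iter_partial (R : realType) (s : seq bool) (f : R * R -> R) :
    R * R -> R :=
  foldr (@partial R) f s.

Definition smooth2 (R : realType) (f : R * R -> R) : Prop :=
  forall s : seq bool,
    continuous (iter_partial s f) /\
    forall z, derivable (iter_partial s f) z (1, 0) /\
              derivable (iter_partial s f) z (0, 1).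

Definition schwartz_real (R : realType) (f : R * R -> R) : Prop :=
  smooth2 f /\
  forall (a b : nat) (s : seq bool), exists C : R, forall z : R * R,
    `|z.1 ^+ a * z.2 ^+ b * iter_partial s f z| <= C.

Definition schwartz (R : realType) (f : R * R -> R[i]) : Prop :=
  schwartz_real (fun z => complex.Re (f z)) /\
  schwartz_real (fun z => complex.Im (f z)).

Definition LPbump (R : realType) (phi0 : R -> R) : Prop :=
  [/\ smooth1 phi0,
      closure [set t | phi0 t != 0] `<=`
        `[- (5 / 2), - (1 / 2)] `|` `[1 / 2, 5 / 2] &
      forall t, (`[- 2, - 1] `|` `[1, 2]) t -> phi0 t = 1].

Definition LPkernel (R : realType) (phi0 : R -> R) (k : int) (t : R) : R[i] :=
  ((2 * pi)^-1)%:C *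
  cintegral setT (fun eta : R => (phi0 (2 ^ (- k) * eta))%:C * expi (eta * t)).

Definition LPproj (R : realType) (phi0 : R -> R) (k : int)
    (f : R * R -> R[i]) : R * R -> R[i] :=
  fun z => cintegral setT (fun t : R => f (z.1, z.2 - t) * LPkernel phi0 k t).

(* The supremum is taken in the extended reals, as it may be infinite. *)
Definition max_parabola (R : realType) (u : R -> R) (g : R * R -> R[i]) :
    R * R -> \bar R :=
  fun z => ereal_sup (range (fun j : int =>
    ((2 ^ j)^-1 *
     cabs (cintegral `[- (2 ^ j), 2 ^ j]
             (fun t : R => g (z.1 - t, z.2 - u z.1 * t ^+ 2))))%:E)).

Definition hilbert_trunc (R : realType) (u : R -> R) (g : R * R -> R[i])
    (z : R * R) (eps : R) : R[i] :=
  cintegral [set t : R | eps < `|t|]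
    (fun t : R => g (z.1 - t, z.2 - u z.1 * t ^+ 2) * (t^-1)%:C).

Definition hilbert_parabola (R : realType) (u : R -> R) (g : R * R -> R[i]) :
    R * R -> R[i] :=
  fun z =>
    lim (complex.Re (hilbert_trunc u g z eps) @[eps --> (0 : R)^'+])
    +i* lim (complex.Im (hilbert_trunc u g z eps) @[eps --> (0 : R)^'+]).

(* Main.v *)
Require Import Defs.
From HB Require Import structures.
From mathcomp Require Import all_boot all_order all_algebra complex.
From mathcomp Require Import all_classical all_reals all_analysis.
From mathcomp Require Import measurable_realfun lra ring.
Import Order.TTheory GRing.Theory Num.Theory.
Import numFieldNormedType.Exports.
Local Open Scope classical_set_scope.
Local Open Scope ring_scope.
Set Implicit Arguments.
Unset Strict Implicit.
Unset Printing Implicit Defensive.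

(** Fix the frequency scale s = 2^k. The real and imaginary parts K of the Littlewood-Paley kernel
    are dominated by the Poisson kernel [poissonk s], change by O(s|v|) times it under a shift v
    with s|v| <= 1, and, since phi0 vanishes near 0, have a primitive J that is smaller by a factor
    1/s ([LPkernel_regular]). Only these bounds are used afterwards, which makes every constant
    uniform in k; the function u enters only through its measurability.

    The core object is [Top K r al f]: the average of f along the parabola with coefficient al(x)
    over 0 < t / r(x) < 1, smoothed by K in the second variable. Suppose s |al(x)| r(x)^2 >= lam >=
    1. In T T* the kernel linking the vertical lines over x and x' is a convolution in y. Its L1
    norm is estimated by integrating by parts with J against the difference of two parabolas, a
    phase whose derivative is affine ([pair_estimate]). With eps = lam^(-1/3) the outcome is
    |r(x)|^(-1) times eps on a ball of radius 2 |r(x)| plus 1 on a ball of radius 3 eps |r(x)|, and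
    the Hardy-Littlewood maximal theorem in x turns this into a bound O(eps) for T T* on L2
    ([Top_L2]). For p > 2 one interpolates with the trivial sup bound. For p < 2 one interpolates
    with an L^(3/2) bound of polynomial growth in lam, which comes from dominating [Top] by a
    maximal function in x of a Poisson mean in y ([Top_growth]). Near p = 2 the decay wins, so
    [Top_Lp] gives a negative power of lam for all p > 199/100.

    Maximal operator. At a given x, all radii 2^j with s |u(x)| 4^j < 4 are controlled at once by
    the maximal function. The remaining ones are numbered by l, with lam = 4^(l+1), and the p-th
    powers are summable in l ([max_nice]).

    Hilbert transform. Cut at rho(x) = (s |u(x)|)^(-1/2). Beyond rho(x), integration against dt/t is
    a superposition in dr/r of averages of radius r rho(x), for which lam = r^2 ([large_Lp]). Below
    rho(x) the parabola is replaced by a horizontal line at the cost of a maximal function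
    ([para_err_bound]), and what remains is a truncated Hilbert transform in x whose truncation may
    depend on x ([hilb_trunc_Lp]). This last bound is classical and is proved from the conjugate
    Poisson integral: with F = U + iV analytic in the upper half-plane, Cauchy's theorem for F^2 and
    for F^2 / (F + a) gives the L2 and the weak L1 bound, interpolation and duality give Lp, and a
    comparison between heights (Cotlar's inequality) passes to maximal truncations.

    The estimates are first proved for Borel functions, mostly bounded and integrable ones. Fatou's
    lemma extends the maximal bound to Lp and passes to the principal value, Borel versions off null
    sets handle Lebesgue measurability, and a complex f splits into four real operators. *)

Local Notation measT := (measurable_fun setT).

(** * Integration of nonnegative functions and measurability *)

(** The integral of a nonnegative function is a supremum over the simple functions below it, so
    enlarging the integrand enlarges the index set. Stated for arbitrary integrands, it serves for
    functions whose measurability has not been examined. *)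
Lemma le_int0 d (T : measurableType d) (R : realType)
  (mu : {measure set T -> \bar R}) (D : set T) (f g : T -> \bar R) :
  (forall x, D x -> (0 <= f x)%E) -> (forall x, D x -> (f x <= g x)%E) ->
  (\int[mu]_(x in D) f x <= \int[mu]_(x in D) g x)%E.
Proof.
move=> f0 fg.
have g0 x : D x -> (0 <= g x)%E by move=> Dx; exact: le_trans (f0 _ Dx) (fg _ Dx).
rewrite !ge0_integralE//.
apply: le_ereal_sup => _ [h hf <-]; exists h => // x.
apply: le_trans (hf x) _; rewrite !patchE; case: ifPn => //; rewrite inE => /fg //.
Qed.

Section Homogeneity.
Import HBNNSimple.

(** Scaling the simple functions below gives one inequality, applied with [c] and with its inverse.
    In the signed case both parts scale by the same factor, infinite values included. *)
Lemma intZ d (T : measurableType d) (R : realType) (nu : {measure set T -> \bar R}) (D : set T)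
    (f : T -> \bar R) (c : R) : 0 <= c -> (\int[nu]_(x in D) (c%:E * f x) = c%:E * \int[nu]_(x in D) f x)%E.
Proof.
rewrite le_eqVlt => /predU1P[<-|c0].
  by rewrite mul0e; under eq_integral do rewrite mul0e; exact: integral0.
have le (b : R) (g : T -> \bar R) : 0 < b -> (forall x, 0 <= g x)%E ->
    (b%:E * \int[nu]_x g x <= \int[nu]_x (b%:E * g x))%E.
  move=> b0 g0; rewrite muleC -lee_pdivlMr// ge0_integralTE//.
  apply: ge_ereal_sup => _ [h hg <-]; rewrite lee_pdivlMr// muleC -integralT_nnsfun.
  have mh : measT (EFin \o h) by apply/measurable_EFinP; exact: measurable_funPT.
  have h0 x : setT x -> (0 <= (EFin \o h) x)%E by move=> _; rewrite lee_fin; exact: fun_ge0.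
  rewrite -(ge0_integralZl_EFin nu measurableT h0 mh (ltW b0)).
  apply: le_int0 => x _; first by rewrite mule_ge0 ?lee_fin// ltW.
  by rewrite lee_pmul2l//; exact: hg.
have eqZ (g : T -> \bar R) : (forall x, 0 <= g x)%E -> (\int[nu]_x (c%:E * g x) = c%:E * \int[nu]_x g x)%E.
  move=> g0; apply/eqP; rewrite eq_le le// andbT.
  have cg0 x : (0 <= c%:E * g x)%E by rewrite mule_ge0// lee_fin ltW.
  have ci0 : 0 < c^-1 by rewrite invr_gt0.
  have := le _ _ ci0 cg0; rewrite muleC lee_pdivrMr// muleC => h.
  apply: le_trans h _; apply: lee_wpmul2l; first by rewrite lee_fin ltW.
  apply: le_int0 => x _; first by rewrite mule_ge0// lee_fin invr_ge0 ltW.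
  by rewrite muleA -EFinM mulVf ?gt_eqF// mul1e.
rewrite [LHS]integral_mkcond [in RHS]integral_mkcond.
rewrite (_ : _ \_ D = (fun x => c%:E * (f \_ D) x)%E); last first.
  by apply/funext => x; rewrite !patchE; case: ifPn => //; rewrite mule0.
rewrite integralE [in RHS]integralE ge0_funeposM ?(ltW c0)// ge0_funenegM ?(ltW c0)// !eqZ//.
have c1 : (0 < c%:E)%E by rewrite lte_fin.
move: (integral _ _ _) (integral _ _ _) => [a||] [b||] //=; rewrite ?(gt0_muley c1) ?(gt0_muleNy c1)//.
by rewrite -EFinM -!EFinD -EFinM mulrDr mulrN.
Qed.

End Homogeneity.

Ltac int_ge0 := apply: integral_ge0 => ? _; rewrite lee_fin;
  first [exact: sqr_ge0 | exact: powR_ge0 | by rewrite mulr_ge0// ?powR_ge0].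

Lemma measurable_invr (R : realType) : measurable_fun [set: R] (@GRing.inv R).
Proof.
rewrite (_ : @GRing.inv R = fun x : R => x * ((x ^+ 2) `^ (-1))); last first.
  apply/funext => x; rewrite powR_inv1 ?sqr_ge0//.
  have [->|x0] := eqVneq x 0; first by rewrite invr0 mul0r.
  by rewrite expr2 invfM mulrA divff// mul1r.
apply: measurable_funM => //.
by apply: (measurableT_comp (@measurable_powR R (-1)) (@exprn_measurable R setT 2)).
Qed.

Lemma measurable_fine_fun d (T : measurableType d) (R : realType) (f : T -> \bar R) :
  measT f -> measT (fun x => fine (f x)).
Proof.
by move=> mf; apply: (measurableT_comp (f := fine)) => //; exact: fine_measurable.
Qed.

Ltac meas1 := match goal with
 | |- measurable_fun _ _ => assumption
 | |- forall _, _ => intro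
 | |- measurable_fun _ (fun x => x) => exact: measurable_id
 | |- measurable_fun _ (fun x => ?c) => exact: measurable_cst
 | |- measurable_fun _ (@cst _ _ _) => exact: measurable_cst
 | |- measurable_fun _ fst => exact: measurable_fst
 | |- measurable_fun _ snd => exact: measurable_snd
 | |- measurable_fun _ EFin => exact: EFin_measurable
 | |- measurable_fun _ (EFin \o _) => apply/measurable_EFinP
 | |- measurable_fun _ (fun x => fst (@?g x)) => refine (@measurableT_comp _ _ _ _ _ _ _ _ g (@measurable_fst _ _ _ _) _); cbn beta
 | |- measurable_fun _ (fun x => snd (@?g x)) => refine (@measurableT_comp _ _ _ _ _ _ _ _ g (@measurable_snd _ _ _ _) _); cbn beta
 | |- measurable_fun _ (fun x => (_ , _)) => apply: measurable_fun_pair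
 | |- measurable_fun _ (fun x => EFin (@?g x)) => apply/measurable_EFinP; cbn beta
 | |- measurable_fun _ (fun x => (_ + _)%E) => apply: emeasurable_funD
 | |- measurable_fun _ (fun x => (_ * _)%E) => apply: emeasurable_funM
 | |- measurable_fun _ (fun x => _ + _) => apply: measurable_funD
 | |- measurable_fun _ (fun x => _ * _) => apply: measurable_funM
 | |- measurable_fun _ (fun x => - (@?g x)) => refine (@measurableT_comp _ _ _ _ _ _ _ _ g (oppr_measurable (D:=setT)) _); cbn beta
 | |- measurable_fun _ (fun x => (@?g x)^-1) => refine (@measurableT_comp _ _ _ _ _ _ _ _ g (@measurable_invr _) _); cbn beta
 | |- measurable_fun _ (fun x => (@?g x) `^ ?p) => refine (@measurableT_comp _ _ _ _ _ _ _ _ g (@measurable_powR _ p) _); cbn beta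
 | |- measurable_fun _ (fun x => ((@?g x) `^ ?p)%E) => refine (@measurableT_comp _ _ _ _ _ _ _ _ g (@measurable_poweR _ p) _); cbn beta
 | |- measurable_fun _ (fun x => (@?g x) ^+ _) => apply: (@measurable_funX _ _ _ _ g); cbn beta
 | |- measurable_fun _ (fun x => Num.Def.normr (@?g x)) => refine (@measurableT_comp _ _ _ _ _ _ _ _ g (normr_measurable (D:=setT)) _); cbn beta
 | |- measurable_fun _ (fun x => `|(@?g x)|%E) => refine (@measurableT_comp _ _ _ _ _ _ _ _ g (abse_measurable (D:=setT)) _); cbn beta
 | |- measurable_fun _ (fun x => fine (@?g x)) => apply: measurable_fine_fun
 | |- measurable_fun _ (fun x => if _ then _ else _) => apply: measurable_fun_ifT
 | |- measurable_fun _ (fun x => _ && _) => apply: measurable_and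
 | |- measurable_fun _ (fun x => _ || _) => apply: measurable_or
 | |- measurable_fun _ (fun x => ~~ _) => apply: measurable_neg
 | |- measurable_fun _ (fun x => (_ < _)%R) => apply: measurable_fun_ltr
 | |- measurable_fun _ (fun x => (_ <= _)%R) => apply: measurable_fun_ler
 | |- measurable_fun _ (fun x => (_ == _ :> Real.sort _)) => apply: measurable_fun_eqr
 | |- measurable_fun _ (fun x => Order.max _ _) => apply: measurable_maxr
 | |- measurable_fun _ (fun x => Order.min _ _) => apply: measurable_minr
 | H : measurable_fun _ ?f |- measurable_fun _ (fun x => ?f (@?g x)) => refine (@measurableT_comp _ _ _ _ _ _ _ _ g H _); cbn beta
 end.
Ltac meas2 := first [ meas1 | apply: measurable_fun_ltr | apply: measurable_fun_ler
 | apply: measurable_fun_eqr | exact: mulrl_measurable | apply: measurable_funM | apply: measurable_and | apply: measurable_or ].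
Ltac meas := repeat meas2.

Lemma meas_int d1 d2 (X : measurableType d1) (Y : measurableType d2)
  (R : realType) (nu : {sigma_finite_measure set Y -> \bar R})
  (F : X -> Y -> \bar R) :
  measT (fun z : X * Y => F z.1 z.2) -> (forall x y, (0 <= F x y)%E) ->
  measT (fun x => \int[nu]_y F x y)%E.
Proof.
move=> mF F0.
exact: (@measurable_fun_fubini_tonelli_F _ _ X Y R nu (fun z => F z.1 z.2)).
Qed.

Lemma meas_Rint d1 d2 (X : measurableType d1) (Y : measurableType d2)
  (R : realType) (nu : {sigma_finite_measure set Y -> \bar R})
  (F : X -> Y -> R) :
  measT (fun z : X * Y => F z.1 z.2) ->
  measT (fun x => \int[nu]_y F x y).
Proof.
move=> mF; rewrite /Rintegral; apply: measurable_fine_fun.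
under eq_fun do rewrite integralE.
apply: emeasurable_funB; apply: meas_int => //.
- under eq_fun do rewrite funeposE; apply: measurable_maxe => //.
  exact/measurable_EFinP.
- under eq_fun do rewrite funenegE; apply: measurable_maxe => //.
  by apply: measurableT_comp => //; exact/measurable_EFinP.
Qed.

Lemma tonelli d1 d2 (X : measurableType d1) (Y : measurableType d2)
  (R : realType) (mu : {sigma_finite_measure set X -> \bar R})
  (nu : {sigma_finite_measure set Y -> \bar R})
  (F : X -> Y -> \bar R) :
  measT (fun z : X * Y => F z.1 z.2) -> (forall x y, (0 <= F x y)%E) ->
  (\int[mu]_x \int[nu]_y F x y = \int[nu]_y \int[mu]_x F x y)%E.
Proof.
move=> mF F0.
exact: (@fubini_tonelli _ _ X Y R mu nu (fun z => F z.1 z.2)).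
Qed.

(** * Change of variables and explicit integrals on the line *)

(** Lebesgue measure is determined by its values on half-open intervals, and |a| times its image
    under x -> a x + b has the same values. For a < 0 the preimage is half-open at the other end,
    which does not change its length. *)
Lemma ge0_integral_affine (R : realType) (a b : R) (f : R -> \bar R) : a != 0 ->
  measT f -> (forall x, (0 <= f x)%E) ->
  (\int[leb1 R]_x f (a * x + b)%R
    = (`|a|^-1)%:E * \int[leb1 R]_x f x)%E.
Proof.
move=> a0 mf f0.
have mphi : measT (fun x : R => a * x + b) by meas.
have k0 : 0 <= `|a| by [].
pose phi : R -> measurableTypeR R := fun x : R => a * x + b.
have mphi' : measurable_fun [set: measurableTypeR R] phi by [].
pose nu' := mscale (NngNum k0) (pushforward (leb1 R) phi).
pose nu := nu' mphi'.
have nuE : forall A, measurable A -> leb1 R A = nu A.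
  apply: lebesgue_measure_unique => X [[u v] _ <-].
  rewrite /nu /nu'/= /mscale/= /pushforward.
  have na0 : 0 < `|a| by rewrite normr_gt0.
  have [a_gt0|a_lt0|aE] := ltgtP a 0.
  - rewrite (_ : phi @^-1` _ = [set` Interval (BLeft ((v - b) / a)) (BLeft ((u - b) / a))]); last first.
      apply/seteqP; split=> x /=; rewrite !in_itv/= /phi -!ltrBlDr -!lerBrDr.
        by rewrite ler_ndivrMr// ltr_ndivlMr// mulrC => /andP[-> ->].
      by rewrite ler_ndivrMr// ltr_ndivlMr// mulrC => /andP[-> ->].
    rewrite !lebesgue_measure_itv/= !lte_fin.
    rewrite ltr_nM2r ?invr_lt0// ltrD2r.
    case: ifPn => _; last by rewrite mule0.
    rewrite -!EFinD -EFinM ltr0_norm//; congr EFin; field.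
    by rewrite lt_eqF.
  - rewrite (_ : phi @^-1` _ = [set` Interval (BRight ((u - b) / a)) (BRight ((v - b) / a))]); last first.
      apply/seteqP; split=> x /=; rewrite !in_itv/= /phi -!ltrBlDr -!lerBrDr.
        by rewrite ler_pdivlMr// ltr_pdivrMr// mulrC => /andP[-> ->].
      by rewrite ler_pdivlMr// ltr_pdivrMr// mulrC => /andP[-> ->].
    rewrite !lebesgue_measure_itv/= !lte_fin.
    rewrite ltr_pM2r ?invr_gt0// ltrD2r.
    case: ifPn => _; last by rewrite mule0.
    rewrite -!EFinD -EFinM gtr0_norm//; congr EFin; field.
    by rewrite gt_eqF.
  - by rewrite aE eqxx in a0.
have -> : (\int[leb1 R]_x f x = `|a|%:E * \int[leb1 R]_x f (a * x + b)%R)%E.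
  transitivity (\int[nu]_x f x)%E.
    apply: eq_measure_integral => A mA _; exact: nuE.
  rewrite ge0_integral_mscale//=.
  by rewrite (ge0_integral_pushforward mphi').
by rewrite muleA -EFinM mulVf ?mul1e// normr_eq0.
Qed.

Lemma FTC_is_derive (R : realType) (f F : R -> R) (a b : R) : a <= b ->
  (forall x, a <= x <= b -> is_derive x (1:R) F (f x)) ->
  (forall x, a <= x <= b -> {for x, continuous f}) ->
  (\int[leb1 R]_(x in `[a, b]) (f x)%:E = (F b - F a)%:E)%E.
Proof.
rewrite le_eqVlt => /predU1P[<-|ab] dF cf.
  by rewrite set_itv1 integral_set1 subrr.
have cF x : a <= x <= b -> {for x, continuous F}.
  by move=> xab; apply/differentiable_continuous/derivable1_diffP; apply: @ex_derive; exact: dF.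
rewrite EFinB (@continuous_FTC2 _ f F)//.
- apply: continuous_in_subspaceT => x /[!inE]/= xab.
  by apply: cf; move: xab; rewrite in_itv.
- split => //.
  + move=> x xab; apply: @ex_derive; apply: dF.
    by move: xab; rewrite in_itv/= => /andP[/ltW -> /ltW ->].
  + by apply: cvg_at_right_filter; apply: cF; rewrite lexx ltW.
  + by apply: cvg_at_left_filter; apply: cF; rewrite lexx ltW.
- move=> x xab; rewrite derive1E; apply: @derive_val; apply: dF.
  by move: xab; rewrite in_itv/= => /andP[/ltW -> /ltW ->].
Qed.

Lemma FTC_is_derivey (R : realType) (f F : R -> R) (a l : R) :
  (forall x, a <= x -> 0 <= f x) ->
  (forall x, a <= x -> is_derive x (1:R) F (f x)) ->
  (forall x, a <= x -> {for x, continuous f}) ->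
  F x @[x --> +oo%R] --> l ->
  (\int[leb1 R]_(x in `[a, +oo[) (f x)%:E = (l - F a)%:E)%E.
Proof.
move=> f0 dF cf Fl.
rewrite EFinB (@ge0_continuous_FTC2y _ f F a l)//.
- apply: continuous_in_subspaceT => x /[!inE]/= xab.
  by apply: cf; move: xab; rewrite in_itv/= andbT.
- by move=> x /ltW ax; apply: @ex_derive; exact: dF.
- apply: cvg_at_right_filter; apply/differentiable_continuous/derivable1_diffP.
  by apply: @ex_derive; exact: dF.
- move=> x; rewrite in_itv/= andbT => /ltW ax.
  by rewrite derive1E; apply: @derive_val; exact: dF.
Qed.

Lemma derivable_cont (R : realType) (f : R -> R) (x : R) :
  derivable f x 1 -> {for x, continuous f}.
Proof. by move=> df; apply/differentiable_continuous/derivable1_diffP. Qed.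

(** Together with [powR_inty], these are the integrals in the height a that Marcinkiewicz
    interpolation produces. The possible singularity at 0 is reached by exhausting ]0, c] with the
    intervals [c / (n + 1), c]. *)
Lemma powR_int0 (R : realType) (s c : R) : 0 < s -> 0 <= c ->
  (\int[leb1 R]_a (if (0 < a < c) then a `^ (s - 1) else 0)%:E
    = (c `^ s / s)%:E)%E.
Proof.
move=> s0; rewrite le_eqVlt => /predU1P[<-|c0].
  rewrite integral0_eq; last by move=> x _; case: ifPn => // /andP[a b]; have := lt_trans a b; rewrite ltxx.
  by rewrite powR0 ?gt_eqF// mul0r.
have mf : measT (fun a : R => a `^ (s - 1)) by meas.
have -> : (\int[leb1 R]_a (if (0 < a < c) then a `^ (s - 1) else 0)%:E
  = \int[leb1 R]_(a in `]0%R, c[) (a `^ (s - 1))%:E)%E.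
  rewrite [RHS]integral_mkcond; apply: eq_integral => x _.
  by rewrite patchE mem_setE in_itv/=; case: ifPn.
rewrite -(@integral_itv_bndoo _ _ _ (fun a => (a `^ (s - 1))%:E) false false); last first.
  by apply: measurable_funTS; exact/measurable_EFinP.
pose F n : set (measurableTypeR R) := `[c / n.+1%:R, c]%classic.
have nn n : 0 < n.+1%:R :> R by rewrite ltr0n.
have FU : \bigcup_n F n = `]0, c]%classic.
  apply/seteqP; split=> x /=.
    move=> [n _]; rewrite /F/= !in_itv/= => /andP[h ->].
    by rewrite (lt_le_trans _ h)// divr_gt0.
  rewrite in_itv/= => /andP[x0 xc].
  exists (Num.truncn (c / x)) => //; rewrite /F/= in_itv/= xc andbT.
  rewrite ler_pdivrMr// mulrC -ler_pdivrMr//.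
  by apply/ltW/truncnS_gt.
have := @ge0_nondecreasing_set_cvg_integral _ (measurableTypeR R) R F (fun a => (a `^ (s - 1))%:E) (leb1 R).
move=> /(_ _ _ _ _)/cvg_lim; rewrite FU => <- //.
- apply/cvg_lim => //.
  have E n : (\int[leb1 R]_(x in F n) (x `^ (s - 1))%:E = (c `^ s / s - (c / n.+1%:R) `^ s / s)%:E)%E.
    have cn : 0 < c / n.+1%:R by rewrite divr_gt0.
    apply: (etrans (@FTC_is_derive _ _ (fun x => x `^ s / s) _ _ _ _ _)).
    + by rewrite ler_pdivrMr// ler_peMr// ?ler1n// ltW.
    + move=> x /andP[x1 _]; have x0 := lt_le_trans cn x1.
      have ? := @is_derive1_powR _ s x x0.
      apply: is_derive_eq; rewrite scaler0 add0r/= /GRing.scale/= .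
      by rewrite mulrA mulVf ?mul1r// gt_eqF.
    + move=> x /andP[x1 _]; have x0 := lt_le_trans cn x1.
      by apply: derivable_cont; apply: @ex_derive; exact: is_derive1_powR.
    + by [].
  rewrite (_ : (fun i => _) = (fun n => (c `^ s / s - (c / n.+1%:R) `^ s / s)%:E)); last by apply/funext => n; rewrite E.
  apply: cvg_EFin; first by near=> n.
  rewrite -[X in _ --> X]subr0; apply: cvgB; first exact: cvg_cst.
  rewrite -[X in _ --> X](mul0r s^-1); apply: cvgMl.
  have := @powR_cvg0 R s s0; move/cvg_at_rightP; apply; split.
    by move=> n; rewrite divr_gt0.
  rewrite -[X in _ --> X](mulr0 c); apply: cvgMr; exact: cvg_harmonic.
- apply/nondecreasing_seqP => n; rewrite subsetEset => x; rewrite /F/= !in_itv/= => /andP[h ->].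
  rewrite andbT (le_trans _ h)// ler_pM2l// lef_pV2 ?posrE// ler_nat.
  exact: leqnSn.
- by move=> n; exact: measurable_itv.
- by move=> n; apply: measurable_funTS; exact/measurable_EFinP.
- by move=> n x _; rewrite lee_fin powR_ge0.
Unshelve. all: by end_near.
Qed.

Lemma powR_inty (R : realType) (s c : R) : 0 < s -> 0 < c ->
  (\int[leb1 R]_a (if (c <= a) then a `^ (- s - 1) else 0)%:E
    = (c `^ (- s) / s)%:E)%E.
Proof.
move=> s0 c0.
have -> : (\int[leb1 R]_a (if (c <= a) then a `^ (- s - 1) else 0)%:E
  = \int[leb1 R]_(a in `[c, +oo[) (a `^ (- s - 1))%:E)%E.
  rewrite [RHS]integral_mkcond; apply: eq_integral => x _.
  by rewrite patchE mem_setE in_itv/= andbT; case: ifPn.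
apply: (etrans (@FTC_is_derivey _ (fun x => x `^ (- s - 1)) (fun x => - (x `^ (- s) / s)) c 0 _ _ _ _)).
- by move=> x _; exact: powR_ge0.
- move=> x cx; have x0 := lt_le_trans c0 cx.
  have ? := @is_derive1_powR _ (- s) x x0.
  apply: is_derive_eq; rewrite scaler0 add0r/= /GRing.scale/= .
  by rewrite mulNr mulrN opprK mulrA mulVf ?mul1r// gt_eqF.
- move=> x cx; have x0 := lt_le_trans c0 cx.
  by apply: derivable_cont; apply: @ex_derive; exact: is_derive1_powR.
- rewrite -oppr0; apply: cvgN; rewrite -[X in _ --> X](mul0r s^-1); apply: cvgMl.
  apply/cvgr0Pnorm_lt => e e0; near=> x.
  have x0 : 0 < x by near: x; exact: nbhs_pinfty_gt.
  rewrite ger0_norm ?powR_ge0// powRN invf_plt ?posrE ?powR_gt0//.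
  have -> : e^-1 = ((e^-1) `^ s^-1) `^ s.
    by rewrite -powRrM mulVf ?gt_eqF// powRr1// invr_ge0 ltW.
  apply: gt0_ltr_powR => //; rewrite ?nnegrE ?powR_ge0 ?(ltW x0)//.
- by rewrite sub0r opprK.
Unshelve. all: by end_near.
Qed.

(** * Hölder inequalities, the Poisson kernel, interpolation *)

(** Hölder for F k = (F k^(1/p)) k^(1/q) with q = p / (p - 1): the second factor has q-norm at most
    m^(1/q), and p / q = p - 1. *)
Lemma jensen_kernel d (T : measurableType d) (R : realType)
  (nu : {measure set T -> \bar R}) (F k : T -> R) (m p : R) :
  measT F -> measT k ->
  (forall y, 0 <= F y) -> (forall y, 0 <= k y) -> 1 < p -> 0 <= m ->
  (\int[nu]_y (k y)%:E <= m%:E)%E ->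
  ((\int[nu]_y (F y * k y)%:E) `^ p <=
    (m `^ (p - 1))%:E * \int[nu]_y (F y `^ p * k y)%:E)%E.
Proof.
move=> mF mk F0 k0 p1 m0 km.
have p0 : 0 < p by apply: lt_trans p1.
have pn0 : p != 0 by rewrite gt_eqF.
have p10 : 0 < p - 1 by rewrite subr_gt0.
pose q := p / (p - 1).
have q0 : 0 < q by rewrite divr_gt0.
have pq : p^-1 + q^-1 = 1.
  by rewrite /q invf_div; field.
pose f y := F y * k y `^ p^-1. pose g y := k y `^ q^-1.
have mf : measT f by rewrite /f; meas.
have mg : measT g by rewrite /g; meas.
have kpq y : k y `^ p^-1 * k y `^ q^-1 = k y.
  have [->|ky] := eqVneq (k y) 0; first by rewrite powR0 ?invr_neq0// mul0r.
  by rewrite -powRD ?pq ?powRr1// (negbTE ky) implybT.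
have H := hoelder nu mf mg p0 q0 pq.
have E1 : ('N[nu]_1[EFin \o (f \* g)%R] = \int[nu]_y (F y * k y)%:E)%E.
  rewrite Lnorm1; apply: eq_integral => y _ /=.
  rewrite /f /g -mulrA kpq ger0_norm// mulr_ge0//.
have E2 : ('N[nu]_p%:E[EFin \o f] `^ p = \int[nu]_y (F y `^ p * k y)%:E)%E.
  rewrite poweR_Lnorm//; apply: eq_integral => y _ /=.
  rewrite ger0_norm; last by rewrite mulr_ge0// powR_ge0.
  rewrite powRM ?powR_ge0//.
  by rewrite -powRrM mulVf// powRr1.
have E3 : ('N[nu]_q%:E[EFin \o g] `^ p <= (m `^ (p - 1))%:E)%E.
  have -> : ('N[nu]_q%:E[EFin \o g] `^ p = (\int[nu]_y (k y)%:E) `^ (p - 1))%E.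
    have -> : p = q * (p - 1) by rewrite /q divfK// gt_eqF.
    rewrite poweRrM poweR_Lnorm ?gt_eqF//; congr (_ `^ _)%E; last first.
      by rewrite /q divfK// gt_eqF.
    apply: eq_integral => y _ /=.
    by rewrite ger0_norm ?powR_ge0// -powRrM mulVf ?gt_eqF// powRr1.
  rewrite -poweR_EFin gt0_ler_poweR ?(ltW p10)// in_itv/= ?leey ?andbT.
    by apply: integral_ge0 => y _; rewrite lee_fin.
  by rewrite lee_fin.
rewrite -E1 (le_trans (gt0_ler_poweR (ltW p0) _ _ H))//.
- by rewrite in_itv/= leey andbT Lnorm_ge0.
- by rewrite in_itv/= leey andbT mule_ge0// Lnorm_ge0.
rewrite poweRM ?Lnorm_ge0// E2 muleC lee_wpmul2r//.
by int_ge0.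
Qed.

Lemma cauchy_schwarz d (T : measurableType d) (R : realType)
  (nu : {measure set T -> \bar R}) (F G : T -> R) (a b : R) :
  measT F -> measT G -> 0 <= a -> 0 <= b ->
  (\int[nu]_y (F y ^+ 2)%:E <= a%:E)%E ->
  (\int[nu]_y (G y ^+ 2)%:E <= b%:E)%E ->
  (\int[nu]_y (`|F y * G y|)%:E <= (Num.sqrt a * Num.sqrt b)%:E)%E.
Proof.
move=> mF mG a0 b0 Fa Gb.
have H := @hoelder _ _ _ nu F G 2 2 mF mG _ _ _.
have {}H : ('N[nu]_1[EFin \o (F \* G)%R] <= 'N[nu]_2%:E[EFin \o F] * 'N[nu]_2%:E[EFin \o G])%E.
  by apply: H => //; field.
have E (K : T -> R) c : 0 <= c -> (\int[nu]_y (K y ^+ 2)%:E <= c%:E)%E ->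
    ('N[nu]_2%:E[EFin \o K] <= (Num.sqrt c)%:E)%E.
  move=> c0 Kc.
  have K0 : (0 <= 'N[nu]_2%:E[EFin \o K])%E by exact: Lnorm_ge0.
  have K2 : ('N[nu]_2%:E[EFin \o K] `^ 2 <= c%:E)%E.
    rewrite poweR_Lnorm//; apply: le_trans Kc; rewrite le_eqVlt; apply/predU1l.
    by apply: eq_integral => y _ /=; rewrite powR_mulrn// real_normK// num_real.
  rewrite -powR12_sqrt// -poweR_EFin.
  have -> : ('N[nu]_2%:E[EFin \o K] = ('N[nu]_2%:E[EFin \o K] `^ 2) `^ 2^-1)%E.
    by rewrite -poweRrM mulfV// poweRe1.
  by apply: gt0_ler_poweR; rewrite ?in_itv/= ?leey ?andbT ?poweR_ge0 ?lee_fin.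
rewrite -[leLHS](_ : 'N[nu]_1[EFin \o (F \* G)%R]%E = _); last by rewrite Lnorm1.
apply: le_trans H _; rewrite EFinM; apply: lee_pmul; rewrite ?Lnorm_ge0//; exact: E.
Qed.

(** The Poisson kernel of height 1/s, of total mass pi: a bump of height s and width 1/s, used as
    the universal majorant for kernels at frequency s. *)
Definition poissonk (R : realType) (s t : R) : R := s / (1 + (s * t) ^+ 2).

Lemma poissonk_ge0 (R : realType) (s t : R) : 0 <= s -> 0 <= poissonk s t.
Proof. by move=> s0; rewrite divr_ge0// addr_ge0// sqr_ge0. Qed.

Lemma measurable_poissonk (R : realType) (s : R) : measT (poissonk s).
Proof. by rewrite /poissonk; meas. Qed.

Lemma integral_poissonk (R : realType) (s : R) : 0 < s ->
  (\int[leb1 R]_t (poissonk s t)%:E = pi%:E)%E.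
Proof.
move=> s0.
have H1 : (\int[leb1 R]_t ((1 + t ^+ 2)^-1)%:E = pi%:E)%E.
  rewrite ge0_symfun_integralT//.
  - have -> : [set x : R | 0 <= x] = `[0, +oo[%classic.
      by apply/seteqP; split => x /=; rewrite in_itv/= andbT.
    have := @integral0y_oneDsqr R; rewrite /oneDsqr => -> .
    by rewrite -EFinM; congr EFin; field.
  - by move=> x; rewrite invr_ge0 addr_ge0// sqr_ge0.
  - exact: (@continuous_oneDsqrV R).
  - by move=> x /=; rewrite sqrrN.
have := @ge0_integral_affine R s 0 (fun t => ((1 + t ^+ 2)^-1)%:E).
rewrite H1 => H.
transitivity (s%:E * \int[leb1 R]_x ((1 + (s * x + 0)%R ^+ 2)^-1)%:E)%E.
  by rewrite -intZ ?ltW//; apply: eq_integral => x _; rewrite addr0.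
rewrite H ?gt_eqF//.
- by rewrite -!EFinM; congr EFin; rewrite gtr0_norm// mulrA mulfV ?mul1r ?gt_eqF.
- by meas.
- by move=> x; rewrite lee_fin invr_ge0 addr_ge0// sqr_ge0.
Qed.

(* Marcinkiewicz interpolation on the level of distribution functions; the
   splitting height [g * a] is kept free so that operators with unbalanced
   norms at the two endpoints can be treated. *)
Lemma marcinkiewicz d1 d2 (X : measurableType d1) (Y : measurableType d2)
  (R : realType) (mu : {sigma_finite_measure set X -> \bar R})
  (nu : {sigma_finite_measure set Y -> \bar R}) (G : X -> R) (F : Y -> R)
  (p q1 q2 A B g : R) :
  measT G -> measT F ->
  (forall x, 0 <= G x) -> (forall y, 0 <= F y) ->
  1 < p -> q1 < p -> p < q2 -> 0 <= A -> 0 <= B -> 0 < g ->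
  (forall a, 0 < a ->
    (mu [set x | (a < G x)%R] <=
      (A * a `^ (- q1))%:E * \int[nu]_y (if g * a < F y then F y `^ q1 else 0)%:E
    + (B * a `^ (- q2))%:E * \int[nu]_y (if F y <= g * a then F y `^ q2 else 0)%:E)%E) ->
  (\int[mu]_x (G x `^ p)%:E <=
    (p * (A * g `^ (q1 - p) / (p - q1) + B * g `^ (q2 - p) / (q2 - p)))%:E
    * \int[nu]_y (F y `^ p)%:E)%E.
Proof.
move=> mG mF G0 F0 p1 q1p pq2 A0 B0 g0 H.
have p0 : 0 < p by apply: lt_trans p1.
pose leb := leb1 R.
have s1 : 0 < p - q1 by rewrite subr_gt0.
have s2 : 0 < q2 - p by rewrite subr_gt0.
(* Layer cake: G^p is the integral of p a^(p - 1) over 0 < a < G. *)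
have layer : (\int[mu]_x (G x `^ p)%:E =
    \int[leb]_a ((if (0 < a)%R then p * a `^ (p - 1) else 0)%:E * mu [set x | (a < G x)%R]))%E.
  transitivity (\int[mu]_x \int[leb]_a (p * (if (0 < a < G x)%R then a `^ (p - 1) else 0))%:E)%E.
    apply: eq_integral => x _.
    under eq_integral do rewrite EFinM.
    by rewrite intZ ?(ltW p0)// powR_int0// -EFinM mulrCA mulfV ?mulr1// gt_eqF.
  rewrite tonelli; last 2 first.
  - by meas.
  - by move=> x a; rewrite lee_fin; case: ifPn => // _; rewrite mulr_ge0 ?powR_ge0// ?ltW// mulr0.
  apply: eq_integral => a _.
  have mA : measurable [set x | (a < G x)%R].
    rewrite -[X in measurable X]setTI.
    have := @measurable_fun_ltr _ X R setT (fun=> a) G (@measurable_cst _ _ _ _ _ _) mG.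
    by move=> /(_ measurableT [set true] I); congr measurable; apply/seteqP; split => x /=.
  case: ifPn => a0; last first.
    by rewrite mul0e integral0_eq// => x _; rewrite mulr0.
  rewrite -(@integral_cst _ _ _ mu _ mA).
  rewrite [RHS]integral_mkcond; apply: eq_integral => x _.
  rewrite patchE/=; case: ifPn => [aG|aG].
    by rewrite mem_set.
  by rewrite memNset ?mulr0//; apply/negP.
rewrite layer.
(* The cut at height g a is read as a condition on a, namely a < F y / g or its complement. After
   exchanging integrals, each weight integrates in a to an explicit power of F y / g. *)
pose W1 a y : R := if (0 < a < F y / g)%R then a `^ (p - q1 - 1) else 0.
pose W2 a y : R := if (F y / g <= a)%R then a `^ (- (q2 - p) - 1) else 0.
have W10 a y : 0 <= W1 a y by rewrite /W1; case: ifPn => // _; rewrite powR_ge0.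
have W20 a y : 0 <= W2 a y by rewrite /W2; case: ifPn => // _; rewrite powR_ge0.
have mW1 : measT (fun z : R * Y => W1 z.1 z.2) by rewrite /W1; meas.
have mW2 : measT (fun z : R * Y => W2 z.1 z.2) by rewrite /W2; meas.
(* Points with F y = 0 are dropped from the second term: F y ^ q2 vanishes there, while the integral
   of [W2] over all a > 0 diverges at 0. *)
apply: (@le_trans _ _ (\int[leb]_a ( (p * A)%:E * \int[nu]_y (F y `^ q1 * W1 a y)%:E
    + (p * B)%:E * \int[nu]_y (if 0 < F y then F y `^ q2 * W2 a y else 0)%:E))%E).
  apply: le_int0 => a _.
    by apply: mule_ge0 => //; rewrite lee_fin; case: ifPn => // _; rewrite mulr_ge0 ?powR_ge0// ltW.
  case: ifPn => a0; last first.
    rewrite mul0e adde_ge0// mule_ge0 ?lee_fin ?mulr_ge0 ?(ltW p0)//; apply: integral_ge0 => y _.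
      by rewrite lee_fin mulr_ge0// powR_ge0.
    by rewrite lee_fin; case: ifPn => // _; rewrite mulr_ge0// powR_ge0.
  apply: (le_trans (lee_wpmul2l _ (H a a0))); first by rewrite lee_fin mulr_ge0 ?powR_ge0// ltW.
  rewrite ge0_muleDr; last 2 first.
  - apply: mule_ge0; first by rewrite lee_fin mulr_ge0// powR_ge0.
    by apply: integral_ge0 => y _; rewrite lee_fin; case: ifPn => // _; rewrite powR_ge0.
  - apply: mule_ge0; first by rewrite lee_fin mulr_ge0// powR_ge0.
    by apply: integral_ge0 => y _; rewrite lee_fin; case: ifPn => // _; rewrite powR_ge0.
  apply: leeD.
    rewrite muleA -EFinM.
    have -> : p * a `^ (p - 1) * (A * a `^ (- q1)) = (p * A) * a `^ (p - q1 - 1).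
      rewrite mulrACA -powRD; last by rewrite (gt_eqF a0) implybT.
      by congr (_ * _ `^ _); ring.
    rewrite EFinM -muleA; apply: lee_wpmul2l; first by rewrite lee_fin mulr_ge0// ltW.
    rewrite -intZ ?powR_ge0//.
    apply: le_int0 => y _.
      by rewrite -EFinM lee_fin mulr_ge0 ?powR_ge0//; case: ifPn => // _; rewrite powR_ge0.
    rewrite -EFinM lee_fin /W1 a0/= ltr_pdivlMr// [a * g]mulrC.
    by case: ifPn => _; rewrite ?mulr0 ?mulr0// mulrC.
  rewrite muleA -EFinM.
  have -> : p * a `^ (p - 1) * (B * a `^ (- q2)) = (p * B) * a `^ (- (q2 - p) - 1).
    rewrite mulrACA -powRD; last by rewrite (gt_eqF a0) implybT.
    by congr (_ * _ `^ _); ring.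
  rewrite EFinM -muleA; apply: lee_wpmul2l; first by rewrite lee_fin mulr_ge0// ltW.
  rewrite -intZ ?powR_ge0//.
  apply: le_int0 => y _.
    by rewrite -EFinM lee_fin mulr_ge0 ?powR_ge0//; case: ifPn => // _; rewrite powR_ge0.
  rewrite -EFinM lee_fin /W2 ler_pdivrMr// [a * g]mulrC.
  have := F0 y; rewrite le_eqVlt => /predU1P[<-|Fy0].
    by rewrite ltxx powR0 ?gt_eqF ?(lt_trans p0)// if_same mulr0.
  by rewrite Fy0; case: ifPn => _; rewrite ?mulr0// mulrC.
have m1 : measT (fun a => \int[nu]_y (F y `^ q1 * W1 a y)%:E)%E.
  apply: meas_int => [|a y]; last by rewrite lee_fin mulr_ge0// powR_ge0.
  by meas.
have m2 : measT (fun a => \int[nu]_y (if 0 < F y then F y `^ q2 * W2 a y else 0)%:E)%E.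
  apply: meas_int => [|a y]; first by meas.
  by rewrite lee_fin; case: ifPn => // _; rewrite mulr_ge0// powR_ge0.
have i1 a : (0 <= \int[nu]_y (F y `^ q1 * W1 a y)%:E)%E.
  by int_ge0.
have i2 a : (0 <= \int[nu]_y (if 0 < F y then F y `^ q2 * W2 a y else 0)%:E)%E.
  by apply: integral_ge0 => y _; rewrite lee_fin; case: ifPn => // _; rewrite mulr_ge0// powR_ge0.
have pA : 0 <= p * A by rewrite mulr_ge0// ltW.
have pB : 0 <= p * B by rewrite mulr_ge0// ltW.
rewrite ge0_integralD//; last 4 first.
- by move=> a _; rewrite mule_ge0.
- by apply: emeasurable_funM => //; exact: measurable_cst.
- by move=> a _; rewrite mule_ge0.
- by apply: emeasurable_funM => //; exact: measurable_cst.
rewrite !intZ//.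
rewrite mulrDr EFinD ge0_muleDl; last 2 first.
- by rewrite lee_fin mulr_ge0 ?(ltW p0)// divr_ge0 ?(ltW s1)// mulr_ge0// powR_ge0.
- by rewrite lee_fin mulr_ge0 ?(ltW p0)// divr_ge0 ?(ltW s2)// mulr_ge0// powR_ge0.
apply: leeD.
- rewrite (_ : p * (A * _ / _) = (p * A) * (g `^ (q1 - p) * (p - q1)^-1)); last by rewrite !mulrA.
  rewrite [X in (_ <= X * _)%E]EFinM -muleA; apply: lee_wpmul2l => //.
  rewrite tonelli; last 2 first.
  + by meas.
  + by move=> a y; rewrite lee_fin mulr_ge0// powR_ge0.
  rewrite -intZ//; last by rewrite mulr_ge0 ?powR_ge0// invr_ge0 ltW.
  apply: le_int0 => y _.
    by int_ge0.
  under eq_integral do rewrite EFinM.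
  rewrite intZ ?powR_ge0//.
  rewrite /W1 powR_int0//; last by rewrite divr_ge0// ltW.
  rewrite -!EFinM lee_fin.
  have := F0 y; rewrite le_eqVlt => /predU1P[<-|Fy0].
    by rewrite mul0r (powR0 (lt0r_neq0 s1)) mul0r mulr0 mulr_ge0 ?powR_ge0// mulr_ge0 ?powR_ge0// invr_ge0 ltW.
  rewrite powRM ?invr_ge0 ?(ltW Fy0) ?(ltW g0)//.
  rewrite -powR_inv1 ?(ltW g0)// -powRrM mulN1r opprB.
  rewrite !mulrA -powRD; last by rewrite (gt_eqF Fy0) implybT.
  by rewrite addrC subrK -mulrA mulrC.
- rewrite (_ : p * (B * _ / _) = (p * B) * (g `^ (q2 - p) * (q2 - p)^-1)); last by rewrite !mulrA.
  rewrite [X in (_ <= X * _)%E]EFinM -muleA; apply: lee_wpmul2l => //.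
  rewrite tonelli; last 2 first.
  + by meas.
  + by move=> a y; rewrite lee_fin; case: ifPn => // _; rewrite mulr_ge0// powR_ge0.
  rewrite -intZ//; last by rewrite mulr_ge0 ?powR_ge0// invr_ge0 ltW.
  apply: le_int0 => y _.
    by apply: integral_ge0 => a _; rewrite lee_fin; case: ifPn => // _; rewrite mulr_ge0// powR_ge0.
  have [Fy0|Fy0] := boolP (0 < F y); last first.
    rewrite integral0_eq// -EFinM lee_fin mulr_ge0 ?powR_ge0// mulr_ge0 ?powR_ge0// invr_ge0 ltW//.
  under eq_integral do rewrite EFinM.
  rewrite intZ ?powR_ge0//.
  rewrite /W2 powR_inty//; last by rewrite divr_gt0.
  rewrite -!EFinM lee_fin.
  rewrite powRM ?invr_ge0 ?(ltW Fy0) ?(ltW g0)//.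
  rewrite -powR_inv1 ?(ltW g0)// -powRrM mulN1r opprK.
  rewrite !mulrA -powRD; last by rewrite (gt_eqF Fy0) implybT.
  have -> : q2 + - (q2 - p) = p by ring.
  by rewrite -mulrA mulrC.
Qed.

(** * The Hardy-Littlewood maximal function *)

Lemma bounded_locally_integrable (R : realType) (F : R -> R) (B : R) :
  measT F -> (forall x, `|F x| <= B) -> locally_integrable setT F.
Proof.
move=> mF FB; split => //; first exact: openT.
move=> K _ cK; have mK := compact_measurable cK.
apply: (@le_lt_trans _ _ (\int[leb1 R]_(x in K) (cst B%:E x))%E).
  by apply: le_int0 => x _; rewrite lee_fin ?FB.
rewrite integral_cst//.
rewrite lte_mul_pinfty//; last exact: compact_finite_measure.
by rewrite lee_fin (le_trans _ (FB 0)).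
Qed.

Section HardyLittlewood.
Variable R : realType.
Local Notation mu := (leb1 R).
Implicit Type F : R -> R.

(** A real-valued maximal function, meant for bounded functions: there the supremum is finite and
    [fine] loses nothing ([HLrE]). *)
Definition HLr F x : R := fine (HL_maximal F x).

Lemma HL_maximal_le F (B : R) x : measT F -> (forall x, `|F x| <= B) ->
  (HL_maximal F x <= B%:E)%E.
Proof.
move=> mF FB; apply: ge_ereal_sup => z [r]; rewrite /= in_itv/= andbT => r0 <-.
have r20 : 0 < r *+ 2 by rewrite mulrn_wgt0.
rewrite /iavg lebesgue_measure_ball ?(ltW r0)// inver gt_eqF//.
rewrite lee_pdivrMl//; apply: le_trans (_ : \int[mu]_(y in ball x r) (cst B%:E y) <= _)%E.
  by apply: le_int0 => y _; rewrite lee_fin ?FB.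
rewrite integral_cst; last exact: measurable_ball.
by rewrite [X in (_ * X)%E](lebesgue_measure_ball x (ltW r0)) muleC.
Qed.

Lemma HLrE F (B : R) x : measT F -> (forall x, `|F x| <= B) ->
  (HLr F x)%:E = HL_maximal F x.
Proof.
move=> mF FB; rewrite /HLr fineK// ge0_fin_numE.
  by rewrite (le_lt_trans (HL_maximal_le x mF FB))// ltry.
by apply: HL_maximalT_ge0; apply: bounded_locally_integrable FB.
Qed.

Lemma HLr_ge0 F x : 0 <= HLr F x.
Proof.
rewrite /HLr fine_ge0//; apply: ereal_sup_ge; exists (iavg F (ball x 1)).
  by exists 1 => //=; rewrite in_itv/= ltr01.
exact: iavg_ge0.
Qed.

Lemma measurable_HLr F (B : R) : measT F -> (forall x, `|F x| <= B) ->
  measT (HLr F).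
Proof.
move=> mF FB; apply: measurable_fine_fun; apply: measurable_HL_maximal.
exact: bounded_locally_integrable FB.
Qed.

Lemma HLr_avg F (B x r : R) : measT F -> (forall x, 0 <= F x <= B) -> 0 < r ->
  (\int[mu]_w (if `|x - w| < r then F w else 0)%:E <= (2 * r * HLr F x)%:E)%E.
Proof.
move=> mF FB r0.
have FB' w : `|F w| <= B by case/andP: (FB w) => *; rewrite ger0_norm.
have r20 : 0 < r *+ 2 by rewrite mulrn_wgt0.
rewrite EFinM (HLrE _ mF FB').
have H : (iavg F (ball x r) <= HL_maximal F x)%E.
  by apply: ereal_sup_ubound; exists r => //=; rewrite in_itv/= r0.
have r20' : 0 <= 2 * r by rewrite mulr_ge0// ltW.
apply: le_trans (lee_wpmul2l _ H); last by rewrite lee_fin.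
rewrite /iavg lebesgue_measure_ball ?(ltW r0)// inver gt_eqF// muleA -EFinM.
rewrite mulr_natl divff ?gt_eqF// mul1e.
rewrite [leRHS]integral_mkcond; apply: le_int0 => w _.
  by case: ifPn => // _; rewrite lee_fin; case/andP: (FB w).
rewrite patchE; case: ifPn => H1.
  by rewrite mem_set// lee_fin ler_norm.
by case: ifPn => _ //; rewrite lee_fin.
Qed.

(** The part of F below a / 2 has averages at most a / 2, so {HLr F > a} lies in {HL F1 > a / 2}
    with F1 the part above a / 2. The weak (1,1) inequality for F1 then has exactly the form asked
    by [marcinkiewicz] with g = 1/2. *)
Lemma HLr_weak F (B a : R) : measT F -> (forall x, 0 <= F x <= B) -> 0 < a ->
  (mu [set x | (a < HLr F x)%R] <=
    (6 * a `^ (- 1))%:E * \int[mu]_y (if 2^-1 * a < F y then F y `^ 1 else 0)%:E)%E.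
Proof.
move=> mF FB a0.
have FB' w : `|F w| <= B by case/andP: (FB w) => *; rewrite ger0_norm.
pose F1 y := if 2^-1 * a < F y then F y else 0.
have mF1 : measT F1 by rewrite /F1; meas.
have F1B y : `|F1 y| <= B.
  by rewrite /F1; case: ifPn => // _; rewrite normr0 (le_trans _ (FB' 0)).
have F10 y : 0 <= F1 y by rewrite /F1; case: ifPn => // _; case/andP: (FB y).
have lF1 := bounded_locally_integrable mF1 F1B.
have a20 : 0 < a / 2 by rewrite divr_gt0.
have sub : [set x | (a < HLr F x)%R] `<=` [set x | ((a / 2)%:E < HL_maximal F1 x)%E].
  move=> x /=; rewrite -lte_fin (HLrE _ mF FB') => /ereal_sup_gt[_ [r r0 <-]] H.
  apply: (@lt_le_trans _ _ (iavg F1 (ball x r))); last by apply: ereal_sup_ubound; exists r.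
  move: r0 H; rewrite /= in_itv/= andbT => r0; have r20 : 0 < r *+ 2 by rewrite mulrn_wgt0.
  rewrite /iavg lebesgue_measure_ball ?(ltW r0)// inver gt_eqF//.
  rewrite !lte_pdivlMl//.
  have : (\int[mu]_(y in ball x r) `|(F y)%:E| <= \int[mu]_(y in ball x r) `|(F1 y)%:E| + (r *+ 2 * (a / 2))%:E)%E.
    have -> : (r *+ 2 * (a / 2))%:E = (\int[mu]_(y in ball x r) cst (a / 2)%:E y)%E.
      rewrite integral_cst; last exact: measurable_ball.
      by rewrite [X in (_ * X)%E](lebesgue_measure_ball x (ltW r0)) -EFinM mulrC.
    have mb : measurable (ball x r) by exact: measurable_ball.
    rewrite -ge0_integralD//; last 2 first.
    - by apply: measurable_funTS; apply: measurableT_comp => //; exact/measurable_EFinP.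
    - by move=> y _; rewrite /cst lee_fin ltW.
    apply: le_int0 => y _ //; rewrite /= -EFinD lee_fin.
    rewrite /F1; case: ifPn => [_|]; first by rewrite lerDl ltW.
    rewrite -leNgt normr0 add0r => H1; rewrite ger0_norm; last by case/andP: (FB y).
    by rewrite mulrC.
  move=> H1 H2; have := lt_le_trans H2 H1.
  have -> : ((r *+ 2)%:E * a%:E = (r *+ 2 * (a / 2))%:E + (r *+ 2 * (a / 2))%:E)%E.
    by rewrite -EFinM -EFinD; congr EFin; field.
  by rewrite -EFinM lteD2rE.
apply: (@le_trans _ _ (mu [set x | ((a / 2)%:E < HL_maximal F1 x)%E])).
  apply: le_measure => //; rewrite inE.
    rewrite -[X in measurable X]setTI.
    have := @measurable_fun_ltr _ R R setT (fun=> a) (HLr F) (@measurable_cst _ _ _ _ _ _) (measurable_HLr mF FB').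
    by move=> /(_ measurableT [set true] I); congr measurable; apply/seteqP; split => x /=.
  rewrite -[X in measurable X]setTI.
  by apply: emeasurable_fun_o_infty => //; exact: measurable_HL_maximal.
apply: le_trans (maximal_inequality lF1 a20) _.
rewrite powR_inv1 ?(ltW a0)// (_ : 3 / (a / 2) = 6 * a^-1); last by field; rewrite gt_eqF.
apply: lee_wpmul2l; first by rewrite lee_fin divr_ge0// ltW.
apply: le_int0 => y _ //; rewrite /= lee_fin ger0_norm// /F1.
by case: ifPn => // _; rewrite powRr1//; case/andP: (FB y).
Qed.

Lemma HLr_strong (p : R) : 1 < p -> exists2 C : R, 0 < C &
  forall F (B : R), measT F -> (forall x, 0 <= F x <= B) ->
  (\int[mu]_x (HLr F x `^ p)%:E <= C%:E * \int[mu]_x (F x `^ p)%:E)%E.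
Proof.
move=> p1; have p0 : 0 < p by apply: lt_trans p1.
have p10 : 0 < p - 1 by rewrite subr_gt0.
(* The upper endpoint p + 1 is an arbitrary exponent above p and carries the coefficient 0: the low
   part of F has already been absorbed into the level. *)
exists (p * (6 * 2^-1 `^ (1 - p) / (p - 1) + 0 * 2^-1 `^ (p + 1 - p) / (p + 1 - p))).
  rewrite !mul0r addr0 mulr_gt0// divr_gt0// mulr_gt0// powR_gt0//.
move=> F B mF FB.
have FB' w : `|F w| <= B by case/andP: (FB w) => *; rewrite ger0_norm.
apply: (@marcinkiewicz _ _ _ _ R mu mu (HLr F) F p 1 (p + 1) 6 0 2^-1) => //.
- exact: measurable_HLr FB'.
- by move=> x; exact: HLr_ge0.
- by move=> x; case/andP: (FB x).
- by rewrite ltrDl.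
- move=> a a0; rewrite mul0r mul0e adde0; exact: HLr_weak FB _.
Qed.

(** Take the least k with s |t| < 2^k. If k > 0 then s |t| >= 2^(k - 1), which makes the Poisson
    kernel at most s 4^(1 - k). *)
Lemma poissonk_dyadic (s t : R) : 0 < s ->
  exists k : nat, poissonk s t <= 4 * s * 4^-1 ^+ k /\ `|t| < 2 ^+ k / s.
Proof.
move=> s0.
have [|n Hn] := @ex_minnP (fun k : nat => `|t| < 2 ^+ k / s).
  exists (Num.truncn (`|t| * s)).+1; rewrite ltr_pdivlMr//.
  apply: lt_trans (truncnS_gt _) _; rewrite -natrX ltr_nat.
  exact: ltn_expl.
move=> Hmin; exists n; split => //.
have D0 : 0 < 1 + (s * t) ^+ 2 by rewrite ltr_pwDl// sqr_ge0.
rewrite /poissonk ler_pdivrMr//.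
case: n Hn Hmin => [|n] Hn Hmin.
  rewrite expr0 mulr1 -mulrA; rewrite (mulrCA 4) ler_peMr// ?(ltW s0)//.
  by rewrite mulrDr; have := sqr_ge0 (s * t); lra.
have : 2 ^+ n / s <= `|t|.
  rewrite leNgt; apply/negP => /Hmin; by rewrite ltnn.
rewrite ler_pdivrMr// => H.
have H2 : 4 ^+ n <= (s * t) ^+ 2.
  rewrite (_ : 4 = 2 ^+ 2 :> R); last by ring.
  rewrite exprAC -[(s * t) ^+ 2]real_normK ?num_real//.
  rewrite ler_pXn2r ?nnegrE ?exprn_ge0//.
  by rewrite normrM (gtr0_norm s0) mulrC.
rewrite exprVn exprS invfM !mulrA -[4 * s * 4^-1](_ : s = _); last by field.
rewrite -mulrA ler_peMr ?(ltW s0)//.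
rewrite ler_pdivlMl ?exprn_gt0// mulr1; lra.
Qed.

(** The Poisson kernel is below a sum of indicators of balls of radius 2^k / s with weights 4 s
    4^(-k). The k-th ball costs 4 s 4^(-k) * 2 * 2^k / s = 8 / 2^k times the maximal function, and
    these sum to 16. *)
Lemma HLr_poisson F (B x s : R) : measT F -> (forall x, 0 <= F x <= B) -> 0 < s ->
  (\int[mu]_w (F w * poissonk s (x - w))%:E <= (16 * HLr F x)%:E)%E.
Proof.
move=> mF FB s0.
have F0 w : 0 <= F w by case/andP: (FB w).
pose T k w : R := 4 * s * 4^-1 ^+ k * (if `|x - w| < 2 ^+ k / s then F w else 0).
have T0 k w : 0 <= T k w.
  rewrite /T; case: ifPn => _; rewrite ?mulr0// !mulr_ge0 ?(ltW s0)// exprn_ge0// invr_ge0.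
have mT k : measT (fun w => (T k w)%:E) by rewrite /T; meas.
apply: (@le_trans _ _ (\int[mu]_w (\sum_(k <oo) (T k w)%:E))%E).
  apply: le_int0 => w _; first by rewrite lee_fin mulr_ge0// poissonk_ge0// ltW.
  have [k [H1 H2]] := poissonk_dyadic (x - w) s0.
  apply: (@le_trans _ _ (T k w)%:E).
    by rewrite lee_fin /T H2 mulrC ler_wpM2r.
  rewrite -[leLHS]add0e.
  apply: le_trans (nneseries_lim_ge k.+1 _) => [|i _ _]; last by rewrite lee_fin.
  rewrite big_mkord big_ord_recr/= leeD//; apply: sume_ge0 => i _; by rewrite lee_fin.
rewrite integral_nneseries//; last by move=> n w _; rewrite lee_fin.
apply: le_trans (@epsilon_trick0 R (16 * HLr F x) xpredT _); last first.
  by rewrite mulr_ge0// HLr_ge0.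
apply: lee_nneseries => [k _ _|k _]; first by apply: integral_ge0 => w _; rewrite lee_fin.
under eq_integral do rewrite EFinM.
rewrite intZ//; last by rewrite !mulr_ge0 ?(ltW s0)// exprn_ge0// invr_ge0.
have k0 : 0 < 2 ^+ k / s by rewrite divr_gt0// exprn_gt0.
apply: le_trans (lee_wpmul2l _ (HLr_avg x mF FB k0)) _.
  by rewrite lee_fin !mulr_ge0 ?(ltW s0)// exprn_ge0// invr_ge0.
rewrite -EFinM lee_fin natrX exprS exprVn.
rewrite (_ : 4 = 2 ^+ 2 :> R); last by ring.
rewrite -exprM mulnC exprM.
rewrite le_eqVlt; apply/predU1l; field.
by rewrite gt_eqF//= gt_eqF// exprn_gt0.
Qed.

End HardyLittlewood.

(** * Derivatives and van der Corput estimates in L1 *)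

Section DeriveRules.
Variable R : realType.
Implicit Types (f g : R -> R) (x a b c : R).

Lemma derD f g x a b : is_derive x (1:R) f a -> is_derive x (1:R) g b ->
  is_derive x (1:R) (fun y => f y + g y) (a + b).
Proof. by move=> df dg; exact: is_deriveD. Qed.

Lemma derN f x a : is_derive x (1:R) f a -> is_derive x (1:R) (fun y => - f y) (- a).
Proof. by move=> df; exact: is_deriveN. Qed.

Lemma derM f g x a b : is_derive x (1:R) f a -> is_derive x (1:R) g b ->
  is_derive x (1:R) (fun y => f y * g y) (a * g x + f x * b).
Proof.
move=> df dg; have := is_deriveM df dg; move=> H; apply: is_derive_eq.
by rewrite /GRing.scale/= addrC mulrC.
Qed.

Lemma derV f x a : f x != 0 -> is_derive x (1:R) f a ->
  is_derive x (1:R) (fun y => (f y)^-1) (- a / (f x) ^+ 2).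
Proof.
move=> fx df; have := is_deriveV fx df; move=> H; apply: is_derive_eq.
by rewrite /GRing.scale/= mulNr [_ ^- 2 * a]mulrC mulNr.
Qed.

Lemma derC c x : is_derive x (1:R) (fun _ : R => c) 0.
Proof. exact: is_derive_cst. Qed.

Lemma derId x : is_derive x (1:R) (fun y : R => y) 1.
Proof. exact: is_derive_id. Qed.

Lemma derComp f g x a b : is_derive (g x) (1:R) f a -> is_derive x (1:R) g b ->
  is_derive x (1:R) (fun y => f (g y)) (a * b).
Proof. by move=> df dg; exact: is_derive1_comp. Qed.

Lemma der_cont f x a : is_derive x (1:R) f a -> {for x, continuous f}.
Proof. by move=> df; apply: derivable_cont; exact: ex_derive. Qed.
End DeriveRules.

Ltac der1 := match goal with
 | |- is_derive _ _ (fun y => y) _ => exact: derId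
 | |- is_derive _ _ (fun y => ?c) _ => exact: derC
 | |- is_derive _ _ (fun y => _ + _) _ => apply: derD
 | |- is_derive _ _ (fun y => - _) _ => apply: derN
 | |- is_derive _ _ (fun y => _ * _) _ => apply: derM
 | |- is_derive _ _ (fun y => (_)^-1) _ => apply: derV
 | H : forall x, is_derive x _ ?f _ |- is_derive _ _ (fun y => ?f (@?g y)) _ => refine (derComp (f := f) (g := g) (H _) _); cbn beta
 | H : forall x, is_derive x _ ?f _ |- is_derive _ _ ?f _ => exact: H
 end.
Ltac der := repeat der1.

Lemma cont_invsq (R : realType) (c d k w : R) : c * w + d != 0 ->
  {for w, continuous (fun w => k / (c * w + d) ^+ 2)}.
Proof.
move=> n0; have h : {for w, continuous (fun w => c * w + d)}.
  by apply: der_cont; der.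
apply: cvgM; first exact: cvg_cst.
apply: cvgV; first by rewrite expf_neq0.
by rewrite expr2; under eq_fun do rewrite expr2; apply: cvgM.
Qed.

(** The interval [u, v] is cut out of [a, b] by a subdivision a <= l <= r <= b. When it sticks out
    or is disjoint from [a, b] an outer piece degenerates to a point, hence the conditional
    conclusions. *)
Lemma clamp (R : realType) (a b u v : R) : a <= b -> u <= v -> exists l r,
  [/\ a <= l, l <= r, r <= b, a < l -> l <= u & (r < b -> v <= r) /\ r - l <= v - u].
Proof.
move=> ab uv; have [va|av] := leP v a.
  by exists a, a; split => //; [rewrite ltxx | split => //; lra].
have [bu|ub] := leP b u.
  by exists b, b; split => //; split; [rewrite ltxx | lra].
exists (if a <= u then u else a), (if b <= v then b else v).
by case: ifPn; rewrite -?ltNge => ?; case: ifPn; rewrite -?ltNge => ?; split => //;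
  try lra; try split; try lra; rewrite ltxx.
Qed.

Section VanDerCorput.
Variables (R : realType) (K J : R -> R) (mK mJ : R).
Local Notation mu := (leb1 R).
Hypotheses (cK : continuous K) (dJ : forall t, is_derive t (1:R) J (K t)).
Hypotheses (iK : (\int[mu]_t `|K t|%:E <= mK%:E)%E) (iJ : (\int[mu]_t `|J t|%:E <= mJ%:E)%E).
Hypotheses (mK0 : 0 <= mK) (mJ0 : 0 <= mJ).

Let mesK : measT K.
Proof. exact: continuous_measurable_fun. Qed.

Let cJ : continuous J.
Proof. by move=> x; exact: der_cont. Qed.

Let mesJ : measT J.
Proof. exact: continuous_measurable_fun. Qed.

Let shift_int (g : R -> R) (m b : R) : measT g ->
  (\int[mu]_t `|g t|%:E <= m%:E)%E -> (\int[mu]_y `|g (y - b)|%:E <= m%:E)%E.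
Proof.
move=> mg gm; have := @ge0_integral_affine R 1 (- b) (fun t => `|g t|%:E).
under eq_integral do rewrite mul1r.
by rewrite normr1 invr1 mul1e => H; rewrite H//; meas.
Qed.

Lemma vdc_trivial (phi : R -> R) (a b : R) : a <= b -> measT phi ->
  (\int[mu]_y `| \int[mu]_(w in `[a, b]) K (y - phi w)|%:E <= ((b - a) * mK)%:E)%E.
Proof.
move=> ab mphi.
have mI : measurable (`[a, b]%classic : set R) by exact: measurable_itv.
apply: (@le_trans _ _ (\int[mu]_y \int[mu]_w (if a <= w <= b then `|K (y - phi w)| else 0)%:E)%E).
  apply: le_int0 => y _ //.
  apply: (@le_trans _ _ (\int[mu]_(w in `[a, b]) `|K (y - phi w)|%:E)%E); last first.
    rewrite integral_mkcond; apply: le_int0 => w _.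
      by rewrite patchE; case: ifPn => // _; rewrite lee_fin.
    by rewrite patchE mem_setE in_itv/=; case: ifPn.
  rewrite /Rintegral; set z := (\int[mu]_(w in `[a, b]) (K (y - phi w))%:E)%E.
  apply: (@le_trans _ _ `|z|%E).
    by case: z => [r| |] //=; rewrite normr0 leey.
  apply: le_abse_integral => //; apply: measurable_funTS; meas.
rewrite tonelli; last 2 first.
- by meas.
- by move=> y w; rewrite lee_fin; case: ifPn.
apply: (@le_trans _ _ (\int[mu]_(w in `[a, b]) cst mK%:E w)%E).
  rewrite [leRHS]integral_mkcond; apply: le_int0 => w _.
    by apply: integral_ge0 => y _; rewrite lee_fin; case: ifPn.
  rewrite patchE mem_setE in_itv/=; case: ifPn => _; last by rewrite integral0.
  exact: shift_int.
rewrite integral_cst//= lebesgue_measure_itv/= lte_fin.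
case: ifPn => _; first by rewrite -EFinD -EFinM lee_fin mulrC.
by rewrite mule0 lee_fin mulr_ge0// subr_ge0.
Qed.

(** Integrate K(y - phi) = (- J(y - phi))' / phi' by parts, with |phi'| >= m. After integration in
    y, the two boundary terms cost 2 mJ / m together, and so does the total variation of 1 / phi',
    which is at most 2 / m. The lower bound is required only when a < b, so degenerate pieces of a
    subdivision come for free. *)
Lemma vdc_nonstationary (phi : R -> R) (a b c d m : R) : a <= b ->
  (forall w, is_derive w (1:R) phi (c * w + d)) -> 0 < m ->
  (a < b -> forall w, a <= w <= b -> m <= `|c * w + d|) ->
  (\int[mu]_y `| \int[mu]_(w in `[a, b]) K (y - phi w)|%:E <= (4 * mJ / m)%:E)%E.
Proof.
move=> ab dphi m0 lb.
move: ab; rewrite le_eqVlt => /predU1P[E|ab].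
  subst b; rewrite integral0_eq ?lee_fin ?divr_ge0 ?mulr_ge0 ?(ltW m0)//.
  by move=> y _; rewrite set_itv1 Rintegral_set1 normr0.
have {}lb w : a <= w <= b -> m <= `|c * w + d| by exact: lb.
have cphi : continuous phi by move=> x; exact: der_cont.
have mphi : measT phi by exact: continuous_measurable_fun.
have n0 w : a <= w <= b -> c * w + d != 0.
  by move=> /lb H; rewrite -normr_gt0 (lt_le_trans m0).
pose F w := (c * w + d)^-1. pose f w := - c / (c * w + d) ^+ 2.
have dF w : a <= w <= b -> is_derive w (1:R) F (f w).
  move=> wab; apply: is_derive_eq; first by rewrite /F; der; exact: n0.
  by rewrite /f /GRing.scale/= mulr1 addr0.
have cf w : a <= w <= b -> {for w, continuous f}.
  by move=> wab; apply: cont_invsq; exact: n0.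
(* [Q] is the absolute value of the derivative of 1 / phi' on [a, b]. *)
pose Q w : R := if a <= w <= b then `|c| / (c * w + d) ^+ 2 else 0.
have Q0 w : 0 <= Q w by rewrite /Q; case: ifPn => // _; rewrite divr_ge0// sqr_ge0.
have mQ : measT Q by rewrite /Q; meas.
have key y : (`| \int[mu]_(w in `[a, b]) K (y - phi w)|%:E <=
   (m^-1)%:E * `|J (y - phi b)|%:E + (m^-1)%:E * `|J (y - phi a)|%:E +
   \int[mu]_w (Q w * `|J (y - phi w)|)%:E)%E.
  pose g w := K (y - phi w) * (c * w + d). pose G w := - J (y - phi w).
  have dG w : is_derive w (1:R) G (g w).
    apply: is_derive_eq; rewrite /G; der.
    by rewrite /g /GRing.scale/=; ring.
  have cG : continuous G by move=> w; exact: der_cont.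
  have cg : continuous g.
    move=> w; apply: cvgM; last first.
      by apply: (@der_cont _ (fun w => c * w + d)); der.
    apply: (continuous_comp (f := fun w => y - phi w)); last exact: cK.
    by apply: (@der_cont _ (fun w => y - phi w)); der.
  have E : \int[mu]_(w in `[a, b]) K (y - phi w) = \int[mu]_(w in `[a, b]) (F w * g w).
    apply: eq_Rintegral => w; rewrite inE/= in_itv/= => wab.
    by rewrite /F /g mulrC mulfK// n0.
  have wc (h : R -> R) : (forall w, a <= w <= b -> {for w, continuous h}) -> {within `[a, b], continuous h}.
    by move=> H; apply: continuous_in_subspaceT => w /[!inE]/=; rewrite in_itv; exact: H.
  rewrite E (@Rintegration_by_parts _ F G f g)//; last 6 first.
  - exact: wc.
  - split.
    + by move=> x; rewrite in_itv/= => /andP[/ltW ax /ltW xb]; apply: @ex_derive; apply: dF; rewrite ax.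
    + by apply: cvg_at_right_filter; apply: der_cont; apply: dF; rewrite lexx ltW.
    + by apply: cvg_at_left_filter; apply: der_cont; apply: dF; rewrite lexx ltW.
  - move=> x; rewrite in_itv/= => /andP[/ltW ax /ltW xb].
    by rewrite derive1E; apply: @derive_val; apply: dF; rewrite ax.
  - by apply: wc => w _; exact: cg.
  - split.
    + by move=> x _; exact: ex_derive.
    + by apply: cvg_at_right_filter; exact: cG.
    + by apply: cvg_at_left_filter; exact: cG.
  - by move=> x _; rewrite derive1E; exact: derive_val.
  apply: (@le_trans _ _ (`|F b * G b - F a * G a|%:E + `|\int[mu]_(w in `[a, b]) (f w * G w)|%:E)%E).
    by rewrite -EFinD lee_fin; exact: ler_normB.
  apply: leeD.
    rewrite -!EFinM -EFinD lee_fin; apply: le_trans (ler_normB _ _) _.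
    by rewrite !normrM /G !normrN; apply: lerD; apply: ler_wpM2r => //;
      rewrite /F normfV lef_pV2 ?posrE ?normr_gt0 ?n0 ?lb ?lexx ?(ltW ab)//.
  rewrite /Rintegral; set z := (\int[mu]_(w in `[a, b]) (f w * G w)%:E)%E.
  apply: (@le_trans _ _ `|z|%E).
    by case: z => [r| |] //=; rewrite normr0 leey.
  apply: (@le_trans _ _ (\int[mu]_(w in `[a, b]) `|(f w * G w)%:E|)%E).
    apply: le_abse_integral => //.
    have : {within `[a, b], continuous (fun w => f w * G w)}.
      by apply: wc => w wab; apply: cvgM; [exact: cf | exact: cG].
    move/subspace_continuous_measurable_fun => H; apply/measurable_EFinP; exact: H.
  rewrite [leLHS]integral_mkcond; apply: le_int0 => w _.
    by rewrite patchE; case: ifPn => // _; rewrite lee_fin.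
  rewrite patchE mem_setE in_itv/= /Q; case: ifPn => wab; last by rewrite mul0r.
  by rewrite lee_fin normrM /f /G normrM normfV !normrN normrX real_normK ?num_real.
have mQJ : measT (fun z : R * R => (Q z.2 * `|J (z.1 - phi z.2)|)%:E) by meas.
have mi0 : 0 <= m^-1 by rewrite invr_ge0 ltW.
apply: (@le_trans _ _ (\int[mu]_y ((m^-1)%:E * `|J (y - phi b)|%:E + (m^-1)%:E * `|J (y - phi a)|%:E +
   \int[mu]_w (Q w * `|J (y - phi w)|)%:E))%E).
  by apply: le_int0 => y _.
have mi : measT (fun y : R => \int[mu]_w (Q w * `|J (y - phi w)|)%:E)%E.
  by apply: meas_int => // y w; rewrite lee_fin mulr_ge0.
have m1 z : measT (fun y : R => (m^-1)%:E * `|J (y - phi z)|%:E)%E by meas.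
have p1 y z : (0 <= (m^-1)%:E * `|J (y - phi z)|%:E)%E by rewrite -EFinM lee_fin mulr_ge0.
rewrite ge0_integralD//; last 3 first.
- by move=> y _; rewrite adde_ge0.
- by apply: emeasurable_funD; exact: m1.
- by move=> y _; apply: integral_ge0 => w _; rewrite lee_fin mulr_ge0.
rewrite ge0_integralD//; [|exact: m1|exact: m1].
have iz z : (\int[mu]_y ((m^-1)%:E * `|J (y - phi z)|%:E) <= (mJ / m)%:E)%E.
  rewrite intZ//.
  rewrite mulrC EFinM; apply: lee_wpmul2l; first by rewrite lee_fin.
  exact: shift_int.
rewrite (_ : 4 * mJ / m = mJ / m + mJ / m + mJ * (m^-1 + m^-1)); last by field; rewrite gt_eqF.
rewrite [leRHS]EFinD [X in (_ <= X + _)%E]EFinD.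
apply: leeD; first by apply: leeD; exact: iz.
rewrite (@tonelli _ _ _ _ _ mu mu (fun y w => (Q w * `|J (y - phi w)|)%:E))//; last first.
  by move=> y w; rewrite lee_fin mulr_ge0.
apply: (@le_trans _ _ (\int[mu]_w (mJ%:E * (Q w)%:E))%E).
  apply: le_int0 => w _.
    by int_ge0.
  under eq_integral do rewrite EFinM.
  rewrite intZ//.
  by rewrite muleC; apply: lee_wpmul2r; rewrite ?lee_fin//; exact: shift_int.
rewrite intZ//.
rewrite EFinM; apply: lee_wpmul2l; rewrite ?lee_fin//.
have -> : (\int[mu]_w (Q w)%:E = \int[mu]_(w in `[a, b]) (`|c| / (c * w + d) ^+ 2)%:E)%E.
  rewrite [RHS]integral_mkcond; apply: eq_integral => w _.
  by rewrite patchE mem_setE in_itv/= /Q; case: ifPn.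
(* The derivative - c / (c w + d)^2 of 1 / phi' keeps the sign of - c, so [Q] integrates to the
   absolute difference of the end values of 1 / phi'. *)
pose sg := if 0 <= c then -1 else 1 : R.
have sgc : sg * (- c) = `|c|.
  by rewrite /sg; case: ifPn => c0; [rewrite ger0_norm// mulrNN mul1r | rewrite mul1r ltr0_norm// ltNge].
have cn w : a <= w <= b -> {for w, continuous (fun w => `|c| / (c * w + d) ^+ 2)}.
  by move=> wab; apply: cont_invsq; exact: n0.
have ds w : a <= w <= b -> is_derive w (1:R) (fun w => sg * F w) (`|c| / (c * w + d) ^+ 2).
  move=> wab; have H := derM (derC sg w) (dF w wab).
  by rewrite (_ : `|c| / _ = 0 * F w + sg * f w)// mul0r add0r /f mulrA sgc.
rewrite (FTC_is_derive (ltW ab) ds cn) lee_fin -mulrBr.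
apply: le_trans (ler_norm _) _; rewrite normrM (_ : `|sg| = 1); last first.
  by rewrite /sg; case: ifPn; rewrite ?normrN normr1.
rewrite mul1r; apply: le_trans (ler_normB _ _) _.
by apply: lerD; rewrite /F normfV lef_pV2 ?posrE ?normr_gt0 ?n0 ?lb ?lexx ?(ltW ab).
Qed.

Lemma Rintegral_split (g : R -> R) (a b c : R) : continuous g -> a <= b -> b <= c ->
  \int[mu]_(w in `[a, c]) g w = \int[mu]_(w in `[a, b]) g w + \int[mu]_(w in `[b, c]) g w.
Proof.
move=> cg ab bc.
have ig x y : mu.-integrable `[x, y] (EFin \o g).
  apply: continuous_compact_integrable; first exact: segment_compact.
  exact: continuous_subspaceT.
have := @Rintegral_itvB R g (BLeft a) (BRight c) b (ig _ _).
rewrite !bnd_simp => /(_ ab bc) H; rewrite -[X in _ = _ + X]Rintegral_itv_obnd_cbnd; last first.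
  by apply: integrableS (ig b c) => //; apply: subset_itv; rewrite bnd_simp.
by rewrite -H addrC subrK.
Qed.

(** The set |phi'| < m is an interval of length 2 m / |c| around the zero of phi', where the trivial
    bound is used. Each of the two remaining pieces is nonstationary and costs 4 mJ / m. *)
Lemma vdc_stationary (phi : R -> R) (a b c d m : R) : a <= b ->
  (forall w, is_derive w (1:R) phi (c * w + d)) -> 0 < m -> c != 0 ->
  (\int[mu]_y `| \int[mu]_(w in `[a, b]) K (y - phi w)|%:E
    <= (2 * m / `|c| * mK + 8 * mJ / m)%:E)%E.
Proof.
move=> ab dphi m0 c0.
have cphi : continuous phi by move=> x; exact: der_cont.
have mphi : measT phi by exact: continuous_measurable_fun.
have nc0 : 0 < `|c| by rewrite normr_gt0.
pose w0 := - d / c. pose del := m / `|c|.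
have del0 : 0 < del by rewrite divr_gt0.
have lin w : `|c * w + d| = `|c| * `|w - w0|.
  by rewrite -normrM /w0; congr (`| _ |); field.
have [l [r [al lr rb lu [rv lrd]]]] := @clamp R a b (w0 - del) (w0 + del) ab ltac:(lra).
have cK' y : continuous (fun w => K (y - phi w)).
  move=> w; apply: (continuous_comp (f := fun w => y - phi w)); last exact: cK.
  by apply: (@der_cont _ (fun w => y - phi w)); der.
have mT u v : measT (fun y : R => `|\int[mu]_(w in `[u, v]) K (y - phi w)|).
  apply: measurableT_comp; first exact: normr_measurable.
  rewrite (_ : (fun y => _) = fun y => \int[mu]_w (if u <= w <= v then K (y - phi w) else 0)).
    by apply: meas_Rint; meas.
  apply/funext => y; rewrite Rintegral_mkcond; apply: eq_Rintegral => w _.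
  by rewrite patchE mem_setE in_itv/=.
have B1 : (\int[mu]_y `|\int[mu]_(w in `[a, l]) K (y - phi w)|%:E <= (4 * mJ / m)%:E)%E.
  apply: (vdc_nonstationary al dphi m0) => all w /andP[aw wl].
  have := lu all => {}lu; have H : w <= w0 - del by lra.
  rewrite lin -ler_pdivrMl// mulrC -/del ler0_norm; lra.
have B3 : (\int[mu]_y `|\int[mu]_(w in `[r, b]) K (y - phi w)|%:E <= (4 * mJ / m)%:E)%E.
  apply: (vdc_nonstationary rb dphi m0) => rltb w /andP[rw wb].
  have := rv rltb => {}rv; have H : w0 + del <= w by lra.
  rewrite lin -ler_pdivrMl// mulrC -/del ger0_norm; lra.
have B2 : (\int[mu]_y `|\int[mu]_(w in `[l, r]) K (y - phi w)|%:E <= (2 * m / `|c| * mK)%:E)%E.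
  apply: le_trans (vdc_trivial lr mphi) _; rewrite lee_fin ler_wpM2r// -mulrA -/del.
  lra.
apply: (@le_trans _ _ (\int[mu]_y (`|\int[mu]_(w in `[a, l]) K (y - phi w)|%:E +
   (`|\int[mu]_(w in `[l, r]) K (y - phi w)|%:E + `|\int[mu]_(w in `[r, b]) K (y - phi w)|%:E)))%E).
  apply: le_int0 => y _ //.
  rewrite (Rintegral_split (cK' y) al (le_trans lr rb)) (Rintegral_split (cK' y) lr rb).
  rewrite -!EFinD lee_fin; apply: le_trans (ler_normD _ _) _.
  by rewrite lerD2l; exact: ler_normD.
rewrite ge0_integralD//; last 3 first.
- by apply/measurable_EFinP; exact: mT.
- by move=> y _; rewrite adde_ge0.
- by apply: emeasurable_funD; apply/measurable_EFinP; exact: mT.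
rewrite ge0_integralD//; last 2 first.
- by apply/measurable_EFinP; exact: mT.
- by apply/measurable_EFinP; exact: mT.
rewrite (_ : 2 * m / `|c| * mK + 8 * mJ / m = 4 * mJ / m + (2 * m / `|c| * mK + 4 * mJ / m)); last by field; rewrite !gt_eqF.
rewrite EFinD; apply: leeD; first exact: B1.
by rewrite EFinD; apply: leeD; [exact: B2|exact: B3].
Qed.

End VanDerCorput.

(** * Real integrals and products of sigma-finite measures *)

Lemma le_norm_Rintegral d (T : measurableType d) (R : realType)
  (mu : {measure set T -> \bar R}) (D : set T) (f : T -> R) : measurable D ->
  measurable_fun D f ->
  (`|\int[mu]_(x in D) f x|%:E <= \int[mu]_(x in D) `|f x|%:E)%E.
Proof.
move=> mD mf; rewrite /Rintegral; set z := (\int[mu]_(w in D) (f w)%:E)%E.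
apply: (@le_trans _ _ `|z|%E).
  by case: z => [r| |] //=; rewrite normr0 leey.
by apply: le_abse_integral => //; exact/measurable_EFinP.
Qed.

Lemma integrableP' d (T : measurableType d) (R : realType)
  (mu : {measure set T -> \bar R}) (f : T -> R) :
  measT f -> (\int[mu]_x `|f x|%:E < +oo)%E ->
  mu.-integrable setT (EFin \o f).
Proof. by move=> mf fi; apply/integrableP; split => //; exact/measurable_EFinP. Qed.

Lemma EFin_Rintegral d (T : measurableType d) (R : realType)
  (mu : {measure set T -> \bar R}) (f : T -> R) :
  mu.-integrable setT (EFin \o f) -> (\int[mu]_x f x)%:E = (\int[mu]_x (f x)%:E)%E.
Proof. by move=> fi; rewrite /Rintegral fineK//; exact: (integrable_fin_num measurableT fi). Qed.

(* The library equips [m1 \x m2] with a sigma-finite structure, but the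
   canonical instance is shadowed by the one for subprobabilities; this copy
   makes iterated products usable. *)
Section ProductSigmaFinite.
Context d1 d2 (T1 : measurableType d1) (T2 : measurableType d2) (R : realType).
Variables (m1 : {sigma_finite_measure set T1 -> \bar R})
  (m2 : {sigma_finite_measure set T2 -> \bar R}).

Definition sfprod : set (T1 * T2) -> \bar R := (m1 \x m2)%E.

HB.instance Definition _ := Measure.on sfprod.

Lemma sfprod_sigma_finite : sigma_finite setT sfprod.
Proof.
by case: (lebesgue_integral_fubini.measure_function_Measure_isSigmaFinite__to__measure_function_isSigmaFinite m1 m2).
Qed.

HB.instance Definition _ :=
  Measure_isSigmaFinite.Build _ _ _ sfprod sfprod_sigma_finite.

Lemma sf_tonelli12 (f : T1 * T2 -> \bar R) : measT f ->
  (forall z, (0 <= f z)%E) ->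
  (\int[sfprod]_z f z = \int[m1]_x \int[m2]_y f (x, y))%E.
Proof. by move=> mf f0; exact: (fubini_tonelli1 f mf f0). Qed.

Lemma sf_integrable12P (f : T1 * T2 -> \bar R) : measT f ->
  sfprod.-integrable setT f <-> (\int[m1]_x \int[m2]_y `|f (x, y)| < +oo)%E.
Proof. by move=> mf; exact: integrable12ltyP. Qed.

Lemma sf_integral12 (f : T1 * T2 -> \bar R) : sfprod.-integrable setT f ->
  (\int[sfprod]_z f z = \int[m1]_x \int[m2]_y f (x, y))%E.
Proof. by move=> fi; rewrite -[LHS](integral12_prod_meas1 fi). Qed.

End ProductSigmaFinite.

Local Notation sleb2 R := (sfprod (leb1 R) (leb1 R)).

(** * The T T* argument *)

Section TTstar.
Context d1 d2 (X : measurableType d1) (W : measurableType d2) (R : realType).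
Variables (mu : {sigma_finite_measure set X -> \bar R}) (nu : {sigma_finite_measure set W -> \bar R}).
Variables (a : X -> W -> R) (f : W -> R) (M N : R).
Hypotheses (ma : measT (fun z : X * W => a z.1 z.2)) (mf : measT f).
Hypotheses (M0 : 0 <= M) (N0 : 0 <= N).
Hypothesis ia : forall w, (\int[mu]_x `|a x w|%:E < +oo)%E.
Hypothesis ia2 : (\int[mu]_x \int[mu]_y \int[nu]_w (`|a x w| * `|a y w|)%:E < +oo)%E.
Hypothesis TT : (\int[mu]_x \int[mu]_y `|\int[nu]_w (a x w * a y w)|%:E <= M%:E)%E.
Hypothesis iaf : (\int[mu]_x \int[nu]_w `|a x w * f w|%:E < +oo)%E.
Hypothesis f2 : (\int[nu]_w (f w ^+ 2)%:E <= N%:E)%E.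

Local Notation mu2 := (sfprod mu mu).

Let ma1 w : measT (fun x => a x w).
Proof. by apply: (measurableT_comp (f := fun z : X * W => a z.1 z.2) (g := fun x => (x, w))) => //; meas. Qed.

Let ma2 x : measT (fun w => a x w).
Proof. by apply: (measurableT_comp (f := fun z : X * W => a z.1 z.2) (g := fun w => (x, w))) => //; meas. Qed.

Let S w := \int[mu]_x a x w.

Let mS : measT S.
Proof.
apply: (@meas_Rint _ _ _ _ _ mu (fun w x => a x w)).
by apply: (measurableT_comp (f := fun z : X * W => a z.1 z.2) (g := fun z : W * X => (z.2, z.1))) => //; meas.
Qed.

Let mG : measT (fun z : W * (X * X) => a z.2.1 z.1 * a z.2.2 z.1).
Proof.
apply: measurable_funM.
- by apply: (measurableT_comp (f := fun z : X * W => a z.1 z.2) (g := fun z : W * (X * X) => (z.2.1, z.1))) => //; meas.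
- by apply: (measurableT_comp (f := fun z : X * W => a z.1 z.2) (g := fun z : W * (X * X) => (z.2.2, z.1))) => //; meas.
Qed.

Let mG' : measT (fun z : (X * X) * W => a z.1.1 z.2 * a z.1.2 z.2).
Proof.
by apply: (measurableT_comp (f := fun z : W * (X * X) => a z.2.1 z.1 * a z.2.2 z.1) (g := fun z : (X * X) * W => (z.2, z.1))) => //; meas.
Qed.

Let S2E w : ((S w ^+ 2)%:E = \int[mu2]_z (a z.1 w * a z.2 w)%:E)%E.
Proof.
have iw : mu.-integrable setT (EFin \o a^~ w) by apply: integrableP'.
have sE : ((S w)%:E = \int[mu]_x (a x w)%:E)%E by rewrite EFin_Rintegral.
have maw : measT (fun z : X * X => (a z.1 w * a z.2 w)%:E).
  apply/measurable_EFinP; apply: measurable_funM.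
  - exact: (measurableT_comp (ma1 w) measurable_fst).
  - exact: (measurableT_comp (ma1 w) measurable_snd).
rewrite sf_integral12//; last first.
  apply/sf_integrable12P; first exact: maw.
  rewrite /=.
  under eq_integral do under eq_integral do rewrite normrM EFinM.
  under eq_integral.
    move=> x _; rewrite intZ//.
    over.
  have J0 : (0 <= \int[mu]_x `|a x w|%:E)%E by apply: integral_ge0.
  rewrite ge0_integralZr//; last by apply/measurable_EFinP; apply: measurableT_comp.
  by apply: lte_mul_pinfty => //; rewrite ?ge0_fin_numE.
under eq_integral.
  move=> x _; under eq_integral do rewrite /= EFinM.
  rewrite /= integralZl//= -sE; over.
by rewrite /= integralZr//= -sE -EFinM expr2.
Qed.

Let S2 : (\int[nu]_w (S w ^+ 2)%:E <= M%:E)%E.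
Proof.
under eq_integral do rewrite S2E.
have iG : (nu \x mu2)%E.-integrable setT (fun z : W * (X * X) => (a z.2.1 z.1 * a z.2.2 z.1)%:E).
  apply/integrable21ltyP => //=; first exact/measurable_EFinP.
  rewrite (@sf_tonelli12 _ _ _ _ _ mu mu (fun p => \int[nu]_w `|a p.1 w * a p.2 w|%:E)%E).
  - apply: le_lt_trans ia2; apply: le_int0 => x _.
      by do 2 (apply: integral_ge0 => ? _).
    apply: le_int0 => y _; first exact: integral_ge0.
    by apply: le_int0 => w _; rewrite ?lee_fin ?normrM.
  - apply: (@meas_int _ _ _ _ _ nu (fun (p : X * X) w => `|a p.1 w * a p.2 w|%:E)) => //.
    apply/measurable_EFinP; apply: measurableT_comp; first exact: normr_measurable.
    exact: mG'.
  - by move=> p; apply: integral_ge0.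
rewrite (Fubini iG)/=.
have mR : measT (fun p : X * X => `|\int[nu]_w (a p.1 w * a p.2 w)|%:E).
  apply/measurable_EFinP; apply: measurableT_comp; first exact: normr_measurable.
  exact: (@meas_Rint _ _ _ _ _ nu (fun (p : X * X) w => a p.1 w * a p.2 w) mG').
apply: (@le_trans _ _ (\int[mu2]_p `|\int[nu]_w (a p.1 w * a p.2 w)|%:E)%E); last first.
  by rewrite (@sf_tonelli12 _ _ _ _ _ mu mu (fun p => `|\int[nu]_w (a p.1 w * a p.2 w)|%:E)).
set z := (\int[mu2]_y \int[nu]_x (a y.1 x * a y.2 x)%:E)%E.
apply: (@le_trans _ _ `|z|%E); first exact: lee_abs.
have -> : z = (\int[mu2]_p \int[nu]_w (a p.1 w * a p.2 w)%:E)%E by [].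
have mm : measT (fun p : X * X => \int[nu]_w (a p.1 w * a p.2 w)%:E)%E.
  exact: (measurable_fubini_G iG).
apply: le_trans (le_abse_integral mu2 measurableT mm) _.
(* The inner integral is known to be finite only for almost every pair, so [fine] passes inside only
   almost everywhere. *)
have [N1 [mN1 N10] HN] := ae_integrable2 iG.
apply: ae_ge0_le_integral => //.
- exact: measurableT_comp.
- exists N1; split => // p /= H; apply: HN => /= ip; apply: H => _.
  by rewrite -EFin_Rintegral//= lee_fin.
Qed.

(** The pairing equals the integral of S f, where S w is the integral of a(x, w) in x.
    Cauchy-Schwarz leaves the square norm of S, which opens into the double integral of the T T*
    kernel and is at most [M]. The finiteness hypotheses justify the three uses of Fubini; a test
    function on X is meant to be absorbed into [a]. *)
Lemma TTstar_bound :
  `|\int[mu]_x \int[nu]_w (a x w * f w)| <= Num.sqrt N * Num.sqrt M.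
Proof.
have maf : measT (fun z : X * W => a z.1 z.2 * f z.2).
  by apply: measurable_funM => //; exact: (measurableT_comp mf measurable_snd).
have iA : (mu \x nu)%E.-integrable setT (fun z : X * W => (a z.1 z.2 * f z.2)%:E).
  by apply/integrable12ltyP => //; exact/measurable_EFinP.
have E1 : (\int[mu]_x \int[nu]_w (a x w * f w)%:E = \int[nu]_w (S w * f w)%:E)%E.
  rewrite (Fubini iA)/=; apply: eq_integral => w _.
  have iw : mu.-integrable setT (EFin \o a^~ w) by apply: integrableP'.
  under eq_integral do rewrite EFinM.
  by rewrite integralZr//= EFinM -EFin_Rintegral.
have E2 : (\int[mu]_x \int[nu]_w (a x w * f w))%:E = (\int[nu]_w (S w * f w)%:E)%E.
  rewrite -E1.
  have iF := integrable_fubini_F iA.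
  have -> : (\int[mu]_x \int[nu]_w (a x w * f w)%:E = \int[mu]_x fubini_F nu (fun z : X * W => (a z.1 z.2 * f z.2)%:E) x)%E by [].
  rewrite /Rintegral; under eq_integral.
    move=> x _; over.
  have [N1 [mN1 N10] HN] := integrable_ae measurableT iF.
  have mF1 : measT (fun x => (fine (\int[nu]_w (a x w * f w)%:E))%:E).
    exact/measurable_EFinP/(@meas_Rint _ _ _ _ _ nu (fun x w => a x w * f w)).
  have aeE : (\int[mu]_x (fine (\int[nu]_w (a x w * f w)%:E))%:E = \int[mu]_x fubini_F nu (fun z : X * W => (a z.1 z.2 * f z.2)%:E) x)%E.
    apply: ae_eq_integral => //; first by move/integrableP: iF => [].
    exists N1; split => // x /= H; apply: HN => /= ip; apply: H => _.
    by rewrite fineK//; exact: ip.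
  by rewrite aeE fineK//; exact: (integrable_fin_num measurableT iF).
rewrite -lee_fin.
have -> : (`|\int[mu]_x \int[nu]_w (a x w * f w)|%:E = `|(\int[mu]_x \int[nu]_w (a x w * f w))%:E|)%E by [].
rewrite E2.
have mSf : measT (fun w => (S w * f w)%:E).
  by apply/measurable_EFinP; exact: measurable_funM.
apply: le_trans (le_abse_integral nu measurableT mSf) _.
rewrite mulrC.
by have := cauchy_schwarz mS mf M0 N0 S2 f2.
Qed.

End TTstar.

(** * The estimate for a pair of parabolas *)

(** A negative [r] describes the interval to the right of x, so one condition on (x - w) / r covers
    one-sided averages on both sides. *)
Lemma unit_interval (R : realType) (x r : R) : r != 0 -> exists lo hi,
  [/\ hi - lo = `|r|, lo <= x <= hi & forall w, (0 < (x - w) / r < 1) = (lo < w < hi)].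
Proof.
move=> r0; have [rp|rn|/eqP] := ltgtP r 0; last by rewrite (negbTE r0).
- exists x, (x - r); split; first by rewrite ltr0_norm//; ring.
    by rewrite lexx/=; lra.
  move=> w; rewrite ltr_ndivlMr// ltr_ndivrMr// mul0r mul1r.
  by apply/idP/idP => /andP[? ?]; apply/andP; split; lra.
- exists (x - r), x; split; first by rewrite gtr0_norm//; ring.
    by rewrite lexx andbT; lra.
  move=> w; rewrite ltr_pdivlMr// ltr_pdivrMr// mul0r mul1r.
  by apply/idP/idP => /andP[? ?]; apply/andP; split; lra.
Qed.

Lemma interval_inter (R : realType) (a b c d : R) : exists l h,
  [/\ a <= l, c <= l, h <= b, h <= d & forall w, (a < w < b) && (c < w < d) = (l < w < h)].
Proof.
exists (if a <= c then c else a), (if b <= d then b else d).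
by split; try (case: ifPn; rewrite -?ltNge => ?; lra);
  move=> w; case: ifPn; rewrite -?ltNge => ?; case: ifPn; rewrite -?ltNge => ?;
  apply/idP/idP => [/andP[/andP[? ?] /andP[? ?]]|/andP[? ?]]; apply/andP; split; try lra;
  apply/andP; split; lra.
Qed.

Lemma integrable_poisson_bound (R : realType) (s A : R) (g : R -> R) : 0 < s -> 0 <= A ->
  measT g -> (forall t, `|g t| <= A * poissonk s t) ->
  (\int[leb1 R]_t `|g t|%:E <= (pi * A)%:E)%E.
Proof.
move=> s0 A0 mg gb.
apply: (@le_trans _ _ (\int[leb1 R]_t (A%:E * (poissonk s t)%:E))%E).
  by apply: le_int0 => t _; rewrite ?lee_fin// -EFinM lee_fin.
by rewrite intZ// integral_poissonk// -EFinM mulrC.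
Qed.

Section PairEstimate.
Variables (R : realType) (K J : R -> R) (s A : R).
Local Notation mu := (leb1 R).
Hypotheses (s0 : 0 < s) (A0 : 0 <= A).
Hypotheses (cK : continuous K) (dJ : forall t, is_derive t (1:R) J (K t)).
Hypotheses (bK : forall t, `|K t| <= A * poissonk s t) (bJ : forall t, `|J t| <= A / s * poissonk s t).

Let mesK : measT K.
Proof. exact: continuous_measurable_fun. Qed.

Let iK : (\int[mu]_t `|K t|%:E <= (pi * A)%:E)%E.
Proof. exact: integrable_poisson_bound bK. Qed.

Let iJ : (\int[mu]_t `|J t|%:E <= (pi * A / s)%:E)%E.
Proof.
rewrite -mulrA; apply: integrable_poisson_bound bJ => //; first by rewrite divr_ge0// ltW.
by apply: continuous_measurable_fun => x; exact: der_cont.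
Qed.

(** The phase al (x - w)^2 - al' (x' - w)^2 has an affine derivative. If the curvatures al, al'
    differ enough, it is small only on a short interval; if they are close and x, x' are far apart,
    it is bounded below throughout. Either way the gain over the trivial bound |r'| pi A is a factor
    of order eps, and eps = lam^(-1/3) is what balances the cases. For x' within 3 eps |r| of x no
    gain is claimed. *)
Lemma pair_estimate (lam eps x x' r r' al al' : R) :
  0 < eps -> eps <= 1 -> eps ^+ 3 * lam = 1 -> r != 0 -> r' != 0 -> `|r'| <= `|r| ->
  lam <= s * `|al'| * r' ^+ 2 ->
  (\int[mu]_y `|\int[mu]_w (if (0 < (x - w) / r < 1) && (0 < (x' - w) / r' < 1)
       then K (y - (al * (x - w) ^+ 2 - al' * (x' - w) ^+ 2)) else 0)|%:E
   <= (`|r'| * (9 * pi * A) * (eps * (`|x - x'| < 2 * `|r|)%R%:R + (`|x - x'| < 3 * eps * `|r|)%R%:R))%:E)%E.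
Proof.
move=> e0 e1 el r0 r'0 rr lal.
have [lo [hi [hlo xin HI]]] := unit_interval x r0.
have [lo' [hi' [hlo' xin' HI']]] := unit_interval x' r'0.
have [L [H [Llo Llo' Hhi Hhi' HLH]]] := interval_inter lo hi lo' hi'.
set phi := fun w : R => al * (x - w) ^+ 2 - al' * (x' - w) ^+ 2.
have rp : 0 < `|r'| by rewrite normr_gt0.
set rho := `|r'| in rp rr hlo' *.
have pi0 : 0 <= pi :> R by exact: pi_ge0.
have pA0 : 0 <= pi * A by rewrite mulr_ge0.
have rhs0 : 0 <= rho * (9 * pi * A) * (eps * (`|x - x'| < 2 * `|r|)%R%:R + (`|x - x'| < 3 * eps * `|r|)%R%:R).
  by rewrite mulr_ge0 ?mulr_ge0 ?(ltW rp)// addr_ge0// mulr_ge0// ltW.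
have [HL|LH] := leP H L.
  rewrite integral0_eq ?lee_fin// => y _.
  rewrite (_ : (fun _ => _) = cst 0); last first.
    apply/funext => w; rewrite HI HI' HLH; case: ifPn => // /andP[? ?]; lra.
  by rewrite /Rintegral integral0 normr0.
have E y : \int[mu]_w (if (0 < (x - w) / r < 1) && (0 < (x' - w) / r' < 1) then K (y - phi w) else 0)
   = \int[mu]_(w in `[L, H]) K (y - phi w).
  rewrite [in RHS]/Rintegral (@integral_itv_bndoo _ _ _ (fun w => (K (y - phi w))%:E) true false); last first.
    by apply: measurable_funTS; rewrite /phi; meas.
  rewrite /Rintegral [in RHS]integral_mkcond; congr fine; apply: eq_integral => w _.
  by rewrite patchE mem_setE in_itv/= HI HI' HLH; case: ifPn.
under eq_integral do rewrite E.
have dphi w : is_derive w (1:R) phi (2 * (al - al') * w + 2 * (al' * x' - al * x)).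
  have -> : phi = (fun w => (al - al') * (w * w) + ((2 * (al' * x' - al * x)) * w + (al * (x * x) - al' * (x' * x')))).
    by apply/funext => v; rewrite /phi; ring.
  by apply: is_derive_eq; der; rewrite /GRing.scale/=; ring.
have mphi : measT phi.
  by apply: continuous_measurable_fun => w; exact: der_cont.
have LHr : H - L <= rho by lra.
have LH' := ltW LH.
have pJ0 : 0 <= pi * A / s by rewrite divr_ge0// ltW.
(* The two w-intervals meet, which forces x and x' within |r| + |r'| <= 2 |r|. *)
have near1 : `|x - x'| < 2 * `|r|.
  by have := ler_norm r; have := normr_ge0 r; rewrite ltr_norml; move/andP: xin xin' => [? ?] /andP[? ?] *; apply/andP; split; lra.
have triv c : rho * (pi * A) <= c -> (\int[mu]_y `|\int[mu]_(w in `[L, H]) K (y - phi w)|%:E <= c%:E)%E.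
  move=> hc; apply: le_trans (vdc_trivial cK iK pA0 LH' mphi) _.
  by rewrite lee_fin (le_trans _ hc)// ler_wpM2r.
rewrite near1 mulr1.
(* For eps > 1/2, and next for |x - x'| < 3 eps |r|, the right side already exceeds the trivial
   bound. *)
have [ebig|esmall] := ltP 2^-1 eps.
  apply: triv; rewrite -mulrA ler_wpM2l ?(ltW rp)//.
  rewrite (_ : 9 * pi * A * _ = pi * A * (9 * (eps + (`|x - x'| < 3 * eps * `|r|)%R%:R))); last by ring.
  by rewrite ler_peMr//; have : 0 <= (`|x - x'| < 3 * eps * `|r|)%R%:R :> R by []; lra.
have [|far] := boolP (`|x - x'| < 3 * eps * `|r|).
  move=> _; apply: triv; rewrite -mulrA ler_wpM2l ?(ltW rp)//.
  rewrite (_ : true%:R = 1 :> R)// (_ : 9 * pi * A * _ = pi * A * (9 * (eps + 1))); last by ring.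
  by rewrite ler_peMr//; lra.
rewrite (_ : false%:R = 0 :> R)// addr0.
(* [m] is the lower bound on |phi'| for which the nonstationary cost (pi A / s) / m equals pi A eps
   rho. [D] is the curvature gap for which {|phi'| < m} has length at most eps rho. *)
pose m := (s * eps * rho)^-1.
have m0 : 0 < m by rewrite invr_gt0 !mulr_gt0.
have mE : m * (s * eps * rho) = 1 by rewrite mulVf// gt_eqF// !mulr_gt0.
pose D := (s * eps ^+ 2 * rho ^+ 2)^-1.
have D0 : 0 < D by rewrite invr_gt0 !mulr_gt0// exprn_gt0.
have DE : D * (eps * rho) = m.
  by rewrite /D /m; field; rewrite !gt_eqF.
have [big|small] := leP D `|al - al'|.
  have c0 : 2 * (al - al') != 0.
    by rewrite mulf_neq0// -normr_gt0 (lt_le_trans D0).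
  apply: le_trans (vdc_stationary cK dJ iK iJ pA0 pJ0 LH' dphi m0 c0) _.
  rewrite lee_fin normrM ger0_norm//.
  have h1 : 2 * m / (2 * `|al - al'|) <= eps * rho.
    rewrite ler_pdivrMr; last by rewrite mulr_gt0// (lt_le_trans D0).
    rewrite -DE; have := ltW (mulr_gt0 e0 rp); nra.
  have h2 : 8 * (pi * A / s) / m = 8 * (pi * A) * (eps * rho).
    by rewrite /m; field; rewrite !gt_eqF.
  rewrite h2 (_ : rho * (9 * pi * A) * eps = eps * rho * (pi * A) + 8 * (pi * A) * (eps * rho)); last by ring.
  by rewrite lerD2r ler_wpM2r.
(* Curvatures closer than [D]: then |al| >= lam / (2 s rho^2), so with |x - x'| >= 3 eps rho the
   term 2 al (x - x') of phi' is at least 3 D rho. The other term is at most 2 D rho, and D rho >=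
   m. *)
have lb w : L <= w <= H -> m <= `|2 * (al - al') * w + 2 * (al' * x' - al * x)|.
  move=> /andP[Lw wH].
  rewrite (_ : 2 * (al - al') * w + 2 * (al' * x' - al * x) =
     2 * (al' - al) * (x' - w) - 2 * al * (x - x')); last by ring.
  rewrite -normrN opprB; apply: le_trans (lerB_dist _ _).
  rewrite !normrM !(ger0_norm (_ : 0 <= 2))//.
  have xw : `|x' - w| <= rho.
    by rewrite -/rho ler_norml; move/andP: xin' => [? ?]; apply/andP; split; lra.
  have h1 : 2 * `|al' - al| * `|x' - w| <= 2 * (D * rho).
    rewrite -mulrA ler_pM2l//; apply: ler_pM => //.
    by rewrite distrC ltW.
  have a1 : lam / (s * rho ^+ 2) <= `|al'|.
    rewrite ler_pdivrMr; last by rewrite mulr_gt0// exprn_gt0.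
    have r2 : r' ^+ 2 = rho ^+ 2 by rewrite /rho real_normK ?num_real.
    by apply: le_trans lal _; rewrite r2 le_eqVlt; apply/predU1l; ring.
  have lE : lam = (eps ^+ 3)^-1.
    by rewrite -[LHS]mul1r -(mulVf (_ : eps ^+ 3 != 0)) ?expf_neq0 ?gt_eqF// -mulrA el mulr1.
  have a2 : D <= lam / (s * rho ^+ 2) / 2.
    rewrite (_ : lam / (s * rho ^+ 2) / 2 = D * (eps^-1 / 2)); last first.
      by rewrite lE /D; field; rewrite !gt_eqF.
    rewrite ler_peMr ?(ltW D0)// ler_pdivlMr// mul1r.
    by rewrite -[leLHS]invrK lef_pV2 ?posrE// invr_gt0.
  have a3 : lam / (s * rho ^+ 2) / 2 <= `|al|.
    have : `|al'| - `|al| <= `|al - al'| by rewrite distrC lerB_dist.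
    lra.
  have xx : 3 * eps * rho <= `|x - x'|.
    by rewrite -leNgt in far; apply: le_trans far; rewrite ler_wpM2l// mulr_ge0// ltW.
  have h2 : 3 * (D * rho) <= 2 * `|al| * `|x - x'|.
    have -> : 3 * (D * rho) = 2 * (lam / (s * rho ^+ 2) / 2) * (3 * eps * rho).
      by rewrite lE /D; field; rewrite !gt_eqF.
    apply: ler_pM => //.
    - rewrite lE !mulr_ge0 ?invr_ge0 ?mulr_ge0 ?exprn_ge0 ?(ltW s0) ?(ltW rp) ?(ltW e0)//.
    - by rewrite !mulr_ge0// ltW.
    - by rewrite ler_pM2l.
  have h3 : m <= D * rho.
    by rewrite -DE mulrCA ler_piMl// mulr_ge0// ltW.
  lra.
apply: le_trans (vdc_nonstationary cK dJ iJ pJ0 LH' dphi m0 (fun _ => lb)) _.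
rewrite lee_fin.
have -> : 4 * (pi * A / s) / m = 4 * (pi * A) * (eps * rho).
  by rewrite /m; field; rewrite !gt_eqF.
rewrite (_ : rho * (9 * pi * A) * eps = 4 * (pi * A) * (eps * rho) + 5 * (pi * A * (eps * rho))); last by ring.
by rewrite lerDl mulr_ge0// mulr_ge0// mulr_ge0// ltW.
Qed.

End PairEstimate.

(** * Substitutions and Fubini for real integrals *)

Lemma ge0_integral_shift (R : realType) (c : R) (f : R -> \bar R) :
  measT f -> (forall x, 0 <= f x)%E ->
  (\int[leb1 R]_x f (x + c)%R = \int[leb1 R]_x f x)%E.
Proof.
move=> mf f0; have := @ge0_integral_affine R 1 c f (oner_neq0 _) mf f0.
rewrite normr1 invr1 mul1e => <-.
by apply: eq_integral => x _; rewrite mul1r.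
Qed.

Lemma ge0_integral_reflect (R : realType) (c : R) (f : R -> \bar R) :
  measT f -> (forall x, 0 <= f x)%E ->
  (\int[leb1 R]_x f (c - x)%R = \int[leb1 R]_x f x)%E.
Proof.
move=> mf f0; have := @ge0_integral_affine R (-1) c f _ mf f0.
rewrite normrN1 invr1 mul1e => <-; last by rewrite oppr_eq0 oner_neq0.
by apply: eq_integral => x _; rewrite mulN1r addrC.
Qed.

Lemma EFin_Rintegral2 d1 d2 (X : measurableType d1) (Y : measurableType d2) (R : realType)
  (mu : {sigma_finite_measure set X -> \bar R}) (nu : {sigma_finite_measure set Y -> \bar R})
  (F : X -> Y -> R) : measT (fun z : X * Y => F z.1 z.2) ->
  (\int[mu]_x \int[nu]_y `|F x y|%:E < +oo)%E ->
  ((\int[mu]_x \int[nu]_y F x y)%:E = \int[mu]_x \int[nu]_y (F x y)%:E)%E.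
Proof.
move=> mF iF.
have iFm : (mu \x nu)%E.-integrable setT (fun z : X * Y => (F z.1 z.2)%:E).
  by apply/integrable12ltyP => //; exact/measurable_EFinP.
have iG := integrable_fubini_F iFm.
have [N1 [mN1 N10] HN] := integrable_ae measurableT iG.
have mG : measT (fun x => (fine (\int[nu]_y (F x y)%:E))%:E).
  exact/measurable_EFinP/(@meas_Rint _ _ _ _ _ nu F).
have aeE : (\int[mu]_x (fine (\int[nu]_y (F x y)%:E))%:E = \int[mu]_x fubini_F nu (fun z : X * Y => (F z.1 z.2)%:E) x)%E.
  apply: ae_eq_integral => //; first by move/integrableP: iG => [].
  exists N1; split => // x /= H; apply: HN => /= ip; apply: H => _.
  by rewrite fineK//; exact: ip.
have -> : (\int[mu]_x \int[nu]_y (F x y)%:E = \int[mu]_x fubini_F nu (fun z : X * Y => (F z.1 z.2)%:E) x)%E by [].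
rewrite /Rintegral aeE fineK//; exact: (integrable_fin_num measurableT iG).
Qed.

Section RFubini.
Context d1 d2 (X : measurableType d1) (Y : measurableType d2) (R : realType).
Variables (mu : {sigma_finite_measure set X -> \bar R}) (nu : {sigma_finite_measure set Y -> \bar R}).
Variable F : X -> Y -> R.
Hypotheses (mF : measT (fun z : X * Y => F z.1 z.2))
  (iF : (\int[mu]_x \int[nu]_y `|F x y|%:E < +oo)%E).

Lemma Rintegral_sfprod12 :
  \int[sfprod mu nu]_z F z.1 z.2 = \int[mu]_x \int[nu]_y F x y.
Proof.
have iFm : (mu \x nu)%E.-integrable setT (fun z : X * Y => (F z.1 z.2)%:E).
  by apply/integrable12ltyP => //; exact/measurable_EFinP.
by apply: EFin_inj; rewrite EFin_Rintegral// sf_integral12//= EFin_Rintegral2.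
Qed.

Lemma RFubini : \int[mu]_x \int[nu]_y F x y = \int[nu]_y \int[mu]_x F x y.
Proof.
have iFm : (mu \x nu)%E.-integrable setT (fun z : X * Y => (F z.1 z.2)%:E).
  by apply/integrable12ltyP => //; exact/measurable_EFinP.
have mF' : measT (fun z : Y * X => F z.2 z.1).
  by apply: (measurableT_comp (f := fun z : X * Y => F z.1 z.2) (g := fun z : Y * X => (z.2, z.1))) => //; meas.
apply: EFin_inj; rewrite EFin_Rintegral2// (EFin_Rintegral2 (F := fun y x => F x y))//.
  exact: (Fubini iFm).
rewrite tonelli//.
by apply/measurable_EFinP; apply: measurableT_comp; [exact: normr_measurable | exact: mF'].
Qed.
End RFubini.

Lemma Rintegral_affine (R : realType) (a b : R) (f : R -> R) : a != 0 ->
  measT f ->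
  \int[leb1 R]_x f (a * x + b) = `|a|^-1 * \int[leb1 R]_x f x.
Proof.
move=> a0 mf; rewrite /Rintegral integralE [X in _ = _ * fine X]integralE.
have mp := measurable_funepos (proj2 (measurable_EFinP _ _) mf).
have mn := measurable_funeneg (proj2 (measurable_EFinP _ _) mf).
have := @ge0_integral_affine R a b (fun x => (EFin \o f)^\+ x)%E a0 mp (fun x => funepos_ge0 _ x).
have := @ge0_integral_affine R a b (fun x => (EFin \o f)^\- x)%E a0 mn (fun x => funeneg_ge0 _ x).
have -> : (\int[leb1 R]_x (fun x => (f (a * x + b)%R)%:E)^\+ x =
  \int[leb1 R]_x (EFin \o f)^\+ (a * x + b)%R)%E.
  by apply: eq_integral => x _; rewrite !funeposE.
have -> : (\int[leb1 R]_x (fun x => (f (a * x + b)%R)%:E)^\- x =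
  \int[leb1 R]_x (EFin \o f)^\- (a * x + b)%R)%E.
  by apply: eq_integral => x _; rewrite !funenegE.
move=> -> ->.
have -> : (fun x => (f x)%:E)^\+%E = (EFin \o f)^\+%E by [].
have -> : (fun x => (f x)%:E)^\-%E = (EFin \o f)^\-%E by [].
set u := (\int[leb1 R]_x (EFin \o f)^\+ x)%E.
set v := (\int[leb1 R]_x (EFin \o f)^\- x)%E.
have u0 : (0 <= u)%E by exact: integral_ge0.
have v0 : (0 <= v)%E by exact: integral_ge0.
have ap : 0 < `|a|^-1 by rewrite invr_gt0 normr_gt0.
case: u u0 => [u| |]// u0; case: v v0 => [v| |]// v0; rewrite ?gt0_muley ?lte_fin ?mulr0//=.
by rewrite mulrBr.
Qed.

Lemma Rintegral_reflect (R : realType) (c : R) (f : R -> R) : measT f ->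
  \int[leb1 R]_x f (c - x) = \int[leb1 R]_x f x.
Proof.
move=> mf; have c0 : (-1 : R) != 0 by rewrite oppr_eq0 oner_neq0.
have := Rintegral_affine c c0 mf; rewrite normrN1 invr1 mul1r => E; rewrite -[RHS]E.
by congr Rintegral; apply/funext => x; rewrite mulN1r addrC.
Qed.

(** * Averages along parabolas as integral operators *)

Section TOperator.
Variables (R : realType) (K J : R -> R) (s A : R).
Local Notation mu := (leb1 R).
Local Notation mu2 := (sfprod mu mu).
Hypotheses (s0 : 0 < s) (A0 : 0 <= A).
Hypotheses (cK : continuous K) (dJ : forall t, is_derive t (1:R) J (K t)).
Hypotheses (bK : forall t, `|K t| <= A * poissonk s t) (bJ : forall t, `|J t| <= A / s * poissonk s t).
Variables (r al : R -> R).
Hypotheses (mr : measT r) (mal : measT al).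

Let mesK : measT K.
Proof. exact: continuous_measurable_fun. Qed.

Let iK : (\int[mu]_t `|K t|%:E <= (pi * A)%:E)%E.
Proof. exact: integrable_poisson_bound bK. Qed.

Let pA0 : 0 <= pi * A :> R.
Proof. by rewrite mulr_ge0// pi_ge0. Qed.

Lemma kernel_sup t : `|K t| <= A * s.
Proof.
apply: le_trans (bK t) _; rewrite ler_wpM2l// /poissonk ler_pdivrMr.
  by rewrite ler_peMr ?(ltW s0)// lerDl sqr_ge0.
by rewrite ltr_pwDl// sqr_ge0.
Qed.

Lemma kernel_reflect_mass c : (\int[mu]_z `|K (c - z)|%:E <= (pi * A)%:E)%E.
Proof.
have := @ge0_integral_affine R (-1) c (fun t => `|K t|%:E).
under eq_integral do rewrite mulN1r addrC.
by rewrite normrN1 invr1 mul1e => H; rewrite H ?oppr_eq0 ?oner_eq0//; meas.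
Qed.

(** Kernel of the average over t = x - w between 0 and r(x), along the parabola with coefficient
    al(x), after convolution with K in the second variable. The sign of r(x) selects the side; r(x)
    = 0 gives the zero kernel, since division by 0 returns 0. *)
Definition Tk (X W : R * R) : R := if 0 < (X.1 - W.1) / r X.1 < 1 then
  `|r X.1|^-1 * K (X.2 - W.2 - al X.1 * (X.1 - W.1) ^+ 2) else 0.

Definition Top (f : R * R -> R) (X : R * R) : R := \int[mu2]_W (Tk X W * f W).

Lemma measurable_Tk : measT (fun z : (R * R) * (R * R) => Tk z.1 z.2).
Proof. by rewrite /Tk; meas. Qed.

Lemma measurable_Top f : measT f -> measT (Top f).
Proof.
move=> mf; apply: (@meas_Rint _ _ _ _ _ mu2 (fun X W => Tk X W * f W)).
apply: measurable_funM; first exact: measurable_Tk.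
exact: (measurableT_comp mf measurable_snd).
Qed.

Lemma Tk_sup X W : `|Tk X W| <= `|r X.1|^-1 * (A * s).
Proof.
rewrite /Tk; case: ifPn => _; last by rewrite normr0 mulr_ge0 ?invr_ge0// mulr_ge0// ltW.
by rewrite normrM normfV normr_id ler_wpM2l ?invr_ge0// kernel_sup.
Qed.

Lemma unit_interval_mass x : (\int[mu]_w (if (0 < (x - w) / r x < 1)%R then `|r x|^-1 else 0)%:E <= 1%:E)%E.
Proof.
have [->|r0] := eqVneq (r x) 0.
  rewrite integral0_eq ?lee_fin// => w _.
  by rewrite invr0 mulr0 ltxx.
have [lo [hi [hlo _ H]]] := unit_interval x r0.
apply: (@le_trans _ _ (\int[mu]_(w in `]lo, hi[) cst (`|r x|^-1)%:E w)%E).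
  rewrite [leRHS]integral_mkcond; apply: le_int0 => w _.
    by rewrite lee_fin; case: ifPn => // _; rewrite invr_ge0.
  by rewrite patchE mem_setE in_itv/= H; case: ifPn.
rewrite integral_cst//= lebesgue_measure_itv/= lte_fin.
have rp : 0 < `|r x| by rewrite normr_gt0.
have lh : lo < hi by rewrite -subr_gt0 hlo.
by rewrite lh -EFinD -EFinM hlo mulVf// gt_eqF.
Qed.

Lemma Tk_mass X : (\int[mu2]_W `|Tk X W|%:E <= (pi * A)%:E)%E.
Proof.
rewrite sf_tonelli12//; last first.
  apply/measurable_EFinP; apply: measurableT_comp; first exact: normr_measurable.
  by rewrite /Tk; meas.
apply: (@le_trans _ _ (\int[mu]_w ((if (0 < (X.1 - w) / r X.1 < 1)%R then `|r X.1|^-1 else 0)%:E * (pi * A)%:E))%E).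
  apply: le_int0 => w _; first exact: integral_ge0.
  rewrite /Tk/=; case: ifPn => _; last by rewrite integral0_eq ?mul0e// => z _; rewrite normr0.
  under eq_integral do rewrite normrM normfV normr_id EFinM.
  rewrite intZ ?invr_ge0//.
  apply: lee_wpmul2l; first by rewrite lee_fin invr_ge0.
  under eq_integral do rewrite addrAC.
  exact: kernel_reflect_mass.
rewrite ge0_integralZr//; last 2 first.
- by meas.
- by move=> w _; rewrite lee_fin; case: ifPn => // _; rewrite invr_ge0.
rewrite -[leRHS]mul1e; apply: lee_wpmul2r; first by rewrite lee_fin.
exact: unit_interval_mass.
Qed.

(* L1(dz)-profile of the kernel of T T^* between the lines x and x'. *)
Definition Vk (x x' z : R) : R :=
  `|\int[mu]_w (if (0 < (x - w) / r x < 1) && (0 < (x' - w) / r x' < 1)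
       then K (z - (al x * (x - w) ^+ 2 - al x' * (x' - w) ^+ 2)) else 0)|.

(** The profile [Vk] smeared by |K|: a majorant of the T T* kernel as a function of the height
    difference z, with mass at most pi A times that of [Vk] up to the factors 1 / |r|. *)
Definition Uk (x x' z : R) : \bar R :=
  (\int[mu]_t (`|r x|^-1 * `|r x'|^-1 * (`|K t| * Vk x x' (z + t)))%:E)%E.

Lemma Vk_ge0 x x' z : 0 <= Vk x x' z.
Proof. exact: normr_ge0. Qed.

Lemma measurable_Vk : measT (fun p : (R * R) * R => Vk p.1.1 p.1.2 p.2).
Proof.
apply: measurableT_comp; first exact: normr_measurable.
apply: (@meas_Rint _ _ _ _ _ mu (fun (p : (R * R) * R) w =>
 (if (0 < (p.1.1 - w) / r p.1.1 < 1) && (0 < (p.1.2 - w) / r p.1.2 < 1)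
       then K (p.2 - (al p.1.1 * (p.1.1 - w) ^+ 2 - al p.1.2 * (p.1.2 - w) ^+ 2)) else 0))).
by meas.
Qed.

Lemma measurable_Uk : measT (fun p : (R * R) * R => Uk p.1.1 p.1.2 p.2).
Proof.
apply: (@meas_int _ _ _ _ _ mu (fun (p : (R * R) * R) t =>
  (`|r p.1.1|^-1 * `|r p.1.2|^-1 * (`|K t| * Vk p.1.1 p.1.2 (p.2 + t)))%:E)).
  apply/measurable_EFinP; apply: measurable_funM; first by meas.
  apply: measurable_funM; first by meas.
  apply: (measurableT_comp (f := fun p : (R * R) * R => Vk p.1.1 p.1.2 p.2)
    (g := fun z : ((R * R) * R) * R => ((z.1.1.1, z.1.1.2), z.1.2 + z.2))); first exact: measurable_Vk.
  by meas.
by move=> p t; rewrite lee_fin mulr_ge0// mulr_ge0 ?invr_ge0// Vk_ge0.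
Qed.

(** For fixed w the integral in the second variable is a correlation of K with itself, so the T T*
    kernel depends on the heights only through their difference. Moving the absolute value inside
    the correlation integral but outside the w-integral keeps the cancellation in w. *)
Lemma Tk_pair X Y :
  (`|\int[mu2]_W (Tk X W * Tk Y W)|%:E <= Uk X.1 Y.1 (X.2 - Y.2))%E.
Proof.
have mT Z : measT (Tk Z) by rewrite /Tk; meas.
have mTT : measT (fun W => Tk X W * Tk Y W) by apply: measurable_funM; exact: mT.
have fin : (\int[mu]_w \int[mu]_z `|Tk X (w, z) * Tk Y (w, z)|%:E < +oo)%E.
  rewrite -(@sf_tonelli12 _ _ _ _ _ mu mu (fun W => `|Tk X W * Tk Y W|%:E))//; last first.
    by apply/measurable_EFinP; apply: measurableT_comp; [exact: normr_measurable|].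
  apply: (@le_lt_trans _ _ (\int[mu2]_W ((`|r Y.1|^-1 * (A * s))%:E * `|Tk X W|%:E))%E).
    apply: le_int0 => W _ //.
    by rewrite -EFinM lee_fin normrM mulrC ler_wpM2r// Tk_sup.
  rewrite intZ//; last by rewrite mulr_ge0 ?invr_ge0// mulr_ge0// ltW.
  rewrite lte_mul_pinfty//.
    by rewrite lee_fin mulr_ge0 ?invr_ge0// mulr_ge0// ltW.
  by rewrite (le_lt_trans (Tk_mass X))// ltry.
have -> : \int[mu2]_W (Tk X W * Tk Y W) = \int[mu]_w \int[mu]_z (Tk X (w, z) * Tk Y (w, z)).
  rewrite -(@Rintegral_sfprod12 _ _ _ _ _ mu mu (fun w z => Tk X (w, z) * Tk Y (w, z)))//.
pose c := `|r X.1|^-1 * `|r Y.1|^-1.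
pose I w := (0 < (X.1 - w) / r X.1 < 1) && (0 < (Y.1 - w) / r Y.1 < 1).
pose phi w := al X.1 * (X.1 - w) ^+ 2 - al Y.1 * (Y.1 - w) ^+ 2.
pose F w t := if I w then c * (K t * K (X.2 - Y.2 + t - phi w)) else 0.
have mF : measT (fun z : R * R => F z.1 z.2) by rewrite /F /I /phi; meas.
have E w : \int[mu]_z (Tk X (w, z) * Tk Y (w, z)) = \int[mu]_t F w t.
  rewrite /Tk /F /I /=.
  case h1: (0 < (X.1 - w) / r X.1 < 1) => /=; last first.
    by congr Rintegral; apply/funext => z; rewrite mul0r.
  case h2: (0 < (Y.1 - w) / r Y.1 < 1) => /=; last first.
    by congr Rintegral; apply/funext => z; rewrite mulr0.
  have m1 : measT (fun z : R => `|r X.1|^-1 * K (X.2 - z - al X.1 * (X.1 - w) ^+ 2) *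
     (`|r Y.1|^-1 * K (Y.2 - z - al Y.1 * (Y.1 - w) ^+ 2))) by meas.
  (* Substituting z = Y.2 - al (Y.1 - w)^2 - t leaves w in the argument of only one of the two
     factors K. *)
  have := @Rintegral_affine R (-1) (Y.2 - al Y.1 * (Y.1 - w) ^+ 2) _ _ m1.
  rewrite normrN1 invr1 mul1r => <-; last by rewrite oppr_eq0 oner_neq0.
  congr Rintegral; apply/funext => t; rewrite /c /phi mulrACA; congr (_ * _).
  rewrite mulrC; congr (K _ * K _); ring.
under eq_Rintegral do rewrite E.
have finF : (\int[mu]_w \int[mu]_t `|F w t|%:E < +oo)%E.
  apply: (@le_lt_trans _ _ (\int[mu]_w ((if (0 < (X.1 - w) / r X.1 < 1)%R then `|r X.1|^-1 else 0)%:E * ((`|r Y.1|^-1 * (A * s) * (pi * A))%:E)))%E).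
    apply: le_int0 => w _; first exact: integral_ge0.
    rewrite /F; case hI: (I w); last first.
      rewrite integral0_eq; last by move=> t _; rewrite normr0.
      rewrite mule_ge0//; first by rewrite lee_fin; case: ifPn => // _; rewrite invr_ge0.
      by rewrite lee_fin mulr_ge0// mulr_ge0 ?invr_ge0// mulr_ge0// ltW.
    move: hI; rewrite /I => /andP[-> _]; rewrite -EFinM.
    apply: (@le_trans _ _ (\int[mu]_t ((c * (A * s))%:E * `|K t|%:E))%E).
      apply: le_int0 => t _ //; rewrite -EFinM lee_fin !normrM !normfV !normr_id.
      rewrite -[leRHS]mulrA; apply: ler_wpM2l; first by rewrite mulr_ge0 ?invr_ge0.
      by rewrite mulrC ler_wpM2r// kernel_sup.
    rewrite intZ//; last by rewrite !mulr_ge0 ?invr_ge0// ltW.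
    rewrite (_ : `|r X.1|^-1 * _ = c * (A * s) * (pi * A)); last by rewrite /c; ring.
    by rewrite [leRHS]EFinM; apply: lee_wpmul2l; rewrite ?lee_fin// !mulr_ge0 ?invr_ge0// ltW.
  rewrite ge0_integralZr//; last 3 first.
  - by meas.
  - by move=> w _; rewrite lee_fin; case: ifPn => // _; rewrite invr_ge0.
  - by rewrite lee_fin mulr_ge0// mulr_ge0 ?invr_ge0// mulr_ge0// ltW.
  apply: (@le_lt_trans _ _ (1%:E * (`|r Y.1|^-1 * (A * s) * (pi * A))%:E)%E); last by rewrite -EFinM ltry.
  apply: lee_wpmul2r; last exact: unit_interval_mass.
  by rewrite lee_fin mulr_ge0// mulr_ge0 ?invr_ge0// mulr_ge0// ltW.
rewrite (@RFubini _ _ _ _ _ mu mu F mF finF).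
have mR : measT (fun t => \int[mu]_w F w t).
  apply: (@meas_Rint _ _ _ _ _ mu (fun t w => F w t)).
  by rewrite /F /I /phi; meas.
apply: (le_trans (le_norm_Rintegral mu measurableT mR)).
apply: le_int0 => t _ //; rewrite lee_fin.
have -> : \int[mu]_w F w t = (c * K t) * \int[mu]_w (if I w then K (X.2 - Y.2 + t - phi w) else 0).
  rewrite -RintegralZl//; last first.
    apply: integrableP'; first by rewrite /I /phi; meas.
    have [r0|r0] := eqVneq (r X.1) 0.
      rewrite integral0_eq// => w _; rewrite /I r0 invr0 mulr0 ltxx/= normr0//.
    have rp : 0 < `|r X.1| by rewrite normr_gt0.
    apply: (@le_lt_trans _ _ (\int[mu]_w ((`|r X.1| * (A * s))%:E * (if (0 < (X.1 - w) / r X.1 < 1)%R then `|r X.1|^-1 else 0)%:E))%E).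
      apply: le_int0 => w _ //; rewrite /I; case: ifPn => [/andP[-> _]|_].
        by rewrite -EFinM lee_fin mulrAC divff ?gt_eqF// mul1r kernel_sup.
      rewrite normr0 mule_ge0 ?lee_fin ?mulr_ge0 ?(ltW s0)//.
      by case: ifPn => // _; rewrite invr_ge0.
    rewrite intZ//; last by rewrite !mulr_ge0// ltW.
    rewrite lte_mul_pinfty//; first by rewrite lee_fin !mulr_ge0// ltW.
    by rewrite (le_lt_trans (unit_interval_mass X.1))// ltry.
  congr Rintegral; apply/funext => w; rewrite /F; case: ifPn => _; last by rewrite mulr0.
  by rewrite mulrA.
rewrite !normrM !normfV !normr_id -!mulrA /Vk /I /phi//.
Qed.

Lemma Uk_mass x x' B : (\int[mu]_z (Vk x x' z)%:E <= B%:E)%E ->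
  (\int[mu]_z Uk x x' z <= (`|r x|^-1 * `|r x'|^-1 * (pi * A) * B)%:E)%E.
Proof.
move=> HB.
have mV : measT (Vk x x').
  apply: (measurableT_comp (f := fun p : (R * R) * R => Vk p.1.1 p.1.2 p.2)
    (g := fun z => ((x, x'), z))); first exact: measurable_Vk.
  by meas.
have c0 : 0 <= `|r x|^-1 * `|r x'|^-1 by rewrite mulr_ge0 ?invr_ge0.
have B0 : 0 <= B by rewrite -lee_fin; apply: le_trans HB; apply: integral_ge0 => z _; rewrite lee_fin Vk_ge0.
rewrite /Uk tonelli; last 2 first.
- by meas.
- by move=> z t; rewrite lee_fin mulr_ge0// mulr_ge0// Vk_ge0.
apply: (@le_trans _ _ (\int[mu]_t ((`|r x|^-1 * `|r x'|^-1 * B)%:E * `|K t|%:E))%E).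
  apply: le_int0 => t _.
    by apply: integral_ge0 => z _; rewrite lee_fin mulr_ge0// mulr_ge0// Vk_ge0.
  under eq_integral do rewrite mulrA EFinM.
  rewrite intZ//.
  rewrite -[X in (_ <= X)%E]EFinM.
  rewrite (_ : _ * B * _ = (`|r x|^-1 * `|r x'|^-1 * `|K t|) * B); last by ring.
  rewrite [leRHS]EFinM.
  apply: lee_wpmul2l; first by rewrite lee_fin mulr_ge0.
  rewrite (@ge0_integral_shift R t (fun t => (Vk x x' t)%:E))//; first by meas.
  by move=> z; rewrite lee_fin Vk_ge0.
rewrite intZ//; last by rewrite mulr_ge0.
rewrite (_ : _ * (pi * A) * B = `|r x|^-1 * `|r x'|^-1 * B * (pi * A)); last by ring.
by rewrite [leRHS]EFinM; apply: lee_wpmul2l; rewrite ?lee_fin ?mulr_ge0.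
Qed.

End TOperator.

(** * Fatou's lemma and mass bounds for the T T* kernel *)

Lemma limn_einf_ge (R : realType) (u : (\bar R)^nat) (b : \bar R) :
  (\forall n \near \oo, b <= u n)%E -> (b <= limn_einf u)%E.
Proof.
move=> [N _ H]; rewrite limn_einf_lim.
rewrite (cvg_lim (@ereal_hausdorff R) (ereal_nondecreasing_cvgn (nondecreasing_einfs u))).
apply: (@le_trans _ _ (einfs u N)); last by apply: ereal_sup_ubound; exists N.
by apply: le_ereal_inf_tmp => _ [m /= Nm <-]; exact: H.
Qed.

Lemma limn_einf_le (R : realType) (u : (\bar R)^nat) (b : \bar R) :
  (forall n, u n <= b)%E -> (limn_einf u <= b)%E.
Proof.
move=> H; rewrite limn_einf_lim.
rewrite (cvg_lim (@ereal_hausdorff R) (ereal_nondecreasing_cvgn (nondecreasing_einfs u))).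
apply: ge_ereal_sup => _ [n _ <-]; apply: (@le_trans _ _ (u n)) => //.
by apply: ereal_inf_lbound; exists n => //=.
Qed.

Lemma fatou_le d (T : measurableType d) (R : realType) (mu : {measure set T -> \bar R})
  (f : nat -> T -> \bar R) (F : T -> \bar R) (b : \bar R) :
  (forall n, measT (f n)) -> (forall n x, 0 <= f n x)%E ->
  (forall n, \int[mu]_x f n x <= b)%E -> (forall x, 0 <= F x)%E ->
  (forall x, F x <= limn_einf (f ^~ x))%E -> (\int[mu]_x F x <= b)%E.
Proof.
move=> mf f0 fb F0 Ff.
apply: (@le_trans _ _ (\int[mu]_x limn_einf (f ^~ x))%E); first by apply: le_int0.
apply: (le_trans (fatou mu measurableT mf (fun n x _ => f0 n x))).
exact: limn_einf_le.
Qed.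

Lemma fatou_near d (T : measurableType d) (R : realType) (mu : {measure set T -> \bar R})
  (f : nat -> T -> \bar R) (F : T -> \bar R) (b : \bar R) :
  (forall n, measT (f n)) -> (forall n x, 0 <= f n x)%E ->
  (forall n, \int[mu]_x f n x <= b)%E -> (forall x, 0 <= F x)%E ->
  (forall x, \forall n \near \oo, F x <= f n x)%E -> (\int[mu]_x F x <= b)%E.
Proof.
by move=> mf f0 fb F0 Ff; apply: (fatou_le mf) => // x; exact: limn_einf_ge.
Qed.

(** Young's inequality in bilinear form: put t = z - w, apply Cauchy-Schwarz in z for each t, then
    integrate U. *)
Lemma convolution_cauchy_schwarz (R : realType) (h h' : R -> R) (U : R -> \bar R) (m a b : R) :
  measT h -> measT h' -> measT U ->
  (forall z, 0 <= U z)%E -> 0 <= a -> 0 <= b ->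
  (\int[leb1 R]_z U z <= m%:E)%E ->
  (\int[leb1 R]_z (h z ^+ 2)%:E <= a%:E)%E ->
  (\int[leb1 R]_z (h' z ^+ 2)%:E <= b%:E)%E ->
  (\int[leb1 R]_z \int[leb1 R]_w ((`|h z| * `|h' w|)%:E * U (z - w)%R)
    <= (m * (Num.sqrt a * Num.sqrt b))%:E)%E.
Proof.
move=> mh mh' mU U0 a0 b0 Um ha hb.
have E z : (\int[leb1 R]_w ((`|h z| * `|h' w|)%:E * U (z - w)%R) =
   \int[leb1 R]_t ((`|h z| * `|h' (z - t)%R|)%:E * U t))%E.
  rewrite -(@ge0_integral_reflect R z (fun w => (`|h z| * `|h' w|)%:E * U (z - w)%R)%E).
  - by apply: eq_integral => t _; rewrite opprB addrCA subrr addr0.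
  - apply: emeasurable_funM; first by meas.
    by apply: (measurableT_comp mU); meas.
  - by move=> w; rewrite mule_ge0 ?lee_fin// mulr_ge0.
under eq_integral do rewrite E.
rewrite tonelli; last 2 first.
- apply: emeasurable_funM; first by meas.
  exact: (measurableT_comp mU measurable_snd).
- by move=> z t; rewrite mule_ge0 ?lee_fin// mulr_ge0.
apply: (@le_trans _ _ (\int[leb1 R]_t ((Num.sqrt a * Num.sqrt b)%:E * U t))%E).
  apply: le_int0 => t _.
    by apply: integral_ge0 => z _; rewrite mule_ge0 ?lee_fin// mulr_ge0.
  rewrite ge0_integralZr//; last by meas.
  apply: lee_wpmul2r => //.
  under eq_integral do rewrite -normrM.
  have := @cauchy_schwarz _ _ R (leb1 R) h (fun z : R => h' (z - t)) a b mh _ a0 b0 ha.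
  apply; first by meas.
  rewrite (@ge0_integral_shift R (- t) (fun w => (h' w ^+ 2)%:E))//; first by meas.
  by move=> w; rewrite lee_fin sqr_ge0.
rewrite intZ ?mulr_ge0//.
rewrite (mulrC m) [leRHS]EFinM; apply: lee_wpmul2l => //.
Qed.

(** [pair_estimate] is normalised by the larger radius, and its factor |r'| cancels 1 / |r'|.
    Exchanging x and x' reverses the sign of the phase, so the second bound is the same estimate for
    - al and - al'. *)
Lemma poisson_kernel_pair (R : realType) (K J : R -> R) (s A : R) (r al : R -> R) (lam eps x x' : R) :
  0 < s -> 0 <= A -> continuous K -> (forall t, is_derive t (1:R) J (K t)) ->
  (forall t, `|K t| <= A * poissonk s t) -> (forall t, `|J t| <= A / s * poissonk s t) ->
  measT r -> measT al ->
  0 < eps -> eps <= 1 -> eps ^+ 3 * lam = 1 ->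
  (forall x, r x != 0 -> lam <= s * `|al x| * r x ^+ 2) -> `|r x'| <= `|r x| ->
  (\int[leb1 R]_z Uk K r al x x' z <=
   (9 * pi ^+ 2 * A ^+ 2 * `|r x|^-1 *
     (eps * (`|x - x'| < 2 * `|r x|)%R%:R + (`|x - x'| < 3 * eps * `|r x|)%R%:R))%:E)%E /\
  (\int[leb1 R]_z Uk K r al x' x z <=
   (9 * pi ^+ 2 * A ^+ 2 * `|r x|^-1 *
     (eps * (`|x - x'| < 2 * `|r x|)%R%:R + (`|x - x'| < 3 * eps * `|r x|)%R%:R))%:E)%E.
Proof.
move=> s0 A0 cK dJ bK bJ mr mal e0 e1 el Hl rr.
set G := _ + _.
have G0 : 0 <= G by rewrite addr_ge0// mulr_ge0// ltW.
have RHS0 : 0 <= 9 * pi ^+ 2 * A ^+ 2 * `|r x|^-1 * G.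
  by rewrite !mulr_ge0 ?invr_ge0 ?exprn_ge0 ?pi_ge0.
have [r'0|r'0] := eqVneq (r x') 0.
  have Z y y' z : r y = 0 \/ r y' = 0 -> Uk K r al y y' z = 0%E.
    move=> yy; rewrite /Uk integral0_eq// => t _.
    by case: yy => ->; rewrite normr0 invr0 ?mulr0 !mul0r.
  split; (rewrite integral0_eq; [by rewrite lee_fin|move=> z _]).
    by apply: Z; right.
  by apply: Z; left.
have r0 : r x != 0 by rewrite -normr_gt0 (lt_le_trans _ rr)// normr_gt0.
have PE := @pair_estimate R K J s A s0 A0 cK dJ bK bJ lam eps x x' (r x) (r x').
have cancel B : `|r x|^-1 * `|r x'|^-1 * (pi * A) * (`|r x'| * (9 * pi * A) * B) =
   9 * pi ^+ 2 * A ^+ 2 * `|r x|^-1 * B.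
  transitivity ((`|r x'|^-1 * `|r x'|) * (9 * pi ^+ 2 * A ^+ 2 * `|r x|^-1 * B)); first by ring.
  by rewrite mulVf ?mul1r// normr_eq0.
split.
  apply: le_trans (@Uk_mass _ K s A s0 A0 cK bK r al mr mal x x' _ (PE (al x) (al x') e0 e1 el r0 r'0 rr (Hl _ r'0))) _.
  by rewrite cancel.
have H := PE (- al x) (- al x') e0 e1 el r0 r'0 rr.
rewrite normrN in H.
have H' : (\int[leb1 R]_z (Vk K r al x' x z)%:E <= (`|r x'| * (9 * pi * A) * G)%:E)%E.
  apply: le_trans (H (Hl _ r'0)); apply: le_int0 => z _; first by rewrite lee_fin Vk_ge0.
  rewrite /Vk lee_fin; set u := Rintegral _ _ _; set v := Rintegral _ _ _.
  rewrite (_ : u = v)//; congr Rintegral; apply/funext => w.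
  rewrite andbC; case: ifPn => // _; congr (K (z - _)); ring.
apply: le_trans (@Uk_mass _ K s A s0 A0 cK bK r al mr mal x' x _ H') _.
by rewrite -cancel [`|r x'|^-1 * _]mulrC.
Qed.

(** * The L2 estimate with decay *)

Section BallKernel.
Variables (R : realType) (r : R -> R) (eps C2 : R).
Local Notation mu := (leb1 R).
Hypotheses (mr : measT r) (e0 : 0 < eps).
Hypothesis HC2 : forall (F : R -> R) (B : R), measT F -> (forall x, 0 <= F x <= B) ->
  (\int[mu]_x (HLr F x `^ 2)%:E <= C2%:E * \int[mu]_x (F x `^ 2)%:E)%E.

Definition ball_kernel (x x' : R) : R := `|r x|^-1 *
  (eps * (`|x - x'| < 2 * `|r x|)%R%:R + (`|x - x'| < 3 * eps * `|r x|)%R%:R).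

Lemma ball_kernel_ge0 x x' : 0 <= ball_kernel x x'.
Proof. by rewrite mulr_ge0 ?invr_ge0// addr_ge0// mulr_ge0// ltW. Qed.

Lemma measurable_ball_kernel : measT (fun z : R * R => ball_kernel z.1 z.2).
Proof.
have E (b : bool) : b%:R = (if b then 1 else 0) :> R by case: b.
rewrite (_ : (fun z : R * R => _) = (fun z : R * R => `|r z.1|^-1 *
  (eps * (if `|z.1 - z.2| < 2 * `|r z.1| then 1 else 0) +
   (if `|z.1 - z.2| < 3 * eps * `|r z.1| then 1 else 0)))); first by meas.
by apply/funext => z; rewrite /ball_kernel !E.
Qed.

(** For fixed x the kernel averages H over a ball of radius 2 |r| with weight eps and over one of
    radius 3 eps |r|: 4 eps + 6 eps = 10 eps times the maximal function of H. Cauchy-Schwarz and the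
    L2 maximal theorem finish. *)
Lemma ball_kernel_sum (H : R -> R) (B N : R) : measT H ->
  (forall x, 0 <= H x <= B) -> 0 <= N -> 0 <= C2 ->
  (\int[mu]_x (H x ^+ 2)%:E <= N%:E)%E ->
  (\int[mu]_x \int[mu]_x' (H x * H x' * ball_kernel x x')%:E
     <= (10 * eps * (Num.sqrt N * Num.sqrt (C2 * N)))%:E)%E.
Proof.
move=> mH HB N0 C20 HN.
have H0 x : 0 <= H x by have /andP[] := HB x.
have mHL := measurable_HLr (F := H) (B := B) mH (fun x => _ : `|H x| <= B).
have {}mHL : measT (HLr H).
  by apply: mHL => x; rewrite ger0_norm//; have /andP[] := HB x.
apply: (@le_trans _ _ (\int[mu]_x ((10 * eps)%:E * `|H x * HLr H x|%:E))%E).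
  apply: le_int0 => x _.
    by apply: integral_ge0 => x' _; rewrite lee_fin mulr_ge0 ?ball_kernel_ge0// mulr_ge0.
  have [r0|r0] := eqVneq (r x) 0.
    rewrite integral0_eq => [|x' _]; first by rewrite mule_ge0 ?lee_fin// mulr_ge0// ltW.
    by rewrite /ball_kernel r0 normr0 invr0 mul0r mulr0.
  have rp : 0 < `|r x| by rewrite normr_gt0.
  have E x' : ((H x * H x' * ball_kernel x x')%:E =
    (H x * `|r x|^-1 * eps)%:E * (if (`|x - x'| < 2 * `|r x|)%R then H x' else 0)%:E +
    (H x * `|r x|^-1)%:E * (if (`|x - x'| < 3 * eps * `|r x|)%R then H x' else 0)%:E)%E.
    rewrite -!EFinM -EFinD /ball_kernel; congr EFin.
    by case: ifPn => _; case: ifPn => _ /=; rewrite ?mulr1 ?mulr0; ring.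
  under eq_integral do rewrite E.
  have n0 : 0 <= H x * `|r x|^-1 by rewrite mulr_ge0 ?invr_ge0.
  have n1 : 0 <= H x * `|r x|^-1 * eps by rewrite mulr_ge0// ltW.
  have i0 c x' : 0 <= (if `|x - x'| < c then H x' else 0) by case: ifPn.
  rewrite ge0_integralD//; try by meas.
  all: try by move=> x' _; rewrite mule_ge0 ?lee_fin.
  rewrite !intZ//.
  apply: (@le_trans _ _ ((H x * `|r x|^-1 * eps)%:E * (2 * (2 * `|r x|) * HLr H x)%:E +
     (H x * `|r x|^-1)%:E * (2 * (3 * eps * `|r x|) * HLr H x)%:E)%E).
    have p2 : 0 < 2 * `|r x| by rewrite mulr_gt0.
    have p3 : 0 < 3 * eps * `|r x| by rewrite !mulr_gt0.
    apply: leeD; apply: lee_wpmul2l; rewrite ?lee_fin//.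
      exact: (HLr_avg _ mH HB).
    exact: (HLr_avg _ mH HB).
  rewrite -!EFinM -EFinD lee_fin (@ger0_norm _ (H x * HLr H x)) ?mulr_ge0 ?HLr_ge0//.
  apply: (@le_trans _ _ ((`|r x|^-1 * `|r x|) * (10 * eps * (H x * HLr H x)))).
    by rewrite le_eqVlt; apply/orP; left; apply/eqP; ring.
  by rewrite mulVf ?mul1r// gt_eqF.
rewrite intZ//.
  have hh : (\int[mu]_x (HLr H x ^+ 2)%:E <= (C2 * N)%:E)%E.
    have E F : 0 <= F -> (F `^ 2 = F ^+ 2 :> R) by move=> F0; rewrite powR_mulrn.
    have := HC2 mH HB.
    under eq_integral do rewrite E ?HLr_ge0//.
    under [X in (_ <= _ * X)%E -> _]eq_integral do rewrite E//.
    move=> /le_trans -> //; rewrite [leRHS]EFinM; exact: lee_wpmul2l.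
  rewrite [leRHS]EFinM; apply: lee_wpmul2l; first by rewrite lee_fin mulr_ge0// ltW.
  have CN0 : 0 <= C2 * N by rewrite mulr_ge0.
  exact: (@cauchy_schwarz _ _ R mu H (HLr H) N (C2 * N) mH mHL N0 CN0 HN hh).
by rewrite mulr_ge0// ltW.
Qed.

End BallKernel.

Section BilinearBound.
Variables (R : realType) (K J : R -> R) (s A : R).
Local Notation mu := (leb1 R).
Local Notation mu2 := (sfprod mu mu).
Hypotheses (s0 : 0 < s) (A0 : 0 <= A).
Hypotheses (cK : continuous K) (dJ : forall t, is_derive t (1:R) J (K t)).
Hypotheses (bK : forall t, `|K t| <= A * poissonk s t) (bJ : forall t, `|J t| <= A / s * poissonk s t).
Variables (r al : R -> R).
Hypotheses (mr : measT r) (mal : measT al).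
Variables (lam eps C2 : R).
Hypotheses (e0 : 0 < eps) (e1 : eps <= 1) (el : eps ^+ 3 * lam = 1).
Hypothesis Hlam : forall x, r x != 0 -> lam <= s * `|al x| * r x ^+ 2.
Hypotheses (C20 : 0 <= C2)
  (HC2 : forall (F : R -> R) (B : R), measT F -> (forall x, 0 <= F x <= B) ->
  (\int[mu]_x (HLr F x `^ 2)%:E <= C2%:E * \int[mu]_x (F x `^ 2)%:E)%E).
Variables (h : R * R -> R) (Bh L dl : R).
Hypotheses (mh : measT h) (hB : forall X, `|h X| <= Bh) (L0 : 0 <= L) (dl0 : 0 < dl).
Hypothesis hsupp : forall X, h X != 0 -> [/\ `|X.1| <= L, `|X.2| <= L & dl <= `|r X.1|].

Local Notation T := (Tk K r al).

Let mT : measT (fun z : (R * R) * (R * R) => T z.1 z.2).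
Proof. exact: (measurable_Tk cK mr mal). Qed.

Let mT1 X : measT (T X).
Proof. by apply: (measurableT_comp (f := fun z : (R * R) * (R * R) => T z.1 z.2) (g := fun W => (X, W))); [exact: mT|meas]. Qed.

Let q (x : R) : R := \int[mu]_z (h (x, z) ^+ 2).
(** The L2 norm of [h] on the vertical line over x; Young's inequality on pairs of lines reduces the
    plane to this function of x. *)
Let H (x : R) : R := Num.sqrt (q x).

Let Bh0 : 0 <= Bh.
Proof. exact: le_trans (normr_ge0 (h (0, 0))) (hB _). Qed.

Let h2_mass x : (\int[mu]_z (h (x, z) ^+ 2)%:E <= (Bh ^+ 2 * (2 * L))%:E)%E.
Proof.
apply: (@le_trans _ _ (\int[mu]_(z in `[(- L)%R, L]) cst (Bh ^+ 2)%:E z)%E).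
  rewrite [leRHS]integral_mkcond; apply: le_int0 => z _.
    by rewrite lee_fin sqr_ge0.
  rewrite patchE mem_setE in_itv/=; case: ifPn => zL.
    by rewrite lee_fin -(ger0_norm (sqr_ge0 (h _))) normrX lerXn2r ?nnegrE.
  have [->|/hsupp[_ /=]] := eqVneq (h (x, z)) 0; first by rewrite expr0n.
  by rewrite ler_norml (negbTE zL).
rewrite integral_cst//= lebesgue_measure_itv/= lte_fin.
case: ifPn => _; last by rewrite mule0 lee_fin !mulr_ge0 ?exprn_ge0.
by rewrite -EFinD -EFinM lee_fin opprK -mulr2n mulr_natl.
Qed.

Let qE x : ((q x)%:E = \int[mu]_z (h (x, z) ^+ 2)%:E)%E.
Proof.
rewrite /q /Rintegral fineK// ge0_fin_numE; last by int_ge0.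
by rewrite (le_lt_trans (h2_mass x))// ltry.
Qed.

Let q0 x : 0 <= q x.
Proof. by rewrite -lee_fin qE integral_ge0// => z _; rewrite lee_fin sqr_ge0. Qed.

Let mH : measT H.
Proof.
apply: (measurableT_comp (f := @Num.sqrt R)).
  by apply: continuous_measurable_fun; exact: sqrt_continuous.
apply: (@meas_Rint _ _ _ _ _ mu (fun x z => h (x, z) ^+ 2)).
apply: measurable_funX; apply: (measurableT_comp mh); by meas.
Qed.

Let HB x : 0 <= H x <= Num.sqrt (Bh ^+ 2 * (2 * L)).
Proof. by rewrite sqrtr_ge0/= ler_wsqrtr// -lee_fin qE h2_mass. Qed.

Let HE (N : R) : (\int[mu2]_X (h X ^+ 2)%:E <= N%:E)%E -> (\int[mu]_x (H x ^+ 2)%:E <= N%:E)%E.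
Proof.
rewrite sf_tonelli12//; last 2 first.
- by meas.
- by move=> X; rewrite lee_fin sqr_ge0.
by apply: le_trans; apply: le_int0 => x _; rewrite ?lee_fin ?sqr_ge0// /H sqr_sqrtr// qE.
Qed.

Let M0 : R := 180 * pi ^+ 2 * A ^+ 2 * eps.

(** Young's inequality bounds the integral over the lines x and x' by H(x) H(x') times the mass of
    [Uk], that is, times [ball_kernel]. The constant 180 is 9 * 10, doubled by the two orders of x
    and x'. *)
Lemma Uk_sum (N : R) : 0 <= N -> (\int[mu2]_X (h X ^+ 2)%:E <= N%:E)%E ->
  (\int[mu2]_X \int[mu2]_Y ((`|h X| * `|h Y|)%:E * Uk K r al X.1 Y.1 (X.2 - Y.2)%R)
   <= (M0 * (Num.sqrt N * Num.sqrt (C2 * N)))%:E)%E.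
Proof.
move=> N0 hN.
have mU := measurable_Uk cK mr mal.
have U0 x x' z : (0 <= Uk K r al x x' z)%E.
  by apply: integral_ge0 => t _; rewrite lee_fin !mulr_ge0 ?invr_ge0// Vk_ge0.
pose G (X Y : R * R) := ((`|h X| * `|h Y|)%:E * Uk K r al X.1 Y.1 (X.2 - Y.2)%R)%E.
have mG d (Z : measurableType d) (f g : Z -> R * R) : measT f -> measT g ->
   measT (fun z => G (f z) (g z)).
  move=> mf mg; rewrite /G; apply: emeasurable_funM.
    by apply/measurable_EFinP; apply: measurable_funM;
      (apply: measurableT_comp; first exact: normr_measurable);
      [exact: (measurableT_comp mh mf)|exact: (measurableT_comp mh mg)].
  have mf1 := measurableT_comp (@measurable_fst _ _ _ _) mf.
  have mf2 := measurableT_comp (@measurable_snd _ _ _ _) mf.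
  have mg1 := measurableT_comp (@measurable_fst _ _ _ _) mg.
  have mg2 := measurableT_comp (@measurable_snd _ _ _ _) mg.
  apply: (measurableT_comp (f := fun p : (R * R) * R => Uk K r al p.1.1 p.1.2 p.2)
    (g := fun z => (((f z).1, (g z).1), (f z).2 - (g z).2)) mU).
  apply: measurable_fun_pair; first exact: measurable_fun_pair.
  exact: measurable_funB.
have G0 X Y : (0 <= G X Y)%E by rewrite mule_ge0// lee_fin mulr_ge0.
have -> : (\int[mu2]_X \int[mu2]_Y G X Y = \int[mu]_x \int[mu]_x' \int[mu]_z \int[mu]_z' G (x, z) (x', z'))%E.
  rewrite sf_tonelli12; last 2 first.
  - by apply: (@meas_int _ _ _ _ _ mu2 G) => //; apply: mG.
  - by move=> X; apply: integral_ge0.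
  apply: eq_integral => x _.
  transitivity (\int[mu]_z \int[mu]_x' \int[mu]_z' G (x, z) (x', z'))%E.
    apply: eq_integral => z _; rewrite sf_tonelli12//.
    by apply: (mG _ _ (fun=> (x, z)) id).
  apply: (@tonelli _ _ _ _ _ mu mu (fun z x' => \int[mu]_z' G (x, z) (x', z')))%E.
    apply: (@meas_int _ _ _ _ _ mu (fun (p : R * R) z' => G (x, p.1) (p.2, z'))) => //.
    by apply: mG; meas.
  by move=> z x'; apply: integral_ge0.
pose c := 9 * pi ^+ 2 * A ^+ 2 : R.
have c0 : 0 <= c by rewrite !mulr_ge0 ?exprn_ge0 ?pi_ge0.
pose g := ball_kernel r eps.
have g0 x x' : 0 <= g x x' by exact: ball_kernel_ge0.
have mg := measurable_ball_kernel eps mr.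
(* The larger of the two radii normalises the bound; adding the kernel in both orders covers either
   case. *)
have mass x x' : (\int[mu]_z Uk K r al x x' z <= (c * (g x x' + g x' x))%:E)%E.
  case: (leP `|r x'| `|r x|) => rr.
    have [H1 _] := poisson_kernel_pair s0 A0 cK dJ bK bJ mr mal e0 e1 el Hlam rr.
    by apply: (le_trans H1); rewrite lee_fin /c -(mulrA c) ler_wpM2l// lerDl.
  have [_ H1] := poisson_kernel_pair s0 A0 cK dJ bK bJ mr mal e0 e1 el Hlam (ltW rr).
  by apply: (le_trans H1); rewrite lee_fin /c -(mulrA c) ler_wpM2l// lerDr.
apply: (@le_trans _ _ (\int[mu]_x \int[mu]_x' (c%:E * (H x * H x' * g x x')%:E + c%:E * (H x * H x' * g x' x)%:E)))%E.
  apply: le_int0 => x _; first by do 3 (apply: integral_ge0 => ? _).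
  apply: le_int0 => x' _; first by do 2 (apply: integral_ge0 => ? _).
  have mh1 y : measT (fun z => h (y, z)) by apply: (measurableT_comp mh); meas.
  have mU1 : measT (Uk K r al x x').
    by apply: (measurableT_comp (f := fun p : (R * R) * R => Uk K r al p.1.1 p.1.2 p.2) (g := fun z => ((x, x'), z)) mU); meas.
  have := @convolution_cauchy_schwarz R (fun z => h (x, z)) (fun z => h (x', z)) (Uk K r al x x')
    (c * (g x x' + g x' x)) (q x) (q x') (mh1 x) (mh1 x') mU1 (U0 x x') (q0 x) (q0 x') (mass x x').
  rewrite !qE !lexx => /(_ isT isT) /le_trans -> //.
  by rewrite -!EFinM -EFinD lee_fin le_eqVlt; apply/orP; left; apply/eqP; rewrite /H; ring.
have HH0 x x' : 0 <= H x * H x' by rewrite mulr_ge0 ?sqrtr_ge0.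
have mHH : measT (fun z : R * R => H z.1 * H z.2).
  by apply: measurable_funM; [exact: (measurableT_comp mH measurable_fst)|exact: (measurableT_comp mH measurable_snd)].
have mHg : measT (fun z : R * R => (H z.1 * H z.2 * g z.1 z.2)%:E).
  by apply/measurable_EFinP; exact: measurable_funM.
have mHg' : measT (fun z : R * R => (H z.1 * H z.2 * g z.2 z.1)%:E).
  apply/measurable_EFinP; apply: measurable_funM => //.
  by apply: (measurableT_comp (f := fun z : R * R => g z.1 z.2) (g := fun z => (z.2, z.1))) => //; meas.
have S1 := ball_kernel_sum r e0 HC2 mH HB N0 C20 (HE hN).
have S2 : (\int[mu]_x \int[mu]_x' (H x * H x' * g x' x)%:E <= (10 * eps * (Num.sqrt N * Num.sqrt (C2 * N)))%:E)%E.
  rewrite (@tonelli _ _ _ _ _ mu mu (fun x x' => (H x * H x' * g x' x)%:E) mHg'); last first.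
    by move=> x x'; rewrite lee_fin mulr_ge0.
  apply: le_trans S1; apply: le_int0 => x _.
    by int_ge0.
  apply: le_int0 => x' _; first by rewrite lee_fin mulr_ge0.
  by rewrite lee_fin (mulrC (H x)).
have E x : (\int[mu]_x' (c%:E * (H x * H x' * g x x')%:E + c%:E * (H x * H x' * g x' x)%:E) =
   c%:E * \int[mu]_x' (H x * H x' * g x x')%:E + c%:E * \int[mu]_x' (H x * H x' * g x' x)%:E)%E.
  have m1 : measT (fun x' => (H x * H x' * g x x')%:E)
    by apply: (measurableT_comp (f := fun z : R * R => (H z.1 * H z.2 * g z.1 z.2)%:E) (g := fun x' : R => (x, x'))) => //; meas.
  have m2 : measT (fun x' => (H x * H x' * g x' x)%:E) 
    by apply: (measurableT_comp (f := fun z : R * R => (H z.1 * H z.2 * g z.2 z.1)%:E) (g := fun x' : R => (x, x'))) => //; meas.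
  rewrite ge0_integralD//; last 4 first.
  - by move=> x' _; rewrite mule_ge0 ?lee_fin// mulr_ge0.
  - exact: measurable_funeM.
  - by move=> x' _; rewrite mule_ge0 ?lee_fin// mulr_ge0.
  - exact: measurable_funeM.
  by rewrite !intZ.
under eq_integral do rewrite E.
have I1 : measT (fun x => \int[mu]_x' (H x * H x' * g x x')%:E)%E.
  by apply: (@meas_int _ _ _ _ _ mu (fun x x' => (H x * H x' * g x x')%:E)) => // x x'; rewrite lee_fin mulr_ge0.
have I2 : measT (fun x => \int[mu]_x' (H x * H x' * g x' x)%:E)%E.
  by apply: (@meas_int _ _ _ _ _ mu (fun x x' => (H x * H x' * g x' x)%:E)) => // x x'; rewrite lee_fin mulr_ge0.
have J1 x : (0 <= \int[mu]_x' (H x * H x' * g x x')%:E)%E by int_ge0.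
have J2 x : (0 <= \int[mu]_x' (H x * H x' * g x' x)%:E)%E by int_ge0.
rewrite ge0_integralD//; last 4 first.
- by move=> x _; rewrite mule_ge0 ?lee_fin.
- exact: measurable_funeM.
- by move=> x _; rewrite mule_ge0 ?lee_fin.
- exact: measurable_funeM.
rewrite !intZ//.
apply: (@le_trans _ _ (c%:E * (10 * eps * (Num.sqrt N * Num.sqrt (C2 * N)))%:E + c%:E * (10 * eps * (Num.sqrt N * Num.sqrt (C2 * N)))%:E)%E).
  have c0e : (0 <= c%:E)%E by rewrite lee_fin.
  exact: leeD (lee_wpmul2l c0e S1) (lee_wpmul2l c0e S2).
rewrite -!EFinM -EFinD lee_fin le_eqVlt; apply/orP; left; apply/eqP; rewrite /M0 /c; ring.
Qed.

Let Tsup X W : h X != 0 -> `|T X W| <= dl^-1 * (A * s).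
Proof.
move=> /hsupp[_ _ dr]; apply: le_trans (Tk_sup s0 A0 bK r al X W) _.
rewrite ler_wpM2r//; first by rewrite mulr_ge0// ltW.
by rewrite lef_pV2// posrE// (lt_le_trans dl0).
Qed.

Let box_mass c : 0 <= c -> (\int[mu2]_X (if h X != 0 then c else 0)%:E < +oo)%E.
Proof.
move=> c0.
apply: (@le_lt_trans _ _ (\int[mu2]_X ((if `|X.1| <= L then c else 0) * (if `|X.2| <= L then 1 else 0))%:E)%E).
  apply: le_int0 => X _; first by rewrite lee_fin; case: ifPn.
  rewrite lee_fin; case: ifPn => [/hsupp[-> -> _]|_]; first by rewrite mulr1.
  by rewrite mulr_ge0//; case: ifPn.
rewrite sf_tonelli12//; last 2 first.
- by meas.
- by move=> X; rewrite lee_fin mulr_ge0//; case: ifPn.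
have I (a : R) : 0 <= a -> (\int[mu]_z (if (`|z| <= L)%R then a else 0)%:E = (a * (2 * L))%:E)%E.
  move=> a0.
  transitivity (\int[mu]_(z in `[(- L)%R, L]) cst a%:E z)%E.
    rewrite [RHS]integral_mkcond; apply: eq_integral => z _.
    by rewrite patchE mem_setE in_itv/= ler_norml; case: ifPn.
  rewrite integral_cst//= lebesgue_measure_itv/= lte_fin.
  case: ifPn => [_|]; first by rewrite -EFinD -EFinM opprK -mulr2n mulr_natl.
  rewrite -leNgt => LL; have -> : L = 0 by apply: le_anti; rewrite L0 andbT; lra.
  by rewrite mulr0 mulr0 mule0.
under eq_integral.
  move=> x _; under eq_integral do rewrite EFinM.
  rewrite /= intZ; last by case: ifPn.
  rewrite I//; over.
rewrite ge0_integralZr//; try by meas.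
all: try by [rewrite lee_fin !mulr_ge0|move=> z _; rewrite lee_fin; case: ifPn].
by rewrite I// -EFinM ltry.
Qed.

Let Tprod_integrable X Y : mu2.-integrable setT (EFin \o (fun W => T X W * T Y W)).
Proof.
apply: integrableP'; first by apply: measurable_funM; exact: mT1.
apply: (@le_lt_trans _ _ (\int[mu2]_W ((`|r Y.1|^-1 * (A * s))%:E * `|T X W|%:E))%E).
  apply: le_int0 => W _ //.
  by rewrite -EFinM lee_fin normrM mulrC ler_wpM2r// (Tk_sup s0 A0 bK).
rewrite intZ//; last by rewrite mulr_ge0 ?invr_ge0// mulr_ge0// ltW.
rewrite lte_mul_pinfty//.
  by rewrite lee_fin mulr_ge0 ?invr_ge0// mulr_ge0// ltW.
by rewrite (le_lt_trans (Tk_mass s0 A0 cK bK r al X))// ltry.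
Qed.

(** [TTstar_bound] for the kernel h(X) T(X, W). As h is bounded with bounded support, on which |r|
    stays away from 0, all the absolute integrals required there are finite. *)
Lemma T_bilin (f : R * R -> R) (Bf N Nf : R) : measT f -> (forall W, `|f W| <= Bf) ->
  0 <= N -> 0 <= Nf -> (\int[mu2]_X (h X ^+ 2)%:E <= N%:E)%E -> (\int[mu2]_X (f X ^+ 2)%:E <= Nf%:E)%E ->
  `|\int[mu2]_X (h X * Top K r al f X)| <= Num.sqrt Nf * Num.sqrt (M0 * (Num.sqrt N * Num.sqrt (C2 * N))).
Proof.
move=> mf fB N0 Nf0 hN fN.
pose a (X W : R * R) := h X * T X W.
have Bf0 : 0 <= Bf by exact: le_trans (fB (0, 0)).
have D0 : 0 <= dl^-1 * (A * s) by rewrite !mulr_ge0 ?invr_ge0// ltW.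
have ma : measT (fun z : (R * R) * (R * R) => a z.1 z.2).
  by apply: measurable_funM => //; exact: (measurableT_comp mh measurable_fst).
have mna : measT (fun z : (R * R) * (R * R) => `|a z.1 z.2|).
  by apply: measurableT_comp => //; exact: normr_measurable.
have mnT X : measT (fun W => `|T X W|%:E).
  by apply/measurable_EFinP; apply: measurableT_comp; [exact: normr_measurable|exact: mT1].
have aB X W : `|a X W| <= (if h X != 0 then Bh * (dl^-1 * (A * s)) else 0).
  rewrite /a normrM; case: ifPn => [h0|/negPn/eqP ->]; last by rewrite normr0 mul0r.
  by apply: ler_pM => //; exact: Tsup.
have rowmass X c : 0 <= c -> (\int[mu2]_W (c * `|a X W|)%:E <= (if h X != 0 then c * (Bh * (pi * A)) else 0)%:E)%E.
  move=> c0; rewrite /a; case: ifPn => [h0|/negPn/eqP ->]; last first.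
    by rewrite integral0_eq// => W _; rewrite mul0r normr0 mulr0.
  apply: (@le_trans _ _ (\int[mu2]_W ((c * Bh)%:E * `|T X W|%:E))%E).
    apply: le_int0 => W _; first by rewrite lee_fin mulr_ge0.
    by rewrite -EFinM lee_fin normrM -mulrA ler_wpM2l// ler_wpM2r.
  rewrite intZ//; last by rewrite mulr_ge0.
  rewrite (mulrA c Bh) [leRHS]EFinM; apply: lee_wpmul2l; first by rewrite lee_fin mulr_ge0.
  exact: (Tk_mass s0 A0 cK bK).
have -> : \int[mu2]_X (h X * Top K r al f X) = \int[mu2]_X \int[mu2]_W (a X W * f W).
  congr Rintegral; apply/funext => X; rewrite /Top /a -RintegralZl//.
    by congr Rintegral; apply/funext => W; rewrite mulrA.
  apply: integrableP'; first by apply: measurable_funM => //; exact: mT1.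
  apply: (@le_lt_trans _ _ (\int[mu2]_W (Bf%:E * `|T X W|%:E))%E).
    apply: le_int0 => W _ //.
    by rewrite -EFinM lee_fin normrM mulrC ler_wpM2r.
  rewrite intZ//.
  rewrite lte_mul_pinfty//.
  by rewrite (le_lt_trans (Tk_mass s0 A0 cK bK r al X))// ltry.
have MM0 : 0 <= M0 * (Num.sqrt N * Num.sqrt (C2 * N)).
  by rewrite !mulr_ge0 ?sqrtr_ge0 ?exprn_ge0 ?pi_ge0// ltW.
apply: (@TTstar_bound _ _ _ _ R mu2 mu2 a f _ _ ma mf MM0 Nf0) => //.
- move=> w; apply: le_lt_trans (box_mass (mulr_ge0 Bh0 D0)).
  by apply: le_int0 => X _ //; rewrite lee_fin aB.
- set B1 := Bh * (dl^-1 * (A * s)).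
  have B10 : 0 <= B1 by exact: mulr_ge0.
  set B2 := B1 * (Bh * (pi * A)).
  have B20 : 0 <= B2 by apply: mulr_ge0 => //; rewrite !mulr_ge0 ?pi_ge0.
  apply: (@le_lt_trans _ _ (\int[mu2]_X ((if h X != 0 then 1 else 0)%:E * \int[mu2]_Y (if h Y != 0 then B2 else 0)%:E))%E).
    apply: le_int0 => X _; first by apply: integral_ge0 => Y _; apply: integral_ge0 => W _; rewrite lee_fin mulr_ge0.
    case: ifPn => [hX|/negPn/eqP hX]; last first.
      rewrite integral0_eq ?mul0e// => Y _; rewrite integral0_eq// => W _.
      by rewrite /a hX mul0r normr0 mul0r.
    rewrite mul1e; apply: le_int0 => Y _; first by int_ge0.
    apply: le_trans (rowmass Y B1 B10).
    apply: le_int0 => W _; first by rewrite lee_fin mulr_ge0.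
    by rewrite lee_fin ler_wpM2r//; have := aB X W; rewrite hX.
  have mi (c : R) : measT (fun X => (if h X != 0 then c else 0)%:E) by meas.
  rewrite ge0_integralZr//; last 2 first.
  - by move=> X _; rewrite lee_fin; case: ifPn.
  - by apply: integral_ge0 => X _; rewrite lee_fin; case: ifPn.
  apply: lte_mul_pinfty; last exact: box_mass.
  - by apply: integral_ge0 => X _; rewrite lee_fin; case: ifPn.
  - rewrite ge0_fin_numE; first exact: box_mass.
    by apply: integral_ge0 => X _; rewrite lee_fin; case: ifPn.
  - exact: mi.
- apply: le_trans (Uk_sum N0 hN).
  apply: le_int0 => X _; first exact: integral_ge0.
  apply: le_int0 => Y _ //.
  rewrite (_ : Rintegral _ _ _ = (h X * h Y) * \int[mu2]_W (T X W * T Y W)); last first.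
    rewrite -RintegralZl//; congr Rintegral; apply/funext => W; rewrite /a; ring.
  rewrite normrM EFinM normrM; apply: lee_wpmul2l; first by rewrite lee_fin mulr_ge0.
  exact: (Tk_pair s0 A0 cK bK r al X Y).
- apply: (@le_lt_trans _ _ (\int[mu2]_X (if h X != 0 then Bf * (Bh * (pi * A)) else 0)%:E)%E); last first.
    by apply: box_mass; rewrite !mulr_ge0 ?pi_ge0//.
  apply: le_int0 => X _; first exact: integral_ge0.
  apply: le_trans (rowmass X Bf Bf0).
  apply: le_int0 => W _ //.
  by rewrite lee_fin normrM mulrC ler_wpM2r.
Qed.

Lemma boxed_square_fin : (\int[mu2]_X (h X ^+ 2)%:E < +oo)%E.
Proof.
apply: le_lt_trans (box_mass (exprn_ge0 2 Bh0)).
apply: le_int0 => X _; first by rewrite lee_fin sqr_ge0.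
rewrite lee_fin; case: ifPn => [_|/negPn/eqP ->]; last by rewrite expr0n.
by rewrite -(ger0_norm (sqr_ge0 (h _))) normrX lerXn2r ?nnegrE.
Qed.

End BilinearBound.

Lemma Top_sup (R : realType) (K : R -> R) (s A : R) (r al : R -> R) (f : R * R -> R) (B : R) X :
  0 < s -> 0 <= A -> continuous K -> (forall t, `|K t| <= A * poissonk s t) ->
  measT r -> measT al ->
  measT f -> (forall W, `|f W| <= B) -> `|Top K r al f X| <= pi * A * B.
Proof.
move=> s0 A0 cK bK mr mal mf fB.
have B0 : 0 <= B by exact: le_trans (fB (0, 0)).
have mT : measT (Tk K r al X).
  apply: (measurableT_comp (f := fun z : (R * R) * (R * R) => Tk K r al z.1 z.2) (g := fun W => (X, W))).
    exact: (measurable_Tk cK mr mal).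
  by meas.
rewrite -lee_fin /Top.
have mTf : measT (fun W => Tk K r al X W * f W) by exact: measurable_funM.
apply: (le_trans (le_norm_Rintegral (sleb2 R) measurableT mTf)).
apply: (@le_trans _ _ (\int[sleb2 R]_W (B%:E * `|Tk K r al X W|%:E))%E).
  apply: le_int0 => W _ //.
  by rewrite -EFinM lee_fin normrM mulrC ler_wpM2r.
rewrite intZ//.
rewrite (mulrC (pi * A)) [leRHS]EFinM; apply: lee_wpmul2l; first by rewrite lee_fin.
exact: (Tk_mass s0 A0 cK bK).
Qed.

(** Test [T_bilin] with h a cut-off of Top f itself: the pairing is then N, the square norm of h,
    and N^2 <= Nf * M0 * sqrt C2 * N. Dividing by N, which is finite because of the cut-off, and
    letting the cut-off grow by Fatou gives the claim. *)
Lemma Top_L2 (R : realType) (K J : R -> R) (s A : R) (r al : R -> R) (lam eps C2 : R)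
  (f : R * R -> R) (Bf Nf : R) :
  0 < s -> 0 <= A -> continuous K -> (forall t, is_derive t (1:R) J (K t)) ->
  (forall t, `|K t| <= A * poissonk s t) -> (forall t, `|J t| <= A / s * poissonk s t) ->
  measT r -> measT al ->
  0 < eps -> eps <= 1 -> eps ^+ 3 * lam = 1 ->
  (forall x, r x != 0 -> lam <= s * `|al x| * r x ^+ 2) ->
  0 <= C2 -> (forall (F : R -> R) (B : R), measT F -> (forall x, 0 <= F x <= B) ->
  (\int[leb1 R]_x (HLr F x `^ 2)%:E <= C2%:E * \int[leb1 R]_x (F x `^ 2)%:E)%E) ->
  measT f -> (forall W, `|f W| <= Bf) -> 0 <= Nf ->
  (\int[sleb2 R]_X (f X ^+ 2)%:E <= Nf%:E)%E ->
  (\int[sleb2 R]_X (Top K r al f X ^+ 2)%:E <=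
     (180 * pi ^+ 2 * A ^+ 2 * eps * Num.sqrt C2 * Nf)%:E)%E.
Proof.
move=> s0 A0 cK dJ bK bJ mr mal e0 e1 el Hlam C20 HC2 mf fB Nf0 fN.
set mu2 := sfprod _ _.
(* The index 0 is sent to the zero function, because 0^-1 = 0 would impose no lower bound on |r|. *)
pose h n (X : R * R) := if [&& `|X.1| <= n%:R, `|X.2| <= n%:R & n%:R^-1 <= `|r X.1|] && (0 < n)%N then Top K r al f X else 0.
have mTop := measurable_Top cK mr mal mf.
have mh n : measT (h n).
  rewrite /h; case: n => [|n]; first by under eq_fun do rewrite andbF; exact: measurable_cst.
  under eq_fun do rewrite andbT.
  apply: measurable_fun_ifT => //.
  by apply: measurable_and; [|apply: measurable_and]; meas.
have Bf0 : 0 <= Bf by exact: le_trans (fB (0, 0)).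
have TB X := Top_sup X s0 A0 cK bK mr mal mf fB.
have hB n X : `|h n X| <= pi * A * Bf.
  by rewrite /h; case: ifPn => // _; rewrite normr0 !mulr_ge0 ?pi_ge0.
set M0 := 180 * pi ^+ 2 * A ^+ 2 * eps.
have M00 : 0 <= M0 by rewrite !mulr_ge0 ?exprn_ge0 ?pi_ge0// ltW.
have MM : 0 <= M0 * Num.sqrt C2 * Nf.
  by apply: mulr_ge0 => //; apply: mulr_ge0 => //; exact: sqrtr_ge0.
have hN n : (\int[mu2]_X (h n X ^+ 2)%:E <= (M0 * Num.sqrt C2 * Nf)%:E)%E.
  case: n => [|n].
    rewrite integral0_eq ?lee_fin//.
    by move=> X _; rewrite /h andbF expr0n.
  have hs X : h n.+1 X != 0 -> [/\ `|X.1| <= n.+1%:R, `|X.2| <= n.+1%:R & n.+1%:R^-1 <= `|r X.1|].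
    by rewrite /h; case: ifPn => [/andP[/and3P[]]|]; rewrite ?eqxx.
  have n0 : 0 <= n.+1%:R :> R by [].
  have d0 : 0 < n.+1%:R^-1 :> R by rewrite invr_gt0.
  have fin := boxed_square_fin (hB n.+1) n0 hs.
  set N := fine (\int[mu2]_X (h n.+1 X ^+ 2)%:E).
  have NE : (N%:E = \int[mu2]_X (h n.+1 X ^+ 2)%:E)%E.
    by rewrite fineK// ge0_fin_numE//; apply: integral_ge0 => X _; rewrite lee_fin sqr_ge0.
  have N0 : 0 <= N by rewrite fine_ge0//; apply: integral_ge0 => X _; rewrite lee_fin sqr_ge0.
  have TBi := T_bilin s0 A0 cK dJ bK bJ mr mal e0 e1 el Hlam C20 HC2 (mh n.+1) (hB n.+1) n0 d0 hs
     mf fB N0 Nf0.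
  rewrite -NE lexx in TBi; have {TBi} := TBi isT fN.
  have -> : \int[mu2]_X (h n.+1 X * Top K r al f X) = N.
    rewrite /N /Rintegral; congr fine; apply: eq_integral => X _; congr EFin.
    by rewrite /h; case: ifPn => _; rewrite ?mul0r ?expr0n// expr2.
  rewrite ger0_norm// -/M0 => H.
  rewrite -NE lee_fin; have [->|Nn0] := eqVneq N 0; first exact: MM.
  have Np : 0 < N by rewrite lt_neqAle eq_sym Nn0.
  have : N ^+ 2 <= (Num.sqrt Nf * Num.sqrt (M0 * (Num.sqrt N * Num.sqrt (C2 * N)))) ^+ 2.
    by rewrite lerXn2r ?nnegrE// mulr_ge0 ?sqrtr_ge0.
  rewrite exprMn !sqr_sqrtr//; last by apply: mulr_ge0 => //; rewrite mulr_ge0 ?sqrtr_ge0.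
  rewrite sqrtrM// (mulrCA (Num.sqrt N)) -(expr2 (Num.sqrt N)) sqr_sqrtr// expr2 => H2.
  rewrite -(ler_pM2r Np); apply: le_trans H2 _.
  by rewrite le_eqVlt; apply/orP; left; apply/eqP; ring.
apply: (@fatou_near _ _ _ mu2 (fun n X => (h n X ^+ 2)%:E)) => //.
- by move=> n; apply/measurable_EFinP; apply: measurable_funX; exact: mh.
- by move=> n X; rewrite lee_fin sqr_ge0.
- by move=> X; rewrite lee_fin sqr_ge0.
move=> X; have [r0|r0] := eqVneq (r X.1) 0.
  apply: nearW => n; rewrite /Top (_ : Rintegral _ _ _ = 0) ?expr0n ?lee_fin ?sqr_ge0//.
  rewrite /Rintegral integral0_eq// => W _.
  by rewrite /Tk r0 invr0 mulr0 ltxx mul0r.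
have rp : 0 < `|r X.1| by rewrite normr_gt0.
near=> n; rewrite /h.
have n0 : (0 < n)%N by near: n; exact: nbhs_infty_gt.
rewrite n0 andbT ifT// ; apply/and3P; split.
- by near: n; exact: nbhs_infty_ger.
- by near: n; exact: nbhs_infty_ger.
- rewrite invf_ple ?posrE ?ltr0n//.
  by near: n; exact: nbhs_infty_ger.
Unshelve. all: by end_near. Qed.

(** * Domination by maximal functions and Poisson means *)

Lemma sf_tonelli21 (R : realType) (f : R * R -> \bar R) : measT f ->
  (forall z, (0 <= f z)%E) ->
  (\int[sleb2 R]_z f z =
   \int[leb1 R]_y \int[leb1 R]_x f (x, y))%E.
Proof.
move=> mf f0; rewrite (@sf_tonelli12 _ _ _ _ _ (leb1 R) (leb1 R) _ mf f0).
apply: (@tonelli _ _ _ _ _ (leb1 R) (leb1 R) (fun x y => f (x, y))) => //.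
by apply: eq_measurable_fun mf => -[].
Qed.

(** Moving by b widths 1/s costs a factor quadratic in b, the kernel decaying quadratically. *)
Lemma poissonk_shift (R : realType) (s t v b : R) : 0 < s -> `|s * v| <= b ->
  poissonk s (t + v) <= (2 + 2 * b ^+ 2) * poissonk s t.
Proof.
move=> s0 sv; rewrite /poissonk.
have b0 : 0 <= b by exact: le_trans sv.
have d1 : 0 < 1 + (s * (t + v)) ^+ 2 by rewrite ltr_pwDl// sqr_ge0.
have d2 : 0 < 1 + (s * t) ^+ 2 by rewrite ltr_pwDl// sqr_ge0.
rewrite mulrA ler_pdivrMr// mulrAC ler_pdivlMr// (mulrC _ s) -mulrA ler_wpM2l ?(ltW s0)//.
have : (s * v) ^+ 2 <= b ^+ 2 by rewrite -(ger0_norm (sqr_ge0 (s * v))) normrX lerXn2r ?nnegrE.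
rewrite (mulrDr s).
move: (s * t) (s * v) => p q qb.
have : 0 <= (p + 2 * q) ^+ 2 by exact: sqr_ge0.
have : 0 <= b ^+ 2 * (p + q) ^+ 2 by rewrite mulr_ge0 ?sqr_ge0.
move: qb; rewrite !expr2; nra.
Qed.

Section PoissonSmoothing.
Variables (R : realType) (s : R).
Local Notation mu := (leb1 R).
Local Notation mu2 := (sfprod mu mu).
Hypothesis s0 : 0 < s.

Definition Npois (f : R * R -> R) (x y : R) : R := \int[mu]_z (`|f (x, z)| * poissonk s (y - z)).

Section Bounded.
Variables (f : R * R -> R) (B : R).
Hypotheses (mf : measT f) (fB : forall X, `|f X| <= B).

Let B0 : 0 <= B.
Proof. exact: le_trans (fB (0, 0)). Qed.

Let mpk : measT (poissonk s).
Proof. exact: measurable_poissonk. Qed.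

Let mfx x : measT (fun z => f (x, z)).
Proof. by apply: (measurableT_comp mf); meas. Qed.

Let mk (y : R) : measT (fun z : R => poissonk s (y - z)).
Proof. by apply: (measurableT_comp (f := poissonk s)) => //; meas. Qed.

Let pk0 t : 0 <= poissonk s t.
Proof. by rewrite poissonk_ge0// ltW. Qed.

Lemma poissonk_reflect_mass (y : R) : (\int[mu]_z (poissonk s (y - z))%:E = pi%:E)%E.
Proof.
rewrite (@ge0_integral_reflect R y (fun z => (poissonk s z)%:E)) ?integral_poissonk//.
by apply/measurable_EFinP.
Qed.

Lemma Npois_int_le x y : (\int[mu]_z (`|f (x, z)| * poissonk s (y - z))%:E <= (pi * B)%:E)%E.
Proof.
apply: (@le_trans _ _ (\int[mu]_z (B%:E * (poissonk s (y - z))%:E))%E).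
  apply: le_int0 => z _; first by rewrite lee_fin mulr_ge0.
  by rewrite -EFinM lee_fin ler_wpM2r.
by rewrite intZ// poissonk_reflect_mass -EFinM mulrC.
Qed.

Lemma NpoisE x y : ((Npois f x y)%:E = \int[mu]_z (`|f (x, z)| * poissonk s (y - z))%:E)%E.
Proof.
rewrite /Npois /Rintegral fineK// ge0_fin_numE; last first.
  by int_ge0.
by rewrite (le_lt_trans (Npois_int_le x y))// ltry.
Qed.

Lemma Npois_bound x y : 0 <= Npois f x y <= pi * B.
Proof.
rewrite -!lee_fin NpoisE Npois_int_le andbT integral_ge0// => z _.
by rewrite lee_fin mulr_ge0.
Qed.

Lemma measurable_Npois : measT (fun p : R * R => Npois f p.1 p.2).
Proof.
apply: (@meas_Rint _ _ _ _ _ mu (fun (p : R * R) z => `|f (p.1, z)| * poissonk s (p.2 - z))).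
apply: measurable_funM.
  apply: measurableT_comp; first exact: normr_measurable.
  by apply: (measurableT_comp mf); meas.
by apply: (measurableT_comp (f := poissonk s)) => //; meas.
Qed.

(** Jensen for the Poisson kernel in the second variable: pi^(p - 1) from its mass, and another pi
    from integrating it in y. *)
Lemma Npois_Lp (p : R) : 1 < p ->
  (\int[mu]_y \int[mu]_x (Npois f x y `^ p)%:E <= (pi `^ p)%:E * \int[mu2]_X (`|f X| `^ p)%:E)%E.
Proof.
move=> p1.
have mN : measT (fun z : R * R => (Npois f z.1 z.2 `^ p)%:E).
  apply/measurable_EFinP; apply: (measurableT_comp (f := @powR R ^~ p)); first exact: measurable_powR.
  exact: measurable_Npois.
have mN' : measT (fun z : R * R => (Npois f z.2 z.1 `^ p)%:E).
  by apply: (measurableT_comp mN (g := fun z : R * R => (z.2, z.1))); meas.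
have mfp : measT (fun X => (`|f X| `^ p)%:E) by meas.
rewrite (@tonelli _ _ _ _ _ mu mu (fun y x => (Npois f x y `^ p)%:E) mN'); last first.
  by move=> y x; rewrite lee_fin powR_ge0.
rewrite sf_tonelli12//.
have mJ : measT (fun x => \int[mu]_y (`|f (x, y)| `^ p)%:E)%E.
  apply: (@meas_int _ _ _ _ _ mu (fun x y => (`|f (x, y)| `^ p)%:E)).
    by apply: eq_measurable_fun mfp => -[].
  by move=> x y; rewrite lee_fin powR_ge0.
rewrite -intZ ?powR_ge0//.
apply: le_int0 => x _; first by int_ge0.
have mfxp : measT (fun z => `|f (x, z)| `^ p) by have := mfx x; meas.
have mnfx : measT (fun z => `|f (x, z)|) by have := mfx x; meas.
apply: (@le_trans _ _ (\int[mu]_y ((pi `^ (p - 1))%:E * \int[mu]_z (`|f (x, z)| `^ p * poissonk s (y - z))%:E))%E).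
  apply: le_int0 => y _; first by rewrite lee_fin powR_ge0.
  have := @jensen_kernel _ _ R mu (fun z => `|f (x, z)|) (fun z => poissonk s (y - z)) pi p mnfx (mk y)
    (fun=> normr_ge0 _) (fun z => pk0 _) p1 (pi_ge0 R).
  rewrite poissonk_reflect_mass lexx => /(_ isT); apply: le_trans.
  by rewrite -NpoisE poweR_EFin.
have mG : measT (fun z : R * R => (`|f (x, z.2)| `^ p * poissonk s (z.1 - z.2))%:E).
  apply/measurable_EFinP; apply: measurable_funM.
    by apply: (measurableT_comp mfxp measurable_snd).
  by apply: (measurableT_comp (f := poissonk s)) => //; meas.
rewrite intZ ?powR_ge0//.
rewrite (@tonelli _ _ _ _ _ mu mu (fun y z => (`|f (x, z)| `^ p * poissonk s (y - z))%:E) mG); last first.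
  by move=> y z; rewrite lee_fin mulr_ge0// powR_ge0.
have -> : pi `^ p = pi `^ (p - 1) * pi :> R.
  by rewrite -{3}(powRr1 (pi_ge0 R)) -powRD ?subrK//; apply/implyP => _; rewrite gt_eqF// pi_gt0.
rewrite EFinM -muleA; apply: lee_wpmul2l; first by rewrite lee_fin powR_ge0.
rewrite -intZ ?pi_ge0//.
apply: le_int0 => z _; first by int_ge0.
under eq_integral do rewrite EFinM.
have msh : measT (fun y : R => poissonk s (y - z)).
  by apply: (measurableT_comp (f := poissonk s)) => //; meas.
rewrite intZ ?powR_ge0//.
rewrite (@ge0_integral_shift R (- z) (fun z => (poissonk s z)%:E)); last 2 first.
- exact/measurable_EFinP.
- by move=> y; rewrite lee_fin.
by rewrite integral_poissonk// -!EFinM mulrC.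
Qed.

(** The maximal theorem is applied in x on each horizontal line, then the Poisson mean is removed by
    integrating in y. This is the shape of every error term below. *)
Lemma HL_Npois_Lp (g : R * R -> R) (p c C : R) : 1 < p -> 0 <= c -> 0 <= C ->
  (forall (F : R -> R) (B : R), measT F -> (forall x, 0 <= F x <= B) ->
  (\int[mu]_x (HLr F x `^ p)%:E <= C%:E * \int[mu]_x (F x `^ p)%:E)%E) ->
  measT g ->
  (forall x y, 0 <= g (x, y) <= c * HLr (fun w => Npois f w y) x) ->
  (\int[mu2]_X (g X `^ p)%:E <= (c `^ p * C * pi `^ p)%:E * \int[mu2]_X (`|f X| `^ p)%:E)%E.
Proof.
move=> p1 c0 C0 HC mg gN.
have p0 : 0 <= p by rewrite (le_trans ler01)// ltW.
have mgp : measT (fun X => (g X `^ p)%:E) by meas.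
have mN y : measT (fun w => Npois f w y).
  by apply: (measurableT_comp measurable_Npois (g := fun w : R => (w, y))); meas.
rewrite sf_tonelli21//; last by move=> X; rewrite lee_fin powR_ge0.
apply: (@le_trans _ _ (\int[mu]_y ((c `^ p * C)%:E * \int[mu]_x (Npois f x y `^ p)%:E))%E).
  apply: le_int0 => y _; first by int_ge0.
  have NB x : 0 <= Npois f x y <= pi * B by exact: Npois_bound.
  apply: (@le_trans _ _ (\int[mu]_x ((c `^ p)%:E * (HLr (fun w => Npois f w y) x `^ p)%:E))%E).
    apply: le_int0 => x _; first by rewrite lee_fin powR_ge0.
    have /andP[g0 gl] := gN x y.
    rewrite -EFinM lee_fin -powRM ?HLr_ge0// ge0_ler_powR// ?nnegrE//.
    by rewrite mulr_ge0// HLr_ge0.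
  have mHL : measT (HLr (fun w => Npois f w y)).
    apply: (measurable_HLr (B := pi * B)) => // x.
    by have /andP[n0 nB] := NB x; rewrite ger0_norm.
  rewrite intZ ?powR_ge0//.
  rewrite EFinM -muleA; apply: lee_wpmul2l; first by rewrite lee_fin powR_ge0.
  exact: (HC _ (pi * B)).
have mN2 : measT (fun z : R * R => (Npois f z.2 z.1 `^ p)%:E).
  apply/measurable_EFinP; apply: (measurableT_comp (f := @powR R ^~ p)); first exact: measurable_powR.
  by apply: (measurableT_comp measurable_Npois (g := fun z : R * R => (z.2, z.1))); meas.
rewrite intZ//; last by rewrite mulr_ge0// powR_ge0.
rewrite [X in (_ <= X * _)%E]EFinM -muleA; apply: lee_wpmul2l; first by rewrite lee_fin mulr_ge0// powR_ge0.
exact: Npois_Lp.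
Qed.

End Bounded.
End PoissonSmoothing.

Section Growth.
Variables (R : realType) (K : R -> R) (s A : R) (r al : R -> R).
Local Notation mu := (leb1 R).
Local Notation mu2 := (sfprod mu mu).
Hypotheses (s0 : 0 < s) (A0 : 0 <= A) (cK : continuous K).
Hypotheses (bK : forall t, `|K t| <= A * poissonk s t).
Hypotheses (mr : measT r) (mal : measT al).

(** When s |al| r^2 <= b the parabola moves by at most b kernel widths over the whole piece, so it
    may be flattened at the cost of [poissonk_shift]. An average in x over a ball of radius |r|
    remains. *)
Lemma Tk_growth (f : R * R -> R) (B b : R) X : measT f -> (forall W, `|f W| <= B) ->
  s * `|al X.1| * r X.1 ^+ 2 <= b ->
  (\int[mu2]_W `|Tk K r al X W * f W|%:E <=
   (A * (2 + 2 * b ^+ 2) * 2 * HLr (fun w => Npois s f w X.2) X.1)%:E)%E.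
Proof.
move=> mf fB hb.
have mT : measT (Tk K r al X).
  apply: (measurableT_comp (f := fun z : (R * R) * (R * R) => Tk K r al z.1 z.2) (g := fun W => (X, W))).
    exact: (measurable_Tk cK mr mal).
  by meas.
have mN : measT (fun w => Npois s f w X.2).
  by apply: (measurableT_comp (measurable_Npois s mf) (g := fun w : R => (w, X.2))); meas.
have D0 : 0 <= A * (2 + 2 * b ^+ 2) by rewrite mulr_ge0// addr_ge0// mulr_ge0// sqr_ge0.
rewrite sf_tonelli12//; last by meas.
have NB x : 0 <= Npois s f x X.2 <= pi * B by exact: Npois_bound.
have [r0|r0] := eqVneq (r X.1) 0.
  rewrite integral0_eq => [|w _].
    by rewrite lee_fin !mulr_ge0 ?HLr_ge0// addr_ge0// mulr_ge0// sqr_ge0.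
  by rewrite integral0_eq// => z _; rewrite /Tk r0 invr0 mulr0 ltxx mul0r normr0.
have rp : 0 < `|r X.1| by rewrite normr_gt0.
apply: (@le_trans _ _ (\int[mu]_w ((A * (2 + 2 * b ^+ 2) * `|r X.1|^-1)%:E * (if `|X.1 - w| < `|r X.1| then Npois s f w X.2 else 0)%:E))%E).
  apply: le_int0 => w _; first exact: integral_ge0.
  rewrite /Tk /=; case hw: (0 < (X.1 - w) / r X.1 < 1); last first.
    rewrite integral0_eq => [|z _]; last by rewrite mul0r normr0.
    rewrite mule_ge0 ?lee_fin ?mulr_ge0 ?invr_ge0//; last by case: ifPn => // _; have /andP[] := NB w.
    by rewrite addr_ge0// mulr_ge0// sqr_ge0.
  have hw1 : `|X.1 - w| < `|r X.1|.
    have : `|(X.1 - w) / r X.1| < 1 by rewrite ltr_norml; move: hw; lra.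
    by rewrite normrM normfV ltr_pdivrMr// mul1r.
  rewrite hw1 (NpoisE s0 fB) -intZ//; last by rewrite mulr_ge0// invr_ge0.
  apply: le_int0 => z _ //.
  rewrite -EFinM lee_fin !normrM normfV normr_id.
  apply: (@le_trans _ _ (`|r X.1|^-1 * (A * ((2 + 2 * b ^+ 2) * poissonk s (X.2 - z))) * `|f (w, z)|)).
    rewrite ler_wpM2r// ler_wpM2l ?invr_ge0//; apply: le_trans (bK _) _; rewrite ler_wpM2l//.
    apply: poissonk_shift => //; rewrite normrM (gtr0_norm s0) normrN normrM normrX mulrA.
    apply: le_trans hb; rewrite ler_wpM2l//; first by rewrite mulr_ge0// ltW.
    by rewrite -(real_normK (num_real (r _))) lerXn2r ?nnegrE// ltW.
  by rewrite le_eqVlt; apply/orP; left; apply/eqP; ring.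
rewrite intZ//; last by rewrite mulr_ge0// invr_ge0.
apply: (@le_trans _ _ ((A * (2 + 2 * b ^+ 2) * `|r X.1|^-1)%:E * (2 * `|r X.1| * HLr (fun w => Npois s f w X.2) X.1)%:E)%E).
  apply: lee_wpmul2l; first by rewrite lee_fin mulr_ge0// invr_ge0.
  exact: (HLr_avg _ mN NB).
rewrite -EFinM lee_fin.
apply: (@le_trans _ _ ((`|r X.1|^-1 * `|r X.1|) * (A * (2 + 2 * b ^+ 2) * 2 * HLr (fun w => Npois s f w X.2) X.1))).
  by rewrite le_eqVlt; apply/orP; left; apply/eqP; ring.
by rewrite mulVf ?mul1r// gt_eqF.
Qed.

Lemma Top_growth (f : R * R -> R) (B b : R) X : measT f -> (forall W, `|f W| <= B) ->
  s * `|al X.1| * r X.1 ^+ 2 <= b ->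
  `|Top K r al f X| <= A * (2 + 2 * b ^+ 2) * 2 * HLr (fun w => Npois s f w X.2) X.1.
Proof.
move=> mf fB hb.
have mT : measT (fun W => Tk K r al X W * f W).
  apply: measurable_funM => //.
  apply: (measurableT_comp (f := fun z : (R * R) * (R * R) => Tk K r al z.1 z.2) (g := fun W => (X, W))).
    exact: (measurable_Tk cK mr mal).
  by meas.
rewrite -lee_fin; apply: (le_trans (le_norm_Rintegral mu2 measurableT mT)).
exact: (Tk_growth mf fB hb).
Qed.

End Growth.

(** * Lp decay for the averages *)

Lemma measurable_gt_set d (T : measurableType d) (R : realType) (G : T -> R) (a : R) :
  measT G -> measurable [set x | a < G x].
Proof.
move=> mG.
have -> : [set x | a < G x] = setT `&` G @^-1` `]a, +oo[.
  by rewrite setTI; apply/seteqP; split=> x /=; rewrite in_itv/= andbT.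
exact: mG.
Qed.

Lemma chebyshev_powR d (T : measurableType d) (R : realType) (mu : {measure set T -> \bar R})
  (G : T -> R) (a q : R) : measT G -> (forall x, 0 <= G x) -> 0 < a -> 0 <= q ->
  (mu [set x | (a < G x)%R] <= (a `^ (- q))%:E * \int[mu]_x (G x `^ q)%:E)%E.
Proof.
move=> mG G0 a0 q0.
have mE : measurable [set x | a < G x] by exact: measurable_gt_set.
have -> : (mu [set x | (a < G x)%R] = \int[mu]_(x in [set x | (a < G x)%R]) 1)%E by rewrite integral_cst// mul1e.
rewrite integral_mkcond -intZ ?powR_ge0//.
apply: le_int0 => x _; rewrite patchE; case: ifPn => //.
  rewrite inE/= => aG; rewrite -EFinM lee_fin powRN mulrC ler_pdivlMr ?powR_gt0// mul1r.
  by rewrite ge0_ler_powR// ?nnegrE// ltW.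
by move=> _; rewrite -EFinM lee_fin mulr_ge0// powR_ge0.
Qed.

Lemma sqr_powR2 (R : realType) (x : R) : x ^+ 2 = `|x| `^ 2.
Proof. by rewrite powR_mulrn// real_normK// num_real. Qed.

(** The class in which all integrals converge absolutely; it is stable under cutting at a height, as
    interpolation requires. *)
Definition nice (R : realType) (f : R * R -> R) (B : R) : Prop :=
  [/\ measT f, forall X, `|f X| <= B &
      (\int[sleb2 R]_X `|f X|%:E < +oo)%E].

Lemma nice_cut (R : realType) (f : R * R -> R) (B : R) (c : R * R -> bool) :
  nice f B -> measT c -> nice (fun X => if c X then f X else 0) B.
Proof.
move=> [mf fB fi] mc; split.
- by apply: measurable_fun_ifT.
- by move=> X; case: ifPn => // _; rewrite normr0; exact: le_trans (fB X).
- apply: le_lt_trans fi; apply: le_int0 => X _ //.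
  by rewrite lee_fin; case: ifPn => // _; rewrite normr0.
Qed.

Lemma nice_square_fin (R : realType) (f : R * R -> R) (B : R) : nice f B ->
  (\int[sleb2 R]_X (f X ^+ 2)%:E < +oo)%E.
Proof.
move=> [mf fB fi].
have B0 : 0 <= B by exact: le_trans (fB (0, 0)).
apply: (@le_lt_trans _ _ (\int[sleb2 R]_X (B%:E * `|f X|%:E))%E).
  apply: le_int0 => X _; first by rewrite lee_fin sqr_ge0.
  by rewrite -EFinM lee_fin -(real_normK (num_real (f X))) expr2 ler_wpM2r.
rewrite intZ//.
rewrite lte_mul_pinfty//.
Qed.

Section TopLp.
Variables (R : realType) (A : R).
Local Notation mu := (leb1 R).
Local Notation mu2 := (sfprod mu mu).
Hypothesis A0 : 0 < A.

(** A kernel at frequency s with constants independent of s. The primitive [J], smaller by 1/s,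
    encodes the absence of low frequencies and is the source of all cancellation. *)
Definition kernel_pair (K J : R -> R) (s : R) : Prop :=
  [/\ 0 < s, continuous K, forall t, is_derive t (1:R) J (K t),
      forall t, `|K t| <= A * poissonk s t & forall t, `|J t| <= A / s * poissonk s t].

Lemma Tk_integrable (K J : R -> R) (s : R) (r al : R -> R) (f : R * R -> R) (B : R) X : kernel_pair K J s ->
  measT r -> measT al -> measT f -> (forall W, `|f W| <= B) ->
  mu2.-integrable setT (EFin \o (fun W => Tk K r al X W * f W)).
Proof.
move=> [s0 cK dJ bK bJ] mr mal mf fB.
have B0 : 0 <= B by exact: le_trans (fB (0, 0)).
have mT : measT (Tk K r al X).
  apply: (measurableT_comp (f := fun z : (R * R) * (R * R) => Tk K r al z.1 z.2) (g := fun W => (X, W))).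
    exact: (measurable_Tk cK mr mal).
  by meas.
apply: integrableP'; first exact: measurable_funM.
apply: (@le_lt_trans _ _ (\int[mu2]_W (B%:E * `|Tk K r al X W|%:E))%E).
  by apply: le_int0 => W _ //; rewrite -EFinM lee_fin normrM mulrC ler_wpM2r.
rewrite intZ//.
rewrite lte_mul_pinfty//.
by rewrite (le_lt_trans (Tk_mass s0 (ltW A0) cK bK r al X))// ltry.
Qed.

Lemma Top_split (K J : R -> R) (s : R) (r al : R -> R) (f : R * R -> R) (B : R) (c : R * R -> bool) X :
  kernel_pair K J s ->
  measT r -> measT al -> measT f -> (forall W, `|f W| <= B) ->
  measT c ->
  Top K r al f X = Top K r al (fun W => if c W then f W else 0) X
                 + Top K r al (fun W => if c W then 0 else f W) X.
Proof.
move=> kp mr mal mf fB mc.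
have B0 : 0 <= B by exact: le_trans (fB (0, 0)).
rewrite /Top -RintegralD//; last 2 first.
- apply: (Tk_integrable (B := B) X kp mr mal); first exact: measurable_fun_ifT.
  by move=> W; case: ifPn => // _; rewrite normr0.
- apply: (Tk_integrable (B := B) X kp mr mal); first exact: measurable_fun_ifT.
  by move=> W; case: ifPn => // _; rewrite normr0.
by congr Rintegral; apply/funext => W; case: ifPn => _; rewrite mulr0 ?addr0 ?add0r.
Qed.

Variables (C2 : R).
Hypotheses (C20 : 0 <= C2)
  (HC2 : forall (F : R -> R) (B : R), measT F -> (forall x, 0 <= F x <= B) ->
  (\int[mu]_x (HLr F x `^ 2)%:E <= C2%:E * \int[mu]_x (F x `^ 2)%:E)%E).

Let M2 : R := 180 * pi ^+ 2 * A ^+ 2 * Num.sqrt C2.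

Let M20 : 0 <= M2.
Proof. by rewrite !mulr_ge0 ?exprn_ge0 ?pi_ge0 ?sqrtr_ge0// ltW. Qed.

Lemma Top_L2' (K J : R -> R) (s : R) (r al : R -> R) (lam : R) (f : R * R -> R) (B : R) : kernel_pair K J s ->
  measT r -> measT al -> 1 <= lam ->
  (forall x, r x != 0 -> lam <= s * `|al x| * r x ^+ 2) -> nice f B ->
  (\int[mu2]_X (`|Top K r al f X| `^ 2)%:E <= (M2 * lam `^ (- 3^-1))%:E * \int[mu2]_X (`|f X| `^ 2)%:E)%E.
Proof.
move=> [s0 cK dJ bK bJ] mr mal lam1 Hl nf; have [mf fB fi] := nf.
have fin := nice_square_fin nf.
under eq_integral do rewrite -sqr_powR2.
under [X in (_ <= _ * X)%E]eq_integral do rewrite -sqr_powR2.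
have I0 : (0 <= \int[mu2]_X (f X ^+ 2)%:E)%E by int_ge0.
have NE : ((fine (\int[mu2]_X (f X ^+ 2)%:E))%:E = \int[mu2]_X (f X ^+ 2)%:E)%E by rewrite fineK// ge0_fin_numE.
have lam0 : 0 < lam by exact: lt_le_trans lam1.
have e0 : 0 < lam `^ (- 3^-1) by rewrite powR_gt0.
have e1 : lam `^ (- 3^-1) <= 1.
  rewrite powRN invf_le1 ?powR_gt0//; apply: (@le_trans _ _ (lam `^ 0)); first by rewrite powRr0.
  by rewrite ler_powR// invr_ge0.
have e3 : (lam `^ (- 3^-1)) ^+ 3 * lam = 1.
  rewrite -powR_mulrn ?powR_ge0// -powRrM mulNr mulVf// powRN powRr1 ?(ltW lam0)// mulVf//.
  by rewrite gt_eqF.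
rewrite -NE -EFinM.
have := Top_L2 s0 (ltW A0) cK dJ bK bJ mr mal e0 e1 e3 Hl C20 HC2 mf fB (fine_ge0 I0).
rewrite NE lexx => /(_ isT) /le_trans -> //.
by rewrite lee_fin le_eqVlt; apply/orP; left; apply/eqP; rewrite /M2; ring.
Qed.

Lemma measurable_normTop (K J : R -> R) (s : R) (r al : R -> R) (f : R * R -> R) (B : R) : kernel_pair K J s ->
  measT r -> measT al -> nice f B ->
  measT (fun X => `|Top K r al f X|).
Proof.
move=> [s0 cK dJ bK bJ] mr mal [mf _ _].
apply: measurableT_comp; first exact: normr_measurable.
exact: measurable_Top.
Qed.

Lemma measurable_gtcut (f : R * R -> R) (c : R) : measT f ->
  measT (fun X => c < `|f X|).
Proof. by move=> mf; meas. Qed.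

(** Interpolation between L2 and the sup bound pi A. With g = 1 / (2 pi A) the part of f below g a
    contributes at most a / 2 to the average, so only the high part meets the level and the upper
    endpoint has coefficient 0. *)
Lemma Top_Lp_gt2 (p : R) : 2 < p -> exists2 C : R, 0 < C & forall (K J : R -> R) (s : R) (r al : R -> R) (lam : R) (f : R * R -> R) (B : R),
  kernel_pair K J s -> measT r -> measT al -> 1 <= lam ->
  (forall x, r x != 0 -> lam <= s * `|al x| * r x ^+ 2) -> nice f B ->
  (\int[mu2]_X (`|Top K r al f X| `^ p)%:E <= (C * lam `^ (- 3^-1))%:E * \int[mu2]_X (`|f X| `^ p)%:E)%E.
Proof.
move=> p2.
pose g : R := (2 * pi * A)^-1.
have g0 : 0 < g by rewrite invr_gt0 !mulr_gt0// pi_gt0.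
pose C := p * (4 * M2 * g `^ (2 - p) / (p - 2)) + 1.
have pp : 0 < p by lra.
have C0 : 0 <= p * (4 * M2 * g `^ (2 - p) / (p - 2)).
  by rewrite mulr_ge0 ?(ltW pp)// divr_ge0 ?subr_ge0 ?(ltW p2)// mulr_ge0 ?powR_ge0// mulr_ge0.
exists C; first by rewrite ltr_wpDl.
move=> K J s r al lam f B kp mr mal lam1 Hl nf.
have [s0 cK dJ bK bJ] := kp; have [mf fB fi] := nf.
have mG := measurable_normTop kp mr mal nf.
have mF : measT (fun X => `|f X|) by meas.
have e0 : 0 <= lam `^ (- 3^-1) by exact: powR_ge0.
have := @marcinkiewicz _ _ _ _ R mu2 mu2 (fun X => `|Top K r al f X|) (fun X => `|f X|)
  p 2 (p + 1) (4 * M2 * lam `^ (- 3^-1)) 0 g mG mF (fun=> normr_ge0 _) (fun=> normr_ge0 _).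
move=> /(_ _ p2 _ _ (lexx _) g0 _) H.
apply: (@le_trans _ _ ((p * (4 * M2 * lam `^ (- 3^-1) * g `^ (2 - p) / (p - 2) +
           0 * g `^ (p + 1 - p) / (p + 1 - p)))%:E * \int[mu2]_y (`|f y| `^ p)%:E)%E).
  apply: H => //; [lra|lra|by rewrite mulr_ge0// mulr_ge0|].
  move=> a a0; rewrite mul0r mul0e adde0.
  pose c X := g * a < `|f X|.
  have mc : measT c by exact: measurable_gtcut.
  have nb := nice_cut nf mc; have [mb bB bi] := nb.
  apply: (@le_trans _ _ (mu2 [set X | (a / 2 < `|Top K r al (fun X => if c X then f X else 0) X|)%R])).
    apply: le_measure; rewrite ?inE.
    - exact: measurable_gt_set.
    - exact: (measurable_gt_set _ (measurable_normTop kp mr mal nb)).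
    - move=> X /=; rewrite (Top_split X kp mr mal mf fB mc) => aT.
      have S : `|Top K r al (fun W => if c W then 0 else f W) X| <= a / 2.
        have -> : a / 2 = pi * A * (g * a).
          have pi0 : pi != 0 :> R by rewrite gt_eqF// pi_gt0.
          have An0 : A != 0 by rewrite gt_eqF.
          rewrite /g !invfM; apply: (mulfI pi0); apply: (mulfI An0); move: pi0; move: pi => q q0; field; by rewrite ?q0 ?An0.
        apply: (Top_sup X s0 (ltW A0) cK bK mr mal).
          exact: measurable_fun_ifT.
        move=> W; rewrite /c; case: ifPn; rewrite ?normr0 ?mulr_ge0 ?(ltW g0) ?(ltW a0)// -leNgt //.
      have := ler_normD (Top K r al (fun W => if c W then f W else 0) X) (Top K r al (fun W => if c W then 0 else f W) X).
      lra.
  have a20 : 0 < a / 2 by rewrite divr_gt0.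
  apply: (le_trans (chebyshev_powR mu2 (measurable_normTop kp mr mal nb) (fun=> normr_ge0 _) a20 (ler0n R 2))).
  have L2 := Top_L2' kp mr mal lam1 Hl nb.
  apply: (@le_trans _ _ (((a / 2) `^ (- 2))%:E * ((M2 * lam `^ (- 3^-1))%:E * \int[mu2]_X (`|if c X then f X else 0| `^ 2)%:E))%E).
    by apply: lee_wpmul2l => //; rewrite lee_fin powR_ge0.
  rewrite muleA -EFinM.
  have -> : (a / 2) `^ (- 2) * (M2 * lam `^ (- 3^-1)) = 4 * M2 * lam `^ (- 3^-1) * a `^ (- 2).
    have h4 : 2^-1 `^ (- 2) = 4 :> R by rewrite powRN powR_mulrn ?invr_ge0// exprVn invrK; ring.
    by rewrite powRM ?invr_ge0 ?(ltW a0)// h4; ring.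
  apply: lee_wpmul2l; first by rewrite lee_fin mulr_ge0 ?powR_ge0// mulr_ge0 ?powR_ge0// mulr_ge0.
  apply: le_int0 => X _; first by rewrite lee_fin powR_ge0.
  rewrite /c lee_fin; case: ifPn => // _; first by rewrite normr0 powR0.
apply: lee_wpmul2r; first by int_ge0.
rewrite lee_fin !mul0r addr0 /C (mulrDl _ 1) mul1r.
apply: (@le_trans _ _ (p * (4 * M2 * g `^ (2 - p) / (p - 2)) * lam `^ (- 3^-1))); last by rewrite lerDl powR_ge0.
by rewrite le_eqVlt; apply/orP; left; apply/eqP; ring.
Qed.

(** Interpolation between the L2 decay lam^(-1/3) and an L^(3/2) bound growing like lam^3. Splitting
    at height lam^10 a yields the powers 3 + 10 (3/2 - p) and - 1/3 + 10 (2 - p); both are at most -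
    1/5 for p > 199/100, which is where this threshold comes from. *)
Lemma Top_Lp_lt2 (p : R) : 199 / 100 < p -> p < 2 -> exists2 C : R, 0 < C & forall (K J : R -> R) (s : R) (r al : R -> R) (lam : R) (f : R * R -> R) (B : R),
  kernel_pair K J s -> measT r -> measT al -> 1 <= lam ->
  (forall x, r x != 0 -> lam <= s * `|al x| * r x ^+ 2 <= 4 * lam) -> nice f B ->
  (\int[mu2]_X (`|Top K r al f X| `^ p)%:E <= (C * lam `^ (- 5^-1))%:E * \int[mu2]_X (`|f X| `^ p)%:E)%E.
Proof.
move=> p1 p2.
have q1 : 1 < 3 / 2 :> R by lra.
have [Ch Ch0 HCh] := HLr_strong q1.
pose C1 := (68 * A) `^ (3 / 2) * Ch * pi `^ (3 / 2).
have C10 : 0 <= C1 by rewrite !mulr_ge0 ?powR_ge0// ltW.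
pose D1 := (2^-1) `^ (- (3 / 2)) * C1.
have D10 : 0 <= D1 by rewrite mulr_ge0 ?powR_ge0.
pose C := p * (D1 / (p - 3 / 2) + 4 * M2 / (2 - p)) + 1.
have pp : 0 < p by lra.
have C0 : 0 <= p * (D1 / (p - 3 / 2) + 4 * M2 / (2 - p)).
  rewrite mulr_ge0 ?(ltW pp)// addr_ge0// divr_ge0//; last by lra.
    by lra.
  by rewrite mulr_ge0.
exists C; first by rewrite ltr_wpDl.
move=> K J s r al lam f B kp mr mal lam1 Hl nf.
have [s0 cK dJ bK bJ] := kp; have [mf fB fi] := nf.
have mG := measurable_normTop kp mr mal nf.
have mF : measT (fun X => `|f X|) by meas.
have lam0 : 0 < lam by exact: lt_le_trans lam1.
have Hl1 x : r x != 0 -> lam <= s * `|al x| * r x ^+ 2 by move/Hl => /andP[].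
have Hl2 x : s * `|al x| * r x ^+ 2 <= 4 * lam.
  have [->|/Hl/andP[]//] := eqVneq (r x) 0.
  by rewrite expr0n mulr0 mulr_ge0// ltW.
pose g := lam `^ 10.
have g0 : 0 < g by rewrite powR_gt0.
have := @marcinkiewicz _ _ _ _ R mu2 mu2 (fun X => `|Top K r al f X|) (fun X => `|f X|)
  p (3 / 2) 2 (D1 * lam `^ 3) (4 * M2 * lam `^ (- 3^-1)) g mG mF (fun=> normr_ge0 _) (fun=> normr_ge0 _).
move=> /(_ _ _ p2 _ _ g0 _) H.
apply: (@le_trans _ _ ((p * (D1 * lam `^ 3 * g `^ (3 / 2 - p) / (p - 3 / 2) +
           4 * M2 * lam `^ (- 3^-1) * g `^ (2 - p) / (2 - p)))%:E * \int[mu2]_y (`|f y| `^ p)%:E)%E).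
  apply: H => //; [lra|lra|by rewrite mulr_ge0// powR_ge0|by rewrite mulr_ge0 ?powR_ge0// mulr_ge0|].
  move=> a a0.
  pose c X := g * a < `|f X|.
  have mc : measT c by exact: measurable_gtcut.
  have mnc : measT (fun X => ~~ c X) by exact: measurable_neg.
  have nb := nice_cut nf mc; have [mb bB bi] := nb.
  have ns := nice_cut nf mnc; have [ms sB si] := ns.
  have nsE : (fun X => if ~~ c X then f X else 0) = (fun X => if c X then 0 else f X).
    by apply/funext => X; rewrite if_neg.
  rewrite nsE in ns.
  pose Tb := Top K r al (fun X => if c X then f X else 0).
  pose Ts := Top K r al (fun X => if c X then 0 else f X).
  have mTb := measurable_normTop kp mr mal nb.
  have mTs := measurable_normTop kp mr mal ns.
  have a20 : 0 < a / 2 by rewrite divr_gt0.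
  apply: (@le_trans _ _ (mu2 [set X | (a / 2 < `|Tb X|)%R] + mu2 [set X | (a / 2 < `|Ts X|)%R])%E).
    have m1 := measurable_gt_set (a / 2) mTb.
    have m2 := measurable_gt_set (a / 2) mTs.
    apply: (@le_trans _ _ (mu2 ([set X | (a / 2 < `|Tb X|)%R] `|` [set X | (a / 2 < `|Ts X|)%R]))).
      apply: le_measure; rewrite ?inE.
      - exact: measurable_gt_set.
      - exact: measurableU.
      - move=> X /=; rewrite (Top_split X kp mr mal mf fB mc) -/(Tb X) -/(Ts X) => aT.
        have := ler_normD (Tb X) (Ts X).
        case: (ltP (a / 2) `|Tb X|) => h1; first by left.
        by case: (ltP (a / 2) `|Ts X|) => h2; [right|lra].
    exact: measureU2.
  apply: leeD.
    have q0 : 0 <= 3 / 2 :> R by lra.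
    apply: (le_trans (chebyshev_powR mu2 mTb (fun=> normr_ge0 _) a20 q0)).
    (* [Top_growth] with b = 4 lam. As lam >= 1, A (4 + 64 lam^2) <= 68 A lam^2, whose power 3/2
       produces lam^3. *)
    pose cc := A * (2 + 2 * (4 * lam) ^+ 2) * 2.
    have cc0 : 0 <= cc by rewrite !mulr_ge0 ?(ltW A0)// addr_ge0// mulr_ge0// sqr_ge0.
    have := @HL_Npois_Lp R s s0 _ B mb bB (fun X => `|Tb X|) (3 / 2) cc Ch q1 cc0 (ltW Ch0) HCh mTb.
    have gr x y : 0 <= `|Tb (x, y)| <= cc * HLr (fun w => Npois s (fun X => if c X then f X else 0) w y) x.
      by rewrite normr_ge0/=; exact: (@Top_growth R K s A r al s0 (ltW A0) cK bK mr mal _ B (4 * lam) (x, y) mb bB (Hl2 _)).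
    move=> /(_ gr) HL.
    apply: (@le_trans _ _ (((a / 2) `^ (- (3 / 2)))%:E * ((cc `^ (3 / 2) * Ch * pi `^ (3 / 2))%:E * \int[mu2]_X (`|if c X then f X else 0| `^ (3 / 2))%:E))%E).
      by apply: lee_wpmul2l => //; rewrite lee_fin powR_ge0.
    rewrite muleA -EFinM.
    apply: (@le_trans _ _ ((D1 * lam `^ 3 * a `^ (- (3 / 2)))%:E * (\int[mu2]_X (`|if c X then f X else 0| `^ (3 / 2))%:E))%E).
      apply: lee_wpmul2r; first by int_ge0.
      rewrite lee_fin powRM ?invr_ge0 ?(ltW a0)//.
      have ccl : cc `^ (3 / 2) <= (68 * A) `^ (3 / 2) * lam `^ 3.
        have -> : lam `^ 3 = (lam ^+ 2) `^ (3 / 2).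
          by rewrite -powR_mulrn ?(ltW lam0)// -powRrM; congr (_ `^ _); field.
        rewrite -powRM ?sqr_ge0//; last by rewrite mulr_ge0// ltW.
        apply: ge0_ler_powR => //; rewrite ?nnegrE//.
          by rewrite !mulr_ge0 ?sqr_ge0// ltW.
        rewrite /cc; have := exprn_ege1 2 lam1.
        have -> : A * (2 + 2 * (4 * lam) ^+ 2) * 2 = A * (4 + 64 * lam ^+ 2) by ring.
        have -> : 68 * A * lam ^+ 2 = A * (68 * lam ^+ 2) by ring.
        by move=> l2; rewrite ler_wpM2l ?(ltW A0)//; lra.
      rewrite /D1 /C1.
      apply: (@le_trans _ _ (a `^ (- (3 / 2)) * 2^-1 `^ (- (3 / 2)) * ((68 * A) `^ (3 / 2) * lam `^ 3 * Ch * pi `^ (3 / 2)))).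
        rewrite ler_wpM2l ?mulr_ge0 ?powR_ge0// ler_wpM2r ?powR_ge0// ler_wpM2r// ltW//.
      by rewrite le_eqVlt; apply/orP; left; apply/eqP; ring.
    apply: lee_wpmul2l; first by rewrite lee_fin mulr_ge0 ?powR_ge0// mulr_ge0 ?powR_ge0.
    apply: le_int0 => X _; first by rewrite lee_fin powR_ge0.
    by rewrite /c lee_fin; case: ifPn => // _; rewrite normr0 powR0.
  apply: (le_trans (chebyshev_powR mu2 mTs (fun=> normr_ge0 _) a20 (ler0n R 2))).
  have L2 := Top_L2' kp mr mal lam1 Hl1 ns.
  apply: (@le_trans _ _ (((a / 2) `^ (- 2))%:E * ((M2 * lam `^ (- 3^-1))%:E * \int[mu2]_X (`|if c X then 0 else f X| `^ 2)%:E))%E).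
    by apply: lee_wpmul2l => //; rewrite lee_fin powR_ge0.
  rewrite muleA -EFinM.
  have -> : (a / 2) `^ (- 2) * (M2 * lam `^ (- 3^-1)) = 4 * M2 * lam `^ (- 3^-1) * a `^ (- 2).
    have h4 : 2^-1 `^ (- 2) = 4 :> R by rewrite powRN powR_mulrn ?invr_ge0// exprVn invrK; ring.
    by rewrite powRM ?invr_ge0 ?(ltW a0)// h4; ring.
  apply: lee_wpmul2l; first by rewrite lee_fin mulr_ge0 ?powR_ge0// mulr_ge0 ?powR_ge0// mulr_ge0.
  apply: le_int0 => X _; first by rewrite lee_fin powR_ge0.
  rewrite lee_fin /c (leNgt `|f X|); case: ifPn => //=; by rewrite normr0 powR0.
apply: lee_wpmul2r; first by int_ge0.
rewrite lee_fin.
have ln : lam != 0 by rewrite gt_eqF.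
have k1 : lam `^ 3 * g `^ (3 / 2 - p) <= lam `^ (- 5^-1).
  rewrite /g -powRrM -powRD ?ln ?implybT// ler_powR//; lra.
have k2 : lam `^ (- 3^-1) * g `^ (2 - p) <= lam `^ (- 5^-1).
  rewrite /g -powRrM -powRD ?ln ?implybT// ler_powR//; lra.
apply: (@le_trans _ _ (p * (D1 / (p - 3 / 2) + 4 * M2 / (2 - p)) * lam `^ (- 5^-1))); last first.
  by rewrite /C (mulrDl _ 1) mul1r lerDl powR_ge0.
rewrite -[leRHS]mulrA; apply: ler_wpM2l; first exact: ltW.
rewrite (mulrDl (D1 / _)); apply: lerD.
- apply: (@le_trans _ _ (D1 / (p - 3 / 2) * (lam `^ 3 * g `^ (3 / 2 - p)))).
    by rewrite le_eqVlt; apply/orP; left; apply/eqP; ring.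
  apply: ler_wpM2l => //; apply: divr_ge0 => //; lra.
- apply: (@le_trans _ _ (4 * M2 / (2 - p) * (lam `^ (- 3^-1) * g `^ (2 - p)))).
    by rewrite le_eqVlt; apply/orP; left; apply/eqP; ring.
  apply: ler_wpM2l => //; apply: divr_ge0; [exact: mulr_ge0|lra].
Qed.

End TopLp.

Lemma Top_Lp (R : realType) (A p : R) : 0 < A -> 199 / 100 < p ->
  exists C dl : R, [/\ 0 < C, 0 < dl & forall (K J : R -> R) (s : R) (r al : R -> R) (lam : R) (f : R * R -> R) (B : R),
  kernel_pair A K J s -> measT r -> measT al -> 1 <= lam ->
  (forall x, r x != 0 -> lam <= s * `|al x| * r x ^+ 2 <= 4 * lam) -> nice f B ->
  (\int[sleb2 R]_X (`|Top K r al f X| `^ p)%:E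
   <= (C * lam `^ (- dl))%:E * \int[sleb2 R]_X (`|f X| `^ p)%:E)%E].
Proof.
move=> A0 p1.
have [C2 C20 HC2] := @HLr_strong R 2 (ltac:(lra)).
have [p2|p2|p2] := ltgtP p 2.
- have [C C0 H] := Top_Lp_lt2 A0 (ltW C20) HC2 p1 p2.
  by exists C, 5^-1; split=> //.
- have [C C0 H] := Top_Lp_gt2 A0 (ltW C20) HC2 p2.
  exists C, 3^-1; split=> //.
  move=> K J s r al lam f B kp mr mal lam1 Hl nf.
  by apply: (H _ J s _ _ _ _ B) => // x /Hl /andP[].
- rewrite p2; exists (180 * pi ^+ 2 * A ^+ 2 * Num.sqrt C2 + 1), 3^-1; split.
  + by rewrite ltr_wpDl// !mulr_ge0 ?exprn_ge0 ?pi_ge0 ?sqrtr_ge0// ltW.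
  + by [].
  move=> K J s r al lam f B kp mr mal lam1 Hl nf.
  have Hl1 x : r x != 0 -> lam <= s * `|al x| * r x ^+ 2 by move/Hl => /andP[].
  apply: (le_trans (Top_L2' A0 (ltW C20) HC2 kp mr mal lam1 Hl1 nf)).
  apply: lee_wpmul2r; first by int_ge0.
  by rewrite lee_fin (mulrDl _ 1) mul1r lerDl powR_ge0.
Qed.

(** * Differentiation under the integral sign *)

Lemma derX2 (R : realType) (f : R -> R) (x a : R) : is_derive x (1:R) f a ->
  is_derive x (1:R) (fun y => f y ^+ 2) (2 * f x * a).
Proof.
move=> df; rewrite (_ : (fun y => _) = (fun y => f y * f y)); last by apply/funext => y; rewrite expr2.
by apply: is_derive_eq (derM df df) _; ring.
Qed.

Lemma derQuot (R : realType) (f g : R -> R) (x a b : R) : is_derive x (1:R) f a ->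
  is_derive x (1:R) g b -> g x != 0 -> is_derive x (1:R) (fun y => f y / g y) ((a * g x - f x * b) / g x ^+ 2).
Proof.
move=> df dg g0; apply: is_derive_eq (derM df (derV g0 dg)) _.
by field.
Qed.

Section UnderIntegral.
Variables (R : realType) (f : R -> R).
Local Notation mu := (leb1 R).
Hypotheses (mf : measT f) (fi : (\int[mu]_t `|f t|%:E < +oo)%E).

Let fk_integrable (k : R -> R) (C : R) : measT k -> (forall t, `|k t| <= C) ->
  mu.-integrable setT (EFin \o (fun t => f t * k t)).
Proof.
move=> mk kC; have C0 : 0 <= C by exact: le_trans (kC 0).
apply: integrableP'; first exact: measurable_funM.
apply: (@le_lt_trans _ _ (\int[mu]_t (C%:E * `|f t|%:E))%E).
  by apply: le_int0 => t _ //; rewrite -EFinM lee_fin normrM mulrC ler_wpM2r.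
rewrite intZ//.
by rewrite lte_mul_pinfty.
Qed.

Lemma integral_kernel_bound (k : R -> R) (C : R) : measT k -> (forall t, `|k t| <= C) ->
  `|\int[mu]_t (f t * k t)| <= C * fine (\int[mu]_t `|f t|%:E)%E.
Proof.
move=> mk kC; have C0 : 0 <= C by exact: le_trans (kC 0).
have E : ((fine (\int[mu]_t `|f t|%:E))%:E = \int[mu]_t `|f t|%:E)%E.
  by rewrite fineK// ge0_fin_numE// integral_ge0.
rewrite -lee_fin EFinM E; apply: (le_trans (le_norm_Rintegral mu measurableT (measurable_funM mf mk))).
rewrite -intZ//.
by apply: le_int0 => t _ //; rewrite -EFinM lee_fin normrM mulrC ler_wpM2r.
Qed.

Lemma is_derive_kernel_integral (k k' : R -> R -> R) (u v a C : R) : u < a < v ->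
  (forall y, measT (k y)) ->
  (forall y t, u < y < v -> is_derive y (1:R) (k ^~ t) (k' y t)) ->
  (forall y t, u < y < v -> `|k y t| <= C) -> (forall y t, u < y < v -> `|k' y t| <= C) ->
  is_derive a (1:R) (fun y => \int[mu]_t (f t * k y t)) (\int[mu]_t (f t * k' a t)).
Proof.
move=> uav mk dk kC k'C.
have Ia : `]u, v[%classic a by rewrite /= in_itv.
have dfk y t : u < y < v -> is_derive y (1:R) (fun y => f t * k y t) (f t * k' y t).
  move=> uyv; have H := derM (derC (f t) y) (dk y t uyv).
  by apply: is_derive_eq H _; rewrite mul0r add0r.
have C0 : 0 <= C by exact: le_trans (kC _ 0 uav).
have intf x : `]u, v[%classic x -> mu.-integrable setT (EFin \o (fun t => f t * k x t)).
  by rewrite /= in_itv/= => uxv; apply: (fk_integrable (C := C)) => // t; exact: kC.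
have derf1 x t : `]u, v[%classic x -> [set: R] t -> derivable (fun y => f t * k y t) x 1.
  by rewrite /= in_itv/= => uxv _; apply: @ex_derive; exact: dfk.
have D1E x t : u < x < v -> partial1of2 (fun y t => f t * k y t) x t = f t * k' x t.
  by move=> uxv; rewrite /partial1of2 derive1E; apply: @derive_val; exact: dfk.
have intG : mu.-integrable setT (EFin \o (fun t => C * `|f t|)).
  apply: integrableP'; first by meas.
  under eq_integral do rewrite normrM normr_id (ger0_norm C0) EFinM.
  rewrite intZ//.
  by rewrite lte_mul_pinfty.
have Gub x t : `]u, v[%classic x -> [set: R] t -> `|partial1of2 (fun y t => f t * k y t) x t| <= C * `|f t|.
  by rewrite /= in_itv/= => uxv _; rewrite D1E// normrM mulrC ler_wpM2r// k'C.
have G0 t : 0 <= C * `|f t| by exact: mulr_ge0.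
have der := derivable_under_integral measurableT Ia intf derf1 G0 intG Gub.
have val := differentiation_under_integral measurableT Ia intf derf1 G0 intG Gub.
apply: DeriveDef => //; rewrite -derive1E val.
by apply: eq_Rintegral => t _; rewrite D1E.
Qed.

Lemma continuous_kernel_integral (k : R -> R -> R) (u v a C : R) : u < a < v ->
  (forall y, measT (k y)) ->
  (forall y t, u < y < v -> {for y, continuous (k ^~ t)}) ->
  (forall y t, u < y < v -> `|k y t| <= C) ->
  {for a, continuous (fun y => \int[mu]_t (f t * k y t))}.
Proof.
move=> uav mk ck kC.
have C0 : 0 <= C by exact: le_trans (kC _ 0 uav).
have intG : mu.-integrable setT (EFin \o (fun t => C * `|f t|)).
  apply: integrableP'; first by meas.
  under eq_integral do rewrite normrM normr_id (ger0_norm C0) EFinM.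
  rewrite intZ//.
  by rewrite lte_mul_pinfty.
have := @continuity_under_integral R _ _ mu (fun y t => f t * k y t) setT measurableT u v.
apply => //; last 1 first.
- by rewrite inE/= in_itv.
- by move=> x; rewrite /= in_itv/= => uxv; apply: (fk_integrable (C := C)) => // t; exact: kC.
- apply: aeW => t _ y; rewrite inE/= in_itv/= => uyv.
  by apply: cvgM; [exact: cvg_cst|exact: ck].
- exact: intG.
- move=> x; rewrite /= in_itv/= => uxv; apply: aeW => t _.
  by rewrite normrM mulrC ler_wpM2r// kC.
Qed.

End UnderIntegral.

(** * Green's formula on a rectangle *)

Section RectangleContour.
Variables (R : realType) (g k kx : R -> R -> R) (e X C eta : R).
Local Notation mu := (leb1 R).
Hypotheses (e0 : 0 < e) (eX : e <= X).
Hypothesis dg : forall x h, e <= h -> is_derive h (1:R) (g x) (- kx x h).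
Hypothesis dk : forall x h, e <= h -> is_derive x (1:R) (k ^~ h) (kx x h).
Hypothesis ckx1 : forall x h, e <= h -> {for x, continuous (kx ^~ h)}.
Hypothesis ckx2 : forall x h, e <= h -> {for h, continuous (kx x)}.
Hypothesis mkx : measT (fun z : R * R => kx z.1 z.2).
Hypothesis bkx : forall x h, e <= h -> `|kx x h| <= C.
Hypothesis mg : forall h, measT (g ^~ h).
Hypothesis bg : forall x, `|x| <= X -> `|g x X| <= eta.
Hypothesis bk : forall h, e <= h <= X -> `|k X h| <= eta /\ `|k (- X) h| <= eta.

(* Two sides of Green's formula for the closed form [g dx - k dh] on [-X, X] x [e, X]. *)
Lemma rectangle_contour : `|\int[mu]_(x in `[- X, X]) g x e| <= 4 * X * eta.
Proof.
have X0 : 0 <= X by rewrite (le_trans _ eX)// ltW.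
have C0 : 0 <= C by exact: le_trans (bkx 0 (lexx e)).
have eta0 : 0 <= eta by apply: le_trans (bg (x := 0) _); rewrite ?normr0.
(* The common derivative of g and k cut off to the rectangle: integrated in h it gives g on the
   bottom side minus the top side, integrated in x it gives k on the right side minus the left
   side. *)
pose F x h := if (- X <= x <= X) && (e <= h <= X) then kx x h else 0.
have mF : measT (fun z : R * R => F z.1 z.2) by rewrite /F; meas.
have box (c : R) a b : 0 <= c -> (\int[mu]_x (if a <= x <= b then c else 0)%:E <= (c * `|b - a|)%:E)%E.
  move=> c0; have -> : (\int[mu]_x (if a <= x <= b then c else 0)%:E = \int[mu]_(x in `[a, b]) cst c%:E x)%E.
    by rewrite [RHS]integral_mkcond; apply: eq_integral => x _; rewrite patchE mem_setE in_itv/=; case: ifPn.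
  rewrite integral_cst//= lebesgue_measure_itv/= lte_fin; case: ifPn => [ab|_].
    by rewrite -EFinD -EFinM lee_fin ler_wpM2l// ler_norm.
  by rewrite mule0 lee_fin mulr_ge0.
have fin : (\int[mu]_x \int[mu]_h `|F x h|%:E < +oo)%E.
  apply: (@le_lt_trans _ _ (\int[mu]_x (if - X <= x <= X then C * `|X - e| else 0)%:E)%E); last first.
    by rewrite (le_lt_trans (box _ _ _ _)) ?ltry// mulr_ge0.
  apply: le_int0 => x _; first exact: integral_ge0.
  rewrite /F; case: ifPn => _ /=; last by rewrite integral0_eq// => h _; rewrite normr0.
  apply: le_trans (box C e X C0); apply: le_int0 => h _ //.
  by rewrite lee_fin; case: ifPn => [/andP[eh _]|_]; rewrite ?normr0// bkx.
have RE (u : R -> R) a b : \int[mu]_(x in `[a, b]) u x = \int[mu]_x (if a <= x <= b then u x else 0).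
  rewrite /Rintegral integral_mkcond; congr fine; apply: eq_integral => x _.
  by rewrite patchE mem_setE in_itv/=; case: ifPn.
have E1 x : - X <= x <= X -> g x e = g x X + \int[mu]_h F x h.
  move=> xX.
  have -> : \int[mu]_h F x h = \int[mu]_(h in `[e, X]) kx x h.
    by rewrite RE; congr Rintegral; apply/funext => h; rewrite /F xX.
  have d1 h : e <= h <= X -> is_derive h (1:R) (fun h => - g x h) (kx x h).
    by move=> /andP[eh _]; have := derN (dg x eh); rewrite opprK.
  have c1 h : e <= h <= X -> {for h, continuous (kx x)}.
    by move=> /andP[eh _]; exact: ckx2.
  by rewrite /Rintegral (FTC_is_derive eX d1 c1)/=; ring.
pose G x := if - X <= x <= X then g x X else 0.
pose I x := \int[mu]_h F x h.
have mG : measT G by have := mg X; rewrite /G; meas.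
have mI : measT I by apply: (@meas_Rint _ _ _ _ _ mu F).
have bG : (\int[mu]_x `|G x|%:E <= (2 * X * eta)%:E)%E.
  apply: (@le_trans _ _ (eta * `|X - (- X)|)%:E).
    apply: le_trans (box eta (- X) X eta0); apply: le_int0 => x _ //.
    rewrite lee_fin /G; case: ifPn => xX; last by rewrite normr0.
    by apply: bg; rewrite ler_norml.
  by rewrite lee_fin opprK ger0_norm ?addr_ge0// le_eqVlt; apply/orP; left; apply/eqP; ring.
have iG : mu.-integrable setT (EFin \o G).
  by apply: integrableP' => //; rewrite (le_lt_trans bG)// ltry.
have iI : mu.-integrable setT (EFin \o I).
  apply: integrableP' => //; apply: le_lt_trans fin; apply: le_int0 => x _ //.
  apply: (le_norm_Rintegral mu measurableT).
  by apply: (measurableT_comp (f := fun z : R * R => F z.1 z.2) (g := fun h : R => (x, h))) => //; meas.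
have -> : \int[mu]_(x in `[- X, X]) g x e = \int[mu]_x (G x + I x).
  rewrite RE; congr Rintegral; apply/funext => x; rewrite /G; case: ifPn => xX; first exact: E1.
  rewrite /I /Rintegral integral0_eq ?addr0// => h _.
  by rewrite /F (negbTE xX).
rewrite RintegralD//.
apply: le_trans (ler_normD _ _) _.
have hG : `|\int[mu]_x G x| <= 2 * X * eta.
  by rewrite -lee_fin; apply: le_trans (le_norm_Rintegral mu measurableT mG) _.
have hI : `|\int[mu]_x I x| <= 2 * X * eta.
  rewrite /I (@RFubini _ _ _ _ _ mu mu F mF fin).
  have E2 h : \int[mu]_x F x h = if e <= h <= X then k X h - k (- X) h else 0.
    rewrite /F; case: ifPn => eh; last by rewrite /Rintegral integral0_eq// => x _; rewrite andbF.
    have -> : \int[mu]_x (if (- X <= x <= X) && true then kx x h else 0) = \int[mu]_(x in `[(- X), X]) kx x h.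
      by rewrite RE; congr Rintegral; apply/funext => x; rewrite andbT.
    have XX : - X <= X by rewrite (le_trans _ X0)// oppr_le0.
    have {eh} /andP[eh _] := eh.
    have d1 x : - X <= x <= X -> is_derive x (1:R) (k ^~ h) (kx x h) by move=> _; exact: dk.
    have c1 x : - X <= x <= X -> {for x, continuous (kx ^~ h)} by move=> _; exact: ckx1.
    by rewrite /Rintegral (FTC_is_derive XX d1 c1).
  under eq_Rintegral do rewrite E2.
  have mK : measT (fun h => if e <= h <= X then k X h - k (- X) h else 0).
    rewrite (_ : (fun h => _) = (fun h => \int[mu]_x F x h)); last by apply/funext => h; rewrite E2.
    apply: (@meas_Rint _ _ _ _ _ mu (fun h x => F x h)).
    by apply: (measurableT_comp mF (g := fun z : R * R => (z.2, z.1))); meas.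
  rewrite -lee_fin; apply: le_trans (le_norm_Rintegral mu measurableT mK) _.
  apply: (@le_trans _ _ ((2 * eta) * `|X - e|)%:E).
    have eta20 : 0 <= 2 * eta by rewrite mulr_ge0.
    apply: le_trans (box _ e X eta20); apply: le_int0 => h _ //.
    rewrite lee_fin; case: ifPn => eh; last by rewrite normr0.
    have [b1 b2] := bk eh; apply: le_trans (ler_normB _ _) _; lra.
  rewrite lee_fin ger0_norm ?subr_ge0// mulrAC ler_wpM2r//.
  by rewrite ler_wpM2l// lerBlDl lerDr ltW.
by apply: le_trans (lerD hG hI) _; rewrite le_eqVlt; apply/orP; left; apply/eqP; ring.
Qed.

End RectangleContour.

(** * The conjugate Poisson integral *)

Section ConjugatePoisson.
Variables (R : realType) (f : R -> R).
Local Notation mu := (leb1 R).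
Hypotheses (mf : measT f) (fi : (\int[mu]_t `|f t|%:E < +oo)%E).

Let M := fine (\int[mu]_t `|f t|%:E)%E.

Let den (x h t : R) := (x - t) ^+ 2 + h ^+ 2.

Let den_gt0 (x h t : R) : 0 < h -> 0 < den x h t.
Proof. by move=> h0; rewrite /den ltr_wpDl ?sqr_ge0// exprn_gt0. Qed.

(** With z = x + i h, U = [poisI] and V = [conjI] satisfy U + i V = i * integral of f(t) / (z - t)
    dt, analytic in the upper half-plane. The kernels carry no factor 1 / pi; [dpois_ker] and
    [dconj_ker] are their x-derivatives, and the four derivative lemmas below are the Cauchy-Riemann
    equations. *)
Definition pois_ker (x h t : R) := h / ((x - t) ^+ 2 + h ^+ 2).
Definition conj_ker (x h t : R) := (x - t) / ((x - t) ^+ 2 + h ^+ 2).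
Definition dpois_ker (x h t : R) := - (2 * h * (x - t)) / ((x - t) ^+ 2 + h ^+ 2) ^+ 2.
Definition dconj_ker (x h t : R) := (h ^+ 2 - (x - t) ^+ 2) / ((x - t) ^+ 2 + h ^+ 2) ^+ 2.

Definition poisI (x h : R) := \int[mu]_t (f t * pois_ker x h t).
Definition conjI (x h : R) := \int[mu]_t (f t * conj_ker x h t).
Definition dpoisI (x h : R) := \int[mu]_t (f t * dpois_ker x h t).
Definition dconjI (x h : R) := \int[mu]_t (f t * dconj_ker x h t).

Let mpk (x h : R) : measT (pois_ker x h). Proof. by rewrite /pois_ker; meas. Qed.
Let mck (x h : R) : measT (conj_ker x h). Proof. by rewrite /conj_ker; meas. Qed.
Let mdpk (x h : R) : measT (dpois_ker x h). Proof. by rewrite /dpois_ker; meas. Qed.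
Let mdck (x h : R) : measT (dconj_ker x h). Proof. by rewrite /dconj_ker; meas. Qed.

Lemma ker_bounds (e h x t : R) : 0 < e -> e <= h ->
  [/\ `|pois_ker x h t| <= e^-1, `|conj_ker x h t| <= e^-1,
      `|dpois_ker x h t| <= (e ^+ 2)^-1 & `|dconj_ker x h t| <= (e ^+ 2)^-1].
Proof.
move=> e0 eh; have h0 : 0 < h by exact: lt_le_trans eh.
have d0 := den_gt0 x t h0; rewrite /den in d0.
rewrite /pois_ker /conj_ker /dpois_ker /dconj_ker.
move: d0; set y := x - t; set d := _ + _ => d0.
have eh2 : e ^+ 2 <= h ^+ 2 by rewrite lerXn2r ?nnegrE// ltW.
have dE : d = y ^+ 2 + h ^+ 2 by [].
have ey : e * `|y| <= d.
  have := sqr_ge0 (`|y| - h); rewrite sqrrB real_normK ?num_real// dE.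
  have : e * `|y| <= h * `|y| by rewrite ler_wpM2r.
  have : 0 <= `|y| * h by rewrite mulr_ge0// ltW.
  by rewrite -mulr_natl; lra.
have ed : e ^+ 2 <= d by rewrite dE; have := sqr_ge0 y; lra.
have e20 : 0 < e ^+ 2 by rewrite exprn_gt0.
have d20 : 0 < d ^+ 2 by rewrite exprn_gt0.
have A1 a : `|a| * e <= d -> `|a / d| <= e^-1.
  by move=> H; rewrite normrM normfV (gtr0_norm d0) ler_pdivrMr// mulrC ler_pdivlMr.
have A2 a : `|a| <= d -> `|a / d ^+ 2| <= (e ^+ 2)^-1.
  move=> H; rewrite normrM normfV (gtr0_norm d20) ler_pdivrMr// mulrC ler_pdivlMr// expr2.
  by apply: ler_pM => //; exact: ltW.
split.
- apply: A1; rewrite (gtr0_norm h0) dE; have := sqr_ge0 y.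
  have : h * e <= h ^+ 2 by rewrite expr2 ler_wpM2l// ltW.
  lra.
- by apply: A1; rewrite mulrC.
- apply: A2; rewrite normrN !normrM (gtr0_norm h0) (gtr0_norm (ltr0n R 2)) dE.
  have := sqr_ge0 (`|y| - h); rewrite sqrrB real_normK ?num_real// -mulr_natl; lra.
- apply: A2; rewrite dE ler_norml; have := sqr_ge0 y; have := sqr_ge0 h; lra.
Qed.

Let dn0 (x h t : R) : 0 < h -> (x - t) ^+ 2 + h ^+ 2 != 0.
Proof. by move=> h0; rewrite gt_eqF//; exact: den_gt0. Qed.

Let dx_den (x h t : R) : is_derive x (1:R) (fun x => (x - t) ^+ 2 + h ^+ 2) (2 * (x - t)).
Proof.
apply: is_derive_eq (derD (derX2 (derD (derId x) (derC (- t) x))) (derC (h ^+ 2) x)) _; ring.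
Qed.

Let dh_den (x h t : R) : is_derive h (1:R) (fun h => (x - t) ^+ 2 + h ^+ 2) (2 * h).
Proof. by apply: is_derive_eq (derD (derC ((x - t) ^+ 2) h) (derX2 (derId h))) _; ring. Qed.

Lemma dx_pois (x h t : R) : 0 < h -> is_derive x (1:R) (fun x => pois_ker x h t) (dpois_ker x h t).
Proof.
move=> h0; have n0 := dn0 x t h0.
have H := derQuot (derC h x) (dx_den x h t) n0.
rewrite /pois_ker; apply: (is_derive_eq H).
by rewrite /dpois_ker; congr (_ / _); ring.
Qed.

Lemma dx_conj (x h t : R) : 0 < h -> is_derive x (1:R) (fun x => conj_ker x h t) (dconj_ker x h t).
Proof.
move=> h0; have n0 := dn0 x t h0.
have H := derQuot (derD (derId x) (derC (- t) x)) (dx_den x h t) n0.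
rewrite /conj_ker; apply: (is_derive_eq H).
by rewrite /dconj_ker; congr (_ / _); ring.
Qed.

Lemma dh_pois (x h t : R) : 0 < h -> is_derive h (1:R) (fun h => pois_ker x h t) (- dconj_ker x h t).
Proof.
move=> h0; have n0 := dn0 x t h0.
have H := derQuot (derId h) (dh_den x h t) n0.
rewrite /pois_ker; apply: (is_derive_eq H).
by rewrite /dconj_ker -[RHS]mulNr; congr (_ / _); ring.
Qed.

Lemma dh_conj (x h t : R) : 0 < h -> is_derive h (1:R) (fun h => conj_ker x h t) (dpois_ker x h t).
Proof.
move=> h0; have n0 := dn0 x t h0.
have H := derQuot (derC (x - t) h) (dh_den x h t) n0.
rewrite /conj_ker; apply: (is_derive_eq H).
by rewrite /dpois_ker; congr (_ / _); ring.
Qed.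

Let dn2 (x h t : R) : 0 < h -> ((x - t) ^+ 2 + h ^+ 2) ^+ 2 != 0.
Proof. by move=> h0; rewrite expf_neq0//; exact: dn0. Qed.

Lemma cx_dpois (x h t : R) : 0 < h -> {for x, continuous (fun x => dpois_ker x h t)}.
Proof.
move=> h0.
have H := derQuot (derN (derM (derC (2 * h) x) (derD (derId x) (derC (- t) x)))) (derX2 (dx_den x h t)) (dn2 x t h0).
by rewrite /dpois_ker; exact: der_cont H.
Qed.

Lemma cx_dconj (x h t : R) : 0 < h -> {for x, continuous (fun x => dconj_ker x h t)}.
Proof.
move=> h0.
have H := derQuot (derD (derC (h ^+ 2) x) (derN (derX2 (derD (derId x) (derC (- t) x))))) (derX2 (dx_den x h t)) (dn2 x t h0).
by rewrite /dconj_ker; exact: der_cont H.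
Qed.

Lemma ch_dpois (x h t : R) : 0 < h -> {for h, continuous (fun h => dpois_ker x h t)}.
Proof.
move=> h0.
have H := derQuot (derN (derM (derM (derC 2 h) (derId h)) (derC (x - t) h))) (derX2 (dh_den x h t)) (dn2 x t h0).
by rewrite /dpois_ker; exact: der_cont H.
Qed.

Lemma ch_dconj (x h t : R) : 0 < h -> {for h, continuous (fun h => dconj_ker x h t)}.
Proof.
move=> h0.
have H := derQuot (derD (derX2 (derId h)) (derC (- (x - t) ^+ 2) h)) (derX2 (dh_den x h t)) (dn2 x t h0).
by rewrite /dconj_ker; exact: der_cont H.
Qed.

Let box1 (x : R) : x - 1 < x < x + 1.
Proof. by apply/andP; split; lra. Qed.

Let box2 (h : R) : 0 < h -> h / 2 < h < h + 1.
Proof. by move=> h0; apply/andP; split; lra. Qed.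

Let h20 (h : R) : 0 < h -> 0 < h / 2.
Proof. by move=> h0; lra. Qed.

Lemma dx_poisI (x h : R) : 0 < h -> is_derive x (1:R) (fun x => poisI x h) (dpoisI x h).
Proof.
move=> h0; have kb y t := ker_bounds y t h0 (lexx h).
apply: (@is_derive_kernel_integral R f mf fi (fun x => pois_ker x h) (fun x => dpois_ker x h) _ _ x (h^-1 + (h ^+ 2)^-1) (box1 x)) => //.
- by move=> y t _; exact: dx_pois.
- by move=> y t _; have [+ _ _ _] := kb y t; move=> /le_trans -> //; rewrite lerDl invr_ge0 sqr_ge0.
- by move=> y t _; have [_ _ + _] := kb y t; move=> /le_trans -> //; rewrite lerDr invr_ge0 ltW.
Qed.

Lemma dx_conjI (x h : R) : 0 < h -> is_derive x (1:R) (fun x => conjI x h) (dconjI x h).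
Proof.
move=> h0; have kb y t := ker_bounds y t h0 (lexx h).
apply: (@is_derive_kernel_integral R f mf fi (fun x => conj_ker x h) (fun x => dconj_ker x h) _ _ x (h^-1 + (h ^+ 2)^-1) (box1 x)) => //.
- by move=> y t _; exact: dx_conj.
- by move=> y t _; have [_ + _ _] := kb y t; move=> /le_trans -> //; rewrite lerDl invr_ge0 sqr_ge0.
- by move=> y t _; have [_ _ _ +] := kb y t; move=> /le_trans -> //; rewrite lerDr invr_ge0 ltW.
Qed.

Lemma dh_poisI (x h : R) : 0 < h -> is_derive h (1:R) (poisI x) (- dconjI x h).
Proof.
move=> h0; have kb y t : h / 2 < y -> _ := fun H => ker_bounds x t (h20 h0) (ltW H).
have H := @is_derive_kernel_integral R f mf fi (fun h => pois_ker x h) (fun h t => - dconj_ker x h t) _ _ h ((h / 2)^-1 + ((h / 2) ^+ 2)^-1) (box2 h0).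
apply: is_derive_eq; first apply: H => //.
- by move=> y t /andP[H _]; apply: dh_pois; apply: lt_trans H; exact: h20.
- move=> y t /andP[H _]; have [+ _ _ _] := kb y t H; move=> /le_trans -> //; rewrite lerDl invr_ge0 sqr_ge0//.
- move=> y t /andP[H _]; have [_ _ _ +] := kb y t H; rewrite normrN; move=> /le_trans -> //; rewrite lerDr invr_ge0 ltW// h20//.
rewrite /dconjI -mulN1r -RintegralZl//; last first.
  apply: integrableP'; first exact: (measurable_funM mf (mdck x h)).
  have kb' t : `|dconj_ker x h t| <= (h ^+ 2)^-1 by have [] := ker_bounds x t h0 (lexx h).
  apply: (@le_lt_trans _ _ (\int[mu]_t (((h ^+ 2)^-1)%:E * `|f t|%:E))%E).
    by apply: le_int0 => t _ //; rewrite -EFinM lee_fin normrM mulrC ler_wpM2r.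
  rewrite intZ//; last by rewrite invr_ge0 sqr_ge0.
  by rewrite lte_mul_pinfty// lee_fin invr_ge0 sqr_ge0.
by congr Rintegral; apply/funext => t; ring.
Qed.

Lemma dh_conjI (x h : R) : 0 < h -> is_derive h (1:R) (conjI x) (dpoisI x h).
Proof.
move=> h0; have kb y t : h / 2 < y -> _ := fun H => ker_bounds x t (h20 h0) (ltW H).
apply: (@is_derive_kernel_integral R f mf fi (fun h => conj_ker x h) (fun h t => dpois_ker x h t) _ _ h ((h / 2)^-1 + ((h / 2) ^+ 2)^-1) (box2 h0)) => //.
- by move=> y t /andP[H _]; apply: dh_conj; apply: lt_trans H; exact: h20.
- move=> y t /andP[H _]; have [_ + _ _] := kb y t H; move=> /le_trans -> //; rewrite lerDl invr_ge0 sqr_ge0//.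
- move=> y t /andP[H _]; have [_ _ + _] := kb y t H; move=> /le_trans -> //; rewrite lerDr invr_ge0 ltW// h20//.
Qed.

Lemma cx_dpoisI (x h : R) : 0 < h -> {for x, continuous (fun x => dpoisI x h)}.
Proof.
move=> h0; apply: (@continuous_kernel_integral R f mf fi (fun x => dpois_ker x h) _ _ x ((h ^+ 2)^-1) (box1 x)) => //.
- by move=> y t _; exact: cx_dpois.
- by move=> y t _; have [] := ker_bounds y t h0 (lexx h).
Qed.

Lemma cx_dconjI (x h : R) : 0 < h -> {for x, continuous (fun x => dconjI x h)}.
Proof.
move=> h0; apply: (@continuous_kernel_integral R f mf fi (fun x => dconj_ker x h) _ _ x ((h ^+ 2)^-1) (box1 x)) => //.
- by move=> y t _; exact: cx_dconj.
- by move=> y t _; have [] := ker_bounds y t h0 (lexx h).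
Qed.

Lemma ch_dpoisI (x h : R) : 0 < h -> {for h, continuous (dpoisI x)}.
Proof.
move=> h0; apply: (@continuous_kernel_integral R f mf fi (fun h => dpois_ker x h) _ _ h (((h / 2) ^+ 2)^-1) (box2 h0)) => //.
- by move=> y t /andP[H _]; apply: ch_dpois; apply: lt_trans H; exact: h20.
- by move=> y t /andP[H _]; have [] := ker_bounds x t (h20 h0) (ltW H).
Qed.

Lemma ch_dconjI (x h : R) : 0 < h -> {for h, continuous (dconjI x)}.
Proof.
move=> h0; apply: (@continuous_kernel_integral R f mf fi (fun h => dconj_ker x h) _ _ h (((h / 2) ^+ 2)^-1) (box2 h0)) => //.
- by move=> y t /andP[H _]; apply: ch_dconj; apply: lt_trans H; exact: h20.
- by move=> y t /andP[H _]; have [] := ker_bounds x t (h20 h0) (ltW H).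
Qed.

Lemma measurable_poisI : measT (fun z : R * R => poisI z.1 z.2).
Proof.
by apply: (@meas_Rint _ _ _ _ _ mu (fun (z : R * R) t => f t * pois_ker z.1 z.2 t)); rewrite /pois_ker; meas.
Qed.
Lemma measurable_conjI : measT (fun z : R * R => conjI z.1 z.2).
Proof.
by apply: (@meas_Rint _ _ _ _ _ mu (fun (z : R * R) t => f t * conj_ker z.1 z.2 t)); rewrite /conj_ker; meas.
Qed.
Lemma measurable_dpoisI : measT (fun z : R * R => dpoisI z.1 z.2).
Proof.
by apply: (@meas_Rint _ _ _ _ _ mu (fun (z : R * R) t => f t * dpois_ker z.1 z.2 t)); rewrite /dpois_ker; meas.
Qed.
Lemma measurable_dconjI : measT (fun z : R * R => dconjI z.1 z.2).
Proof.
by apply: (@meas_Rint _ _ _ _ _ mu (fun (z : R * R) t => f t * dconj_ker z.1 z.2 t)); rewrite /dconj_ker; meas.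
Qed.

Lemma poisI_bounds (e h x : R) : 0 < e -> e <= h ->
  [/\ `|poisI x h| <= e^-1 * M, `|conjI x h| <= e^-1 * M,
      `|dpoisI x h| <= (e ^+ 2)^-1 * M & `|dconjI x h| <= (e ^+ 2)^-1 * M].
Proof.
move=> e0 eh; have kb t := ker_bounds x t e0 eh.
by split; apply: (integral_kernel_bound mf fi) => // t; have [] := kb t.
Qed.

(** For |x| >= 2 L every point of the support is at distance at least |x| / 2 from x, uniformly in
    the height. *)
Lemma poisI_decay (L h x : R) : 0 < L -> 0 < h -> (forall t, f t != 0 -> `|t| <= L) -> 2 * L <= `|x| ->
  `|poisI x h| <= 2 / `|x| * M /\ `|conjI x h| <= 2 / `|x| * M.
Proof.
move=> L0 h0 fL Lx.
have x0 : 0 < `|x| by lra.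
pose cut (k : R -> R) t := if `|t| <= L then k t else 0.
have mcut k : measT k -> measT (cut k).
  by move=> mk; rewrite /cut; meas.
have cutE k : \int[mu]_t (f t * k t) = \int[mu]_t (f t * cut k t).
  congr Rintegral; apply/funext => t; rewrite /cut; case: ifPn => // tL.
  have [->|/fL] := eqVneq (f t) 0; first by rewrite !mul0r.
  by rewrite (negbTE tL).
have yb t : `|t| <= L -> `|x| <= 2 * `|x - t|.
  move=> tL; have := ler_normD (x - t) t; rewrite subrK; lra.
have kb a t : `|t| <= L -> `|a| * `|x - t| <= den x h t -> `|a / den x h t| <= 2 / `|x|.
  move=> tL H; have d0 := den_gt0 x t h0.
  rewrite normrM normfV (gtr0_norm d0) ler_pdivrMr// mulrAC ler_pdivlMr//.
  have := yb t tL => y2; have : `|a| * `|x| <= `|a| * (2 * `|x - t|) by rewrite ler_wpM2l.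
  move: H; lra.
have n0 : 0 <= 2 / `|x| by rewrite divr_ge0.
rewrite /poisI /conjI (cutE (pois_ker x h)) (cutE (conj_ker x h)); split; apply: (integral_kernel_bound mf fi); [exact: (mcut _ (mpk x h))| |exact: (mcut _ (mck x h))|].
  move=> t; rewrite /cut; case: ifPn => tL; last by rewrite normr0.
  apply: kb => //; rewrite /den (gtr0_norm h0).
  have := sqr_ge0 (`|x - t| - h); rewrite sqrrB real_normK ?num_real// -mulr_natl.
  have := sqr_ge0 (x - t); have := sqr_ge0 h; lra.
move=> t; rewrite /cut; case: ifPn => tL; last by rewrite normr0.
apply: kb => //; rewrite /den -expr2 real_normK ?num_real// lerDl sqr_ge0//.
Qed.

End ConjugatePoisson.

(** * L2 and weak L1 bounds for the conjugate function *)

Lemma EFin_Rintegral_itv (R : realType) (F : R -> R) (a b : R) :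
  (leb1 R).-integrable `[a, b] (EFin \o F) ->
  ((\int[leb1 R]_(x in `[a, b]) F x)%:E = \int[leb1 R]_(x in `[a, b]) (F x)%:E)%E.
Proof. by move=> iF; rewrite /Rintegral fineK//; apply: integrable_fin_num. Qed.

Lemma integrable_itv (R : realType) (F : R -> R) (a b C : R) : measT F ->
  (forall x, `|F x| <= C) -> (leb1 R).-integrable `[a, b] (EFin \o F).
Proof.
move=> mF FC.
have mF' : measurable_fun `[a, b] (EFin \o F) by apply/measurable_EFinP; exact: measurable_funS mF.
have C0 : 0 <= C by exact: le_trans (FC 0).
apply/integrableP; split => //.
apply: (@le_lt_trans _ _ (\int[leb1 R]_(x in `[a, b]) cst C%:E x)%E).
  by apply: le_int0 => x _ //; rewrite lee_fin.
rewrite integral_cst//= lebesgue_measure_itv/= lte_fin; case: ifPn => _; last by rewrite mule0.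
by rewrite -EFinD -EFinM ltry.
Qed.

(* Monotone exhaustion of the line by [-X, X], with an error term O(1/X). *)
Lemma integral_exhaust_itv (R : realType) (F : R -> R) (b : \bar R) (X0 c : R) : measT F ->
  (forall x, 0 <= F x) -> 0 <= c ->
  (forall X : R, (0 < X)%R -> (X0 <= X)%R -> \int[leb1 R]_(x in `[(- X)%R, X]) (F x)%:E <= b + (c / X)%:E)%E ->
  (\int[leb1 R]_x (F x)%:E <= b)%E.
Proof.
move=> mF F0 c0 H.
apply/lee_addgt0Pr => eps e0.
pose N := (Num.bound (`|X0| + c / eps)).+1.
have NX : `|X0| + c / eps < N%:R.
  apply: (@lt_trans _ _ (Num.bound (`|X0| + c / eps))%:R); last by rewrite ltr_nat.
  by apply: archi_boundP; rewrite addr_ge0// divr_ge0// ltW.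
apply: (@fatou_near _ _ R (leb1 R) (fun n x => if `|x| <= (n + N)%:R then (F x)%:E else 0%E)) => //.
- by move=> n; apply: measurable_fun_ifT; meas.
- by move=> n x; case: ifPn => // _; rewrite lee_fin.
- move=> n; set m : R := (n + N)%:R.
  have nN : 0 < m by rewrite ltr0n addnS.
  have NN : N%:R <= m by rewrite ler_nat leq_addl.
  have cc : 0 <= c / eps by rewrite divr_ge0// ltW.
  have XX : X0 <= m by have := ler_norm X0; lra.
  have <- : (\int[leb1 R]_(x in `[(- m)%R, m]) (F x)%:E =
     \int[leb1 R]_x (if (`|x| <= m)%R then (F x)%:E else 0))%E.
    by rewrite integral_mkcond; apply: eq_integral => x _; rewrite patchE mem_setE in_itv/= ler_norml.
  apply: le_trans (H m nN XX) _; apply: leeD2l; rewrite lee_fin ler_pdivrMr// mulrC -ler_pdivrMr//.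
  by have := normr_ge0 X0; lra.
move=> x; near=> n; rewrite ifT//.
apply: (@le_trans _ _ n%:R); last by rewrite ler_nat leq_addr.
by near: n; exact: nbhs_infty_ger.
Unshelve. all: by end_near. Qed.

Lemma pois_ker_poissonk (R : realType) (x h t : R) : 0 < h -> pois_ker x h t = poissonk h^-1 (x - t).
Proof.
move=> h0; rewrite /pois_ker /poissonk.
have n0 : (x - t) ^+ 2 + h ^+ 2 != 0 by rewrite gt_eqF// ltr_wpDl ?sqr_ge0// exprn_gt0.
have n1 : 1 + (h^-1 * (x - t)) ^+ 2 != 0 by rewrite gt_eqF// ltr_pwDl// sqr_ge0.
have hn : h != 0 by rewrite gt_eqF.
have E : (x - t) ^+ 2 + h ^+ 2 = h ^+ 2 * (1 + (h^-1 * (x - t)) ^+ 2).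
  by rewrite !expr2; field.
by rewrite E invfM mulrA; congr (_ / _); rewrite expr2 invfM mulrA divff// mul1r.
Qed.

Section ConjugatePoissonBounds.
Variables (R : realType) (f : R -> R) (B L e : R).
Local Notation mu := (leb1 R).
Hypotheses (mf : measT f) (fB : forall t, `|f t| <= B).
Hypotheses (L0 : 0 < L) (fL : forall t, f t != 0 -> `|t| <= L) (e0 : 0 < e).

Lemma cpt_supp_fin : (\int[mu]_t `|f t|%:E < +oo)%E.
Proof.
have B0 : 0 <= B by exact: le_trans (fB 0).
apply: (@le_lt_trans _ _ (\int[mu]_(t in `[(- L)%R, L]) cst B%:E t)%E).
  rewrite [leRHS]integral_mkcond; apply: le_int0 => t _ //.
  rewrite patchE mem_setE in_itv/= -ler_norml; case: ifPn => tL; first by rewrite lee_fin.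
  have [->|/fL] := eqVneq (f t) 0; first by rewrite normr0.
  by rewrite (negbTE tL).
rewrite integral_cst//= lebesgue_measure_itv/= lte_fin; case: ifPn => _; last by rewrite mule0.
by rewrite -EFinD -EFinM ltry.
Qed.

Let fi := cpt_supp_fin.
Let M := fine (\int[mu]_t `|f t|%:E)%E.
Let U := poisI f.
Let V := conjI f.
Let Ux := dpoisI f.
Let Vx := dconjI f.

Let M0 : 0 <= M.
Proof. by rewrite fine_ge0// integral_ge0. Qed.

Let mU : measT (fun z : R * R => U z.1 z.2). Proof. exact: measurable_poisI. Qed.
Let mV : measT (fun z : R * R => V z.1 z.2). Proof. exact: measurable_conjI. Qed.
Let mUx : measT (fun z : R * R => Ux z.1 z.2). Proof. exact: measurable_dpoisI. Qed.
Let mVx : measT (fun z : R * R => Vx z.1 z.2). Proof. exact: measurable_dconjI. Qed.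

Let msec (F : R -> R -> R) (h : R) : measT (fun z : R * R => F z.1 z.2) -> measT (F ^~ h).
Proof. by move=> mF; apply: (measurableT_comp mF (g := fun x : R => (x, h))); meas. Qed.

Let bnd h x : e <= h -> [/\ `|U x h| <= e^-1 * M, `|V x h| <= e^-1 * M,
  `|Ux x h| <= (e ^+ 2)^-1 * M & `|Vx x h| <= (e ^+ 2)^-1 * M].
Proof. exact: (poisI_bounds mf fi x e0). Qed.

Let hpos h : e <= h -> 0 < h.
Proof. exact: lt_le_trans. Qed.

Let top (X x : R) : 0 < X -> `|U x X| <= 2 * M / X /\ `|V x X| <= 2 * M / X.
Proof.
move=> X0; have [h1 h2 _ _] := poisI_bounds mf fi x X0 (lexx X).
have : X^-1 * M <= 2 * M / X by rewrite mulrC ler_wpM2r ?invr_ge0 ?(ltW X0)//; have := M0; lra.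
by move=> h3; split; [exact: le_trans h1 h3|exact: le_trans h2 h3].
Qed.

Let side (X h : R) : 0 < X -> 2 * L <= X -> 0 < h ->
  (`|U X h| <= 2 * M / X /\ `|V X h| <= 2 * M / X) /\ (`|U (- X) h| <= 2 * M / X /\ `|V (- X) h| <= 2 * M / X).
Proof.
move=> X0 LX h0; have n1 : 2 * L <= `|X| by rewrite gtr0_norm.
have n2 : 2 * L <= `|- X| by rewrite normrN gtr0_norm.
have s1 := poisI_decay mf fi L0 h0 fL n1; have s2 := poisI_decay mf fi L0 h0 fL n2.
move: s1 s2; rewrite -/M.
by rewrite normrN (gtr0_norm X0) (mulrAC 2).
Qed.

Let sqbound (a b c : R) : `|a| <= c -> `|b| <= c -> `|a * b| <= c ^+ 2.
Proof. by move=> ac bc; rewrite normrM expr2; apply: ler_pM. Qed.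

(** Cauchy's theorem for (U + i V)^2, of real part U^2 - V^2 and imaginary part 2 U V. On the three
    far sides the square is O((M / X)^2) and the sides have length O(X). *)
Lemma conj_square_contour X : e <= X -> 2 * L <= X ->
  `|\int[mu]_(x in `[(- X), X]) (U x e ^+ 2 - V x e ^+ 2)| <= 32 * M ^+ 2 / X.
Proof.
move=> eX LX; have X0 := hpos eX.
have -> : 32 * M ^+ 2 / X = 4 * X * (2 * (2 * M / X) ^+ 2).
  by rewrite !expr2; field; rewrite gt_eqF.
apply: (@rectangle_contour R (fun x h => U x h ^+ 2 - V x h ^+ 2) (fun x h => 2 * (U x h * V x h))
  (fun x h => 2 * (Ux x h * V x h + U x h * Vx x h)) e X (2 * (2 * ((e ^+ 2)^-1 * M * (e^-1 * M))))) => //.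
- move=> x h /hpos h0.
  have H := derD (derX2 (dh_poisI mf fi x h0)) (derN (derX2 (dh_conjI mf fi x h0))).
  by apply: (is_derive_eq H); rewrite /U /V /Ux /Vx; ring.
- move=> x h /hpos h0.
  have H := derM (derC 2 x) (derM (dx_poisI mf fi x h0) (dx_conjI mf fi x h0)).
  by apply: (is_derive_eq H); rewrite /U /V /Ux /Vx; ring.
- move=> x h /hpos h0.
  have c1 := der_cont (dx_poisI mf fi x h0); have c2 := der_cont (dx_conjI mf fi x h0).
  have c3 : {for x, continuous (fun x => Ux x h)} by exact: cx_dpoisI.
  have c4 : {for x, continuous (fun x => Vx x h)} by exact: cx_dconjI.
  by apply: cvgM; [exact: cvg_cst|apply: cvgD; apply: cvgM].
- move=> x h /hpos h0.
  have c1 := der_cont (dh_poisI mf fi x h0); have c2 := der_cont (dh_conjI mf fi x h0).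
  have c3 : {for h, continuous (Ux x)} by exact: ch_dpoisI.
  have c4 : {for h, continuous (Vx x)} by exact: ch_dconjI.
  by apply: cvgM; [exact: cvg_cst|apply: cvgD; apply: cvgM].
- by meas.
- move=> x h eh; have [b1 b2 b3 b4] := bnd x eh.
  rewrite normrM (gtr0_norm (ltr0n R 2)) ler_wpM2l// (le_trans (ler_normD _ _))// !normrM.
  have : `|Ux x h| * `|V x h| <= (e ^+ 2)^-1 * M * (e^-1 * M) by apply: ler_pM.
  have : `|U x h| * `|Vx x h| <= e^-1 * M * ((e ^+ 2)^-1 * M) by apply: ler_pM.
  lra.
- move=> h; have := msec h mU; have := msec h mV => m1 m2; by meas.
- move=> x _; have [t1 t2] := top x X0.
  apply: le_trans (ler_normB _ _) _; have := sqbound t1 t1; have := sqbound t2 t2.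
  by rewrite -!expr2; lra.
- move=> h /andP[/hpos h0 _]; have [[s1 s2] [s3 s4]] := side X0 LX h0.
  by split; rewrite normrM (gtr0_norm (ltr0n R 2)) ler_wpM2l// sqbound.
Qed.

Let U_HL x : `|U x e| <= 16 * HLr (fun t => `|f t|) x.
Proof.
have mnf : measT (fun t => `|f t|) by meas.
have nfB t : 0 <= `|f t| <= B by rewrite normr_ge0 fB.
rewrite -lee_fin; apply: le_trans (HLr_poisson x mnf nfB (s := e^-1) _); last by rewrite invr_gt0.
have mk : measT (fun t => f t * pois_ker x e t) by rewrite /pois_ker; meas.
apply: (le_trans (le_norm_Rintegral mu measurableT mk)).
apply: le_int0 => t _ //; rewrite lee_fin pois_ker_poissonk// normrM.
by rewrite (ger0_norm (poissonk_ge0 _ _))// invr_ge0 ltW.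
Qed.

(** By the contour identity, V has at most the L2 norm of U on each height, and |U| <= 16 HLr |f|.
    The bound does not depend on the height e. *)
Lemma conjI_L2 (C2 : R) : 0 <= C2 ->
  (forall (F : R -> R) (B : R), measT F -> (forall x, 0 <= F x <= B) ->
  (\int[mu]_x (HLr F x `^ 2)%:E <= C2%:E * \int[mu]_x (F x `^ 2)%:E)%E) ->
  (\int[mu]_x (`|conjI f x e| `^ 2)%:E <= (16 ^+ 2 * C2)%:E * \int[mu]_x (`|f x| `^ 2)%:E)%E.
Proof.
move=> C20 HC2.
have mnf : measT (fun t => `|f t|) by meas.
have nfB t : 0 <= `|f t| <= B by rewrite normr_ge0 fB.
have mUe := msec e mU; have mVe := msec e mV.
have mHL : measT (HLr (fun t => `|f t|)).
  by apply: (measurable_HLr (B := B)) => // t; rewrite normr_id.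
have IU : (\int[mu]_x (U x e ^+ 2)%:E <= (16 ^+ 2 * C2)%:E * \int[mu]_x (`|f x| `^ 2)%:E)%E.
  apply: (@le_trans _ _ (\int[mu]_x ((16 ^+ 2)%:E * (HLr (fun t => `|f t|) x `^ 2)%:E))%E).
    apply: le_int0 => x _; first by rewrite lee_fin sqr_ge0.
    rewrite -EFinM lee_fin powR_mulrn ?HLr_ge0// -(real_normK (num_real (U x e))).
    have := U_HL x => h; have : `|U x e| ^+ 2 <= (16 * HLr (fun t => `|f t|) x) ^+ 2.
      by rewrite lerXn2r ?nnegrE// mulr_ge0// HLr_ge0.
    by rewrite exprMn.
  rewrite intZ ?exprn_ge0//.
  by rewrite [X in (_ <= X * _)%E]EFinM -muleA; apply: lee_wpmul2l; [by rewrite lee_fin exprn_ge0|exact: (HC2 _ B)].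
under eq_integral do rewrite -sqr_powR2.
apply: (@integral_exhaust_itv R (fun x => V x e ^+ 2) _ (Num.max e (2 * L)) (32 * M ^+ 2)).
- by meas.
- by move=> x; exact: sqr_ge0.
- by rewrite mulr_ge0// sqr_ge0.
move=> X X0; rewrite ge_max => /andP[eX LX].
have ct := conj_square_contour eX LX.
have bU x : `|U x e ^+ 2| <= (e^-1 * M) ^+ 2.
  by have [b1 _ _ _] := bnd x (lexx e); have := sqbound b1 b1; rewrite -expr2.
have bV x : `|V x e ^+ 2| <= (e^-1 * M) ^+ 2.
  by have [_ b1 _ _] := bnd x (lexx e); have := sqbound b1 b1; rewrite -expr2.
have mU2 : measT (fun x => U x e ^+ 2) by meas.
have mV2 : measT (fun x => V x e ^+ 2) by meas.
rewrite (@RintegralB _ _ _ mu `[(- X), X]) in ct => //; try exact: integrable_itv.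
have iV := integrable_itv (- X) X mV2 bV.
have iU := integrable_itv (- X) X mU2 bU.
rewrite -(EFin_Rintegral_itv iV).
apply: (@le_trans _ _ ((\int[mu]_(x in `[(- X), X]) (U x e ^+ 2))%:E + (32 * M ^+ 2 / X)%:E)%E).
  by rewrite -EFinD lee_fin; move: ct; rewrite ler_norml lerNl opprB lerBlDl => /andP[].
apply: leeD => //; rewrite (EFin_Rintegral_itv iU).
apply: le_trans IU; rewrite integral_mkcond; apply: le_int0 => x _; rewrite patchE; case: ifPn => // _;
  by rewrite lee_fin sqr_ge0.
Qed.

Section WeakType.
Hypothesis f0 : forall t, 0 <= f t.

Let pois0 (h x t : R) : 0 < h -> 0 <= pois_ker x h t.
Proof. by move=> h0; rewrite divr_ge0 ?(ltW h0)// addr_ge0// sqr_ge0. Qed.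

Let U0 (x h : R) : 0 < h -> 0 <= U x h.
Proof.
move=> h0; rewrite /U /poisI /Rintegral fine_ge0// integral_ge0// => t _.
by rewrite lee_fin mulr_ge0// pois0.
Qed.

Let UE x h : 0 < h -> ((U x h)%:E = \int[mu]_t (f t * pois_ker x h t)%:E)%E.
Proof.
move=> h0; rewrite /U /poisI EFin_Rintegral//.
apply: integrableP'; first by rewrite /pois_ker; meas.
apply: (@le_lt_trans _ _ (\int[mu]_t ((h^-1)%:E * `|f t|%:E))%E).
  apply: le_int0 => t _ //.
  have [kb _ _ _] := ker_bounds x t h0 (lexx h).
  by rewrite -EFinM lee_fin normrM mulrC ler_wpM2r.
rewrite intZ//; last by rewrite invr_ge0 ltW.
by rewrite lte_mul_pinfty// lee_fin invr_ge0 ltW.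
Qed.

Let massU h : 0 < h -> (\int[mu]_x (U x h)%:E <= (pi * M)%:E)%E.
Proof.
move=> h0; under eq_integral do rewrite UE//.
have mk : measT (fun z : R * R => (f z.2 * pois_ker z.1 h z.2)%:E).
  by rewrite /pois_ker; meas.
rewrite (@tonelli _ _ _ _ _ mu mu (fun x t => (f t * pois_ker x h t)%:E) mk); last first.
  by move=> x t; rewrite lee_fin mulr_ge0// pois0.
apply: (@le_trans _ _ (\int[mu]_t (pi%:E * `|f t|%:E))%E).
  apply: le_int0 => t _; first by apply: integral_ge0 => x _; rewrite lee_fin mulr_ge0// pois0.
  under eq_integral do rewrite EFinM.
  have mp : measT (fun x => pois_ker x h t) by rewrite /pois_ker; meas.
  rewrite intZ//.
  rewrite (ger0_norm (f0 t)) muleC; apply: lee_wpmul2r; first by rewrite lee_fin.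
  under eq_integral do rewrite pois_ker_poissonk//.
  rewrite (@ge0_integral_shift R (- t) (fun x => (poissonk h^-1 x)%:E)); last 2 first.
  - by apply/measurable_EFinP; exact: measurable_poissonk.
  - by move=> x; rewrite lee_fin poissonk_ge0// invr_ge0 ltW.
  by rewrite integral_poissonk// invr_gt0.
rewrite intZ ?pi_ge0//.
have ME : (M%:E = \int[mu]_t `|f t|%:E)%E by rewrite /M fineK// ge0_fin_numE// integral_ge0.
by rewrite EFinM ME.
Qed.

Variable a : R.
Hypothesis a0 : 0 < a.

Let D x h := (U x h + a) ^+ 2 + V x h ^+ 2.

Let Da x h : 0 < h -> a ^+ 2 <= D x h.
Proof.
move=> h0; have := U0 x h0; have := sqr_ge0 (V x h).
have : 0 <= U x h * a -> 0 <= U x h ^+ 2 -> a ^+ 2 <= (U x h + a) ^+ 2 by rewrite sqrrD -mulr_natl => ? ?; lra.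
move=> h1 h2 u0; have := h1 (mulr_ge0 u0 (ltW a0)) (sqr_ge0 _); rewrite /D; lra.
Qed.

Let D0 x h : 0 < h -> 0 < D x h.
Proof. by move=> h0; apply: lt_le_trans (Da x h0); rewrite exprn_gt0. Qed.

Let dUVx x h : 0 < h -> [/\ is_derive x (1:R) (fun x => U x h) (Ux x h), is_derive x (1:R) (fun x => V x h) (Vx x h),
  is_derive h (1:R) (U x) (- Vx x h) & is_derive h (1:R) (V x) (Ux x h)].
Proof. by move=> h0; split; [exact: dx_poisI|exact: dx_conjI|exact: dh_poisI|exact: dh_conjI]. Qed.

(** With F = U + i V, [g] and [k] are the real and imaginary parts of F^2 / (F + a) = F - a + a^2 /
    (F + a), and [D] is |F + a|^2. As f >= 0 gives U >= 0, the denominator never vanishes. *)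
Let g x h := U x h - a + a ^+ 2 * (U x h + a) / D x h.
Let k x h := V x h - a ^+ 2 * V x h / D x h.
Let kx x h := Vx x h - a ^+ 2 * (Vx x h * D x h - V x h * (2 * (U x h + a) * Ux x h + 2 * V x h * Vx x h)) / D x h ^+ 2.

Let gE x h : 0 < h -> g x h = ((U x h ^+ 2 + V x h ^+ 2) * U x h + a * (U x h ^+ 2 - V x h ^+ 2)) / D x h.
Proof.
move=> h0; have := D0 x h0; rewrite /g /D; move: (U x h) (V x h) => u v d0.
have dn : (u + a) ^+ 2 + v ^+ 2 != 0 by rewrite gt_eqF.
by rewrite -[u - a](mulfK dn) -mulrDl; congr (_ / _); ring.
Qed.

Let kE x h : 0 < h -> k x h = V x h * (U x h ^+ 2 + 2 * a * U x h + V x h ^+ 2) / D x h.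
Proof.
move=> h0; have := D0 x h0; rewrite /k /D; move: (U x h) (V x h) => u v d0.
have dn : (u + a) ^+ 2 + v ^+ 2 != 0 by rewrite gt_eqF.
by rewrite -[X in X - _](mulfK dn) -mulrBl; congr (_ / _); ring.
Qed.

(** F^2 / (F + a) is of second order in F, so it decays like 1 / X^2 on the far sides; this is the
    reason for choosing F^2 / (F + a) over F / (F + a). *)
Let gkbound x h c : 0 < h -> `|U x h| <= c -> `|V x h| <= c ->
  `|g x h| <= 4 * c ^+ 2 / a /\ `|k x h| <= 4 * c ^+ 2 / a.
Proof.
move=> h0 uc vc; have u0 := U0 x h0; have d0 := D0 x h0.
have u2 : U x h ^+ 2 <= c ^+ 2 by have := sqbound uc uc; rewrite -expr2 ger0_norm// sqr_ge0.
have v2 : V x h ^+ 2 <= c ^+ 2 by have := sqbound vc vc; rewrite -expr2 ger0_norm// sqr_ge0.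
have au : a * (U x h + a) <= D x h.
  have : 0 <= U x h * (U x h + a) by rewrite mulr_ge0// addr_ge0// ltW.
  by have := sqr_ge0 (V x h); rewrite /D !expr2; lra.
have key w p : `|w| <= p * (U x h + a) -> p <= 4 * c ^+ 2 -> 0 <= p -> `|w / D x h| <= 4 * c ^+ 2 / a.
  move=> wp pc p0; rewrite normrM normfV (gtr0_norm d0) ler_pdivrMr//.
  apply: (le_trans wp); rewrite mulrAC ler_pdivlMr// -mulrA (mulrC _ a).
  by apply: ler_pM => //; rewrite mulr_ge0 ?(ltW a0)// addr_ge0// ltW.
split.
- rewrite gE//; apply: (key _ (U x h ^+ 2 + V x h ^+ 2)) => //; last by rewrite addr_ge0// sqr_ge0.
    apply: le_trans (ler_normD _ _) _; rewrite [leRHS]mulrDr; apply: lerD.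
      by rewrite ger0_norm// mulr_ge0// addr_ge0// sqr_ge0.
    rewrite normrM (gtr0_norm a0) mulrC ler_wpM2r ?(ltW a0)// ler_norml.
    have := sqr_ge0 (U x h); have := sqr_ge0 (V x h); lra.
  have := sqr_ge0 c; lra.
- rewrite kE//.
  have v0 : `|V x h| ^+ 2 <= c ^+ 2 by rewrite real_normK ?num_real.
  have d2 : 2 * `|V x h| * (U x h + a) <= D x h.
    have := sqr_ge0 (`|V x h| - (U x h + a)); rewrite sqrrB /D -mulr_natl real_normK ?num_real//; lra.
  have q0 : 0 <= U x h ^+ 2 + 2 * a * U x h + V x h ^+ 2.
    by rewrite !addr_ge0 ?sqr_ge0// !mulr_ge0// ltW.
  rewrite normrM normrM normfV (gtr0_norm d0) (ger0_norm q0) ler_pdivrMr// [leRHS]mulrAC ler_pdivlMr//.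
  have e1 : 0 <= `|V x h| * (U x h + a) by rewrite mulr_ge0// addr_ge0// ltW.
  have vn := normr_ge0 (V x h).
  have uv2 : U x h * `|V x h| <= c ^+ 2.
    by rewrite expr2; apply: ler_pM => //; rewrite ger0_norm// in uc.
  have t1 : `|V x h| * (U x h ^+ 2 + V x h ^+ 2) * a <= (U x h ^+ 2 + V x h ^+ 2) * (`|V x h| * (U x h + a)).
    rewrite mulrAC (mulrC _ (_ ^+ 2 + _)) ler_wpM2l ?addr_ge0 ?sqr_ge0// ler_wpM2l//; lra.
  have t2 : (U x h ^+ 2 + V x h ^+ 2) * (`|V x h| * (U x h + a)) <= (2 * c ^+ 2) * (2^-1 * D x h).
    apply: ler_pM => //; first by rewrite addr_ge0// sqr_ge0.
      lra.
    lra.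
  have t3 : 2 * (U x h * `|V x h|) * (a ^+ 2) <= 2 * c ^+ 2 * D x h.
    apply: ler_pM; rewrite ?sqr_ge0 ?mulr_ge0//; [lra|exact: Da].
  have -> : `|V x h| * (U x h ^+ 2 + 2 * a * U x h + V x h ^+ 2) * a =
     `|V x h| * (U x h ^+ 2 + V x h ^+ 2) * a + 2 * (U x h * `|V x h|) * (a ^+ 2) by ring.
  have c2d : 0 <= c ^+ 2 * D x h by rewrite mulr_ge0 ?sqr_ge0// ltW.
  lra.
Qed.

Let mg h : measT (g ^~ h).
Proof. by have := msec h mU; have := msec h mV => m1 m2; rewrite /g /D; meas. Qed.

Lemma weak_contour X : e <= X -> 2 * L <= X ->
  `|\int[mu]_(x in `[(- X), X]) g x e| <= 64 * M ^+ 2 / a / X.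
Proof.
move=> eX LX; have X0 := hpos eX.
have -> : 64 * M ^+ 2 / a / X = 4 * X * (4 * (2 * M / X) ^+ 2 / a).
  by rewrite !expr2; field; rewrite !gt_eqF.
pose c1 := (e ^+ 2)^-1 * M.
apply: (@rectangle_contour R g k kx e X (5 * c1)) => //.
- move=> x h /hpos h0; have [d1 d2 d3 d4] := dUVx x h0; have dn : D x h != 0 by rewrite gt_eqF// D0.
  have dD := derD (derX2 (derD d3 (derC a h))) (derX2 d4).
  have H := derD (derD d3 (derC (- a) h)) (derQuot (derM (derC (a ^+ 2) h) (derD d3 (derC a h))) dD dn).
  apply: (is_derive_eq H); rewrite /kx /D in dn *; field => //.
- move=> x h /hpos h0; have [d1 d2 d3 d4] := dUVx x h0; have dn : D x h != 0 by rewrite gt_eqF// D0.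
  have dD := derD (derX2 (derD d1 (derC a x))) (derX2 d2).
  have H := derD d2 (derN (derQuot (derM (derC (a ^+ 2) x) d2) dD dn)).
  apply: (is_derive_eq H); rewrite /kx /D in dn *; field => //.
- move=> x h /hpos h0; have [d1 d2 d3 d4] := dUVx x h0; have dn : D x h != 0 by rewrite gt_eqF// D0.
  have c3 : {for x, continuous (fun x => Ux x h)} by exact: cx_dpoisI.
  have c4 : {for x, continuous (fun x => Vx x h)} by exact: cx_dconjI.
  have e1 := der_cont d1; have e2 := der_cont d2.
  have dD := der_cont (derD (derX2 (derD d1 (derC a x))) (derX2 d2)).
  have dD2 := der_cont (derX2 (derD (derX2 (derD d1 (derC a x))) (derX2 d2))).
  have e3 := der_cont (derM (derC 2 x) (derD d1 (derC a x))).
  have e4 := der_cont (derM (derC 2 x) d2).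
  apply: cvgB => //; apply: cvgM; last by apply: cvgV => //; rewrite expf_neq0.
  apply: cvgM; first exact: cvg_cst.
  apply: cvgB; first exact: cvgM.
  by apply: cvgM => //; apply: cvgD; apply: cvgM.
- move=> x h /hpos h0; have [d1 d2 d3 d4] := dUVx x h0; have dn : D x h != 0 by rewrite gt_eqF// D0.
  have c3 : {for h, continuous (Ux x)} by exact: ch_dpoisI.
  have c4 : {for h, continuous (Vx x)} by exact: ch_dconjI.
  have e1 := der_cont d3; have e2 := der_cont d4.
  have dD := der_cont (derD (derX2 (derD d3 (derC a h))) (derX2 d4)).
  have dD2 := der_cont (derX2 (derD (derX2 (derD d3 (derC a h))) (derX2 d4))).
  have e3 := der_cont (derM (derC 2 h) (derD d3 (derC a h))).
  have e4 := der_cont (derM (derC 2 h) d4).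
  apply: cvgB => //; apply: cvgM; last by apply: cvgV => //; rewrite expf_neq0.
  apply: cvgM; first exact: cvg_cst.
  apply: cvgB; first exact: cvgM.
  by apply: cvgM => //; apply: cvgD; apply: cvgM.
- by rewrite /kx /D; meas.
- move=> x h eh; have [_ _ b3 b4] := bnd x eh; have h0 := hpos eh; have d0 := D0 x h0.
  rewrite -/c1 in b3 b4.
  have c10 : 0 <= c1 by exact: le_trans b3.
  rewrite /kx; apply: le_trans (ler_normB _ _) _.
  have d20 : 0 < D x h ^+ 2 by rewrite exprn_gt0.
  suff : `|a ^+ 2 * (Vx x h * D x h - V x h * (2 * (U x h + a) * Ux x h + 2 * V x h * Vx x h)) / D x h ^+ 2| <= 4 * c1 by lra.
  rewrite 2!normrM normfV (gtr0_norm d20) ler_pdivrMr// (ger0_norm (sqr_ge0 a)).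
  have n1 : `|Vx x h * D x h - V x h * (2 * (U x h + a) * Ux x h + 2 * V x h * Vx x h)| <= 4 * c1 * D x h.
    apply: le_trans (ler_normB _ _) _; rewrite normrM (gtr0_norm d0) normrM.
    have t1 : `|Vx x h| * D x h <= c1 * D x h by rewrite ler_wpM2r// ltW.
    have v2 : `|V x h| ^+ 2 <= D x h by rewrite real_normK ?num_real// /D lerDr sqr_ge0.
    have ua : 0 <= U x h + a by rewrite addr_ge0 ?U0// ltW.
    have d2 : 2 * `|V x h| * (U x h + a) <= D x h.
      have := sqr_ge0 (`|V x h| - (U x h + a)); rewrite sqrrB /D -mulr_natl real_normK ?num_real//; lra.
    have t2 : `|V x h| * `|2 * (U x h + a) * Ux x h + 2 * V x h * Vx x h| <= 3 * c1 * D x h.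
      apply: (@le_trans _ _ (`|V x h| * (2 * (U x h + a) * c1 + 2 * `|V x h| * c1))).
        rewrite ler_wpM2l// (le_trans (ler_normD _ _))// !normrM (ger0_norm ua) (gtr0_norm (ltr0n R 2)).
        by apply: lerD; apply: ler_wpM2l => //; rewrite mulr_ge0.
      have -> : `|V x h| * (2 * (U x h + a) * c1 + 2 * `|V x h| * c1) =
        c1 * (2 * `|V x h| * (U x h + a) + 2 * `|V x h| ^+ 2) by ring.
      have -> : 3 * c1 * D x h = c1 * (3 * D x h) by ring.
      rewrite ler_wpM2l//; lra.
    lra.
  rewrite [D x h ^+ 2]expr2 mulrA (mulrC (a ^+ 2)); apply: ler_pM => //; first exact: sqr_ge0.
  exact: Da.
- move=> x _; have [t1 t2] := top x X0; exact: (proj1 (gkbound X0 t1 t2)).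
- move=> h /andP[/hpos h0 _]; have [[s1 s2] [s3 s4]] := side X0 LX h0.
  by split; [exact: (proj2 (gkbound h0 s1 s2))|exact: (proj2 (gkbound h0 s3 s4))].
Qed.

(** By [weak_contour] the integral of g is O(1 / X), while a V^2 / D <= U - g, so a V^2 / D has
    integral at most that of U, namely pi M. Where |V| > a, either U > a or this quantity exceeds a
    / 5; Chebyshev gives 5 + 1 = 6. *)
Lemma conjI_weak : (mu [set x | (a < `|conjI f x e|)%R] <= (6 * pi * M / a)%:E)%E.
Proof.
pose F x := a * V x e ^+ 2 / D x e.
have mUe := msec e mU; have mVe := msec e mV.
have mF : measT F by rewrite /F /D; meas.
have F0 x : 0 <= F x.
  by apply: divr_ge0; [rewrite mulr_ge0 ?sqr_ge0// ltW|apply: ltW; exact: D0].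
have IF : (\int[mu]_x (F x)%:E <= (pi * M)%:E)%E.
  apply: (@integral_exhaust_itv R F _ (Num.max e (2 * L)) (64 * M ^+ 2 / a)) => //.
    by rewrite divr_ge0 ?(ltW a0)// mulr_ge0// sqr_ge0.
  move=> X X0; rewrite ge_max => /andP[eX LX].
  have ct := weak_contour eX LX.
  have bU x : `|U x e| <= e^-1 * M by have [] := bnd x (lexx e).
  have bV x : `|V x e| <= e^-1 * M by have [] := bnd x (lexx e).
  have bg x : `|g x e| <= 4 * (e^-1 * M) ^+ 2 / a by have [] := gkbound e0 (bU x) (bV x).
  have iU := integrable_itv (- X) X mUe bU.
  have ig := integrable_itv (- X) X (mg e) bg.
  (* The difference is U (a U + a^2) / D, nonnegative because U is. *)
  have FU x : F x <= U x e - g x e.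
    rewrite gE//; have d0 := D0 x e0; have u0 := U0 x e0.
    rewrite -subr_ge0 (_ : _ - F x = (U x e * (2 * a * U x e + a ^+ 2 - a * U x e)) / D x e); last first.
      by rewrite /F /D; rewrite /D in d0; field; rewrite gt_eqF.
    rewrite divr_ge0 ?(ltW d0)// mulr_ge0//.
    by have := mulr_ge0 (ltW a0) u0; have := sqr_ge0 a; lra.
  apply: (@le_trans _ _ (\int[mu]_(x in `[(- X)%R, X]) (U x e - g x e)%:E)%E).
    by apply: le_int0 => x _; rewrite lee_fin.
  rewrite -EFin_Rintegral_itv; last first.
    have -> : (EFin \o (fun x => U x e - g x e)) = ((EFin \o (fun x => U x e)) \- (EFin \o (fun x => g x e)))%E.
      by apply/funext => x /=; rewrite EFinB.
    exact: integrableB.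
  rewrite RintegralB// EFinB EFin_Rintegral_itv//.
  apply: leeD.
    apply: le_trans (massU e0); rewrite integral_mkcond; apply: le_int0 => x _; rewrite patchE; case: ifPn => // _;
      by rewrite lee_fin U0.
  by rewrite -EFinN lee_fin; move: ct; rewrite ler_norml; lra.
have mnV : measT (fun x => `|V x e|) by meas.
apply: (@le_trans _ _ (mu ([set x | (a / 5 < F x)%R] `|` [set x | (a < U x e)%R]))).
  apply: le_measure; rewrite ?inE.
  - exact: measurable_gt_set.
  - by apply: measurableU; exact: measurable_gt_set.
  (* If U <= a < |V| then D <= 4 a^2 + V^2 < 5 V^2. *)
  move=> x /= aV; case: (ltP a (U x e)) => Ua; [by right|left].
  rewrite /F ltr_pdivlMr ?D0// mulrAC ltr_pdivrMr// -mulrA ltr_pM2l// /D.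
  have u0 := U0 x e0; have v2 : a ^+ 2 < V x e ^+ 2.
    by rewrite -(real_normK (num_real (V x e))) ltrXn2r ?nnegrE ?(ltW a0).
  have : (U x e + a) ^+ 2 <= (2 * a) ^+ 2 by rewrite lerXn2r ?nnegrE ?addr_ge0 ?mulr_ge0 ?(ltW a0)//; lra.
  by rewrite exprMn; lra.
apply: (@le_trans _ _ (mu [set x | (a / 5 < F x)%R] + mu [set x | (a < U x e)%R])%E).
  by apply: measureU2; exact: measurable_gt_set.
have a50 : 0 < a / 5 by rewrite divr_gt0.
have C1 := chebyshev_powR mu mF F0 a50 (@ler01 R).
have C2 := chebyshev_powR mu mUe (fun x => U0 x e0) a0 (@ler01 R).
apply: (@le_trans _ _ ((5 / a * (pi * M))%:E + (a^-1 * (pi * M))%:E)%E); last first.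
  by rewrite -EFinD lee_fin le_eqVlt; apply/orP; left; apply/eqP; field; rewrite gt_eqF.
apply: leeD.
  apply: (le_trans C1); rewrite powRN powRr1 ?(ltW a50)// invf_div [leRHS]EFinM.
  under eq_integral do rewrite powRr1//.
  by apply: lee_wpmul2l => //; rewrite lee_fin divr_ge0// ltW.
apply: (le_trans C2); rewrite powRN powRr1 ?(ltW a0)// [leRHS]EFinM.
under eq_integral do rewrite powRr1 ?U0//.
by apply: lee_wpmul2l; [rewrite lee_fin invr_ge0 ltW|exact: massU].
Qed.

End WeakType.

End ConjugatePoissonBounds.

(** * Lp bounds for the conjugate function *)

Lemma powR_limn_einf (R : realType) (u : nat -> R) (a p : R) : 0 < p -> 0 <= a -> (forall n, 0 <= u n) ->
  u n @[n --> \oo] --> a -> ((a `^ p)%:E <= limn_einf (fun n => (u n `^ p)%:E))%E.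
Proof.
move=> p0 a0 u0 ua; apply/lee_subgt0Pr => e e0.
rewrite -EFinB; apply: limn_einf_ge.
have [c0|c0] := ltP (a `^ p - e) 0.
  by apply: nearW => n; rewrite lee_fin (le_trans (ltW c0))// powR_ge0.
have ca : (a `^ p - e) `^ p^-1 < a.
  have aE : a = (a `^ p) `^ p^-1 by rewrite -powRrM mulfV ?powRr1// gt_eqF.
  by rewrite [ltRHS]aE gt0_ltr_powR ?invr_gt0// ?nnegrE ?powR_ge0//; lra.
have : \forall n \near \oo, (a `^ p - e) `^ p^-1 < u n by exact: (cvgr_gt a ua).
apply: filterS => n /= h.
have cE : a `^ p - e = ((a `^ p - e) `^ p^-1) `^ p by rewrite -powRrM mulVf ?powRr1// gt_eqF.
rewrite lee_fin cE.
by rewrite ge0_ler_powR ?nnegrE ?powR_ge0// ?(ltW h)// ltW.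
Qed.

Lemma Rdominated_cvg d (T : measurableType d) (R : realType) (mu : {measure set T -> \bar R})
  (f_ : nat -> T -> R) (f g : T -> R) :
  (forall n, measT (f_ n)) -> measT f ->
  (forall x, f_ n x @[n --> \oo] --> f x) -> (forall n x, `|f_ n x| <= g x) ->
  mu.-integrable setT (EFin \o g) ->
  \int[mu]_x f_ n x @[n --> \oo] --> \int[mu]_x f x.
Proof.
move=> mf_ mf ff fg ig.
have ff' : {ae mu, forall x, [set: T] x -> (fun n => (f_ n x)%:E) @ \oo --> (f x)%:E}.
  by apply: aeW => x _; apply: cvg_EFin; [exact: nearW|exact: ff].
have fg' : {ae mu, forall x n, [set: T] x -> (`|(f_ n x)%:E| <= (EFin \o g) x)%E}.
  by apply: aeW => x n _ /=; rewrite lee_fin.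
have [i1 _ i3] := @dominated_convergence _ _ _ mu setT measurableT (fun n x => (f_ n x)%:E) (EFin \o f) _
  (fun n => proj2 (measurable_EFinP _ _) (mf_ n)) (proj2 (measurable_EFinP _ _) mf) ff' ig fg'.
apply: fine_cvg; rewrite fineK//.
exact: (integrable_fin_num measurableT i1).
Qed.

Section ConjLp.
Variable R : realType.
Local Notation mu := (leb1 R).

Definition cpt (f : R -> R) (B L : R) : Prop :=
  [/\ measT f, (forall t, `|f t| <= B), 0 < L & forall t, f t != 0 -> `|t| <= L].

Lemma cpt_restrict (f g : R -> R) (B L : R) : cpt f B L -> measT g ->
  (forall t, `|g t| <= `|f t|) -> cpt g B L.
Proof.
move=> [mf fB L0 fL] mg gf; split => //; first by move=> t; exact: le_trans (gf t) (fB t).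
move=> t g0; apply: fL; apply: contra g0 => /eqP f0.
by have := gf t; rewrite f0 normr0 normr_le0.
Qed.

Lemma conj_ker_integrable (f : R -> R) (x e : R) : 0 < e -> measT f ->
  (\int[mu]_t `|f t|%:E < +oo)%E -> mu.-integrable setT (EFin \o (fun t => f t * conj_ker x e t)).
Proof.
move=> e0 mf fi.
apply: integrableP'; first by rewrite /conj_ker; meas.
apply: (@le_lt_trans _ _ (\int[mu]_t ((e^-1)%:E * `|f t|%:E))%E).
  apply: le_int0 => t _ //.
  have [_ kb _ _] := ker_bounds x t e0 (lexx e).
  by rewrite -EFinM lee_fin normrM mulrC ler_wpM2r.
rewrite intZ//; last by rewrite invr_ge0 ltW.
by rewrite lte_mul_pinfty// lee_fin invr_ge0 ltW.
Qed.

Lemma conjI_split (f g h : R -> R) (x e : R) : 0 < e -> measT g -> measT h ->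
  (\int[mu]_t `|g t|%:E < +oo)%E -> (\int[mu]_t `|h t|%:E < +oo)%E ->
  (forall t, f t = g t + h t) -> conjI f x e = conjI g x e + conjI h x e.
Proof.
move=> e0 mg mh gi hi fE; rewrite /conjI -RintegralD//; try exact: conj_ker_integrable.
by congr Rintegral; apply/funext => t; rewrite fE mulrDl.
Qed.

Lemma measurable_conj (f : R -> R) (e : R) : measT f -> measT (fun x => conjI f x e).
Proof.
by move=> mf; apply: (measurableT_comp (measurable_conjI mf) (g := fun x : R => (x, e))); meas.
Qed.

Lemma half_cover (V1 V2 V : R -> R) (a : R) : measT V1 -> measT V2 ->
  measT V -> (forall x, V x = V1 x + V2 x) ->
  (mu [set x | (a < `|V x|)%R] <= mu [set x | (a / 2 < `|V1 x|)%R] + mu [set x | (a / 2 < `|V2 x|)%R])%E.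
Proof.
move=> m1 m2 m VE.
have n1 : measT (fun x => `|V1 x|) by meas.
have n2 : measT (fun x => `|V2 x|) by meas.
have n : measT (fun x => `|V x|) by meas.
apply: (@le_trans _ _ (mu ([set x | (a / 2 < `|V1 x|)%R] `|` [set x | (a / 2 < `|V2 x|)%R]))).
  apply: le_measure; rewrite ?inE.
  - exact: measurable_gt_set.
  - by apply: measurableU; exact: measurable_gt_set.
  - move=> X /=; rewrite VE => aT.
    have := ler_normD (V1 X) (V2 X).
    case: (ltP (a / 2) `|V1 X|) => h1; first by left.
    by case: (ltP (a / 2) `|V2 X|) => h2; [right|lra].
by apply: measureU2; exact: measurable_gt_set.
Qed.

(** Positive and negative parts are treated separately at height a / 2, which doubles the constant 6
    pi. *)
Lemma conjI_weak_signed (f : R -> R) (B L e a : R) : cpt f B L -> 0 < e -> 0 < a ->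
  (mu [set x | (a < `|conjI f x e|)%R] <= (12 * pi / a)%:E * \int[mu]_t `|f t|%:E)%E.
Proof.
move=> cf e0 a0; have [mf fB L0 fL] := cf.
pose fp t := if 0 <= f t then f t else 0.
pose fm t := if 0 <= f t then 0 else - f t.
have mp : measT fp by rewrite /fp; meas.
have mm : measT fm by rewrite /fm; meas.
have p0 t : 0 <= fp t by rewrite /fp; case: ifPn.
have m0 t : 0 <= fm t by rewrite /fm; case: ifPn => //; rewrite -ltNge => /ltW; rewrite oppr_ge0.
have cp : cpt fp B L.
  by apply: (cpt_restrict cf) => // t; rewrite /fp; case: ifPn => // _; rewrite normr0.
have cm : cpt fm B L.
  by apply: (cpt_restrict cf) => // t; rewrite /fm; case: ifPn => // _; rewrite ?normr0 ?normrN.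
have [_ pB _ pL] := cp; have [_ mB _ mL] := cm.
have fip := cpt_supp_fin pB pL; have fim := cpt_supp_fin mB mL.
have fif := cpt_supp_fin fB fL.
pose gm t := - fm t.
have mgm : measT gm by rewrite /gm; meas.
have gim : (\int[mu]_t `|gm t|%:E < +oo)%E by under eq_integral do rewrite /gm normrN.
have sp x : conjI f x e = conjI fp x e + conjI gm x e.
  by apply: conjI_split => // t; rewrite /gm /fp /fm; case: ifPn; rewrite ?oppr0 ?addr0 ?opprK ?add0r.
have gmE x : `|conjI gm x e| = `|conjI fm x e|.
  rewrite /conjI -[RHS]normrN; congr `|_|; rewrite -mulN1r -RintegralZl//; last exact: conj_ker_integrable.
  by congr Rintegral; apply/funext => t; rewrite /gm; ring.
have a20 : 0 < a / 2 by rewrite divr_gt0.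
have W1 := conjI_weak mp pB L0 pL e0 p0 a20.
have W2 := conjI_weak mm mB L0 mL e0 m0 a20.
apply: le_trans (half_cover a (measurable_conj e mp) (measurable_conj e mgm) (measurable_conj e mf) sp) _.
under [X in (_ + mu X <= _)%E]eq_set do rewrite gmE.
apply: (le_trans (leeD W1 W2)).
set Mp := fine _; set Mm := fine _.
have EP : (Mp%:E = \int[mu]_t `|fp t|%:E)%E by rewrite /Mp fineK// ge0_fin_numE// integral_ge0.
have EM : (Mm%:E = \int[mu]_t `|fm t|%:E)%E by rewrite /Mm fineK// ge0_fin_numE// integral_ge0.
have -> : (\int[mu]_t `|f t|%:E = Mp%:E + Mm%:E)%E.
  rewrite EP EM -ge0_integralD//; [|by meas|by meas].
  apply: eq_integral => t _; rewrite -EFinD /fp /fm.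
  by case: ifPn => _; rewrite ?normr0 ?addr0 ?add0r ?normrN.
rewrite -!EFinD -EFinM lee_fin le_eqVlt; apply/orP; left; apply/eqP; field.
by rewrite gt_eqF.
Qed.

(** Interpolation of the weak L1 and the L2 bound, cutting f at the height a itself. Halving the
    level turns 12 pi into 24 pi and adds a factor 4 in L2. *)
Lemma conjI_Lp_lt2 (p : R) : 1 < p -> p < 2 -> exists2 C : R, 0 < C & forall (f : R -> R) (B L e : R),
  cpt f B L -> 0 < e ->
  (\int[mu]_x (`|conjI f x e| `^ p)%:E <= C%:E * \int[mu]_x (`|f x| `^ p)%:E)%E.
Proof.
move=> p1 p2.
have [C2 C20 HC2] := @HLr_strong R 2 (ltac:(lra)).
pose C := p * (24 * pi * 1 `^ (1 - p) / (p - 1) + 4 * (16 ^+ 2 * C2) * 1 `^ (2 - p) / (2 - p)) + 1.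
have C0 : 0 <= p * (24 * pi * 1 `^ (1 - p) / (p - 1) + 4 * (16 ^+ 2 * C2) * 1 `^ (2 - p) / (2 - p)).
  have d1 : 0 <= p - 1 by lra.
  have d2 : 0 <= 2 - p by lra.
  apply: mulr_ge0; first by lra.
  apply: addr_ge0; apply: divr_ge0 => //; apply: mulr_ge0; rewrite ?powR_ge0//.
    by rewrite mulr_ge0 ?pi_ge0.
  by rewrite !mulr_ge0 ?exprn_ge0// ltW.
exists C; first by rewrite ltr_wpDl.
move=> f B L e cf e0; have [mf fB L0 fL] := cf.
have mV : measT (fun x => `|conjI f x e|) by have := measurable_conj e mf; meas.
have mF : measT (fun x => `|f x|) by meas.
have := @marcinkiewicz _ _ _ _ R mu mu (fun x => `|conjI f x e|) (fun x => `|f x|)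
  p 1 2 (24 * pi) (4 * (16 ^+ 2 * C2)) 1 mV mF (fun=> normr_ge0 _) (fun=> normr_ge0 _) p1 p1 p2.
have h1 : 0 <= 24 * pi :> R by rewrite mulr_ge0 ?pi_ge0.
have h2 : 0 <= 4 * (16 ^+ 2 * C2) by rewrite !mulr_ge0 ?exprn_ge0// ltW.
move=> /(_ h1 h2 ltr01) H.
apply: le_trans (H _) _; last first.
  apply: lee_wpmul2r; first by int_ge0.
  by rewrite lee_fin /C lerDl.
move=> a a0; rewrite mul1r.
pose fb t := if a < `|f t| then f t else 0.
pose fs t := if a < `|f t| then 0 else f t.
have mb : measT fb by rewrite /fb; meas.
have ms : measT fs by rewrite /fs; meas.
have cb : cpt fb B L.
  by apply: (cpt_restrict cf) => // t; rewrite /fb; case: ifPn => // _; rewrite normr0.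
have cs : cpt fs B L.
  by apply: (cpt_restrict cf) => // t; rewrite /fs; case: ifPn => // _; rewrite normr0.
have [_ bB _ bL] := cb; have [_ sB _ sL] := cs.
have sp x : conjI f x e = conjI fb x e + conjI fs x e.
  apply: conjI_split => //; [exact: (cpt_supp_fin bB bL)|exact: (cpt_supp_fin sB sL)|].
  by move=> t; rewrite /fb /fs; case: ifPn; rewrite ?addr0 ?add0r.
have a20 : 0 < a / 2 by rewrite divr_gt0.
apply: le_trans (half_cover a (measurable_conj e mb) (measurable_conj e ms) (measurable_conj e mf) sp) _.
apply: leeD.
  apply: (le_trans (conjI_weak_signed cb e0 a20)).
  rewrite powRN powRr1 ?(ltW a0)// (_ : 12 * pi / (a / 2) = 24 * pi / a); last by field; rewrite gt_eqF.
  apply: lee_wpmul2l; first by rewrite lee_fin divr_ge0// ltW.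
  apply: le_int0 => t _ //; rewrite /fb lee_fin; case: ifPn => _; last by rewrite normr0.
  by rewrite powRr1.
have mVs : measT (fun x => `|conjI fs x e|) by have := measurable_conj e ms; meas.
apply: (le_trans (chebyshev_powR mu mVs (fun=> normr_ge0 _) a20 (ler0n R 2))).
have L2 := conjI_L2 ms sB L0 sL e0 (ltW C20) HC2.
apply: (@le_trans _ _ (((a / 2) `^ (- 2))%:E * ((16 ^+ 2 * C2)%:E * \int[mu]_x (`|fs x| `^ 2)%:E))%E).
  by apply: lee_wpmul2l => //; rewrite lee_fin powR_ge0.
rewrite muleA -EFinM.
have -> : (a / 2) `^ (- 2) * (16 ^+ 2 * C2) = 4 * (16 ^+ 2 * C2) * a `^ (- 2).
  have h4 : 2^-1 `^ (- 2) = 4 :> R by rewrite powRN powR_mulrn ?invr_ge0// exprVn invrK; ring.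
  by rewrite powRM ?invr_ge0 ?(ltW a0)// h4; ring.
apply: lee_wpmul2l; first by rewrite lee_fin mulr_ge0 ?powR_ge0.
apply: le_int0 => X _; first by rewrite lee_fin powR_ge0.
by rewrite /fs lee_fin (leNgt `|f X|); case: ifPn => //= _; rewrite normr0 powR0.
Qed.

Lemma conjI_antisym (f w : R -> R) (B L e Bw Lw : R) : cpt f B L -> cpt w Bw Lw -> 0 < e ->
  \int[mu]_x (w x * conjI f x e) = - \int[mu]_t (f t * conjI w t e).
Proof.
move=> [mf fB _ fL] [mw wB _ wL] e0.
have fi := cpt_supp_fin fB fL; have wi := cpt_supp_fin wB wL.
pose F x t := w x * (f t * conj_ker x e t).
have mF : measT (fun z : R * R => F z.1 z.2).
  rewrite /F /conj_ker; have m1 := measurableT_comp mw (@measurable_fst _ _ R R).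
  have m2 := measurableT_comp mf (@measurable_snd _ _ R R).
  by apply: measurable_funM => //; apply: measurable_funM => //; meas.
have kb x t : `|conj_ker x e t| <= e^-1 by have [] := ker_bounds x t e0 (lexx e).
have fin : (\int[mu]_x \int[mu]_t `|F x t|%:E < +oo)%E.
  apply: (@le_lt_trans _ _ (\int[mu]_x (`|w x|%:E * ((e^-1)%:E * \int[mu]_t `|f t|%:E)))%E).
    apply: le_int0 => x _; first exact: integral_ge0.
    rewrite muleA -EFinM -intZ//; last by rewrite mulr_ge0 ?invr_ge0// ltW.
    apply: le_int0 => t _ //; rewrite -EFinM lee_fin normrM (normrM (f t)) -mulrA ler_wpM2l//.
    by rewrite mulrC ler_wpM2r.
  rewrite ge0_integralZr//; last 2 first.
  - by meas.
  - by rewrite mule_ge0 ?lee_fin ?invr_ge0 ?(ltW e0)// integral_ge0.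
  rewrite lte_mul_pinfty ?integral_ge0// ?ge0_fin_numE ?integral_ge0//.
  by rewrite lte_mul_pinfty// lee_fin invr_ge0 ltW.
have -> : \int[mu]_x (w x * conjI f x e) = \int[mu]_x \int[mu]_t F x t.
  by congr Rintegral; apply/funext => x; rewrite /conjI -RintegralZl//; exact: conj_ker_integrable.
rewrite (@RFubini _ _ _ _ _ mu mu F mF fin) -mulN1r -RintegralZl//; last first.
  have mc := measurable_conj e mw.
  apply: integrableP'; first exact: measurable_funM.
  pose Mw := fine (\int[mu]_x `|w x|%:E)%E.
  have cb t : `|conjI w t e| <= e^-1 * Mw.
    by apply: (integral_kernel_bound mw wi) => //; rewrite /conj_ker; meas.
  have M0 : 0 <= e^-1 * Mw by exact: le_trans (cb 0).
  apply: (@le_lt_trans _ _ (\int[mu]_t ((e^-1 * Mw)%:E * `|f t|%:E))%E).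
    by apply: le_int0 => t _ //; rewrite -EFinM lee_fin normrM mulrC ler_wpM2r.
  rewrite intZ//.
  by rewrite lte_mul_pinfty.
congr Rintegral; apply/funext => t.
rewrite /F /conjI -RintegralZl//; last exact: conj_ker_integrable.
rewrite -RintegralZl//; last first.
  have := conj_ker_integrable t e0 mw wi => /(integrableZl measurableT (f t)).
  by congr (_.-integrable _ _); apply/funext => x /=; rewrite EFinM.
congr Rintegral; apply/funext => x; rewrite /conj_ker.
have -> : (t - x) ^+ 2 = (x - t) ^+ 2 by ring.
ring.
Qed.

(** Duality with q = p / (p - 1) < 2. The conjugate kernel is odd, hence antisymmetric, so testing V
    against w = sgn(V) |V|^(p - 1) on a bounded interval moves the operator onto w. Young's
    inequality leaves half of the finite quantity I on the right, which is absorbed. *)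
Lemma conjI_Lp_gt2 (p : R) : 2 < p -> exists2 C : R, 0 < C & forall (f : R -> R) (B L e : R),
  cpt f B L -> 0 < e ->
  (\int[mu]_x (`|conjI f x e| `^ p)%:E <= C%:E * \int[mu]_x (`|f x| `^ p)%:E)%E.
Proof.
move=> p2; pose q := p / (p - 1).
have p10 : 0 < p - 1 by lra.
have p0 : 0 < p by lra.
have q1 : 1 < q by rewrite /q ltr_pdivlMr//; lra.
have q2 : q < 2 by rewrite /q ltr_pdivrMr//; lra.
have q0 : 0 < q by lra.
have pq : p^-1 + q^-1 = 1 by rewrite /q invf_div; field; rewrite gt_eqF.
have [Cq Cq0 HCq] := conjI_Lp_lt2 q1 q2.
(* The weight in Young's inequality is chosen so that Cq / l^q = 1/2. *)
pose l := (2 * Cq) `^ (q^-1).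
have l0 : 0 < l by apply: powR_gt0; exact: mulr_gt0.
have lq : l `^ q = 2 * Cq.
  by rewrite /l -powRrM mulVf ?gt_eqF// powRr1// mulr_ge0// ltW.
exists (2 * l `^ p); first by rewrite mulr_gt0// powR_gt0.
move=> f B L e cf e0; have [mf fB L0 fL] := cf.
have fi := cpt_supp_fin fB fL.
have mV := measurable_conj e mf.
pose Mf := fine (\int[mu]_x `|f x|%:E)%E.
pose K := e^-1 * Mf.
have VK x : `|conjI f x e| <= K.
  have kb t : `|conj_ker x e t| <= e^-1 by have [] := ker_bounds x t e0 (lexx e).
  by apply: (integral_kernel_bound mf fi) => //; rewrite /conj_ker; meas.
have K0 : 0 <= K by exact: le_trans (VK 0).
have finF : (\int[mu]_x (`|f x| `^ p)%:E < +oo)%E.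
  have cfp : cpt (fun x => `|f x| `^ p) (B `^ p) L.
    split => //; first by meas.
    - by move=> t; rewrite ger0_norm ?powR_ge0// ge0_ler_powR// ?nnegrE ?(ltW p0)// (le_trans _ (fB t)).
    - by move=> t h; apply: fL; apply: contra h => /eqP ->; rewrite normr0 powR0// gt_eqF.
  have [_ b1 _ b2] := cfp; have := cpt_supp_fin b1 b2.
  by under eq_integral do rewrite ger0_norm ?powR_ge0//.
have F0 : (0 <= \int[mu]_x (`|f x| `^ p)%:E)%E by int_ge0.
pose Ff := fine (\int[mu]_x (`|f x| `^ p)%:E)%E.
have FE : (Ff%:E = \int[mu]_x (`|f x| `^ p)%:E)%E by rewrite fineK// ge0_fin_numE.
rewrite -FE -EFinM.
apply: (@fatou_near _ _ R mu (fun n x => (if `|x| <= n.+1%:R then `|conjI f x e| `^ p else 0)%:E)) => //.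
- by move=> n; meas.
- by move=> n x; rewrite lee_fin; case: ifPn => // _; rewrite powR_ge0.
- move=> n.
  pose w x := if `|x| <= n.+1%:R then Num.sg (conjI f x e) * `|conjI f x e| `^ (p - 1) else 0.
  have sgE (v : R) : Num.sg v * `|v| `^ (p - 1) = if 0 < v then `|v| `^ (p - 1) else - (`|v| `^ (p - 1)).
    have [v0|v0|->] := ltgtP v 0; first by rewrite ltr0_sg// mulN1r.
      by rewrite gtr0_sg// mul1r.
    by rewrite normr0 powR0 ?gt_eqF// mulr0 oppr0.
  have mw : measT w.
    rewrite (_ : w = fun x => if `|x| <= n.+1%:R then if 0 < conjI f x e then `|conjI f x e| `^ (p - 1) else - (`|conjI f x e| `^ (p - 1)) else 0); first by meas.
    by apply/funext => x; rewrite /w sgE.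
  have wn x : `|w x| = if `|x| <= n.+1%:R then `|conjI f x e| `^ (p - 1) else 0.
    rewrite /w; case: ifPn => _; last by rewrite normr0.
    by rewrite sgE; case: ifPn => _; rewrite ?normrN (ger0_norm (powR_ge0 _ _)).
  have cw : cpt w (K `^ (p - 1)) n.+1%:R.
    split => // x.
      rewrite wn; case: ifPn => _; last exact: powR_ge0.
      by rewrite ge0_ler_powR// ?nnegrE// ltW.
    by rewrite /w; case: ifPn => //; rewrite eqxx.
  have [_ wB _ wL] := cw.
  pose I := \int[mu]_x (w x * conjI f x e).
  have wV x : w x * conjI f x e = if `|x| <= n.+1%:R then `|conjI f x e| `^ p else 0.
    rewrite /w; case: ifPn => _; last by rewrite mul0r.
    rewrite mulrAC -normrEsg mulrC -[X in _ * X](powRr1 (normr_ge0 _)) -powRD ?subrK//.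
    by rewrite gt_eqF.
  have iw : mu.-integrable setT (EFin \o (fun x => if `|x| <= n.+1%:R then `|conjI f x e| `^ p else 0)).
    apply: integrableP'; first by meas.
    apply: (@cpt_supp_fin R _ (K `^ p) n.+1%:R).
      move=> x; case: ifPn => _; last by rewrite normr0 powR_ge0.
      by rewrite (ger0_norm (powR_ge0 _ _)) ge0_ler_powR// ?nnegrE// ltW.
    by move=> x; case: ifPn => //; rewrite eqxx.
  have IE : (I%:E = \int[mu]_x (if `|x| <= n.+1%:R then `|conjI f x e| `^ p else 0)%:E)%E.
    by rewrite /I; under eq_Rintegral do rewrite wV; rewrite EFin_Rintegral.
  rewrite -IE lee_fin.
  have I0 : 0 <= I by rewrite -lee_fin IE integral_ge0// => x _; rewrite lee_fin; case: ifPn => // _; exact: powR_ge0.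
  have wq : (\int[mu]_x (`|w x| `^ q)%:E = I%:E)%E.
    rewrite IE; apply: eq_integral => x _; rewrite wn; case: ifPn => _; last by rewrite powR0// gt_eqF.
    by rewrite -powRrM; congr (_ `^ _)%:E; rewrite /q mulrC divfK// gt_eqF.
  have := HCq w _ _ e cw e0; rewrite wq => HW.
  have mVw := measurable_conj e mw.
  have mfV : measT (fun t => f t * conjI w t e) by exact: measurable_funM.
  have : (I%:E <= (l `^ p)%:E * Ff%:E + ((l `^ q)^-1)%:E * (Cq%:E * I%:E))%E.
    apply: (@le_trans _ _ (\int[mu]_t `|f t * conjI w t e|%:E)%E).
      apply: (@le_trans _ _ `|I|%:E); first by rewrite lee_fin ler_norm.
      rewrite /I (conjI_antisym cf cw e0) normrN.
      exact: (le_norm_Rintegral mu measurableT mfV).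
    apply: (@le_trans _ _ (\int[mu]_t ((l `^ p)%:E * (`|f t| `^ p)%:E + ((l `^ q)^-1)%:E * (`|conjI w t e| `^ q)%:E))%E).
      apply: le_int0 => t _ //; rewrite -!EFinM -EFinD lee_fin normrM.
      have := @conjugate_powR R (l * `|f t|) (l^-1 * `|conjI w t e|) p q.
      rewrite !mulr_ge0 ?invr_ge0 ?(ltW l0)// => /(_ isT isT p0 q0 pq).
      rewrite mulrACA divff ?gt_eqF// mul1r => /le_trans -> //.
      have lV : l^-1 `^ q = (l `^ q)^-1 by rewrite -powR_inv1 ?(ltW l0)// -powRrM mulN1r powRN.
      rewrite !powRM ?invr_ge0 ?(ltW l0)// lV.
      have e1 : l `^ p * `|f t| `^ p / p <= l `^ p * `|f t| `^ p.
        by rewrite ler_pdivrMr// ler_peMr ?mulr_ge0 ?powR_ge0//; lra.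
      have e2 : (l `^ q)^-1 * `|conjI w t e| `^ q / q <= (l `^ q)^-1 * `|conjI w t e| `^ q.
        by rewrite ler_pdivrMr// ler_peMr ?mulr_ge0 ?invr_ge0 ?powR_ge0//; lra.
      exact: lerD.
    rewrite ge0_integralD//; last 4 first.
    - by move=> t _; rewrite mule_ge0 ?lee_fin ?powR_ge0.
    - by meas.
    - by move=> t _; rewrite mule_ge0 ?lee_fin ?invr_ge0 ?powR_ge0.
    - by meas.
    rewrite !intZ ?powR_ge0 ?invr_ge0 ?powR_ge0//.
    by rewrite FE; apply: leeD => //; apply: lee_wpmul2l => //; rewrite lee_fin invr_ge0 powR_ge0.
  rewrite -!EFinM -EFinD lee_fin lq invfM mulrA -(mulrA 2^-1) mulVf ?gt_eqF// mulr1; lra.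
move=> x; near=> n; rewrite ifT//.
apply: (@le_trans _ _ n%:R); last by rewrite ler_nat.
by near: n; exact: nbhs_infty_ger.
Unshelve. all: by end_near. Qed.

Lemma conjI_Lp_cpt (p : R) : 1 < p -> exists2 C : R, 0 < C & forall (f : R -> R) (B L e : R),
  cpt f B L -> 0 < e ->
  (\int[mu]_x (`|conjI f x e| `^ p)%:E <= C%:E * \int[mu]_x (`|f x| `^ p)%:E)%E.
Proof.
move=> p1; have [p2|p2|->] := ltgtP p 2; [exact: conjI_Lp_lt2|exact: conjI_Lp_gt2|].
have [C2 C20 HC2] := @HLr_strong R 2 (ltac:(lra)).
exists (16 ^+ 2 * C2); first by rewrite mulr_gt0// exprn_gt0.
by move=> f B L e [mf fB L0 fL] e0; exact: (conjI_L2 mf fB L0 fL e0 (ltW C20) HC2).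
Qed.

(** Bounded support is removed by cutting to |t| <= n + 1: dominated convergence at each x, then
    Fatou. *)
Lemma conjI_Lp (p : R) : 1 < p -> exists2 C : R, 0 < C & forall (f : R -> R) (B e : R),
  measT f -> (forall t, `|f t| <= B) -> (\int[mu]_t `|f t|%:E < +oo)%E -> 0 < e ->
  (\int[mu]_x (`|conjI f x e| `^ p)%:E <= C%:E * \int[mu]_x (`|f x| `^ p)%:E)%E.
Proof.
move=> p1; have [C C0 HC] := conjI_Lp_cpt p1.
have p0 : 0 < p by lra.
exists C => // f B e mf fB fi e0.
pose fn n t := if `|t| <= n.+1%:R then f t else 0.
have mfn n : measT (fn n) by rewrite /fn; meas.
have cfn n : cpt (fn n) B n.+1%:R.
  split => // t; rewrite /fn; case: ifPn => //; last by rewrite eqxx.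
  by move=> _; rewrite normr0; exact: le_trans (fB 0).
have mV n := measurable_conj e (mfn n).
apply: (@fatou_le _ _ R mu (fun n x => (`|conjI (fn n) x e| `^ p)%:E)).
- by move=> n; have := mV n; meas.
- by move=> n x; rewrite lee_fin powR_ge0.
- move=> n; apply: (le_trans (HC _ _ _ _ (cfn n) e0)).
  apply: lee_wpmul2l; first by rewrite lee_fin ltW.
  apply: le_int0 => t _; first by rewrite lee_fin powR_ge0.
  by rewrite lee_fin /fn; case: ifPn => // _; rewrite normr0 powR0 ?powR_ge0// gt_eqF.
- by move=> x; rewrite lee_fin powR_ge0.
move=> x; apply: (@powR_limn_einf R (fun n => `|conjI (fn n) x e|)) => //.
apply: cvg_norm.
apply: (@Rdominated_cvg _ _ R mu (fun n t => fn n t * conj_ker x e t) _ (fun t => `|f t * conj_ker x e t|)).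
- move=> n; apply: (measurable_funM (mfn n)); rewrite /conj_ker; by meas.
- apply: (measurable_funM mf); rewrite /conj_ker; by meas.
- move=> t; apply: cvg_near_cst; near=> n; rewrite /fn ifT//.
  apply: (@le_trans _ _ n%:R); last by rewrite ler_nat.
  by near: n; exact: nbhs_infty_ger.
- by move=> n t; rewrite /fn; case: ifPn => // _; rewrite mul0r normr0.
- have := conj_ker_integrable x e0 mf fi => /integrable_abse.
  by apply: eq_integrable => // t _.
Unshelve. all: by end_near. Qed.

End ConjLp.

(** * Truncated Hilbert transforms and Cotlar's inequality *)

Lemma powR_addr_le (R : realType) (a b p : R) : 0 <= a -> 0 <= b -> 0 <= p ->
  (a + b) `^ p <= 2 `^ p * (a `^ p + b `^ p).
Proof.
move=> a0 b0 p0.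
have h (c d : R) : 0 <= c -> c <= d -> (c + d) `^ p <= 2 `^ p * (c `^ p + d `^ p).
  move=> c0 cd; have d0 : 0 <= d by exact: le_trans cd.
  apply: (@le_trans _ _ (2 `^ p * d `^ p)).
    by rewrite -powRM// ge0_ler_powR// ?nnegrE ?addr_ge0 ?mulr_ge0//; lra.
  by rewrite ler_wpM2l ?powR_ge0// lerDr powR_ge0.
have [ab|ba] := leP a b; first exact: h.
by rewrite addrC [X in _ * X]addrC; apply: h => //; exact: ltW.
Qed.

Lemma integral_powR_addr_le d (T : measurableType d) (R : realType) (nu : {measure set T -> \bar R})
    (p a b : R) (F G H : T -> R) :
  0 <= p -> 0 <= a -> 0 <= b -> measT G -> measT H ->
  (forall x, 0 <= G x) -> (forall x, 0 <= H x) -> (forall x, `|F x| <= a * G x + b * H x) ->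
  (\int[nu]_x (`|F x| `^ p)%:E <= (2 `^ p * a `^ p)%:E * \int[nu]_x (G x `^ p)%:E
                                + (2 `^ p * b `^ p)%:E * \int[nu]_x (H x `^ p)%:E)%E.
Proof.
move=> p0 a0 b0 mG mH G0 H0 FGH.
have mp (f : T -> R) : measT f -> measT (fun x => (f x `^ p)%:E).
  by move=> mf; apply/measurable_EFinP; apply: (measurableT_comp (f := @powR R ^~ p)) => //; exact: measurable_powR.
have n (c : R) : 0 <= 2 `^ p * c `^ p by rewrite mulr_ge0// powR_ge0.
rewrite -!intZ//.
rewrite -ge0_integralD//; last 4 first.
- by move=> x _; rewrite mule_ge0 ?lee_fin ?powR_ge0.
- by apply: measurable_funeM; exact: mp.
- by move=> x _; rewrite mule_ge0 ?lee_fin ?powR_ge0.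
- by apply: measurable_funeM; exact: mp.
apply: le_int0 => x _; first by rewrite lee_fin powR_ge0.
rewrite -!EFinM -EFinD lee_fin -!mulrA -mulrDr -!powRM//.
apply: le_trans (powR_addr_le _ _ p0); rewrite ?mulr_ge0//.
by rewrite ge0_ler_powR ?nnegrE ?addr_ge0 ?mulr_ge0.
Qed.

Section Truncation.
Variable R : realType.
Local Notation mu := (leb1 R).

Let q (e t : R) : R := t / (t ^+ 2 + e ^+ 2).

Let qden (e t : R) : 0 < e -> 0 < t ^+ 2 + e ^+ 2.
Proof. by move=> e0; rewrite ltr_wpDl ?sqr_ge0// exprn_gt0. Qed.

Let q_mul (e t : R) : 0 < e -> `|t| * `|q e t| <= 1.
Proof.
move=> e0; have d0 := qden t e0.
rewrite -normrM /q mulrA normrM normfV (gtr0_norm d0) ler_pdivrMr// mul1r -expr2.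
by rewrite ger0_norm ?sqr_ge0// lerDl sqr_ge0.
Qed.

Let qN (e t : R) : q e (- t) = - q e t.
Proof. by rewrite /q sqrrN mulNr. Qed.

Let q_bound (e t : R) : 0 < e -> `|q e t| <= e^-1.
Proof.
by move=> e0; have [_ + _ _] := ker_bounds t 0 e0 (lexx e); rewrite /conj_ker subr0.
Qed.

Let mq e : measT (q e).
Proof. by rewrite /q; meas. Qed.

(** Away from the origin, moving t by less than r and changing the height from e to r changes t /
    (t^2 + e^2) by no more than a multiple of the Poisson kernel of height r. *)
Let q_far (e r t s : R) : 0 < e -> e <= r -> 2 * r <= `|t| -> `|s| < r ->
  `|q e (t - s) - q r t| <= 11 * (r / (t ^+ 2 + r ^+ 2)).
Proof.
move=> e0 er tr sr; have r0 : 0 < r by exact: lt_le_trans er.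
have t0 : 0 < `|t| by lra.
set u := t - s.
have ut : `|t| <= 2 * `|u| by have := ler_normD u s; rewrite /u subrK; lra.
have ut2 : 2 * `|u| <= 3 * `|t| by have := ler_normB t s; rewrite -/u; lra.
have du := qden u e0; have dt := qden t r0.
have -> : q e u - q r t = (u * t * s + u * r ^+ 2 - t * e ^+ 2) / (u ^+ 2 + e ^+ 2) / (t ^+ 2 + r ^+ 2).
  have -> : s = t - u by rewrite /u; ring.
  by rewrite /q; field; rewrite !gt_eqF.
rewrite !normrM !normfV (gtr0_norm du) (gtr0_norm dt) mulrA ler_wpM2r ?invr_ge0 ?(ltW dt)//.
rewrite ler_pdivrMr//.
have t2 : `|t| ^+ 2 <= 4 * (u ^+ 2 + e ^+ 2).
  have : `|t| ^+ 2 <= (2 * `|u|) ^+ 2 by rewrite lerXn2r ?nnegrE ?mulr_ge0.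
  by rewrite exprMn (real_normK (num_real u)); have := sqr_ge0 e; lra.
have e2 : e ^+ 2 <= r ^+ 2 by rewrite lerXn2r ?nnegrE ?(ltW e0) ?(ltW r0).
apply: le_trans (ler_normB _ _) _.
apply: (@le_trans _ _ (`|u| * `|t| * r + `|u| * r ^+ 2 + `|t| * r ^+ 2)).
  apply: lerD; last by rewrite normrM ler_wpM2l// ger0_norm ?sqr_ge0.
  apply: le_trans (ler_normD _ _) _; apply: lerD.
    by rewrite !normrM ler_wpM2l ?mulr_ge0// ltW.
  by rewrite normrM (ger0_norm (sqr_ge0 r)).
have a1 : `|u| * `|t| * r <= 3 / 2 * `|t| * `|t| * r.
  by rewrite ler_wpM2r ?(ltW r0)// ler_wpM2r//; lra.
have a2 : `|u| * r ^+ 2 <= 3 / 2 * `|t| * (2^-1 * `|t| * r).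
  apply: ler_pM => //; rewrite ?sqr_ge0//; [lra|].
  by rewrite expr2 ler_wpM2r ?(ltW r0)//; lra.
have a3 : `|t| * r ^+ 2 <= `|t| * (2^-1 * `|t| * r).
  by rewrite ler_wpM2l// expr2 ler_wpM2r ?(ltW r0)//; lra.
have a4 : r * `|t| ^+ 2 <= r * (4 * (u ^+ 2 + e ^+ 2)) by rewrite ler_wpM2l// ltW.
move: a1 a2 a3 a4; rewrite (_ : 3 / 2 * `|t| * `|t| * r = 3 / 2 * (r * `|t| ^+ 2)); last by ring.
rewrite (_ : 3 / 2 * `|t| * (2^-1 * `|t| * r) = 3 / 4 * (r * `|t| ^+ 2)); last by field.
rewrite (_ : `|t| * (2^-1 * `|t| * r) = 2^-1 * (r * `|t| ^+ 2)); last by ring.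
rewrite (_ : r * (4 * (u ^+ 2 + e ^+ 2)) = 4 * (r * (u ^+ 2 + e ^+ 2))); last by ring.
move: (r * (u ^+ 2 + e ^+ 2)) (r * `|t| ^+ 2) (mulrA 11 r (u ^+ 2 + e ^+ 2)) => v w <-; lra.
Qed.

(** A Lipschitz averaging weight: the Lipschitz bound pays for the singularity of the conjugate
    kernel at 0, uniformly in the height e. *)
Definition tent (r s : R) : R := if `|s| < r then 1 - `|s| / r else 0.

Lemma measurable_tent r : measT (tent r).
Proof. by rewrite /tent; meas. Qed.

Lemma tent_bounds r s : 0 < r -> 0 <= tent r s <= (if `|s| < r then 1 else 0).
Proof.
move=> r0; rewrite /tent; case: ifPn => sr; rewrite ?lexx//.
have h1 : `|s| / r < 1 by rewrite ltr_pdivrMr// mul1r.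
have h2 : 0 <= `|s| / r by rewrite divr_ge0// ltW.
by apply/andP; split; lra.
Qed.

Lemma tent_lip r a b : 0 < r -> `|tent r a - tent r b| <= `|a - b| / r.
Proof.
move=> r0.
have t1 s : tent r s = Num.max 0 (1 - `|s| / r).
  rewrite /tent; have [sr|sr] := ltP `|s| r.
    by rewrite max_r// subr_ge0 ler_pdivrMr// mul1r ltW.
  by rewrite max_l// subr_le0 ler_pdivlMr// mul1r.
have t2 (c d : R) : `|Num.max 0 c - Num.max 0 d| <= `|c - d|.
  have [c0|c0] := leP 0 c; have [d0|d0] := leP 0 d; rewrite ?subrr ?subr0 ?normr0//.
  - by rewrite !ger0_norm ?subr_ge0//; lra.
  - by rewrite sub0r normrN (ger0_norm d0) distrC ger0_norm; lra.
rewrite !t1; apply: le_trans (t2 _ _) _.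
rewrite (_ : _ - _ = (`|b| - `|a|) / r); last by ring.
rewrite normrM normfV (gtr0_norm r0) ler_wpM2r ?invr_ge0 ?(ltW r0)//.
by rewrite distrC; exact: ler_dist_dist.
Qed.

Lemma indic_mass (c : R) : 0 <= c -> (\int[mu]_s (if `|s| < c then 1 else 0)%:E = (2 * c)%:E)%E.
Proof.
move=> c0.
have -> : (\int[mu]_s (if `|s| < c then 1 else 0)%:E = \int[mu]_(s in `](- c)%R, c[) cst 1%E s)%E.
  rewrite [RHS]integral_mkcond; apply: eq_integral => s _.
  by rewrite patchE mem_setE in_itv/= -ltr_norml; case: ifPn.
rewrite integral_cst//= mul1e lebesgue_measure_itv/= lte_fin; case: ifPn => h.
  by rewrite -EFinD; congr EFin; ring.
have -> : c = 0 by move: h; rewrite -leNgt => h; lra.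
by rewrite mulr0.
Qed.

Lemma tent_integrable r : 0 < r -> mu.-integrable setT (EFin \o tent r).
Proof.
move=> r0; apply: integrableP'; first exact: measurable_tent.
apply: (@le_lt_trans _ _ (\int[mu]_s (if `|s| < r then 1 else 0)%:E)%E).
  apply: le_int0 => s _ //; rewrite lee_fin.
  by have /andP[t0 t1] := tent_bounds s r0; rewrite ger0_norm.
by rewrite indic_mass ?ltry// ltW.
Qed.

Let m r := \int[mu]_s tent r s.

Let mE r : 0 < r -> ((m r)%:E = \int[mu]_s (tent r s)%:E)%E.
Proof. by move=> r0; rewrite /m EFin_Rintegral//; exact: tent_integrable. Qed.

Let m_lb r : 0 < r -> r / 2 <= m r.
Proof.
move=> r0; rewrite -lee_fin mE//.
apply: (@le_trans _ _ (\int[mu]_s (2^-1%:E * (if `|s| < r / 2 then 1 else 0)%:E))%E).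
  rewrite intZ//.
  by rewrite indic_mass ?divr_ge0 ?(ltW r0)// -EFinM lee_fin; lra.
apply: le_int0 => s _.
  by rewrite -EFinM lee_fin; case: ifPn; rewrite ?mulr1 ?mulr0.
rewrite -EFinM lee_fin; case: ifPn => [sr|_]; last by rewrite mulr0; have /andP[] := tent_bounds s r0.
rewrite /tent ifT; last by lra.
have : `|s| / r <= 2^-1 by rewrite ler_pdivrMr//; lra.
by rewrite mulr1; lra.
Qed.

Let m_gt0 r : 0 < r -> 0 < m r.
Proof. by move=> r0; apply: lt_le_trans (m_lb r0); rewrite divr_gt0. Qed.

Let tq_integrable e r t : 0 < e -> 0 < r -> mu.-integrable setT (EFin \o (fun s => tent r s * q e (t - s))).
Proof.
move=> e0 r0; have mt := measurable_tent r.
have mqs : measT (fun s : R => q e (t - s)) by apply: (measurableT_comp (mq e)); meas.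
apply: integrableP'; first exact: measurable_funM.
apply: (@le_lt_trans _ _ (\int[mu]_s ((e^-1)%:E * (if `|s| < r then 1 else 0)%:E))%E).
  apply: le_int0 => s _ //; rewrite -EFinM lee_fin normrM mulrC.
  have /andP[t0 t1] := tent_bounds s r0; rewrite (ger0_norm t0).
  by apply: ler_pM => //; exact: q_bound.
rewrite intZ ?invr_ge0 ?(ltW e0)//.
by rewrite indic_mass ?(ltW r0)// -EFinM ltry.
Qed.

(** As q_e is odd, twice the integral is that of (tent(t - s) - tent(t + s)) q_e(s), where the
    Lipschitz bound 2 |s| / r cancels |q_e(s)| <= 1 / |s|. The support |s| < 3 r gives 12 in all,
    independently of e. *)
Let tent_conv_near e r t : 0 < e -> 0 < r -> `|t| < 2 * r ->
  `|\int[mu]_s (tent r s * q e (t - s))| <= 6.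
Proof.
move=> e0 r0 tr; have mt := measurable_tent r; have mqe := mq e.
set I := \int[mu]_s _.
pose G c s := tent r (t + c * s) * q e s.
have mG c : measT (G c).
  by apply: measurable_funM => //; apply: (measurableT_comp mt); meas.
have I1 : I = \int[mu]_s G (-1) s.
  have := @Rintegral_affine R (-1) t (fun s => tent r s * q e (t - s)).
  rewrite oppr_eq0 oner_eq0 normrN1 invr1 mul1r -/I => /(_ isT) <-; last first.
    by apply: (measurable_funM mt); apply: (measurableT_comp mqe); meas.
  congr Rintegral; apply/funext => s; rewrite /G; congr (tent _ _ * q _ _); ring.
have I2 : I = \int[mu]_s (- G 1 s).
  have := @Rintegral_affine R (-1) 0 (G (-1)) _ (mG (-1)).
  rewrite oppr_eq0 oner_eq0 normrN1 invr1 mul1r I1 => /(_ isT) <-.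
  by congr Rintegral; apply/funext => s; rewrite /G mul1r addr0 !mulN1r opprK qN mulrN.
have iG c : `|c| = 1 -> mu.-integrable setT (EFin \o G c).
  move=> c1; apply: integrableP'; first exact: mG.
  apply: (@le_lt_trans _ _ (\int[mu]_s ((e^-1)%:E * (if `|s| < 3 * r then 1 else 0)%:E))%E).
    apply: le_int0 => s _ //; rewrite -EFinM lee_fin normrM mulrC.
    apply: ler_pM => //; first exact: q_bound.
    have /andP[t0 t1] := tent_bounds (t + c * s) r0; rewrite (ger0_norm t0).
    apply: le_trans t1 _; case: ifPn => [tcs|_]; last by case: ifPn.
    rewrite ifT//; have := ler_normB (t + c * s) t.
    by rewrite addrAC subrr add0r normrM c1 mul1r; lra.
  rewrite intZ ?invr_ge0 ?(ltW e0)//.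
  by rewrite indic_mass ?mulr_ge0 ?(ltW r0)// -EFinM ltry.
have iN : mu.-integrable setT (EFin \o (fun s => - G 1 s)).
  have := integrableN (iG 1 (normr1 _)).
  by apply: eq_integrable => // s _ /=; rewrite EFinN.
have i1 := iG (-1) (normrN1 _).
have E : I + I = \int[mu]_s (G (-1) s + - G 1 s).
  by rewrite RintegralD// -I1 -I2.
have bE s : `|G (-1) s + - G 1 s| <= 2 / r * (if `|s| < 3 * r then 1 else 0).
  rewrite /G -mulrBl normrM mul1r mulN1r.
  case: ifPn => [_|s3].
    rewrite mulr1; apply: (@le_trans _ _ (2 * `|s| / r * `|q e s|)).
      rewrite ler_wpM2r//; apply: le_trans (tent_lip _ _ r0) _.
      rewrite ler_wpM2r ?invr_ge0 ?(ltW r0)// (_ : t - s - (t + s) = - (2 * s)); last by ring.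
      by rewrite normrN normrM gtr0_norm.
    rewrite (_ : 2 * `|s| / r * `|q e s| = 2 / r * (`|s| * `|q e s|)); last by ring.
    by rewrite ler_piMr ?divr_ge0 ?(ltW r0)//; exact: q_mul.
  rewrite /tent !ifF ?subrr ?normr0 ?mul0r ?mulr0//; apply/negP; move/negP: s3 => s3 h; apply: s3.
    by have := ler_normB (t + s) t; rewrite addrAC subrr add0r; lra.
  by have := ler_normB t (t - s); rewrite opprB addrCA subrr addr0; lra.
have mE2 : measT (fun s => G (-1) s + - G 1 s).
  by apply: measurable_funD; [exact: mG|apply: measurableT_comp; [exact: oppr_measurable|exact: mG]].
have : `|I + I| <= 12.
  rewrite E -lee_fin; apply: (le_trans (le_norm_Rintegral mu measurableT mE2)).
  apply: (@le_trans _ _ (\int[mu]_s ((2 / r)%:E * (if `|s| < 3 * r then 1 else 0)%:E))%E).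
    by apply: le_int0 => s _ //; rewrite -EFinM lee_fin.
  rewrite intZ ?divr_ge0 ?(ltW r0)//.
  rewrite indic_mass ?mulr_ge0 ?(ltW r0)// -EFinM lee_fin le_eqVlt; apply/orP; left; apply/eqP; field.
  by rewrite gt_eqF.
by rewrite (_ : I + I = 2 * I) ?normrM ?(gtr0_norm (ltr0n R 2)); [lra|ring].
Qed.

Let D e r t := (m r)^-1 * \int[mu]_s (tent r s * q e (t - s)).

(** Averaging the conjugate kernel of height e over radius r produces the one of height r up to a
    Poisson kernel. For |t| < 2 r both are O(1 / r), which the Poisson kernel dominates; otherwise
    use [q_far]. *)
Let tent_conv (e r t : R) : 0 < e -> e <= r -> `|D e r t - q r t| <= 2 ^+ 7 * (r / (t ^+ 2 + r ^+ 2)).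
Proof.
move=> e0 er; have r0 : 0 < r by exact: lt_le_trans er.
have m0 := m_gt0 r0; have dt := qden t r0.
have K0 : 0 <= r / (t ^+ 2 + r ^+ 2) by rewrite divr_ge0 ?ltW.
have [tr|tr] := ltP `|t| (2 * r).
  have n := tent_conv_near e0 r0 tr.
  have k : 1 <= 5 * r * (r / (t ^+ 2 + r ^+ 2)).
    rewrite mulrA ler_pdivlMr// mul1r.
    have : `|t| ^+ 2 <= (2 * r) ^+ 2 by rewrite lerXn2r ?nnegrE ?mulr_ge0 ?(ltW r0)// ltW.
    by rewrite real_normK ?num_real// !expr2; lra.
  apply: le_trans (ler_normB _ _) _.
  have d1 : `|D e r t| <= 12 / r.
    rewrite /D normrM normfV (gtr0_norm m0) mulrC ler_pdivrMr//; apply: (le_trans n).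
    by rewrite mulrAC ler_pdivlMr//; have := m_lb r0; lra.
  have q1 : `|q r t| <= 1 / r by rewrite div1r; exact: q_bound.
  apply: (@le_trans _ _ (13 / r)); first by rewrite (_ : 13 / r = 12 / r + 1 / r); [exact: lerD|field; rewrite gt_eqF].
  rewrite ler_pdivrMr//; move: k; move: (r / (t ^+ 2 + r ^+ 2)) K0 => z z0.
  rewrite (_ : 5 * r * z = 5 * (z * r)); last by ring.
  rewrite (_ : 2 ^+ 7 * z * r = 128 * (z * r)); last by ring.
  by have : 0 <= z * r by [rewrite mulr_ge0// ltW]; lra.
have -> : D e r t - q r t = (m r)^-1 * \int[mu]_s (tent r s * (q e (t - s) - q r t)).
  have it := tent_integrable r0.
  have itq : mu.-integrable setT (EFin \o (fun s => tent r s * q r t)).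
    have := integrableZr measurableT (q r t) it.
    by apply: eq_integrable => // s _ /=; rewrite EFinM.
  under [in RHS]eq_Rintegral do rewrite mulrBr.
  rewrite RintegralB//; last exact: tq_integrable.
  rewrite RintegralZr// -/(m r) mulrBr mulrA mulVf ?mul1r// gt_eqF//.
have mqe := mq e; have mt := measurable_tent r.
have mqs : measT (fun s : R => q e (t - s) - q r t).
  by apply: measurable_funB => //; apply: (measurableT_comp mqe); meas.
have mm : measT (fun s => tent r s * (q e (t - s) - q r t)) by exact: measurable_funM.
rewrite normrM normfV (gtr0_norm m0) ler_pdivrMl//.
rewrite -lee_fin; apply: (le_trans (le_norm_Rintegral mu measurableT mm)).
apply: (@le_trans _ _ (\int[mu]_s ((11 * (r / (t ^+ 2 + r ^+ 2)))%:E * (tent r s)%:E))%E).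
  apply: le_int0 => s _ //; rewrite -EFinM lee_fin normrM.
  have /andP[t0 t1] := tent_bounds s r0; rewrite (ger0_norm t0) mulrC.
  have [sr|sr] := ltP `|s| r; first by rewrite ler_wpM2r//; exact: q_far.
  by rewrite /tent ltNge sr/= !mulr0.
rewrite intZ//; last by rewrite mulr_ge0.
rewrite -mE// -EFinM lee_fin mulrC ler_wpM2l ?(ltW m0)// ler_wpM2r//; lra.
Qed.

Variables (f : R -> R) (B : R).
Hypotheses (mf : measT f) (fB : forall t, `|f t| <= B).
Hypothesis fi : (\int[mu]_t `|f t|%:E < +oo)%E.

Definition hilb_trunc (x r : R) : R := \int[mu]_t (if r < `|x - t| then f t / (x - t) else 0).

Let mnf : measT (fun t => `|f t|). Proof. by meas. Qed.
Let nfB t : 0 <= `|f t| <= B. Proof. by rewrite normr_ge0 fB. Qed.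

Let pois_HL c x (g : R -> R) : 0 <= c -> 0 < x.2 -> measT g ->
  (forall t, `|g t| <= c * (`|f t| * pois_ker x.1 x.2 t)) ->
  `|\int[mu]_t g t| <= c * 16 * HLr (fun t => `|f t|) x.1.
Proof.
move=> c0 h0 mg gb; rewrite -lee_fin; apply: (le_trans (le_norm_Rintegral mu measurableT mg)).
have p0 t : 0 <= pois_ker x.1 x.2 t by rewrite pois_ker_poissonk// poissonk_ge0// invr_ge0 ltW.
apply: (@le_trans _ _ (\int[mu]_t (c%:E * (`|f t| * pois_ker x.1 x.2 t)%:E))%E).
  by apply: le_int0 => t _ //; rewrite -EFinM lee_fin.
rewrite intZ//.
rewrite -mulrA [leRHS]EFinM; apply: lee_wpmul2l; first by rewrite lee_fin.
have hi : 0 < x.2^-1 by rewrite invr_gt0.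
apply: le_trans (HLr_poisson x.1 mnf nfB hi).
by apply: le_int0 => t _; [rewrite lee_fin mulr_ge0|rewrite lee_fin pois_ker_poissonk].
Qed.

(** Sharp and smooth truncation at the same radius differ by at most the Poisson kernel: outside the
    radius r the difference is r^2 / (y (y^2 + r^2)) with r <= |y|, inside it is y / (y^2 + r^2)
    with |y| <= r. *)
Lemma hilb_trunc_conj x r : 0 < r ->
  `|hilb_trunc x r - conjI f x r| <= 16 * HLr (fun t => `|f t|) x.
Proof.
move=> r0; rewrite /hilb_trunc /conjI.
have i1 : mu.-integrable setT (EFin \o (fun t => if r < `|x - t| then f t / (x - t) else 0)).
  apply: integrableP'; first by meas.
  apply: (@le_lt_trans _ _ (\int[mu]_t ((r^-1)%:E * `|f t|%:E))%E).
    apply: le_int0 => t _ //; rewrite -EFinM lee_fin; case: ifPn => h.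
      rewrite normrM normfV mulrC; apply: ler_wpM2r => //.
      by rewrite lef_pV2 ?posrE//; [exact: ltW|exact: lt_trans h].
    by rewrite normr0 mulr_ge0 ?invr_ge0// ltW.
  rewrite intZ//; last by rewrite invr_ge0 ltW.
  by rewrite lte_mul_pinfty// lee_fin invr_ge0 ltW.
rewrite -RintegralB//; last exact: conj_ker_integrable.
rewrite -[16]mul1r; apply: (@pois_HL 1 (x, r)) => //; first by rewrite /conj_ker; meas.
move=> t /=; rewrite mul1r /conj_ker /pois_ker.
have d0 := qden (x - t) r0; move: d0; set y := x - t => d0.
case: ifPn => [ry|]; last first.
  rewrite -leNgt => yr; rewrite sub0r normrN normrM ler_wpM2l// normrM normfV (gtr0_norm d0).
  by rewrite ler_wpM2r// invr_ge0 ltW.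
have y0 : y != 0 by rewrite -normr_gt0 (lt_trans r0).
rewrite -mulrBr normrM ler_wpM2l//.
have -> : y^-1 - y / (y ^+ 2 + r ^+ 2) = r ^+ 2 / y / (y ^+ 2 + r ^+ 2).
  by field; rewrite y0 gt_eqF.
rewrite normrM normfV (gtr0_norm d0) ler_wpM2r ?invr_ge0 ?(ltW d0)// normrM normfV ler_pdivrMr ?normr_gt0//.
by rewrite (ger0_norm (sqr_ge0 r)) expr2 ler_wpM2l// ltW.
Qed.

(** Cotlar's inequality: up to [tent_conv], the conjugate integral at height r is a tent average of
    the one at a fixed smaller height e, hence controlled by its maximal function. The factor 4 is 2
    r divided by the lower bound r / 2 for the tent mass. *)
Lemma conjI_tent x e r : 0 < e -> e <= r ->
  `|conjI f x r| <= 4 * HLr (fun y => `|conjI f y e|) x + 2 ^+ 7 * 16 * HLr (fun t => `|f t|) x.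
Proof.
move=> e0 er; have r0 : 0 < r by exact: lt_le_trans er.
have m0 := m_gt0 r0; have mt := measurable_tent r; have mqe := mq e.
pose F s t := tent r s * (f t * q e (x - s - t)).
have mF : measT (fun z : R * R => F z.1 z.2).
  apply: measurable_funM; first exact: (measurableT_comp mt measurable_fst).
  apply: measurable_funM; first exact: (measurableT_comp mf measurable_snd).
  by apply: (measurableT_comp mqe); meas.
have qc y t : q e (y - t) = conj_ker y e t by [].
have fin : (\int[mu]_s \int[mu]_t `|F s t|%:E < +oo)%E.
  apply: (@le_lt_trans _ _ (\int[mu]_s ((tent r s)%:E * ((e^-1)%:E * \int[mu]_t `|f t|%:E)))%E).
    apply: le_int0 => s _; first exact: integral_ge0.
    have /andP[t0 t1] := tent_bounds s r0.
    rewrite muleA -EFinM -intZ//; last by rewrite mulr_ge0 ?invr_ge0// ltW.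
    apply: le_int0 => t _ //; rewrite -EFinM lee_fin normrM (normrM (f t)) (ger0_norm t0) -mulrA ler_wpM2l//.
    by rewrite mulrC ler_wpM2r//; exact: q_bound.
  rewrite ge0_integralZr//; last 3 first.
  - exact/measurable_EFinP.
  - by move=> s _; rewrite lee_fin; have /andP[] := tent_bounds s r0.
  - by rewrite mule_ge0 ?lee_fin ?invr_ge0 ?(ltW e0)// integral_ge0.
  rewrite -mE// lte_mul_pinfty ?lee_fin ?(ltW m0)//.
  by rewrite lte_mul_pinfty// lee_fin invr_ge0 ltW.
have mV := measurable_conj e mf.
pose Mf := fine (\int[mu]_x `|f x|%:E)%E.
have VK y : `|conjI f y e| <= e^-1 * Mf.
  have kb t : `|conj_ker y e t| <= e^-1 by have [] := ker_bounds y t e0 (lexx e).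
  by apply: (integral_kernel_bound mf fi) => //; rewrite /conj_ker; meas.
have E1 : \int[mu]_s \int[mu]_t F s t = \int[mu]_s (tent r s * conjI f (x - s) e).
  congr Rintegral; apply/funext => s; rewrite /F /conjI -RintegralZl//.
  exact: conj_ker_integrable.
have E2 : \int[mu]_s \int[mu]_t F s t = m r * \int[mu]_t (f t * D e r (x - t)).
  rewrite (@RFubini _ _ _ _ _ mu mu F mF fin).
  have E3 t : \int[mu]_s F s t = m r * (f t * D e r (x - t)).
    rewrite /D (mulrCA (f t)) (mulrA (m r)) divff ?gt_eqF// mul1r -RintegralZl//; last exact: tq_integrable.
    by congr Rintegral; apply/funext => s; rewrite /F mulrCA; congr (_ * (_ * q _ _)); ring.
  under eq_Rintegral do rewrite E3.
  rewrite RintegralZl//.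
  have mD : measT (fun t : R => D e r (x - t)).
    have mD0 : measT (fun y : R => \int[mu]_s (tent r s * q e (y - s))).
      apply: (@meas_Rint _ _ _ _ _ mu (fun y s : R => tent r s * q e (y - s))).
      apply: measurable_funM; first exact: (measurableT_comp mt measurable_snd).
      by apply: (measurableT_comp mqe); meas.
    rewrite /D; apply: measurable_funM; first exact: measurable_cst.
    by apply: (measurableT_comp mD0); meas.
  have Db t : `|D e r (x - t)| <= 2 ^+ 7 * r^-1 + r^-1.
    have c1 := tent_conv (x - t) e0 er; have c2 := q_bound (x - t) r0.
    have c3 : r / ((x - t) ^+ 2 + r ^+ 2) <= r^-1.
      by have [+ _ _ _] := ker_bounds x t r0 (lexx r); apply: le_trans; exact: ler_norm.
    have c4 : 2 ^+ 7 * (r / ((x - t) ^+ 2 + r ^+ 2)) <= 2 ^+ 7 * r^-1 by rewrite ler_wpM2l ?exprn_ge0.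
    have := ler_normD (D e r (x - t) - q r (x - t)) (q r (x - t)); rewrite subrK => /le_trans -> //.
    by apply: lerD => //; exact: le_trans c1 c4.
  have Db0 : 0 <= 2 ^+ 7 * r^-1 + r^-1 by exact: le_trans (Db 0).
  apply: integrableP'; first exact: measurable_funM.
  apply: (@le_lt_trans _ _ (\int[mu]_t ((2 ^+ 7 * r^-1 + r^-1)%:E * `|f t|%:E))%E).
    by apply: le_int0 => t _ //; rewrite -EFinM lee_fin normrM mulrC ler_wpM2r.
  rewrite intZ//.
  by rewrite lte_mul_pinfty.
have mD : measT (fun t : R => D e r (x - t)).
  have mD0 : measT (fun y : R => \int[mu]_s (tent r s * q e (y - s))).
    apply: (@meas_Rint _ _ _ _ _ mu (fun y s : R => tent r s * q e (y - s))).
    apply: measurable_funM; first exact: (measurableT_comp mt measurable_snd).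
    by apply: (measurableT_comp mqe); meas.
  rewrite /D; apply: measurable_funM; first exact: measurable_cst.
  by apply: (measurableT_comp mD0); meas.
have mg : measT (fun t => f t * (q r (x - t) - D e r (x - t))).
  apply: measurable_funM => //; apply: measurable_funB => //.
  by apply: (measurableT_comp (mq r)); meas.
have c64 : 0 <= 2 ^+ 7 :> R by rewrite exprn_ge0.
have err : `|\int[mu]_t (f t * (q r (x - t) - D e r (x - t)))| <= 2 ^+ 7 * 16 * HLr (fun t => `|f t|) x.
  apply: (@pois_HL (2 ^+ 7) (x, r)) => // t /=.
  by rewrite normrM distrC mulrCA ler_wpM2l//; exact: tent_conv.
have qi : mu.-integrable setT (EFin \o (fun t => f t * q r (x - t))) by exact: conj_ker_integrable.
have Db t : `|D e r (x - t)| <= 2 ^+ 7 * r^-1 + r^-1.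
  have c1 := tent_conv (x - t) e0 er; have c2 := q_bound (x - t) r0.
  have c3 : r / ((x - t) ^+ 2 + r ^+ 2) <= r^-1.
    by have [+ _ _ _] := ker_bounds x t r0 (lexx r); apply: le_trans; exact: ler_norm.
  have c4 : 2 ^+ 7 * (r / ((x - t) ^+ 2 + r ^+ 2)) <= 2 ^+ 7 * r^-1 by rewrite ler_wpM2l ?exprn_ge0.
  have := ler_normD (D e r (x - t) - q r (x - t)) (q r (x - t)); rewrite subrK => /le_trans -> //.
  by apply: lerD => //; exact: le_trans c1 c4.
have Db0 : 0 <= 2 ^+ 7 * r^-1 + r^-1 by exact: le_trans (Db 0).
have Di : mu.-integrable setT (EFin \o (fun t => f t * D e r (x - t))).
  apply: integrableP'; first exact: measurable_funM.
  apply: (@le_lt_trans _ _ (\int[mu]_t ((2 ^+ 7 * r^-1 + r^-1)%:E * `|f t|%:E))%E).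
    by apply: le_int0 => t _ //; rewrite -EFinM lee_fin normrM mulrC ler_wpM2r.
  rewrite intZ//.
  by rewrite lte_mul_pinfty.
have split : conjI f x r = (m r)^-1 * \int[mu]_s (tent r s * conjI f (x - s) e)
    + \int[mu]_t (f t * (q r (x - t) - D e r (x - t))).
  rewrite -E1 E2 mulrA mulVf ?gt_eqF// mul1r.
  under [X in _ + X]eq_Rintegral do rewrite mulrBr.
  by rewrite RintegralB// addrC subrK.
rewrite split; apply: le_trans (ler_normD _ _) _; apply: lerD err.
have mnV : measT (fun y => `|conjI f y e|) by meas.
have nVK y : 0 <= `|conjI f y e| <= e^-1 * Mf by rewrite normr_ge0 VK.
have avg := HLr_avg x mnV nVK r0.
have mVs : measT (fun s : R => conjI f (x - s) e) by apply: (measurableT_comp mV); meas.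
have : `|\int[mu]_s (tent r s * conjI f (x - s) e)| <= 2 * r * HLr (fun y => `|conjI f y e|) x.
  rewrite -lee_fin; apply: (le_trans (le_norm_Rintegral mu measurableT (measurable_funM mt mVs))).
  apply: le_trans avg.
  rewrite -(@ge0_integral_reflect R x (fun w => (if `|x - w| < r then `|conjI f w e| else 0)%:E)).
  - apply: le_int0 => s _ //; rewrite lee_fin normrM opprB addrCA subrr addr0.
    have /andP[t0 t1] := tent_bounds s r0; rewrite (ger0_norm t0).
    by move: t1; case: ifPn => _ t1; [rewrite ler_piMl|rewrite (le_anti (introT andP (conj t1 t0))) mul0r].
  - by meas.
  - by move=> w; rewrite lee_fin; case: ifPn.
rewrite normrM normfV (gtr0_norm m0) ler_pdivrMl// => /le_trans; apply.
have h0 := HLr_ge0 (fun y => `|conjI f y e|) x.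
have : r / 2 * HLr (fun y => `|conjI f y e|) x <= m r * HLr (fun y => `|conjI f y e|) x by rewrite ler_wpM2r// m_lb.
lra.
Qed.

Lemma hilb_trunc_bound x e r : 0 < e -> e <= r ->
  `|hilb_trunc x r| <= 4 * HLr (fun y => `|conjI f y e|) x + (2 ^+ 7 * 16 + 16) * HLr (fun t => `|f t|) x.
Proof.
move=> e0 er; have r0 : 0 < r by exact: lt_le_trans er.
have h1 := hilb_trunc_conj x r0; have h2 := conjI_tent x e0 er.
have := ler_normD (hilb_trunc x r - conjI f x r) (conjI f x r); rewrite subrK => h.
by apply: (le_trans h); rewrite (mulrDl _ 16) addrA [leLHS]addrC; exact: lerD h2 h1.
Qed.

End Truncation.

(** The truncation radius may depend on x because the bound of [hilb_trunc_bound] does not contain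
    it. *)
Lemma hilb_trunc_Lp (R : realType) (p : R) : 1 < p -> exists2 C : R, 0 < C &
  forall (f : R -> R) (B e : R) (r : R -> R),
  measT f -> (forall t, `|f t| <= B) -> (\int[leb1 R]_t `|f t|%:E < +oo)%E ->
  0 < e -> (forall x, e <= r x) ->
  (\int[leb1 R]_x (`|hilb_trunc f x (r x)| `^ p)%:E <= C%:E * \int[leb1 R]_x (`|f x| `^ p)%:E)%E.
Proof.
move=> p1; have p0 : 0 < p by lra.
have [C1 C10 H1] := conjI_Lp p1; have [C2 C20 H2] := HLr_strong p1.
pose a : R := 4; pose b : R := 2 ^+ 7 * 16 + 16.
have a0 : 0 <= a by [].
have b0 : 0 <= b by rewrite addr_ge0// mulr_ge0// exprn_ge0.
pose C := 2 `^ p * (a `^ p * C2 * C1 + b `^ p * C2) + 1.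
have C0 : 0 <= 2 `^ p * (a `^ p * C2 * C1 + b `^ p * C2).
  apply: mulr_ge0; first exact: powR_ge0.
  apply: addr_ge0; first by do 2 (apply: mulr_ge0; last exact: ltW); exact: powR_ge0.
  by apply: mulr_ge0; [exact: powR_ge0|exact: ltW].
exists C; first by rewrite ltr_wpDl.
move=> f B e r mf fB fi e0 er.
have mnf : measT (fun t => `|f t|) by meas.
have nfB t : 0 <= `|f t| <= B by rewrite normr_ge0 fB.
have mV := measurable_conj e mf.
have VK y : `|conjI f y e| <= e^-1 * fine (\int[leb1 R]_x `|f x|%:E)%E.
  have kb t : `|conj_ker y e t| <= e^-1 by have [] := ker_bounds y t e0 (lexx e).
  by apply: (integral_kernel_bound mf fi) => //; rewrite /conj_ker; meas.
have mnV : measT (fun y => `|conjI f y e|) by meas.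
have nVK y : 0 <= `|conjI f y e| <= e^-1 * fine (\int[leb1 R]_x `|f x|%:E)%E by rewrite normr_ge0 VK.
have mh1 : measT (HLr (fun t => `|f t|)).
  by apply: (measurable_HLr (B := B)) => // t; rewrite normr_id.
have mh2 : measT (HLr (fun y => `|conjI f y e|)).
  by apply: (measurable_HLr mnV) => t; rewrite normr_id; exact: VK.
have HF x : `|hilb_trunc f x (r x)| <= a * HLr (fun y => `|conjI f y e|) x + b * HLr (fun t => `|f t|) x.
  exact: hilb_trunc_bound.
have n1 : 0 <= 2 `^ p * a `^ p by rewrite mulr_ge0// powR_ge0.
have n2 : 0 <= 2 `^ p * b `^ p by rewrite mulr_ge0// powR_ge0.
apply: (le_trans (integral_powR_addr_le (leb1 R) (ltW p0) a0 b0 mh2 mh1 (HLr_ge0 _) (HLr_ge0 _) HF)).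
have fp0 : (0 <= \int[leb1 R]_x (`|f x| `^ p)%:E)%E by int_ge0.
have L1 := H1 f B e mf fB fi e0.
have L2 : (\int[leb1 R]_x (HLr (fun y => `|conjI f y e|) x `^ p)%:E <= C2%:E * (C1%:E * \int[leb1 R]_x (`|f x| `^ p)%:E))%E.
  apply: (le_trans (H2 _ _ mnV nVK)); apply: lee_wpmul2l; first by rewrite lee_fin ltW.
  exact: L1.
have L3 := H2 _ _ mnf nfB.
apply: (@le_trans _ _ ((2 `^ p * a `^ p)%:E * (C2%:E * (C1%:E * \int[leb1 R]_x (`|f x| `^ p)%:E)) +
   (2 `^ p * b `^ p)%:E * (C2%:E * \int[leb1 R]_x (`|f x| `^ p)%:E))%E).
  by apply: leeD; apply: lee_wpmul2l; rewrite ?lee_fin.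
rewrite !muleA -!EFinM -ge0_muleDl ?lee_fin; last 2 first.
- by rewrite !mulr_ge0 ?powR_ge0// ltW.
- by rewrite !mulr_ge0 ?powR_ge0// ltW.
apply: lee_wpmul2r => //; rewrite -EFinD lee_fin /C.
apply: (@le_trans _ _ (2 `^ p * (a `^ p * C2 * C1 + b `^ p * C2))); last by rewrite lerDl.
by rewrite le_eqVlt; apply/orP; left; apply/eqP; ring.
Qed.

(** * Decay and regularity of the Littlewood-Paley kernel *)

Section Oscillatory.
Variable R : realType.
Local Notation mu := (leb1 R).
Implicit Types (f g psi w : R -> R).

(** The support condition on phi0. Vanishing near 0 is what permits division by x, that is, taking a
    primitive on the kernel side. *)
Definition annular f := forall x : R, (`|x| < 1 / 2) || (5 / 2 < `|x|) -> f x = 0.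

Lemma annular_near f x : annular f -> (`|x| < 1 / 2) || (5 / 2 < `|x|) -> \near x, f x = 0.
Proof.
move=> af /orP[h|h].
  near=> y; apply: af; apply/orP; left; near: y.
  apply: (@cvgr_lt _ _ (nbhs x) _ (fun y : R => `|y|) `|x|) => //.
  exact: norm_continuous.
near=> y; apply: af; apply/orP; right; near: y.
apply: (@cvgr_gt _ _ (nbhs x) _ (fun y : R => `|y|) `|x|) => //.
exact: norm_continuous.
Unshelve. all: by end_near. Qed.

Lemma is_derive_near0 f x : (\near x, f x = 0) -> is_derive x (1:R) f 0.
Proof.
move=> h; have := @near_eq_is_derive R R R (cst 0) f x 1 0; apply.
by apply: filterS h => y ->.
Qed.

Lemma annular_der f g : (forall x : R, is_derive x (1:R) f (g x)) -> annular f -> annular g.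
Proof.
move=> df af x hx; have := is_derive_near0 (annular_near af hx).
by move=> /@derive_val; have /@derive_val -> := df x.
Qed.

Lemma annular_bounded f : continuous f -> annular f -> exists2 M : R, 0 <= M & forall x, `|f x| <= M.
Proof.
move=> cf af.
have cn : {within `[(-3)%R, 3%R], continuous (fun x : R => `|f x|)}.
  apply: continuous_subspaceT => x; apply: (@continuous_comp _ _ _ f (@Num.norm R R)); first exact: cf.
  exact: norm_continuous.
have [|c _ h] := EVT_max _ cn; first by lra.
exists `|f c| => // x; have [x3|x3] := leP `|x| 3.
  by apply: h; rewrite in_itv/= -ler_norml.
by rewrite af ?normr0//; apply/orP; right; lra.
Qed.

(** The derivatives are carried as a sequence so that x f and f / x receive explicit Leibniz
    formulas ([C3_mulX], [C3_div]). *)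
Definition C3 f := exists g : nat -> R -> R, g 0%N = f /\ forall n x, (n < 3)%N -> is_derive x (1:R) (g n) (g n.+1 x).

Lemma C3_mulX f : C3 f -> C3 (fun x => x * f x).
Proof.
move=> [g [g0 dg]]; exists (fun n x => x * g n x + n%:R * g n.-1 x); split.
  by apply/funext => x; rewrite g0 mul0r addr0.
move=> n x n3; have d1 := derM (derId x) (dg n x n3).
case: n n3 d1 => [|n] n3 d1.
  by have H := derD d1 (derM (derC 0%:R x) (dg 0%N x isT)); apply: (is_derive_eq H) => /=; ring.
have d2 := derM (derC n.+1%:R x) (dg n x (ltnW n3)).
by have H := derD d1 d2; apply: (is_derive_eq H) => /=; rewrite -[in RHS](natr1 n.+1); ring.
Qed.

Lemma annular_div f : annular f -> annular (fun x => f x / x).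
Proof. by move=> af x /af ->; rewrite mul0r. Qed.

Lemma div_der f g x : annular f -> is_derive x (1:R) f (g x) -> annular g ->
  is_derive x (1:R) (fun x => f x / x) (g x / x - f x / x / x).
Proof.
move=> af df ag; have [x0|x0] := eqVneq x 0.
  have h : (`|x| < 1 / 2) || (5 / 2 < `|x|) by apply/orP; left; rewrite x0 normr0; lra.
  rewrite (af x h) (ag x h) !mul0r subr0; apply: is_derive_near0.
  exact: annular_near (annular_div af) h.
have H := derQuot df (derId x) x0.
by apply: is_derive_eq; field.
Qed.

(** The n-th derivative G_n of f / x is found recursively by differentiating x (f / x) = f: x
    G_(n+1) + (n + 1) G_n = f^(n+1). At x = 0 everything vanishes in a neighbourhood. *)
Lemma C3_div f : annular f -> C3 f -> C3 (fun x => f x / x).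
Proof.
move=> af [g [g0 dg]].
have ag n : (n <= 3)%N -> annular (g n).
  elim: n => [|n IH] n3; first by rewrite g0.
  by apply: (annular_der _ (IH (ltnW n3))) => x; exact: dg.
pose G := fix G n := match n with 0 => fun x => g 0%N x / x | n.+1 => fun x => g n.+1 x / x - n.+1%:R * (G n x / x) end.
have aG n : (n <= 3)%N -> annular (G n).
  elim: n => [|n IH] n3 /=; first by apply: annular_div; exact: ag.
  by move=> x hx; rewrite (ag n.+1)// IH ?(ltnW n3)// !mul0r mulr0 subr0.
exists G; split; first by rewrite /= g0.
elim=> [|n IH] x n3 /=.
  have H := div_der (ag 0%N isT) (dg 0%N x isT) (ag 1%N isT).
  by apply: is_derive_eq; rewrite mul1r.
have H1 := div_der (ag n.+1 (ltnW n3)) (dg n.+1 x n3) (ag n.+2 n3).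
have H2 := div_der (aG n (ltnW (ltnW n3))) (IH x (ltnW n3)) (aG n.+1 (ltnW n3)).
have H := derD H1 (derN (derM (derC n.+1%:R x) H2)).
by apply: (is_derive_eq H) => /=; rewrite -[in RHS](natr1 n.+1); ring.
Qed.

(** Cosine and sine up to sign, together with the derivative; closed under differentiation and
    integration, so both parts of the complex exponential are handled at once. *)
Definition trig_pair w w' := [/\ forall x : R, is_derive x (1:R) w (w' x),
  forall x : R, is_derive x (1:R) w' (- w x), forall x, `|w x| <= 1 & forall x, `|w' x| <= 1].

Lemma trig_pairN w w' : trig_pair w w' -> trig_pair (fun x => - w' x) w.
Proof.
move=> [d1 d2 b1 b2]; split => // x.
- by have H := derN (d2 x); apply: is_derive_eq; rewrite opprK.
- by rewrite opprK.
- by rewrite normrN.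
Qed.

Lemma trig_pair_der w w' : trig_pair w w' -> trig_pair w' (fun x => - w x).
Proof. by move=> [d1 d2 b1 b2]; split => // x; [exact: derN|rewrite normrN]. Qed.

Lemma trig_pair_cos : trig_pair (@cos R) (fun x => - sin x).
Proof.
split => x; rewrite ?normrN ?cos_max ?sin_max//; first exact: is_derive_cos.
by apply: derN; exact: is_derive_sin.
Qed.

Lemma trig_pair_sin : trig_pair (@sin R) (@cos R).
Proof.
by split => x; rewrite ?cos_max ?sin_max//; [exact: is_derive_sin|exact: is_derive_cos].
Qed.

Definition osc w psi (t : R) := \int[mu]_x (psi x * w (x * t)).

Lemma continuous_meas f : continuous f -> measT f.
Proof. by move=> cf; exact: continuous_measurable_fun. Qed.

Lemma trig_meas w w' : trig_pair w w' -> measT w.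
Proof. by move=> [d1 _ _ _]; apply: continuous_meas => x; exact: der_cont (d1 x). Qed.

Lemma annular_int_bound f M : annular f -> (forall x, `|f x| <= M) ->
  (\int[mu]_x `|f x|%:E <= (6 * M)%:E)%E.
Proof.
move=> af fM; have M0 : 0 <= M by exact: le_trans (fM 0).
apply: (@le_trans _ _ (\int[mu]_x (M%:E * (if `|x| < 3 then 1 else 0)%:E))%E).
  apply: le_int0 => x _ //; rewrite -EFinM lee_fin; case: ifPn => x3; first by rewrite mulr1.
  by rewrite af ?normr0 ?mulr0//; apply/orP; right; move: x3; rewrite -leNgt => ?; lra.
rewrite intZ//.
by rewrite indic_mass// -EFinM lee_fin le_eqVlt; apply/orP; left; apply/eqP; ring.
Qed.

Lemma annular_int_fin f : continuous f -> annular f -> (\int[mu]_x `|f x|%:E < +oo)%E.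
Proof.
move=> cf af; have [M _ fM] := annular_bounded cf af.
by apply: le_lt_trans (annular_int_bound af fM) _; rewrite ltry.
Qed.

Lemma osc_bound w w' psi M t : trig_pair w w' -> measT psi -> annular psi -> (forall x, `|psi x| <= M) ->
  `|osc w psi t| <= 6 * M.
Proof.
move=> tw mp ap pM; have [_ _ wb _] := tw; have mw := trig_meas tw.
rewrite -lee_fin.
have mi : measT (fun x : R => psi x * w (x * t)).
  by apply: measurable_funM => //; apply: (measurableT_comp mw); meas.
apply: (le_trans (le_norm_Rintegral mu measurableT mi)).
apply: le_trans (annular_int_bound ap pM); apply: le_int0 => x _ //.
by rewrite lee_fin normrM ler_piMr.
Qed.

Lemma osc_derive w w' psi t : trig_pair w w' -> continuous psi -> annular psi ->
  is_derive t (1:R) (osc w psi) (osc w' (fun x => x * psi x) t).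
Proof.
move=> tw cp ap; have [d1 _ wb wb'] := tw; have mw := trig_meas tw; have mw' := trig_meas (trig_pair_der tw).
have mp := continuous_meas cp; have fp := annular_int_fin cp ap.
pose k (y x : R) := if `|x| < 3 then w (x * y) else 0.
pose k' (y x : R) := if `|x| < 3 then x * w' (x * y) else 0.
have far x : ~~ (`|x| < 3) -> psi x = 0.
  by rewrite -leNgt => x3; apply: ap; apply/orP; right; lra.
rewrite (_ : osc w psi = fun y => \int[mu]_x (psi x * k y x)); last first.
  apply/funext => y; congr Rintegral; apply/funext => x; rewrite /k; case: ifPn => // /far ->.
  by rewrite !mul0r.
rewrite (_ : osc w' _ t = \int[mu]_x (psi x * k' t x)); last first.
  congr Rintegral; apply/funext => x; rewrite /k'; case: ifPn => [_|/far ->]; first by rewrite mulrA (mulrC (psi x)).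
  by rewrite !(mulr0, mul0r).
apply: (is_derive_kernel_integral (u := t - 1) (v := t + 1) (C := 3) mp fp).
- by apply/andP; split; lra.
- move=> y; have mwy : measT (fun x : R => w (x * y)) by apply: (measurableT_comp mw); meas.
  by rewrite /k; meas.
- move=> y x _; rewrite /k /k'; case: ifPn => _; last exact: derC.
  by have H := derComp (f := w) (g := fun y : R => x * y) (d1 (x * y)) (derM (derC x y) (derId y)); apply: (is_derive_eq H); ring.
- by move=> y x _; rewrite /k; case: ifPn => _; [apply: le_trans (wb _) _; lra|rewrite normr0].
- move=> y x _; rewrite /k'; case: ifPn => [x3|_]; last by rewrite normr0.
  by rewrite normrM -[leRHS]mulr1; apply: ler_pM => //; exact: ltW.
Qed.

(** Two integrations by parts turn t^2 times the integral into the same integral for - psi''. Each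
    is at most 6 times a supremum, the support lying in |x| < 3. *)
Lemma osc_decay w w' psi : trig_pair w w' -> annular psi -> C3 psi ->
  exists2 A : R, 0 < A & forall t, `|osc w psi t| <= A * poissonk 1 t.
Proof.
move=> tw ap [g [g0 dg]]; have [d1 d2 wb wb'] := tw.
have ag n : (n <= 3)%N -> annular (g n).
  elim: n => [|n IH] n3; first by rewrite g0.
  by apply: (annular_der _ (IH (ltnW n3))) => x; exact: dg.
have cg n : (n < 3)%N -> continuous (g n) by move=> n3 x; exact: der_cont (dg n x n3).
have [M0 M00 b0] := annular_bounded (cg 0%N isT) (ag 0%N isT).
have [M2 M20 b2] := annular_bounded (cg 2%N isT) (ag 2%N isT).
exists (6 * M0 + 6 * M2 + 1); first by lra.
move=> t; have o0 := osc_bound t tw (continuous_meas (cg 0%N isT)) (ag 0%N isT) b0.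
have o2 := osc_bound t tw (continuous_meas (cg 2%N isT)) (ag 2%N isT) b2.
have E : t ^+ 2 * osc w (g 0%N) t + osc w (g 2%N) t = 0.
  pose G (x : R) := g 1%N x * w (x * t) - t * g 0%N x * w' (x * t).
  have mw := trig_meas tw.
  have int n : (n < 3)%N -> mu.-integrable setT (EFin \o (fun x => g n x * w (x * t))).
    move=> n3; apply: integrableP'.
      by apply: measurable_funM; [exact: continuous_meas (cg n n3)|apply: (measurableT_comp mw); meas].
    apply: le_lt_trans (annular_int_fin (cg n n3) (ag n (ltnW n3))).
    by apply: le_int0 => x _ //; rewrite lee_fin normrM ler_piMr.
  have i0 := int 0%N isT.
  have i0' : mu.-integrable setT (EFin \o (fun x => t ^+ 2 * (g 0%N x * w (x * t)))).
    have := integrableZl measurableT (t ^+ 2) i0.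
    by apply: eq_integrable => // x _ /=; rewrite EFinM.
  rewrite /osc -RintegralZl// -RintegralD//; last exact: int.
  have dG (x : R) : is_derive x (1:R) G (t ^+ 2 * (g 0%N x * w (x * t)) + g 2%N x * w (x * t)).
    have dx := derM (derId x) (derC t x).
    have H1 := derM (dg 1%N x isT) (derComp (f := w) (g := fun x : R => x * t) (d1 (x * t)) dx).
    have H2 := derM (derM (derC t x) (dg 0%N x isT)) (derComp (f := w') (g := fun x : R => x * t) (d2 (x * t)) dx).
    by have H := derD H1 (derN H2); apply: (is_derive_eq H); ring.
  have := @FTC_is_derive R (fun x => t ^+ 2 * (g 0%N x * w (x * t)) + g 2%N x * w (x * t)) G (-3) 3.
  have G0 x : 5 / 2 < `|x| -> G x = 0.
    by move=> x3; rewrite /G !ag ?x3 ?orbT// mulr0 !mul0r subrr.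
  rewrite !G0 ?subrr ?normrN ?ger0_norm//; try lra.
  move=> H; rewrite /Rintegral -[RHS]/(fine 0%:E) -H.
  - rewrite [in RHS]integral_mkcond; congr fine; apply: eq_integral => x _.
    rewrite patchE mem_setE in_itv/= -ler_norml; case: ifPn => // x3.
    by rewrite !ag ?mul0r ?mulr0 ?addr0//; apply/orP; right; lra.
  - by lra.
  - move=> x _; have dx := derM (derId x) (derC t x).
    have H1 := derM (dg 0%N x isT) (derComp (f := w) (g := fun x : R => x * t) (d1 (x * t)) dx).
    have H2 := derM (dg 2%N x isT) (derComp (f := w) (g := fun x : R => x * t) (d1 (x * t)) dx).
    exact: der_cont (derD (derM (derC (t ^+ 2) x) H1) H2).
rewrite -g0 /poissonk !mul1r ler_pdivlMr; last by rewrite ltr_pwDl// sqr_ge0.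
have -> : `|osc w (g 0%N) t| * (1 + t ^+ 2) = `|osc w (g 0%N) t| + `|osc w (g 2%N) t|.
  rewrite mulrDr mulr1; congr (_ + _).
  rewrite -[in RHS](_ : - (t ^+ 2 * osc w (g 0%N) t) = osc w (g 2%N) t); last by apply/eqP; rewrite eq_sym -addr_eq0 addrC E.
  by rewrite normrN normrM (ger0_norm (sqr_ge0 t)) mulrC.
lra.
Qed.

(** The additional Lipschitz bound at scale 1/s is what allows a parabola to be replaced by a line
    below the critical radius. *)
Definition regular_pair (A : R) (K J : R -> R) (s : R) := kernel_pair A K J s /\
  forall t v, `|s * v| <= 1 -> `|K (t + v) - K t| <= A * `|s * v| * poissonk s t.

Lemma regular_pair_le A A' K J s : A <= A' -> regular_pair A K J s -> regular_pair A' K J s.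
Proof.
move=> AA [[s0 cK dJ bK bJ] lK].
have p0 t : 0 <= poissonk s t by rewrite poissonk_ge0// ltW.
split; first split => // t.
- by apply: le_trans (bK t) _; rewrite ler_wpM2r.
- by apply: le_trans (bJ t) _; rewrite ler_wpM2r// ler_wpM2r// invr_ge0 ltW.
- by move=> t v h; apply: le_trans (lK t v h) _; rewrite ler_wpM2r// ler_wpM2r.
Qed.

(** A primitive in t is obtained by dividing psi by x and integrating the trigonometric factor, a
    derivative by multiplying psi by x. All three integrals decay by [osc_decay], and scaling t by s
    puts 1/s on the primitive and s on the derivative. The mean value theorem gives the Lipschitz
    bound. *)
Lemma osc_regular w w' psi (c : R) : trig_pair w w' -> annular psi -> C3 psi -> 0 < c ->
  exists2 A : R, 0 < A & forall s, 0 < s -> exists J, regular_pair A (fun t => c * s * osc w psi (s * t)) J s.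
Proof.
move=> tw ap cp c0.
have cont f : C3 f -> continuous f by move=> [g [<- dg]] x; exact: der_cont (dg 0%N x isT).
have mulXa f : annular f -> annular (fun x => x * f x) by move=> af x /af ->; rewrite mulr0.
have [A0 A00 B0] := osc_decay tw ap cp.
have [A1 A10 B1] := osc_decay (trig_pairN tw) (annular_div ap) (C3_div ap cp).
have [A2 A20 B2] := osc_decay (trig_pair_der tw) (mulXa _ ap) (C3_mulX cp).
have d1 t := osc_derive t (trig_pairN tw) (cont _ (C3_div ap cp)) (annular_div ap).
have d2 t := osc_derive t tw (cont _ cp) ap.
have Epsi : (fun x => x * (psi x / x)) = psi.
  apply/funext => x; have [->|x0] := eqVneq x 0; last by field.
  by rewrite mul0r ap//; apply/orP; left; rewrite normr0; lra.
rewrite Epsi in d1.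
exists (c * (A0 + A1 + 3 * A2)); first by apply: mulr_gt0 => //; lra.
move=> s s0.
have ds t := derM (derC s t) (derId t).
have pE t : poissonk s t = s * poissonk 1 (s * t) by rewrite /poissonk !mul1r.
have p0 (t : R) : 0 <= poissonk 1 t by rewrite poissonk_ge0.
have cs0 : 0 < c * s by rewrite mulr_gt0.
have dK t : is_derive t (1:R) (fun t => c * s * osc w psi (s * t)) (c * s * s * osc w' (fun x => x * psi x) (s * t)).
  have H := derM (derC (c * s) t) (derComp (f := osc w psi) (g := fun t => s * t) (d2 (s * t)) (ds t)).
  by apply: (is_derive_eq H); ring.
exists (fun t => c * osc (fun x => - w' x) (fun x => psi x / x) (s * t)); split.
  split => //.
  - by move=> t; exact: der_cont (dK t).
  - move=> t.
    have H := derM (derC c t) (derComp (f := osc (fun x => - w' x) (fun x => psi x / x)) (g := fun t => s * t) (d1 (s * t)) (ds t)).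
    by apply: (is_derive_eq H); ring.
  - move=> t; rewrite pE normrM gtr0_norm// mulrA (mulrAC c _ s) -!(mulrA (c * s)) ler_wpM2l ?(ltW cs0)//.
    by apply: le_trans (B0 _) _; rewrite ler_wpM2r//; lra.
  - move=> t; rewrite pE mulrA divfK ?gt_eqF// normrM gtr0_norm// -mulrA ler_wpM2l ?(ltW c0)//.
    by apply: le_trans (B1 _) _; rewrite ler_wpM2r//; lra.
move=> t v sv.
(* Within distance 1/s the Poisson kernel changes by at most a factor 3. *)
have near z : `|z - t| <= `|v| -> `|c * s * s * osc w' (fun x => x * psi x) (s * z)| <= c * (3 * A2) * s * poissonk s t.
  move=> zt; rewrite normrM gtr0_norm ?mulr_gt0// pE.
  apply: (@le_trans _ _ (c * s * s * (A2 * (3 * poissonk 1 (s * t))))); last first.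
    by rewrite le_eqVlt; apply/orP; left; apply/eqP; ring.
  rewrite ler_wpM2l ?mulr_ge0 ?(ltW s0) ?(ltW c0)//; apply: le_trans (B2 _) _.
  apply: ler_wpM2l; first exact: ltW.
  have D0 (y : R) : 0 < 1 + y ^+ 2 by rewrite ltr_pwDl// sqr_ge0.
  rewrite /poissonk !mul1r -[leLHS]mul1r ler_pdivrMr// mulrAC ler_pdivlMr// mul1r.
  have b : (s * z - s * t) ^+ 2 <= 1.
    rewrite -mulrBr -real_normK ?num_real// expr_le1// normrM gtr0_norm//.
    by apply: le_trans sv; rewrite normrM (gtr0_norm s0) ler_wpM2l// ltW.
  have -> : (s * t) ^+ 2 = (s * z - (s * z - s * t)) ^+ 2 by congr (_ ^+ 2); ring.
  move: b; set a := s * z - s * t; move: (s * z) => y b.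
  have := sqr_ge0 (y + a); rewrite !expr2 in b *; nra.
have M (a b : R) : a <= b -> (forall z, a <= z <= b -> `|z - t| <= `|v|) ->
    `|c * s * osc w psi (s * b) - c * s * osc w psi (s * a)| <= c * (3 * A2) * s * poissonk s t * (b - a).
  move=> ab h; have [z + ->] := @MVT_segment R (fun t => c * s * osc w psi (s * t)) _ a b ab (fun z _ => dK z)
    (continuous_subspaceT (fun z => der_cont (dK z))).
  rewrite in_itv/= => /h /near zn; rewrite normrM (ger0_norm (_ : 0 <= b - a)) ?subr_ge0// ler_wpM2r ?subr_ge0//.
have key : `|c * s * osc w psi (s * (t + v)) - c * s * osc w psi (s * t)| <= c * (3 * A2) * s * poissonk s t * `|v|.
  have [v0|v0] := leP 0 v.
    have := M t (t + v); rewrite (_ : t + v - t = v); last by ring.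
    rewrite (ger0_norm v0); apply; first by lra.
    by move=> z /andP[z1 z2]; rewrite ger0_norm; lra.
  have := M (t + v) t; rewrite (_ : t - (t + v) = - v); last by ring.
  rewrite distrC (ltr0_norm v0); apply; first by lra.
  by move=> z /andP[z1 z2]; rewrite ler0_norm; lra.
apply: (le_trans key); rewrite normrM gtr0_norm//.
rewrite (_ : _ * _ * `|v| = c * (3 * A2) * (s * `|v| * poissonk s t)); last by ring.
rewrite -[leRHS]mulrA; apply: ler_wpM2r.
  by rewrite pE mulr_ge0// mulr_ge0// ltW.
by rewrite ler_wpM2l ?(ltW c0)//; lra.
Qed.

Lemma LPbump_annular (phi : R -> R) : LPbump phi -> annular phi.
Proof.
move=> [_ sp _] x hx; apply/eqP/negPn/negP => h.
have /sp : closure [set t | phi t != 0] x by apply: subset_closure.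
rewrite /= !in_itv/=; move: hx; case: (ltrP 0 x) => x0.
  by rewrite (gtr0_norm x0) => /orP[]h1 [|] /andP[]; lra.
by rewrite (ler0_norm x0) => /orP[]h1 [|] /andP[]; lra.
Qed.

Lemma LPbump_C3 (phi : R -> R) : LPbump phi -> C3 phi.
Proof.
move=> [sm _ _]; exists (fun n => derive1n n phi); split => // n x _.
have H := sm n x.
by rewrite derive1nS derive1E; exact: derivableP.
Qed.

Lemma LPkernel_osc (phi : R -> R) (k : int) (t : R) : continuous phi ->
  LPkernel phi k t = Complex ((2 * pi)^-1 * 2 ^ k * osc (@cos R) phi (2 ^ k * t))
                             ((2 * pi)^-1 * 2 ^ k * osc (@sin R) phi (2 ^ k * t)).
Proof.
move=> cphi; have mphi := continuous_meas cphi.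
have s0 : 0 < 2 ^ (- k) :> R by rewrite exprz_gt0.
have aff (w : R -> R) : measT w ->
    \int[mu]_x (phi (2 ^ (- k) * x) * w (x * t)) = 2 ^ k * osc w phi (2 ^ k * t).
  move=> mw; have := @Rintegral_affine R (2 ^ (- k)) 0 (fun x => phi x * w (x * (2 ^ k * t))).
  rewrite gt_eqF// (gtr0_norm s0) -invr_expz invrK /osc => <- //.
    congr Rintegral; apply/funext => x; rewrite addr0 invr_expz; congr (_ * w _).
    by rewrite -invr_expz; field; rewrite gt_eqF// exprz_gt0.
  by apply: measurable_funM => //; apply: (measurableT_comp mw); meas.
rewrite /LPkernel /cintegral /expi /=; simpc; congr Complex; rewrite -[RHS]mulrA; congr (_ * _).
  under eq_Rintegral do rewrite mul0r subr0.
  by apply: aff; exact: (trig_meas trig_pair_cos).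
under eq_Rintegral do rewrite mul0r addr0.
by apply: aff; exact: (trig_meas trig_pair_sin).
Qed.

Lemma LPkernel_regular (phi : R -> R) : LPbump phi -> exists2 A : R, 0 < A & forall k : int,
  (exists J, regular_pair A (fun t => complex.Re (LPkernel phi k t)) J (2 ^ k)) /\
  (exists J, regular_pair A (fun t => complex.Im (LPkernel phi k t)) J (2 ^ k)).
Proof.
move=> hp; have ap := LPbump_annular hp; have cp := LPbump_C3 hp.
have c0 : 0 < (2 * pi)^-1 :> R by rewrite invr_gt0 mulr_gt0// pi_gt0.
have cphi : continuous phi by case: cp => g [<- dg] x; exact: der_cont (dg 0%N x isT).
have [A1 A10 H1] := osc_regular trig_pair_cos ap cp c0.
have [A2 A20 H2] := osc_regular trig_pair_sin ap cp c0.
exists (A1 + A2); first exact: addr_gt0.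
move=> k; have s0 : 0 < 2 ^ k :> R by rewrite exprz_gt0.
have [J1 r1] := H1 _ s0; have [J2 r2] := H2 _ s0.
split.
  exists J1; apply: (@regular_pair_le A1); first by rewrite lerDl ltW.
  by rewrite (_ : (fun t => _) = fun t => (2 * pi)^-1 * 2 ^ k * osc (@cos R) phi (2 ^ k * t))//; apply/funext => t; rewrite LPkernel_osc.
exists J2; apply: (@regular_pair_le A2); first by rewrite lerDr ltW.
by rewrite (_ : (fun t => _) = fun t => (2 * pi)^-1 * 2 ^ k * osc (@sin R) phi (2 ^ k * t))//; apply/funext => t; rewrite LPkernel_osc.
Qed.

End Oscillatory.

(** * Dyadic radii and the maximal function *)

Section Dyadic.
Variable R : realType.

(** The integer j for which a 4^j lies in [1, 4): with a = s |u(x)|, the exponent of the critical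
    dyadic radius at x. *)
Definition dyad (a : R) : int := - Num.floor (ln a / ln 4).

Lemma ltr_powR (a x y : R) : 1 < a -> x < y -> a `^ x < a `^ y.
Proof.
move=> a1 xy; have a0 : 0 < a by exact: lt_trans a1.
by rewrite /powR gt_eqF// ltr_expR ltr_pM2r// ln_gt0.
Qed.

Lemma dyadP a : 0 < a -> 1 <= a * (2 ^ dyad a) ^+ 2 < 4.
Proof.
move=> a0; rewrite /dyad; have l4 : 0 < ln 4 :> R by rewrite ln_gt0//; lra.
have : a = 4 `^ (ln a / ln 4) by rewrite /powR gt_eqF// divfK ?gt_eqF// lnK.
move: (ln a / ln 4) => t ->.
have -> : (2 ^ (- Num.floor t)) ^+ 2 = (4 ^ Num.floor t)^-1 :> R.
  by rewrite (_ : 4 = 2 * 2 :> R); [rewrite expfzMl -invr_expz expr2 invfM|ring].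
have m0 : 0 < 4 ^ Num.floor t :> R by rewrite exprz_gt0.
rewrite ler_pdivlMr// mul1r ltr_pdivrMr// -powR_intmul//.
have /andP[h1 h2] := floor_itv t.
apply/andP; split; first by rewrite ler_powR// ler1n.
rewrite -[X in X * _]powRr1// -powRD; last by rewrite pnatr_eq0 implybT.
by apply: ltr_powR; rewrite ?ltr1n// addrC; move: h2; rewrite rmorphD.
Qed.

Lemma measurable_int_comp d (T : measurableType d) d' (T' : measurableType d') (e : T -> int) (F : int -> T') :
  (forall j, measurable [set x | e x = j]) -> measT (fun x => F (e x)).
Proof.
move=> me _ Y mY; rewrite setTI.
pose S n : set T := match @unpickle int n with Some j => if `[< Y (F j) >] then [set x | e x = j] else set0 | None => set0 end.
rewrite (_ : _ @^-1` _ = \bigcup_n S n).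
  by apply: bigcupT_measurable => n; rewrite /S; case: unpickle => // j; case: ifP.
apply/seteqP; split => [x /= Yx|x [n _]]; rewrite ?/S.
  by exists (pickle (e x)); [|rewrite /S pickleK asboolT].
by case: unpickle => // j; case: asboolP => // Yj /= ->.
Qed.

Lemma measurable_dyad d (T : measurableType d) d' (T' : measurableType d') (a : T -> R) (F : int -> T') : measT a ->
  measT (fun x => F (dyad (a x))).
Proof.
move=> ma; apply: (@measurable_int_comp _ _ _ _ (fun x => Num.floor (ln (a x) / ln 4)) (fun j => F (- j))) => j.
have mt : measT (fun x => ln (a x) / ln 4).
  by apply: measurable_funM => //; apply: measurableT_comp => //; exact: measurable_ln.
rewrite (_ : [set x | _] = (fun x => ln (a x) / ln 4) @^-1` `[j%:~R, (j + 1)%:~R[).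
  by rewrite -[X in measurable X]setTI; apply: mt.
apply/seteqP; split => x /=; rewrite in_itv/=; first by move=> <-; exact: floor_itv.
by move=> h; apply: floor_def.
Qed.

Lemma geometric_nneseries_le (q : R) : 0 <= q -> q < 1 -> (\sum_(i <oo) (q ^+ i)%:E <= ((1 - q)^-1)%:E)%E.
Proof.
move=> q0 q1; apply: lime_le; first by apply: is_cvg_nneseries => n _ _; rewrite lee_fin exprn_ge0.
near=> n; rewrite sumEFin lee_fin -[leRHS]mul1r ler_pdivlMr ?subr_gt0// mulrC big_mkord.
have := subrX1 q n; have := exprn_ge0 n q0; move: (\sum_(i < n) q ^+ i) => S; lra.
Unshelve. all: by end_near. Qed.

End Dyadic.

(** Below the critical radius at x, all j share one maximal-function bound. Above it, j = l + 1 +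
    [dyad], so for fixed l the radii form one measurable function of x with lam = 4^(l+1); the
    supremum over l is replaced by the sum of p-th powers, a geometric series of ratio 4^(- dl). *)
Lemma max_nice (R : realType) (A p : R) : 0 < A -> 199 / 100 < p -> exists2 C : R, 0 < C &
  forall (K J : R -> R) (s : R) (u : R -> R) (sg : R) (f : R * R -> R) (B : R),
  kernel_pair A K J s -> measT u -> `|sg| = 1 -> nice f B ->
  exists G : R * R -> \bar R, [/\ measT G, forall X, (0 <= G X)%E,
    forall X (j : int), ((`|Top K (fun _ => (sg * 2 ^ j)%R) u f X| `^ p)%:E <= G X)%E &
    (\int[sleb2 R]_X G X
      <= C%:E * \int[sleb2 R]_X (`|f X| `^ p)%:E)%E].
Proof.
move=> A0 p199; have p1 : 1 < p by lra.
have p0 : 0 < p by lra.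
have [Ch Ch0 HCh] := HLr_strong p1.
have [C [dl [C0 dl0 HC]]] := Top_Lp A0 p199.
(* [Top_growth] with b = 4, the bound on s |u| 4^j in the small range. *)
pose c := A * (2 + 2 * 4 ^+ 2) * 2.
have c0 : 0 <= c by rewrite !mulr_ge0 ?(ltW A0)// addr_ge0// mulr_ge0// exprn_ge0.
pose q : R := 4 `^ (- dl).
have q0 : 0 <= q by exact: powR_ge0.
have q1 : q < 1 by rewrite /q -[ltRHS](powRr0 4); apply: ltr_powR; rewrite ?ltr1n// oppr_lt0.
have cC : 0 <= c `^ p * Ch * pi `^ p by rewrite !mulr_ge0 ?powR_ge0// ltW.
have cq : 0 < C / (1 - q) by rewrite divr_gt0// subr_gt0.
exists (c `^ p * Ch * pi `^ p + C / (1 - q)); first by rewrite ltr_wpDl.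
move=> K J s u sg f B kp mu_ sg1 nf.
have [s0 cK dJ bK bJ] := kp; have [mf fB fi] := nf.
have A0' := ltW A0.
have sg0 : sg != 0 by rewrite -normr_gt0 sg1.
pose mu2 := sleb2 R.
pose T (j : int) X := `|Top K (fun _ => sg * 2 ^ j) u f X|.
have mT j : measT (T j).
  by apply: measurableT_comp; [exact: normr_measurable|apply: (measurable_Top cK) => //; exact: measurable_cst].
have ma : measT (fun x => s * `|u x|) by meas.
(* The integers j are enumerated by naturals, so that the supremum over small radii is a measurable
   [sups]. *)
pose h (n : nat) X := if @unpickle int n is Some j then
  (if s * `|u X.1| * (2 ^ j) ^+ 2 < 4 then T j X else 0) else 0.
have mh n : measT (h n).
  rewrite /h; case: unpickle => [j|]; last exact: measurable_cst.
  by have m := mT j; meas.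
have hb n X : 0 <= h n X <= c * HLr (fun w => Npois s f w X.2) X.1.
  have H0 : 0 <= c * HLr (fun w => Npois s f w X.2) X.1 by rewrite mulr_ge0// HLr_ge0.
  rewrite /h; case: unpickle => [j|]; last by rewrite lexx.
  case: ifPn => [hj|_]; last by rewrite lexx.
  rewrite normr_ge0/=; apply: (Top_growth s0 A0' cK bK _ mu_ mf fB) => //=.
  by rewrite exprMn -(real_normK (num_real sg)) sg1 expr1n mul1r ltW.
pose g0 X := sups (fun n => h n X) 0%N.
have ub X : has_ubound (range (fun n => h n X)).
  by exists (c * HLr (fun w => Npois s f w X.2) X.1) => _ [n _ <-]; case/andP: (hb n X).
have hg n X : h n X <= g0 X.
  apply: ub_le_sup; last by exists n.
  by exists (c * HLr (fun w => Npois s f w X.2) X.1) => _ [m _ <-]; case/andP: (hb m X).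
have mg0 : measT g0 by apply: measurable_fun_sups => // X _; exact: ub.
have g00 X : 0 <= g0 X by apply: le_trans (hg 0%N X); case/andP: (hb 0%N X).
have g0b x y : 0 <= g0 (x, y) <= c * HLr (fun w => Npois s f w y) x.
  rewrite g00 /g0 /sups/=; apply: sup_le_ub; first by exists (h 0%N (x, y)), 0%N.
  by move=> _ [n _ <-]; case/andP: (hb n (x, y)).
have I0 := HL_Npois_Lp s0 mf fB p1 c0 (ltW Ch0) HCh mg0 g0b.
(* Where u vanishes every j is small, and radius 0 switches the operator off. *)
pose r l x := if u x == 0 then 0 else sg * (2 ^+ l * 2 ^ dyad (s * `|u x|)).
have mr l : measT (r l).
  have md : measT (fun x : R => (2 : R) ^ dyad (s * `|u x|)).
    exact: (@measurable_dyad _ _ _ _ _ (fun x : R => s * `|u x|) (fun j : int => (2 : R) ^ j) ma).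
  by rewrite /r; meas.
pose S l X := (`|Top K (r l.+1) u f X| `^ p)%:E.
have S0 l X : (0 <= S l X)%E by rewrite lee_fin powR_ge0.
have mS l : measT (S l).
  apply/measurable_EFinP; apply: (measurableT_comp (f := @powR R ^~ p)); first exact: measurable_powR.
  by apply: measurableT_comp; [exact: normr_measurable|exact: measurable_Top].
have IS l : (\int[mu2]_X S l X <= (C * q ^+ l)%:E * \int[mu2]_X (`|f X| `^ p)%:E)%E.
  have -> : C * q ^+ l = C * (4 ^+ l) `^ (- dl).
    by congr (C * _); rewrite -(powR_mulrn l q0) -(powR_mulrn l (ler0n R 4)) /q -!powRrM mulrC.
  have l1 : 1 <= 4 ^+ l.+1 :> R by rewrite exprn_ege1// ler1n.
  apply: (le_trans (HC K J s (r l.+1) u (4 ^+ l.+1) f B kp (mr _) mu_ l1 _ nf)).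
    move=> x; rewrite /r; case: ifPn; rewrite ?eqxx// => ux _.
    have a0 : 0 < s * `|u x| by rewrite mulr_gt0// normr_gt0.
    have := dyadP a0; rewrite !exprMn -(real_normK (num_real sg)) sg1 expr1n mul1r -exprM mulnC exprM.
    have -> : (2 ^+ 2 : R) = 4 by rewrite expr2 -natrM.
    have z0 : 0 <= 4 ^+ l.+1 :> R by rewrite exprn_ge0.
    move: (4 ^+ l.+1) z0 => z z0; move=> /andP[z1 z2]; rewrite [X in z <= X <= _]mulrCA.
    by rewrite ler_peMr//= (mulrC 4) ler_wpM2l// ltW.
  apply: lee_wpmul2r; first by int_ge0.
  rewrite lee_fin ler_wpM2l ?(ltW C0)// !powRN lef_pV2 ?posrE ?powR_gt0 ?exprn_gt0//.
  by rewrite ge0_ler_powR ?nnegrE ?exprn_ge0 ?(ltW dl0)// ler_eXn2l ?ltr1n.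
pose fp := (\int[mu2]_X (`|f X| `^ p)%:E)%E.
have {}IS l : (\int[mu2]_X S l X <= (C * q ^+ l)%:E * fp)%E by exact: IS.
have fp0 : (0 <= fp)%E by int_ge0.
have mg0p : measT (fun X => (g0 X `^ p)%:E).
  by apply/measurable_EFinP; apply: (measurableT_comp (f := @powR R ^~ p)) => //; exact: measurable_powR.
have mSS : measT (fun X => \sum_(l <oo) S l X)%E.
  by apply: ge0_emeasurable_sum => // l X _ _.
have SS0 X : (0 <= \sum_(l <oo) S l X)%E by apply: nneseries_ge0.
exists (fun X => (g0 X `^ p)%:E + \sum_(l <oo) S l X)%E; split.
- exact: emeasurable_funD.
- by move=> X; rewrite adde_ge0// lee_fin powR_ge0.
- move=> X j; have [hj|hj] := ltP (s * `|u X.1| * (2 ^ j) ^+ 2) 4.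
    apply: (@le_trans _ _ (g0 X `^ p)%:E); last by rewrite leeDl.
    rewrite lee_fin ge0_ler_powR ?nnegrE ?(ltW p0)//.
    by apply: le_trans (hg (pickle j) X); rewrite /h pickleK hj.
  have u0 : u X.1 != 0 by apply/eqP => u0; move: hj; rewrite u0 normr0 mulr0 mul0r; lra.
  have a0 : 0 < s * `|u X.1| by rewrite mulr_gt0// normr_gt0.
  have /andP[d1 d2] := dyadP a0.
  have dj : dyad (s * `|u X.1|) < j.
    rewrite ltNge; apply/negP => jd; have : (2 ^ j : R) <= 2 ^ dyad (s * `|u X.1|) by rewrite ler_eXz2l ?ltr1n.
    move=> le2; have : (2 ^ j : R) ^+ 2 <= (2 ^ dyad (s * `|u X.1|)) ^+ 2 by rewrite lerXn2r ?nnegrE ?exprz_ge0.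
    by move=> /(ler_wpM2l (ltW a0)) /(le_trans hj); rewrite leNgt d2.
  have [l jl] : exists l : nat, j = l.+1%:Z + dyad (s * `|u X.1|).
    exists (absz (j - dyad (s * `|u X.1|))).-1.
    by rewrite prednK ?absz_gt0 ?subr_eq0 ?gt_eqF// gtz0_abs ?subr_gt0// subrK.
  have -> : (`|Top K (fun _ => (sg * 2 ^ j)%R) u f X| `^ p)%:E = S l X.
    rewrite /S /Top; congr (`| _ | `^ _)%:E; apply: eq_Rintegral => W _; congr (_ * _).
    by rewrite /Tk /r (negPf u0) jl expfzDr// -exprnP.
  apply: (@le_trans _ _ (\sum_(m <oo) S m X)%E); last by rewrite leeDr// lee_fin powR_ge0.
  apply: le_trans (@nneseries_lim_ge _ _ xpredT 0%N l.+1 _) => //.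
  by rewrite big_nat_recr//= leeDr// sume_ge0.
rewrite ge0_integralD//; last by move=> X _; rewrite lee_fin powR_ge0.
rewrite integral_nneseries// EFinD ge0_muleDl ?lee_fin ?(ltW cq)//; apply: leeD; first exact: I0.
rewrite -/fp; move: fp fp0 IS => [v| |] // fp0 IS; last by rewrite mulr_infty gtr0_sg// mul1e leey.
apply: (@le_trans _ _ (\sum_(l <oo) ((C * v)%:E * (q ^+ l)%:E))%E).
  apply: lee_nneseries => [l _ _|l _]; first exact: integral_ge0.
  by apply: le_trans (IS l) _; rewrite -!EFinM lee_fin mulrAC.
rewrite nneseriesZl; last by move=> l _; rewrite lee_fin exprn_ge0.
apply: (@le_trans _ _ ((C * v)%:E * ((1 - q)^-1)%:E)%E).
  by apply: lee_wpmul2l; [rewrite lee_fin mulr_ge0// ltW|exact: geometric_nneseries_le].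
by rewrite -!EFinM mulrAC.
Qed.

(** * Operators along parabolas as iterated integrals *)

(** Whenever a part is infinite the extended integral is infinite, and [fine] sends it to 0. This
    default makes [Rintegral_scale] hold for every measurable function. *)
Lemma Rintegral_nonintegrable d (T : measurableType d) (R : realType) (nu : {measure set T -> \bar R}) (f : T -> R) :
  measT f -> ~ nu.-integrable setT (EFin \o f) -> \int[nu]_x f x = 0.
Proof.
move=> mf nf; rewrite /Rintegral integralE.
have p0 : (0 <= \int[nu]_x (fun x => (f x)%:E)^\+ x)%E by apply: integral_ge0 => x _; exact: funepos_ge0.
have n0 : (0 <= \int[nu]_x (fun x => (f x)%:E)^\- x)%E by apply: integral_ge0 => x _; exact: funeneg_ge0.
have [pf|] := boolP ((\int[nu]_x (fun x => (f x)%:E)^\+ x) \is a fin_num)%E; last first.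
  rewrite ge0_fin_numE// -leNgt leye_eq => /eqP ->.
  by move: n0; case: (\int[nu]_x _)%E.
have [qf|] := boolP ((\int[nu]_x (fun x => (f x)%:E)^\- x) \is a fin_num)%E; last first.
  rewrite ge0_fin_numE// -leNgt leye_eq => /eqP ->.
  by move: pf; case: (\int[nu]_x _)%E.
case: nf; apply/integrableP; split; first exact/measurable_EFinP.
have mE : measT (EFin \o f) by exact/measurable_EFinP.
rewrite (_ : (fun x => _) = (fun x => (EFin \o f)^\+ x + (EFin \o f)^\- x)%E); last exact: fune_abse.
rewrite ge0_integralD//; try by [move=> x _; exact: funepos_ge0|move=> x _; exact: funeneg_ge0|exact: measurable_funepos|exact: measurable_funeneg].
by rewrite lte_add_pinfty// -ge0_fin_numE.
Qed.

Lemma Rintegral_scale d (T : measurableType d) (R : realType) (nu : {measure set T -> \bar R}) (f : T -> R) (c : R) :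
  measT f -> \int[nu]_x (c * f x) = c * \int[nu]_x f x.
Proof.
move=> mf; have [fi|nfi] := pselect (nu.-integrable setT (EFin \o f)); first exact: RintegralZl.
rewrite (Rintegral_nonintegrable mf nfi) mulr0; have [->|c0] := eqVneq c 0.
  by under eq_Rintegral do rewrite mul0r; rewrite /Rintegral integral0.
apply: Rintegral_nonintegrable; first by apply: measurable_funM => //; exact: measurable_cst.
move=> cfi; apply: nfi; have := integrableZl measurableT c^-1 cfi.
by apply: eq_integrable => // x _ /=; rewrite -EFinM mulrA mulVf// mul1r.
Qed.

Section Parabola.
Variable R : realType.
Local Notation mu := (leb1 R).
Local Notation mu2 := (sleb2 R).

Definition para_arg (u : R -> R) (X w : R * R) : R * R := (X.1 - w.1, X.2 - u X.1 * w.1 ^+ 2 - w.2).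

(** One form for both operators: the weight a(t) is the indicator [box] for averages and 1/t cut off
    near 0 ([trunc_inv]) for the Hilbert transform; K acts in the second variable. *)
Definition para (a K u : R -> R) (f : R * R -> R) (X : R * R) : R :=
  \int[mu2]_w (a w.1 * (f (para_arg u X w) * K w.2)).

Definition para_abs (a K u : R -> R) (f : R * R -> R) (X : R * R) : \bar R :=
  (\int[mu2]_w `|a w.1 * (f (para_arg u X w) * K w.2)|%:E)%E.

Definition box (c t : R) : R := if `|t| <= c then 1 else 0.

Lemma measurable_box c : measT (box c).
Proof. by rewrite /box; meas. Qed.

Section Fixed.
Variables (a K u : R -> R) (f : R * R -> R).
Hypotheses (ma : measT a) (mK : measT K).
Hypotheses (mu_ : measT u) (mf : measT f).

Lemma measurable_para_arg : measT (fun z : (R * R) * (R * R) => para_arg u z.1 z.2).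
Proof. by rewrite /para_arg; meas. Qed.

Lemma measurable_para_fun : measT
  (fun z : (R * R) * (R * R) => a z.2.1 * (f (para_arg u z.1 z.2) * K z.2.2)).
Proof.
apply: measurable_funM; first by apply: (measurableT_comp ma); meas.
apply: measurable_funM; last by apply: (measurableT_comp mK); meas.
exact: (measurableT_comp mf measurable_para_arg).
Qed.

Lemma measurable_para_fun_at X : measT (fun w => a w.1 * (f (para_arg u X w) * K w.2)).
Proof.
by apply: (measurableT_comp measurable_para_fun (g := fun w => (X, w))); meas.
Qed.

Lemma para_integrable X : (para_abs a K u f X < +oo)%E ->
  mu2.-integrable setT (EFin \o (fun w => a w.1 * (f (para_arg u X w) * K w.2))).
Proof. by move=> h; apply: integrableP' h; exact: measurable_para_fun_at. Qed.

Lemma para_iter X : (para_abs a K u f X < +oo)%E ->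
  para a K u f X = \int[mu]_t (a t * \int[mu]_z (f (para_arg u X (t, z)) * K z)).
Proof.
move=> h; have fi := para_integrable h.
have m2 := measurable_para_fun_at X.
rewrite /para (@Rintegral_sfprod12 _ _ _ _ _ mu mu (fun t z => a t * (f (para_arg u X (t, z)) * K z))).
- congr Rintegral; apply/funext => t; apply: Rintegral_scale.
  apply: measurable_funM => //; apply: (measurableT_comp mf); rewrite /para_arg; meas.
- by apply: eq_measurable_fun m2 => -[].
- by have /integrableP[mE] := fi; rewrite sf_tonelli12//; exact: measurableT_comp.
Qed.

(** Pointwise |f| <= 1 + |f|^p, and the weight a(t) K(z) is integrable. For fixed (t, z), [para_arg]
    is a shear and translation in X, which preserves the measure, so the p-part is integrable in X
    and hence finite almost everywhere. *)
Lemma para_Lp_fin (p : R) : 1 <= p -> (\int[mu]_t `|a t|%:E < +oo)%E -> (\int[mu]_t `|K t|%:E < +oo)%E ->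
  (\int[mu2]_X (`|f X| `^ p)%:E < +oo)%E ->
  {ae mu2, forall X, (para_abs a K u f X < +oo)%E}.
Proof.
move=> p1 ai Ki fp.
have mfp : measT (fun X => (`|f X| `^ p)%:E).
  apply/measurable_EFinP; apply: (measurableT_comp (f := @powR R ^~ p)); first exact: measurable_powR.
  by apply: measurableT_comp; first exact: normr_measurable.
pose F (X w : R * R) : \bar R := ((`|a w.1| * `|K w.2|)%:E * (`|f (para_arg u X w)| `^ p)%:E)%E.
have F0 X w : (0 <= F X w)%E by rewrite mule_ge0// lee_fin ?mulr_ge0// powR_ge0.
have maK : measT (fun w : R * R => (`|a w.1| * `|K w.2|)%:E).
  apply/measurable_EFinP; apply: measurable_funM; apply: measurableT_comp => //; try exact: normr_measurable.
    exact: (measurableT_comp ma measurable_fst).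
  exact: (measurableT_comp mK measurable_snd).
have mF : measT (fun z : (R * R) * (R * R) => F z.1 z.2).
  apply: emeasurable_funM; first exact: (measurableT_comp maK measurable_snd).
  exact: (measurableT_comp mfp measurable_para_arg).
have shift w : (\int[mu2]_X (`|f (para_arg u X w)| `^ p)%:E = \int[mu2]_X (`|f X| `^ p)%:E)%E.
  have m1 : measT (fun X => (`|f (para_arg u X w)| `^ p)%:E).
    apply: (measurableT_comp mfp); apply: (measurableT_comp measurable_para_arg (g := fun X => (X, w))); meas.
  have P0 Y : (0 <= (`|f Y| `^ p)%:E)%E by rewrite lee_fin powR_ge0.
  rewrite (@sf_tonelli12 _ _ _ _ _ mu mu _ m1 (fun Y => P0 (para_arg u Y w))) (@sf_tonelli12 _ _ _ _ _ mu mu _ mfp P0).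
  have mH : measT (fun x => \int[mu]_y (`|f (x, y)| `^ p)%:E)%E.
    apply: (@meas_int _ _ _ _ _ mu (fun x y => (`|f (x, y)| `^ p)%:E)).
    - by apply: eq_measurable_fun mfp => -[].
    - by move=> x y; rewrite lee_fin powR_ge0.
  have H0 x : (0 <= \int[mu]_y (`|f (x, y)| `^ p)%:E)%E by int_ge0.
  rewrite -[RHS](@ge0_integral_shift R (- w.1) _ mH H0); apply: eq_integral => x _.
  rewrite -(@ge0_integral_shift R (- (u x * w.1 ^+ 2) - w.2)).
  - by apply: eq_integral => y _; rewrite /para_arg/= addrA.
  - by apply: (measurableT_comp mfp); meas.
  - by move=> y; rewrite lee_fin powR_ge0.
have aK : (\int[mu2]_w (`|a w.1| * `|K w.2|)%:E < +oo)%E.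
  have aK0 (w : R * R) : (0 <= (`|a w.1| * `|K w.2|)%:E)%E by rewrite lee_fin mulr_ge0.
  rewrite (@sf_tonelli12 _ _ _ _ _ mu mu _ maK aK0)/=.
  have nm (h : R -> R) : measT h -> measT (fun t => `|h t|%:E).
    by move=> mh; apply/measurable_EFinP; apply: measurableT_comp => //; exact: normr_measurable.
  have E t : (\int[mu]_y (`|a t| * `|K y|)%:E = `|a t|%:E * \int[mu]_y `|K y|%:E)%E.
    by under eq_integral do rewrite EFinM; rewrite intZ.
  under eq_integral do rewrite E.
  rewrite ge0_integralZr//; [|exact: nm|exact: integral_ge0].
  by rewrite lte_mul_pinfty//; [exact: integral_ge0|rewrite ge0_fin_numE// integral_ge0].
have Ifin : (\int[mu2]_X \int[mu2]_w F X w < +oo)%E.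
  rewrite (@tonelli _ _ _ _ _ mu2 mu2 F mF F0).
  have E w : (\int[mu2]_X F X w = (`|a w.1| * `|K w.2|)%:E * \int[mu2]_X (`|f X| `^ p)%:E)%E.
    have aK1 : 0 <= `|a w.1| * `|K w.2| by rewrite mulr_ge0.
    by rewrite /F (intZ mu2 setT _ aK1) shift.
  under eq_integral do rewrite E.
  have fp0 : (0 <= \int[mu2]_X (`|f X| `^ p)%:E)%E by int_ge0.
  have aK0 : (0 <= \int[mu2]_w (`|a w.1| * `|K w.2|)%:E)%E by int_ge0.
  rewrite ge0_integralZr//.
  by rewrite lte_mul_pinfty// ge0_fin_numE.
have iF : mu2.-integrable setT (fun X => \int[mu2]_w F X w)%E.
  apply/integrableP; split; first exact: (@meas_int _ _ _ _ _ mu2 F).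
  by under eq_integral do rewrite gee0_abs ?integral_ge0//.
have := integrable_ae measurableT iF; apply: filterS => X /(_ Logic.I) FX; rewrite /para_abs.
apply: (@le_lt_trans _ _ (\int[mu2]_w ((`|a w.1| * `|K w.2|)%:E + F X w))%E).
  apply: le_int0 => w _ //.
  rewrite /F -EFinM -EFinD lee_fin !normrM mulrA mulrAC -[X in X + _]mulr1 -mulrDr ler_wpM2l ?mulr_ge0//.
  have [f1|f1] := leP `|f (para_arg u X w)| 1; first by rewrite (le_trans f1)// lerDl powR_ge0.
  by rewrite (@le_trans _ _ (`|f (para_arg u X w)| `^ p)) ?lerDr// le1r_powR// ltW.
have mFX : measT (F X) by apply: (measurableT_comp mF (g := fun w => (X, w))); meas.
rewrite ge0_integralD//.
by rewrite lte_add_pinfty// -ge0_fin_numE// integral_ge0.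
Qed.
End Fixed.

Lemma poissonk_kernel_fin (A s : R) (K : R -> R) : 0 < s -> (forall t, `|K t| <= A * poissonk s t) ->
  (\int[mu]_t `|K t|%:E <= (pi * A)%:E)%E.
Proof.
move=> s0 bK; have p0 t : 0 <= poissonk s t by rewrite poissonk_ge0// ltW.
have A0 : 0 <= A.
  have := le_trans (normr_ge0 _) (bK 0); rewrite pmulr_lge0// /poissonk mulr0 expr0n addr0 divr1.
  exact: s0.
apply: (@le_trans _ _ (\int[mu]_t (A%:E * (poissonk s t)%:E))%E).
  by apply: le_int0 => t _ //; rewrite -EFinM lee_fin.
rewrite intZ//.
by rewrite integral_poissonk// -EFinM mulrC.
Qed.

Definition para_in (K u : R -> R) (f : R * R -> R) (X : R * R) (t : R) : R :=
  \int[mu]_z (f (para_arg u X (t, z)) * K z).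

Lemma measurable_para_in (K u : R -> R) (f : R * R -> R) X : measT K -> measT f ->
  measT (para_in K u f X).
Proof.
move=> mK mf; apply: (@meas_Rint _ _ _ _ _ mu (fun t z => f (para_arg u X (t, z)) * K z)).
apply: measurable_funM; last exact: (measurableT_comp mK measurable_snd).
by apply: (measurableT_comp mf); rewrite /para_arg; meas.
Qed.

Lemma Top_avg (A : R) (K J u : R -> R) (s e B : R) (f : R * R -> R) X :
  0 < A -> kernel_pair A K J s -> measT u -> measT f -> (forall X, `|f X| <= B) -> e != 0 ->
  Top K (fun _ => e) u f X = `|e|^-1 * \int[mu]_t (if 0 < t / e < 1 then para_in K u f X t else 0).
Proof.
move=> A0 kp mu_ mf fB e0; have [s0 cK dJ bK bJ] := kp.
have mK := continuous_meas cK; have mg := measurable_para_in u X mK mf.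
set g := para_in K u f X in mg *.
pose F w1 w2 := Tk K (fun _ => e) u X (w1, w2) * f (w1, w2).
have Ti := Tk_integrable A0 X kp (@measurable_cst _ _ _ _ setT e) mu_ mf fB.
have [mTi fTi] := integrableP _ _ _ Ti.
rewrite (_ : Top _ _ _ _ _ = \int[mu2]_z F z.1 z.2); last by congr Rintegral; apply/funext => -[].
rewrite (@Rintegral_sfprod12 _ _ _ _ _ mu mu F).
- have inner w1 : \int[mu]_w2 F w1 w2 = `|e|^-1 * (if 0 < (X.1 - w1) / e < 1 then g (X.1 - w1) else 0).
    rewrite /F /Tk/=; case: ifPn => h; last first.
      by rewrite mulr0; under eq_Rintegral do rewrite mul0r; rewrite /Rintegral integral0.
    under eq_Rintegral do rewrite -mulrA.
    have mKf : measT (fun w2 : R => K (X.2 - w2 - u X.1 * (X.1 - w1) ^+ 2) * f (w1, w2)).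
      apply: measurable_funM; first by apply: (measurableT_comp mK); meas.
      by apply: (measurableT_comp mf); meas.
    rewrite (Rintegral_scale mu _ mKf); congr (_ * _).
    have := @Rintegral_affine R (-1) (X.2 - u X.1 * (X.1 - w1) ^+ 2) (fun w2 : R => K (X.2 - w2 - u X.1 * (X.1 - w1) ^+ 2) * f (w1, w2)).
    rewrite oppr_eq0 oner_neq0 normrN1 invr1 mul1r => <- //.
    congr Rintegral; apply/funext => z; rewrite /para_arg/= mulrC; congr (f (_, _) * K _); ring.
  under eq_Rintegral do rewrite inner.
  have mh : measT (fun t : R => if 0 < t / e < 1 then g t else 0) by meas.
  have mhx : measT (fun w1 : R => if 0 < (X.1 - w1) / e < 1 then g (X.1 - w1) else 0).
    by apply: (measurableT_comp mh (g := fun w1 : R => X.1 - w1)); meas.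
  rewrite [LHS](Rintegral_scale mu `|e|^-1 mhx); congr (_ * _).
  exact: (Rintegral_reflect X.1 mh).
- move: mTi => /measurable_EFinP; apply: eq_measurable_fun => -[a b] _ //.
- by rewrite sf_tonelli12// in fTi; exact: measurableT_comp.
Qed.

(** The symmetric average is the sum of the two one-sided ones; the integrands differ at most at the
    points - c, 0 and c. *)
Lemma para_box_Top (A : R) (K J u : R -> R) (s c B : R) (f : R * R -> R) X :
  0 < A -> kernel_pair A K J s -> measT u -> measT f -> (forall X, `|f X| <= B) -> 0 < c ->
  para (box c) K u f X = c * (Top K (fun _ => c) u f X + Top K (fun _ => - c) u f X).
Proof.
move=> A0 kp mu_ mf fB c0; have [s0 cK dJ bK bJ] := kp.
have mK := continuous_meas cK; have mb := measurable_box c.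
have B0 : 0 <= B by exact: le_trans (fB (0, 0)).
have Ki := poissonk_kernel_fin s0 bK.
pose g := para_in K u f X.
have mg : measT g := measurable_para_in u X mK mf.
have mfK t : measT (fun z => f (para_arg u X (t, z)) * K z).
  apply: measurable_funM => //; apply: (measurableT_comp mf); rewrite /para_arg; meas.
have absg t : (\int[mu]_z `|f (para_arg u X (t, z)) * K z|%:E <= (B * (pi * A))%:E)%E.
  apply: (@le_trans _ _ (\int[mu]_z (B%:E * `|K z|%:E))%E).
    by apply: le_int0 => z _ //; rewrite -EFinM lee_fin normrM ler_wpM2r.
  by rewrite intZ// [leRHS]EFinM lee_wpmul2l.
have gB t : `|g t| <= B * (pi * A).
  by rewrite -lee_fin; apply: (le_trans (le_norm_Rintegral mu measurableT (mfK t))).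
have C0 : 0 <= B * (pi * A) by rewrite !mulr_ge0 ?(ltW A0)// pi_ge0.
have cN : - c != 0 by rewrite oppr_eq0 gt_eqF.
have TE := Top_avg X A0 kp mu_ mf fB.
rewrite (TE _ cN) (TE c) ?gt_eqF// -/g normrN (gtr0_norm c0) -mulrDr mulrA divff ?gt_eqF// mul1r.
have bnd (h : R -> R) : (forall t, `|h t| <= `|box c t * g t|) -> measT h -> mu.-integrable setT (EFin \o h).
  move=> hb mh; apply: integrableP' => //.
  apply: (@le_lt_trans _ _ (\int[mu]_t ((B * (pi * A))%:E * (if `|t| < c + 1 then 1 else 0)%:E))%E).
    apply: le_int0 => t _ //; rewrite -EFinM lee_fin; apply: le_trans (hb t) _.
    rewrite normrM mulrC; apply: ler_pM => //.
    rewrite /box; case: ifPn => h1; last by rewrite normr0; case: ifPn.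
    by rewrite normr1 ifT//; apply: le_lt_trans h1 _; rewrite ltrDl.
  rewrite intZ//.
  by rewrite indic_mass ?addr_ge0 ?(ltW c0)// -EFinM ltry.
have i1 : mu.-integrable setT (EFin \o (fun t => if 0 < t / c < 1 then g t else 0)).
  apply: bnd; last by meas.
  move=> t; case: ifPn => [/andP[h1 h2]|_]; last by rewrite normr0.
  rewrite /box ifT ?mul1r//; move: h1 h2; rewrite pmulr_lgt0 ?invr_gt0// ltr_pdivrMr// mul1r => h1 h2.
  by rewrite gtr0_norm// ltW.
have i2 : mu.-integrable setT (EFin \o (fun t => if 0 < t / (- c) < 1 then g t else 0)).
  apply: bnd; last by meas.
  move=> t; case: ifPn => [/andP[h1 h2]|_]; last by rewrite normr0.
  rewrite /box ifT ?mul1r//; move: h1 h2; rewrite invrN mulrN -mulNr pmulr_lgt0 ?invr_gt0// ltr_pdivrMr// mul1r => h1 h2.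
  by rewrite -normrN gtr0_norm// ltW.
have i0 : mu.-integrable setT (EFin \o (fun t => box c t * g t)).
  by apply: bnd; [|exact: measurable_funM].
rewrite -RintegralD// para_iter//; last first.
  rewrite /para_abs sf_tonelli12//; last first.
    by apply/measurable_EFinP; apply: measurableT_comp; [exact: normr_measurable|exact: measurable_para_fun_at].
  apply: (@le_lt_trans _ _ (\int[mu]_t ((B * (pi * A))%:E * (if `|t| < c + 1 then 1 else 0)%:E))%E).
    apply: le_int0 => t _; first exact: integral_ge0.
    rewrite /box/=; case: ifPn => h1; last first.
      rewrite (@eq_integral _ _ _ _ _ (cst 0%E)); first by rewrite integral0 mule_ge0// lee_fin; case: ifPn.
      by move=> z _; rewrite mul0r normr0.
    rewrite ifT; last by apply: le_lt_trans h1 _; rewrite ltrDl.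
    by rewrite mule1; under eq_integral do rewrite mul1r; exact: absg.
  rewrite intZ//.
  by rewrite indic_mass ?addr_ge0 ?(ltW c0)// -EFinM ltry.
rewrite -/g /Rintegral; congr fine; apply: ae_eq_integral => //.
- by apply/measurable_EFinP; exact: measurable_funM.
- by apply/measurable_EFinP; apply: measurable_funD; meas.
exists [set - c; 0; c]; split.
- by do 2 apply: measurableU => //.
- apply: countable_lebesgue_measure0; apply: finite_set_countable; exact: finite_set3.
move=> t; apply: contra_notP => h _ /=; congr EFin.
have t0 : t != 0 by apply/eqP => t0; apply: h; left; right.
have tc : t != c by apply/eqP => tc; apply: h; right.
have tc' : t != - c by apply/eqP => tc'; apply: h; left; left.
have ci : 0 < c^-1 by rewrite invr_gt0.
rewrite /box; have [tp|tn|/eqP] := ltrgt0P t; last by rewrite (negPf t0).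
- have -> : (0 < t / - c) = false by rewrite invrN mulrN oppr_gt0 pmulr_llt0// ltNge ltW.
  rewrite /= addr0 divr_gt0//= ltr_pdivrMr// mul1r le_eqVlt (negPf tc)/=.
  by case: ifPn; rewrite ?mul1r ?mul0r.
- have -> : (0 < t / c) = false by rewrite pmulr_lgt0// ltNge ltW.
  rewrite /= add0r invrN mulrN -mulNr divr_gt0 ?oppr_gt0//= ltr_pdivrMr// mul1r le_eqVlt eqr_oppLR (negPf tc')/=.
  by case: ifPn; rewrite ?mul1r ?mul0r.
Qed.

End Parabola.

(** * The maximal operator on Lp *)

Lemma lee_limn_einf (R : realType) (u v : (\bar R)^nat) : (forall n, u n <= v n)%E ->
  (limn_einf u <= limn_einf v)%E.
Proof.
move=> uv; rewrite !limn_einf_lim; apply: lee_lim; try exact: is_cvg_einfs.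
apply: nearW => n; apply: le_ereal_inf_tmp => _ [m /= nm <-]; apply: (@le_trans _ _ (u m)) => //.
by apply: ereal_inf_lbound; exists m.
Qed.

Section Maximal.
Variable R : realType.
Local Notation mu := (leb1 R).
Local Notation mu2 := (sleb2 R).

(** Cutting |f| both above and below makes an Lp function bounded and integrable, the latter because
    |f| <= (n + 1)^(p - 1) |f|^p where |f| >= 1 / (n + 1). *)
Definition level (f : R * R -> R) (n : nat) (X : R * R) : R :=
  if (n.+1%:R^-1 <= `|f X|) && (`|f X| <= n.+1%:R) then f X else 0.

Lemma level_le f n X : `|level f n X| <= `|f X|.
Proof. by rewrite /level; case: ifPn; rewrite ?normr0. Qed.

Lemma measurable_level f n : measT f -> measT (level f n).
Proof. by move=> mf; rewrite /level; meas. Qed.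

Lemma level_near f X : \forall n \near \oo, level f n X = f X.
Proof.
have [f0|f0] := eqVneq (f X) 0; first by apply: nearW => n; rewrite /level f0; case: ifPn.
have fp : 0 < `|f X| by rewrite normr_gt0.
near=> n; rewrite /level ifT//; apply/andP; split.
  rewrite invf_ple ?posrE//; apply: (@le_trans _ _ n%:R); last by rewrite ler_nat.
  by near: n; exact: nbhs_infty_ger.
apply: (@le_trans _ _ n%:R); last by rewrite ler_nat.
by near: n; exact: nbhs_infty_ger.
Unshelve. all: by end_near. Qed.

Lemma level_nice (f : R * R -> R) n (p : R) : 1 <= p -> measT f -> (\int[mu2]_X (`|f X| `^ p)%:E < +oo)%E ->
  nice (level f n) n.+1%:R.
Proof.
move=> p1 mf fp; split; first exact: measurable_level.
  by move=> X; rewrite /level; case: ifPn => [/andP[]//|_]; rewrite normr0.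
pose c : R := (n.+1%:R^-1) `^ (p - 1).
have c0 : 0 < c by rewrite powR_gt0.
apply: (@le_lt_trans _ _ (\int[mu2]_X ((c^-1)%:E * (`|f X| `^ p)%:E))%E).
  apply: le_int0 => X _ //; rewrite -EFinM lee_fin ler_pdivlMl// /level.
  case: ifPn => [/andP[h1 _]|_]; last by rewrite normr0 mulr0 powR_ge0.
  have f0 : 0 < `|f X| by apply: lt_le_trans h1.
  rewrite -(mulr_powRB1 (normr_ge0 _)) ?(lt_le_trans _ p1)// mulrC ler_wpM2l//.
  by rewrite /c ge0_ler_powR ?nnegrE ?subr_ge0.
have ci : 0 <= c^-1 by rewrite invr_ge0 ltW.
by rewrite (intZ mu2 setT _ ci) lte_mul_pinfty//; int_ge0.
Qed.

Lemma para_cvg (a K u : R -> R) (f : R * R -> R) X : measT a -> measT K ->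
  measT u -> measT f -> (para_abs a K u f X < +oo)%E ->
  para a K u (level f n) X @[n --> \oo] --> para a K u f X.
Proof.
move=> ma mK mu_ mf fin; have mfX := measurable_para_fun_at ma mK mu_ mf X.
apply: (@Rdominated_cvg _ _ _ mu2 _ _ (fun w => `|a w.1 * (f (para_arg u X w) * K w.2)|)) => //.
- move=> n; exact: (measurable_para_fun_at ma mK mu_ (measurable_level n mf)).
- move=> w; apply: cvg_near_cst; near=> n; congr (_ * (_ * _)).
  by near: n; exact: level_near.
- by move=> n w; rewrite !normrM ler_wpM2l// ler_wpM2r// level_le.
- have := para_integrable ma mK mu_ mf fin => /integrable_norm.
  by apply: eq_integrable.
Unshelve. all: by end_near. Qed.

(** The majorant is the lower limit of those for the truncations of f. At almost every X all the
    defining integrals converge absolutely, for all j simultaneously since these are countable, and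
    there each average is the limit of its truncations. *)
Lemma max_para_Lp (A p : R) : 0 < A -> 199 / 100 < p -> exists2 C : R, 0 < C &
  forall (K J : R -> R) (s : R) (u : R -> R) (f : R * R -> R),
  kernel_pair A K J s -> measT u -> measT f ->
  (\int[mu2]_X (`|f X| `^ p)%:E < +oo)%E ->
  exists G : R * R -> \bar R, [/\ measT G, forall X, (0 <= G X)%E,
    {ae mu2, forall X, forall j : int, (para_abs (box (2 ^ j)) K u f X < +oo)%E /\
       ((`|(2 ^ j)^-1 * para (box (2 ^ j)) K u f X| `^ p)%:E <= G X)%E} &
    (\int[mu2]_X G X <= C%:E * \int[mu2]_X (`|f X| `^ p)%:E)%E].
Proof.
move=> A0 p199; have [C C0 HC] := max_nice A0 p199.
have p1 : 1 <= p by lra.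
have p0 : 0 < p by lra.
exists (2 `^ p * (C + C)); first by rewrite mulr_gt0 ?powR_gt0// addr_gt0.
move=> K J s u f kp mu_ mf fp; have [s0 cK dJ bK bJ] := kp.
have mK := continuous_meas cK.
have nf n := level_nice n p1 mf fp.
have G1 n := HC K J s u 1 _ _ kp mu_ (normr1 _) (nf n).
have G2 n := HC K J s u (-1) _ _ kp mu_ (normrN1 _) (nf n).
have [g1 Hg1] := choice G1; have [g2 Hg2] := choice G2.
pose Gn n X := ((2 `^ p)%:E * (g1 n X + g2 n X))%E.
have mGn n : measT (Gn n).
  have [m1 _ _ _] := Hg1 n; have [m2 _ _ _] := Hg2 n.
  by apply: measurable_funeM; exact: emeasurable_funD.
have Gn0 n X : (0 <= Gn n X)%E.
  have [_ m1 _ _] := Hg1 n; have [_ m2 _ _] := Hg2 n.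
  by rewrite mule_ge0 ?lee_fin ?powR_ge0// adde_ge0.
have lp n : (\int[mu2]_X (`|level f n X| `^ p)%:E <= \int[mu2]_X (`|f X| `^ p)%:E)%E.
  apply: le_int0 => X _; first by rewrite lee_fin powR_ge0.
  by rewrite lee_fin ge0_ler_powR ?nnegrE ?(ltW p0)// level_le.
have fp0 : (0 <= \int[mu2]_X (`|f X| `^ p)%:E)%E by int_ge0.
have IGn n : (\int[mu2]_X Gn n X <= (2 `^ p * (C + C))%:E * \int[mu2]_X (`|f X| `^ p)%:E)%E.
  have [m1 z1 _ i1] := Hg1 n; have [m2 z2 _ i2] := Hg2 n.
  rewrite (intZ mu2 setT _ (powR_ge0 2 p)) (ge0_integralD mu2 measurableT (fun X _ => z1 X) m1 (fun X _ => z2 X) m2) EFinM -muleA; apply: lee_wpmul2l; first by rewrite lee_fin powR_ge0.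
  rewrite EFinD ge0_muleDl ?lee_fin ?(ltW C0)//; apply: leeD.
    by apply: (le_trans i1); apply: lee_wpmul2l; rewrite ?lee_fin ?(ltW C0).
  by apply: (le_trans i2); apply: lee_wpmul2l; rewrite ?lee_fin ?(ltW C0).
have mG : measT (fun X => limn_einf (Gn ^~ X)) 
  by apply: measurableT_comp; [exact: oppe_measurable|apply: measurable_fun_limn_esup => n; exact: measurableT_comp].
exists (fun X => limn_einf (Gn ^~ X)); split => //.
- by move=> X; apply: limn_einf_ge; apply: nearW.
- have fin (j : int) : {ae mu2, forall X, (para_abs (box (2 ^ j)) K u f X < +oo)%E}.
    apply: (para_Lp_fin (measurable_box _) mK mu_ mf p1 _ _ fp).
      apply: (@le_lt_trans _ _ (\int[mu]_t (if `|t| < 2 ^ j + 1 then 1 else 0)%:E)%E).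
        apply: le_int0 => t _ //; rewrite lee_fin /box; case: ifPn => h1; last by rewrite normr0; case: ifPn.
        by rewrite normr1 ifT//; apply: le_lt_trans h1 _; rewrite ltrDl.
      by rewrite indic_mass ?ltry// addr_ge0// exprz_ge0.
    by apply: le_lt_trans (poissonk_kernel_fin s0 bK) _; rewrite ltry.
  pose e (n : nat) : int := odflt 0 (unpickle n).
  have finA : {ae mu2, forall X, forall n : nat, (para_abs (box (2 ^ e n)) K u f X < +oo)%E}.
    by apply/ae_foralln => n; exact: fin.
  case: finA => N [mN N0 sN]; exists N; split => // X /= nP; apply: sN => /= HX; apply: nP => j.
  have fX : (para_abs (box (2 ^ j)) K u f X < +oo)%E by have := HX (pickle j); rewrite /e pickleK.
  split=> //.
  have cv := para_cvg (measurable_box (2 ^ j)) mK mu_ mf fX.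
  have j0 : 0 < 2 ^ j :> R by rewrite exprz_gt0.
  apply: le_trans (powR_limn_einf p0 (normr_ge0 _) (fun n => normr_ge0 ((2 ^ j)^-1 * para (box (2 ^ j)) K u (level f n) X)) _) _.
    by apply: cvg_norm; apply: cvgM => //; exact: cvg_cst.
  apply: lee_limn_einf => n.
  have [_ z1 b1 _] := Hg1 n; have [_ z2 b2 _] := Hg2 n; have [ml lB _] := nf n.
  rewrite (para_box_Top X A0 kp mu_ ml lB j0) mulrA mulVf ?gt_eqF// mul1r.
  move: (b1 X j) (b2 X j); rewrite mul1r mulN1r => {}b1 {}b2.
  apply: (@le_trans _ _ (2 `^ p * (`|Top K (fun _ => 2 ^ j) u (level f n) X| `^ p + `|Top K (fun _ => - 2 ^ j) u (level f n) X| `^ p))%:E).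
    rewrite lee_fin; apply: le_trans (powR_addr_le (normr_ge0 _) (normr_ge0 _) (ltW p0)).
    by rewrite ge0_ler_powR ?nnegrE ?addr_ge0 ?(ltW p0)// ler_normD.
  by rewrite EFinM EFinD; apply: lee_wpmul2l; [rewrite lee_fin powR_ge0|exact: leeD].
- apply: (@fatou_le _ _ R mu2 Gn (fun X => limn_einf (Gn ^~ X)) _ mGn Gn0 IGn) => // X.
  by apply: limn_einf_ge; apply: nearW.
Qed.

End Maximal.

(** * The Hilbert transform: large radii *)

Lemma ge0_integral_except (R : realType) (a b : R) (f g : R -> \bar R) :
  measT f -> measT g -> (forall x, 0 <= f x)%E -> (forall x, 0 <= g x)%E ->
  (forall x, x != a -> x != b -> f x = g x) ->
  (\int[leb1 R]_x f x = \int[leb1 R]_x g x)%E.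
Proof.
move=> mf mg f0 g0 fg; apply: ge0_ae_eq_integral => //.
exists [set a; b]; split.
- by apply: measurableU.
- by apply: countable_lebesgue_measure0; apply: finite_set_countable; exact: finite_set2.
move=> t; apply: contra_notP => h _ /=.
by apply: fg; apply/eqP => e; apply: h; [left|right].
Qed.

Section LargeAverage.
Variables (R : realType) (h : R -> R) (rho : R).
Local Notation mu := (leb1 R).
Hypotheses (rho0 : 0 < rho) (mh : measT h) (hi : (\int[mu]_t `|h t|%:E < +oo)%E).

Definition avg (r : R) : R := (r * rho)^-1 * \int[mu]_t (if 0 < t < r * rho then h t else 0).

Lemma measurable_avg : measT avg.
Proof.
have m : measT (fun r : R => \int[mu]_t (if 0 < t < r * rho then h t else 0)).
  apply: (@meas_Rint _ _ _ _ _ mu (fun r t : R => if 0 < t < r * rho then h t else 0)).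
  have mh2 : measT (fun z : R * R => h z.2) by exact: (measurableT_comp mh measurable_snd).
  by meas.
by rewrite /avg; meas.
Qed.

Lemma integral_gt_powR2 (c : R) : 0 < c -> (\int[mu]_r (if c < r then r `^ (-1 - 1) else 0)%:E = (c^-1)%:E)%E.
Proof.
move=> c0; have := powR_inty (@ltr01 R) c0; rewrite powR_inv1 ?(ltW c0)// divr1 => <-.
apply: (@ge0_integral_except R c c); try by [meas|move=> x; case: ifPn => _; rewrite lee_fin ?powR_ge0].
by move=> x xc _; rewrite le_eqVlt eq_sym (negPf xc).
Qed.

(** For t >= rho, 1 / t is the integral of 1 / (rho r^2) over r > t / rho. Exchanging integrals
    gives the integral over r >= 1 of avg(r) / r - avg(1) / r^2, and 1 / r^2 has integral 1. *)
Lemma integral_div_avg :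
  (`|\int[mu]_t (if rho <= t then h t / t else 0)|%:E <=
    \int[mu]_r (if 1 <= r then r^-1 * `|avg r| else 0)%:E + `|avg 1|%:E)%E.
Proof.
pose F (t r : R) := if (rho <= t) && (t < r * rho) then rho^-1 * (r `^ (-1 - 1)) * h t else 0.
have mF : measT (fun z : R * R => F z.1 z.2).
  rewrite /F; have mh1 : measT (fun z : R * R => h z.1) by exact: (measurableT_comp mh measurable_fst).
  by meas.
have FE t r : rho <= t -> F t r = rho^-1 * h t * (if t / rho < r then r `^ (-1 - 1) else 0).
  by move=> rt; rewrite /F rt/= ltr_pdivrMr//; case: ifPn => _; rewrite ?mulr0// mulrAC.
have int2 c : 0 < c -> mu.-integrable setT (EFin \o (fun r => if c < r then r `^ (-1 - 1) else 0)).
  move=> c0; apply: integrableP'; first by meas.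
  under eq_integral => r _.
    rewrite (_ : `|_| = if c < r then r `^ (-1 - 1) else 0); last by case: ifPn => _; rewrite ?normr0// ger0_norm// powR_ge0.
    over.
  by rewrite integral_gt_powR2// ltry.
have fin : (\int[mu]_t \int[mu]_r `|F t r|%:E < +oo)%E.
  apply: (@le_lt_trans _ _ (\int[mu]_t ((rho^-1)%:E * `|h t|%:E))%E); last first.
    rewrite intZ ?invr_ge0 ?(ltW rho0)//.
    by rewrite lte_mul_pinfty// lee_fin invr_ge0 ltW.
  apply: le_int0 => t _; first exact: integral_ge0.
  have [rt|rt] := leP rho t; last first.
    rewrite (eq_integral (cst 0%E)) ?integral0 ?mule_ge0 ?lee_fin ?invr_ge0 ?(ltW rho0)// => r _.
    by rewrite /F leNgt rt/= normr0.
  have t0 : 0 < t by exact: lt_le_trans rt.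
  have tr : 0 < t / rho by rewrite divr_gt0.
  apply: (@le_trans _ _ (\int[mu]_r ((rho^-1 * `|h t|)%:E * (if t / rho < r then r `^ (-1 - 1) else 0)%:E))%E).
    apply: le_int0 => r _ //; rewrite FE// !normrM normfV (gtr0_norm rho0) -EFinM lee_fin.
    by rewrite (ger0_norm (_ : 0 <= if _ then _ else 0))//; case: ifPn => // _; rewrite powR_ge0.
  rewrite intZ ?mulr_ge0 ?invr_ge0 ?(ltW rho0)//.
  rewrite integral_gt_powR2// -!EFinM lee_fin ler_piMr ?mulr_ge0 ?invr_ge0 ?(ltW rho0)//.
  by rewrite invf_div ler_pdivrMr// mul1r.
have E1 : \int[mu]_t \int[mu]_r F t r = \int[mu]_t (if rho <= t then h t / t else 0).
  congr Rintegral; apply/funext => t; have [rt|rt] := leP rho t; last first.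
    by under eq_Rintegral do rewrite /F leNgt rt/=; rewrite /Rintegral integral0.
  have tr : 0 < t / rho by rewrite divr_gt0// (lt_le_trans rho0).
  under eq_Rintegral do rewrite FE//.
  rewrite Rintegral_scale; last by meas.
  by rewrite /Rintegral integral_gt_powR2//= invf_div; field; rewrite !gt_eqF// (lt_le_trans rho0).
have pE r : 0 < r -> r `^ (-1 - 1) = r^-1 * r^-1.
  by move=> r0; rewrite powRD ?powR_inv1 ?(ltW r0)//; apply/implyP => _; rewrite gt_eqF.
have ih c : mu.-integrable setT (EFin \o (fun t => if 0 < t < c then h t else 0)).
  apply: integrableP'; first by meas.
  by apply: le_lt_trans hi; apply: le_int0 => t _ //; rewrite lee_fin; case: ifPn => // _; rewrite normr0.
have E2 r : \int[mu]_t F t r = if 1 <= r then r^-1 * avg r - r `^ (-1 - 1) * avg 1 else 0.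
  have [r1|r1] := leP 1 r; last first.
    rewrite /Rintegral (eq_integral (cst 0%E)) ?integral0// => t _; rewrite /F ifF//.
    apply/negP => /andP[a b]; have := le_lt_trans a b.
    by rewrite -[ltLHS]mul1r ltr_pM2r// ltNge ltW.
  have r0 : 0 < r by exact: lt_le_trans r1.
  have -> : \int[mu]_t F t r = \int[mu]_t (rho^-1 * (r `^ (-1 - 1)) *
      ((if 0 < t < r * rho then h t else 0) - (if 0 < t < 1 * rho then h t else 0))).
    congr Rintegral; apply/funext => t; rewrite /F mul1r.
    have [rt|rt] := leP rho t.
      by rewrite (lt_le_trans rho0 rt)/= subr0; case: ifPn; rewrite ?mulr0.
    rewrite /= andbT; case: (ltP 0 t) => t0 /=; last by rewrite subrr mulr0.
    by rewrite ifT ?subrr ?mulr0//; apply: lt_le_trans rt _; rewrite ler_peMl// ltW.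
  rewrite Rintegral_scale; last by meas.
  rewrite RintegralB// /avg pE// !mul1r.
  by field; rewrite !gt_eqF.
have mF2 : measT (fun r => \int[mu]_t F t r).
  apply: (@meas_Rint _ _ _ _ _ mu (fun r t => F t r)).
  by apply: (measurableT_comp mF (g := fun z : R * R => (z.2, z.1))); meas.
have ma := measurable_avg.
rewrite -E1 (@RFubini _ _ _ _ _ mu mu F mF fin).
apply: (le_trans (le_norm_Rintegral mu measurableT mF2)).
apply: (@le_trans _ _ (\int[mu]_r ((if 1 <= r then r^-1 * `|avg r| else 0)%:E +
    `|avg 1|%:E * (if 1 <= r then r `^ (-1 - 1) else 0)%:E))%E).
  apply: le_int0 => r _ //; rewrite E2 -EFinM -EFinD lee_fin.
  case: ifPn => [r1|_]; last by rewrite normr0 mulr0 addr0.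
  have r0 : 0 < r by exact: lt_le_trans r1.
  apply: le_trans (ler_normB _ _) _; rewrite !normrM normfV (gtr0_norm r0) (ger0_norm (powR_ge0 _ _)).
  by rewrite (mulrC _ (r `^ (-1 - 1))).
have n1 (r : R) : (0 <= (if 1 <= r then r^-1 * `|avg r| else 0)%:E)%E.
  by rewrite lee_fin; case: ifPn => // r1; rewrite mulr_ge0// invr_ge0 (le_trans ler01).
have n2 (r : R) : (0 <= (if 1 <= r then r `^ (-1 - 1) else 0)%:E)%E by rewrite lee_fin; case: ifPn => // _; rewrite powR_ge0.
have m1 : measT (fun r : R => (if 1 <= r then r^-1 * `|avg r| else 0)%:E).
  by have mi := @measurable_invr R; meas.
have m2 : measT (fun r : R => (if 1 <= r then r `^ (-1 - 1) else 0)%:E) by meas.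
rewrite ge0_integralD//; last 2 first.
- by move=> r _; rewrite mule_ge0.
- exact: measurable_funeM.
apply: leeD => //; rewrite intZ//.
by rewrite (powR_inty (@ltr01 R) (@ltr01 R)) powR1 divr1 mule1.
Qed.

End LargeAverage.

Section Large.
Variable R : realType.
Local Notation mu := (leb1 R).
Local Notation mu2 := (sleb2 R).

Lemma nice_slice (f : R * R -> R) (B x : R) (c : R -> R) : nice f B -> measT c ->
  (\int[mu]_t \int[mu]_z `|f (x - t, c t - z)|%:E = \int[mu2]_X `|f X|%:E)%E.
Proof.
move=> [mf _ _] mc.
have mn : measT (fun X => `|f X|%:E).
  by apply/measurable_EFinP; apply: measurableT_comp => //; exact: normr_measurable.
have n0 (X : R * R) : (0 <= `|f X|%:E)%E by rewrite lee_fin.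
rewrite (@sf_tonelli12 _ _ _ _ _ mu mu _ mn n0).
rewrite -(@ge0_integral_reflect R x (fun x => \int[mu]_y `|f (x, y)|%:E)%E).
- apply: eq_integral => t _; rewrite (@ge0_integral_reflect R (c t) (fun y => `|f (x - t, y)|%:E))//.
  by apply: (measurableT_comp mn); meas.
- apply: (@meas_int _ _ _ _ _ mu (fun x y => `|f (x, y)|%:E)) => //.
  by apply: eq_measurable_fun mn => -[].
- by move=> t; exact: integral_ge0.
Qed.

Lemma poissonk_le (s t : R) : 0 < s -> poissonk s t <= s.
Proof.
move=> s0; rewrite /poissonk ler_pdivrMr ?ltr_pwDl ?sqr_ge0// ler_peMr ?(ltW s0)//.
by rewrite lerDl sqr_ge0.
Qed.

Lemma para_abs_nice (a K u : R -> R) (f : R * R -> R) (B M N : R) X : nice f B ->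
  measT a -> measT K -> measT u ->
  (forall t, `|a t| <= N) -> (forall t, `|K t| <= M) -> (para_abs a K u f X < +oo)%E.
Proof.
move=> nf ma mK mu_ aN KM; have [mf fB fi] := nf.
have M0 : 0 <= M by exact: le_trans (KM 0).
have N0 : 0 <= N by exact: le_trans (aN 0).
have mX := measurable_para_fun_at ma mK mu_ mf X.
rewrite /para_abs (@sf_tonelli12 _ _ _ _ _ mu mu (fun w => `|a w.1 * (f (para_arg u X w) * K w.2)|%:E))//; last first.
  by apply/measurable_EFinP; apply: measurableT_comp => //; exact: normr_measurable.
have mc : measT (fun t : R => X.2 - u X.1 * t ^+ 2) by meas.
apply: (@le_lt_trans _ _ (\int[mu]_t ((N * M)%:E * \int[mu]_z `|f (X.1 - t, X.2 - u X.1 * t ^+ 2 - z)|%:E))%E).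
  apply: le_int0 => t _; first exact: integral_ge0.
  rewrite -intZ ?mulr_ge0//.
  apply: le_int0 => z _ //; rewrite -EFinM lee_fin !normrM /=.
  rewrite (mulrC `|f _|) mulrA ler_wpM2r//; exact: ler_pM.
rewrite intZ ?mulr_ge0//.
by rewrite (nice_slice _ nf mc) lte_mul_pinfty// lee_fin mulr_ge0.
Qed.

Lemma para_in_fin (K u : R -> R) (f : R * R -> R) (B M : R) X : nice f B ->
  measT K -> measT u -> (forall t, `|K t| <= M) ->
  (\int[mu]_t `|para_in K u f X t|%:E < +oo)%E.
Proof.
move=> nf mK mu_ KM; have [mf fB fi] := nf.
have m1 : measT (fun _ : R => 1 : R) by exact: measurable_cst.
have n1 (t : R) : `|1 : R| <= 1 by rewrite normr1.
have h := para_abs_nice X nf m1 mK mu_ n1 KM.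
apply: le_lt_trans h; have mX := measurable_para_fun_at m1 mK mu_ mf X.
rewrite /para_abs (@sf_tonelli12 _ _ _ _ _ mu mu (fun w => `|1 * (f (para_arg u X w) * K w.2)|%:E))//; last first.
  by apply/measurable_EFinP; apply: measurableT_comp => //; exact: normr_measurable.
apply: le_int0 => t _ //.
have mt : measT (fun z => f (para_arg u X (t, z)) * K z).
  by apply: measurable_funM => //; apply: (measurableT_comp mf); rewrite /para_arg; meas.
apply: (le_trans (le_norm_Rintegral mu measurableT mt)).
by apply: le_int0 => z _ //; rewrite mul1r.
Qed.

(** The critical radius, at which s |u(x)| rho^2 = 1. Where u(x) = 0 the power returns 0, so
    positivity of the radius encodes u(x) != 0. *)
Definition para_radius (s : R) (u : R -> R) (x : R) : R := (s * `|u x|) `^ (- 2^-1).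

Definition para_large (K : R -> R) (s : R) (u : R -> R) (sg : R) (f : R * R -> R) (X : R * R) : R :=
  \int[mu]_t (if (0 < para_radius s u X.1) && (para_radius s u X.1 <= t) then para_in K u f X (sg * t) / t else 0).

Lemma para_radius_sq s u x : 0 < s -> u x != 0 -> s * `|u x| * para_radius s u x ^+ 2 = 1.
Proof.
move=> s0 ux; have a0 : 0 < s * `|u x| by rewrite mulr_gt0// normr_gt0.
rewrite /para_radius -(powR_mulrn _ (powR_ge0 _ _)) -powRrM mulNr mulVf ?pnatr_eq0// powR_inv1 ?(ltW a0)//.
by rewrite divff// gt_eqF.
Qed.

Lemma para_radius_gt0 s u x : 0 < s -> (0 < para_radius s u x) = (u x != 0).
Proof.
move=> s0; rewrite /para_radius; have [->|ux] := eqVneq (u x) 0.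
  by rewrite normr0 mulr0 powR0 ?ltxx// oppr_eq0 invr_eq0 pnatr_eq0.
by rewrite powR_gt0// mulr_gt0// normr_gt0.
Qed.

(** Averages of radius r rho(x) have lam = r^2, so their p-th power integrals decay like r^(- 2 dl).
    Writing 1 / r = r^de r^(- de - 1) with de = 2 dl / p and applying Jensen to the finite measure
    r^(- de - 1) dr on r >= 1, of mass 1 / de, the factor r^(de p) cancels this decay exactly. *)
Lemma large_Lp (A p : R) : 0 < A -> 199 / 100 < p -> exists2 C : R, 0 < C &
  forall (K J : R -> R) (s : R) (u : R -> R) (sg : R) (f : R * R -> R) (B : R),
  kernel_pair A K J s -> measT u -> `|sg| = 1 -> nice f B ->
  (\int[mu2]_X (`|para_large K s u sg f X| `^ p)%:E <= C%:E * \int[mu2]_X (`|f X| `^ p)%:E)%E.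
Proof.
move=> A0 p199; have [C [dl [C0 dl0 HC]]] := Top_Lp A0 p199.
have p1 : 1 < p by lra.
have p0 : 0 < p by lra.
pose de := 2 * dl / p.
have de0 : 0 < de by rewrite divr_gt0 ?mulr_gt0.
pose Cl := (1 / de) `^ (p - 1) * (C * (1 / de)).
have Cl0 : 0 < Cl.
  have i0 : 0 < 1 / de by rewrite divr_gt0.
  by apply: mulr_gt0; [exact: powR_gt0|exact: mulr_gt0].
exists (2 `^ p * (Cl + C)); first by rewrite mulr_gt0 ?powR_gt0// addr_gt0.
move=> K J s u sg f B kp mu_ sg1 nf.
have [s0 cK dJ bK bJ] := kp; have [mf fB fi] := nf; have mK := continuous_meas cK.
have KM t : `|K t| <= A * s by apply: le_trans (bK t) _; rewrite ler_wpM2l ?(ltW A0)// poissonk_le.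
have sg0 : sg != 0 by rewrite -normr_gt0 sg1.
have sgsg : sg * sg = 1 by rewrite -expr2 -real_normK ?num_real// sg1 expr1n.
pose rho := para_radius s u.
have mrho : measT rho by rewrite /rho /para_radius; meas.
pose r_ (r x : R) := sg * (r * rho x).
pose Bo r X := Top K (r_ r) u f X.
have mr_ r : measT (r_ r) by rewrite /r_; meas.
have mBo : measT (fun z : R * (R * R) => Bo z.1 z.2).
  apply: (@meas_Rint _ _ _ _ _ mu2 (fun (z : R * (R * R)) W => Tk K (r_ z.1) u z.2 W * f W)).
  by rewrite /Tk /r_; meas.
pose fp := (\int[mu2]_X (`|f X| `^ p)%:E)%E.
have fp0 : (0 <= fp)%E by int_ge0.
have IB r : 1 <= r -> (\int[mu2]_X (`|Bo r X| `^ p)%:E <= (C * (r ^+ 2) `^ (- dl))%:E * fp)%E.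
  move=> r1; apply: (HC K J s (r_ r) u (r ^+ 2) f B kp (mr_ r) mu_ _ _ nf); first by rewrite exprn_ege1.
  move=> x; rewrite /r_ mulf_eq0 negb_or mulf_eq0 negb_or => /and3P[_ _ rx].
  have ux : u x != 0.
    by rewrite -(para_radius_gt0 u x s0) lt_neqAle powR_ge0 andbT eq_sym.
  rewrite !exprMn (expr2 sg) sgsg mul1r mulrCA para_radius_sq// mulr1 lexx/=.
  by rewrite ler_peMl ?sqr_ge0// ler1n.
have B1 : (\int[mu2]_X (`|Bo 1 X| `^ p)%:E <= C%:E * fp)%E.
  by have := IB 1 (lexx 1); rewrite expr1n powR1 mulr1.
pose W X := (\int[mu]_r (if (1 <= r)%R then r^-1 * `|Bo r X| else 0)%:E)%E.
have W0 X : (0 <= W X)%E.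
  by apply: integral_ge0 => r _; rewrite lee_fin; case: ifPn => // r1; rewrite mulr_ge0// invr_ge0 (le_trans ler01).
have LW X : (`|para_large K s u sg f X|%:E <= W X + `|Bo 1 X|%:E)%E.
  have [u0|ux] := eqVneq (u X.1) 0.
    have -> : para_large K s u sg f X = 0.
      rewrite /para_large; under eq_Rintegral do rewrite para_radius_gt0// u0 eqxx/=.
      by rewrite /Rintegral integral0.
    by rewrite normr0 adde_ge0.
  have rx : 0 < rho X.1 by rewrite /rho para_radius_gt0.
  pose h t := para_in K u f X (sg * t).
  have mh0 := measurable_para_in u X mK mf.
  have mh : measT h by apply: (measurableT_comp mh0); meas.
  have hi : (\int[mu]_t `|h t|%:E < +oo)%E.
    have fin := para_in_fin X nf mK mu_ KM.
    have mn : measT (fun t => `|para_in K u f X t|%:E) by meas.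
    have n0 t : (0 <= `|para_in K u f X t|%:E)%E by rewrite lee_fin.
    have E := @ge0_integral_affine R sg 0 _ sg0 mn n0.
    rewrite sg1 invr1 mul1e in E; rewrite -E in fin; apply: le_lt_trans fin.
    by apply: le_int0 => t _ //; rewrite addr0.
  have avgE r : 0 < r -> avg h (rho X.1) r = Bo r X.
    move=> r0; have rr : 0 < r * rho X.1 by rewrite mulr_gt0.
    have e0 : sg * (r * rho X.1) != 0 by rewrite mulf_neq0// gt_eqF.
    rewrite [RHS](Top_avg X A0 kp mu_ mf fB e0) /avg normrM sg1 mul1r (gtr0_norm rr); congr (_ * _).
    have mphi : measT (fun t : R => if 0 < t / (sg * (r * rho X.1)) < 1 then para_in K u f X t else 0) by meas.
    have := @Rintegral_affine R sg 0 _ sg0 mphi.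
    rewrite sg1 invr1 mul1r => <-; congr Rintegral; apply/funext => t; rewrite addr0.
    rewrite (_ : sg * t / _ = t / (r * rho X.1)); last by field; rewrite sg0 !gt_eqF.
    by rewrite pmulr_lgt0 ?invr_gt0// ltr_pdivrMr// mul1r.
  have := integral_div_avg rx mh hi.
  rewrite (avgE 1 ltr01) (_ : (\int[mu]_r _)%E = W X); last first.
    apply: eq_integral => r _; case: ifPn => // r1.
    by rewrite avgE// (lt_le_trans ltr01).
  apply: le_trans; rewrite lee_fin le_eqVlt; apply/orP; left; apply/eqP; congr `|_|.
  by congr Rintegral; apply/funext => t; rewrite rx.
have mBr r : measT (Bo r) by apply: (measurableT_comp mBo (g := fun X => (r, X))); meas.
have mBp r : measT (fun X => (`|Bo r X| `^ p)%:E).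
  apply/measurable_EFinP; apply: (measurableT_comp (f := @powR R ^~ p)); first exact: measurable_powR.
  by apply: measurableT_comp; first exact: normr_measurable.
have mW : measT W.
  apply: (@meas_int _ _ _ _ _ mu (fun X r => (if 1 <= r then r^-1 * `|Bo r X| else 0)%:E)).
    have mB' : measT (fun z : (R * R) * R => Bo z.2 z.1).
      by apply: (measurableT_comp mBo (g := fun z : (R * R) * R => (z.2, z.1))); meas.
    by have mi := @measurable_invr R; meas.
  by move=> X r; rewrite lee_fin; case: ifPn => // r1; rewrite mulr_ge0// invr_ge0 (le_trans ler01).
have mWp : measT (fun X => W X `^ p)%E.
  by apply: (measurableT_comp (f := fun x => x `^ p)%E) => //; exact: measurable_poweR.
have PW X : ((`|para_large K s u sg f X| `^ p)%:E <= (2 `^ p)%:E * (W X `^ p + (`|Bo 1 X| `^ p)%:E))%E.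
  move: (LW X) (W0 X); case: (W X) => [w| |] // h w0; last first.
    by rewrite poweRyr ?gt_eqF// addye// gt0_muley ?leey// lte_fin powR_gt0.
  rewrite poweR_EFin -EFinD -EFinM lee_fin; rewrite -EFinD !lee_fin in h w0.
  apply: le_trans (powR_addr_le w0 (normr_ge0 _) (ltW p0)).
  by rewrite ge0_ler_powR ?nnegrE ?addr_ge0 ?(ltW p0).
pose k (r : R) := if 1 <= r then r `^ (- de - 1) else 0.
have mk : measT k by rewrite /k; meas.
have k0 r : 0 <= k r by rewrite /k; case: ifPn => // _; rewrite powR_ge0.
have Ik : (\int[mu]_r (k r)%:E = (1 / de)%:E)%E by rewrite (powR_inty de0 (@ltr01 R)) powR1.
pose F (X : R * R) (r : R) := `|Bo r X| * r `^ de.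
have F0 X r : 0 <= F X r by rewrite mulr_ge0// powR_ge0.
have mF : measT (fun z : (R * R) * R => F z.1 z.2).
  have mB' : measT (fun z : (R * R) * R => Bo z.2 z.1).
    by apply: (measurableT_comp mBo (g := fun z : (R * R) * R => (z.2, z.1))); meas.
  by rewrite /F; meas.
have WE X : W X = (\int[mu]_r (F X r * k r)%:E)%E.
  apply: eq_integral => r _; rewrite /F /k; case: ifPn => [r1|_]; last by rewrite mulr0.
  have r0 : 0 < r by exact: lt_le_trans r1.
  rewrite -mulrA -powRD; last by apply/implyP => _; rewrite gt_eqF.
  by rewrite addrA subrr add0r powR_inv1 ?(ltW r0)// mulrC.
have IW : (\int[mu2]_X (W X `^ p) <= Cl%:E * fp)%E.
  have mG : measT (fun z : (R * R) * R => (F z.1 z.2 `^ p * k z.2)%:E) by meas.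
  have G0 X r : (0 <= (F X r `^ p * k r)%:E)%E by rewrite lee_fin mulr_ge0// powR_ge0.
  have d1 : 0 <= (1 / de) `^ (p - 1) by rewrite powR_ge0.
  apply: (@le_trans _ _ (\int[mu2]_X (((1 / de) `^ (p - 1))%:E * \int[mu]_r (F X r `^ p * k r)%:E))%E).
    apply: le_int0 => X _; first exact: poweR_ge0.
    rewrite WE; apply: jensen_kernel => //.
    - by apply: (measurableT_comp mF (g := fun r => (X, r))); meas.
    - by rewrite divr_ge0// ltW.
    - by rewrite Ik.
  rewrite (intZ mu2 setT _ d1) /Cl EFinM -muleA; apply: lee_wpmul2l; first by rewrite lee_fin.
  rewrite (@tonelli _ _ _ _ _ mu2 mu (fun X r => (F X r `^ p * k r)%:E) mG G0).
  apply: (@le_trans _ _ (\int[mu]_r ((C * k r)%:E * fp))%E); last first.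
    rewrite ge0_integralZr//; last 2 first.
    - by meas.
    - by move=> r _; rewrite lee_fin mulr_ge0// ltW.
    under eq_integral do rewrite EFinM.
    by rewrite intZ ?(ltW C0)// Ik EFinM.
  apply: le_int0 => r _; first by apply: integral_ge0.
  have [r1|r1] := leP 1 r; last first.
    have kr : k r = 0 by rewrite /k leNgt r1.
    under eq_integral do rewrite kr mulr0.
    by rewrite integral0 kr mulr0 mul0e.
  have r0 : 0 < r by exact: lt_le_trans r1.
  have c0 : 0 <= r `^ de `^ p * k r by rewrite mulr_ge0// powR_ge0.
  have -> : (\int[mu2]_X (F X r `^ p * k r)%:E = (r `^ de `^ p * k r)%:E * \int[mu2]_X (`|Bo r X| `^ p)%:E)%E.
    rewrite -(intZ mu2 setT _ c0); apply: eq_integral => X _.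
    by rewrite -EFinM /F powRM ?powR_ge0//; congr EFin; ring.
  apply: (@le_trans _ _ ((r `^ de `^ p * k r)%:E * ((C * (r ^+ 2) `^ (- dl))%:E * fp))%E).
    by apply: lee_wpmul2l; [rewrite lee_fin|exact: IB].
  rewrite muleA -EFinM le_eqVlt; apply/orP; left; apply/eqP; congr (_%:E * _)%E.
  rewrite -(powR_mulrn _ (ltW r0)) -!powRrM (_ : de * p = 2 * dl); last by rewrite /de divfK ?gt_eqF.
  rewrite (_ : 2%:R * - dl = - (2 * dl)); last by ring.
  rewrite powRN (_ : _ * _ * _ = r `^ (2 * dl) / r `^ (2 * dl) * (C * k r)); last by ring.
  by rewrite divff ?mul1r// gt_eqF// powR_gt0.
apply: (@le_trans _ _ (\int[mu2]_X ((2 `^ p)%:E * (W X `^ p + (`|Bo 1 X| `^ p)%:E)))%E).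
  by apply: le_int0 => X _; [rewrite lee_fin powR_ge0|exact: PW].
have n1 X : setT X -> (0 <= W X `^ p)%E by move=> _; exact: poweR_ge0.
have n2 X : setT X -> (0 <= (`|Bo 1 X| `^ p)%:E)%E by rewrite lee_fin powR_ge0.
rewrite (intZ mu2 setT _ (powR_ge0 2 p)) EFinM -muleA.
apply: lee_wpmul2l; first by rewrite lee_fin powR_ge0.
rewrite (ge0_integralD mu2 measurableT n1 mWp n2 (mBp 1)) EFinD ge0_muleDl ?lee_fin ?(ltW Cl0) ?(ltW C0)//.
exact: leeD.
Qed.
End Large.

(** * The Hilbert transform: small radii *)

Lemma Rintegral_except (R : realType) (a b : R) (f g : R -> R) :
  measT f -> measT g -> (forall x, x != a -> x != b -> f x = g x) ->
  \int[leb1 R]_x f x = \int[leb1 R]_x g x.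
Proof.
move=> mf mg fg; rewrite /Rintegral; congr fine; apply: ae_eq_integral => //; try exact/measurable_EFinP.
exists [set a; b]; split.
- by apply: measurableU.
- by apply: countable_lebesgue_measure0; apply: finite_set_countable; exact: finite_set2.
move=> t; apply: contra_notP => h _ /=.
by rewrite fg//; apply/eqP => e; apply: h; [left|right].
Qed.

Lemma integrable_boundedM d (T : measurableType d) (R : realType) (nu : {measure set T -> \bar R}) (m g : T -> R) (M : R) :
  0 <= M -> measT m -> measT g -> (forall t, `|m t| <= M) ->
  (\int[nu]_t `|g t|%:E < +oo)%E -> nu.-integrable setT (EFin \o (fun t => m t * g t)).
Proof.
move=> M0 mm mg mM gi; apply: integrableP'; first exact: measurable_funM.
apply: (@le_lt_trans _ _ (\int[nu]_t (M%:E * `|g t|%:E))%E).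
  by apply: le_int0 => x _ //; rewrite -EFinM lee_fin normrM ler_wpM2r.
rewrite intZ//.
by rewrite lte_mul_pinfty.
Qed.

Section Small.
Variable R : realType.
Local Notation mu := (leb1 R).
Local Notation mu2 := (sleb2 R).

(** The smoothed function on the horizontal line of height y: what the parabola sees when its
    curvature is neglected. *)
Definition strip (K : R -> R) (f : R * R -> R) (y w : R) : R := \int[mu]_z (f (w, y - z) * K z).

Definition trunc_inv (e t : R) : R := if e < `|t| then t^-1 else 0.

Lemma measurable_trunc_inv e : measT (trunc_inv e).
Proof. by have mi := @measurable_invr R; rewrite /trunc_inv; meas. Qed.

Lemma trunc_inv_bound e t : 0 < e -> `|trunc_inv e t| <= e^-1.
Proof.
move=> e0; rewrite /trunc_inv; case: ifPn => [h|_]; last by rewrite normr0 invr_ge0 ltW.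
by rewrite normfV lef_pV2 ?posrE//; [exact: ltW|exact: lt_trans h].
Qed.

Section Fixed.
Variables (A : R) (K J u : R -> R) (s B : R) (f : R * R -> R).
Hypotheses (A0 : 0 < A) (rp : regular_pair A K J s) (mu_ : measT u) (nf : nice f B).

Let s0 : 0 < s. Proof. by case: rp => -[]. Qed.
Let mK : measT K. Proof. by case: rp => -[_ cK _ _ _] _; exact: continuous_meas. Qed.
Let bK t : `|K t| <= A * poissonk s t. Proof. by case: rp => -[]. Qed.
Let p0 t : 0 <= poissonk s t. Proof. by rewrite poissonk_ge0// ltW. Qed.
Let KM t : `|K t| <= A * s. Proof. by apply: le_trans (bK t) _; rewrite ler_wpM2l ?(ltW A0)// poissonk_le. Qed.
Let mf : measT f. Proof. by case: nf. Qed.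
Let fB X : `|f X| <= B. Proof. by case: nf. Qed.
Let Ki : (\int[mu]_t `|K t|%:E < +oo)%E.
Proof. by apply: le_lt_trans (poissonk_kernel_fin s0 bK) _; rewrite ltry. Qed.

Let mstrip2 : measT (fun z : R * R => strip K f z.1 z.2).
Proof.
apply: (@meas_Rint _ _ _ _ _ mu (fun (z : R * R) t => f (z.2, z.1 - t) * K t)).
apply: measurable_funM; last exact: (measurableT_comp mK measurable_snd).
by apply: (measurableT_comp mf); meas.
Qed.

Lemma measurable_strip y : measT (strip K f y).
Proof. by apply: (measurableT_comp mstrip2 (g := fun w => (y, w))); meas. Qed.

Let mslice w y : measT (fun z : R => f (w, y - z)).
Proof. by apply: (measurableT_comp mf); meas. Qed.

Lemma poisson_average_Npois w y : (\int[mu]_z (`|f (w, y - z)| * poissonk s z)%:E = (Npois s f w y)%:E)%E.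
Proof.
rewrite (NpoisE s0 fB) -(@ge0_integral_reflect R y (fun z => (`|f (w, z)| * poissonk s (y - z))%:E)).
- by apply: eq_integral => z _; rewrite opprB addrCA subrr addr0.
- have mfw : measT (fun z : R => f (w, z)) by apply: (measurableT_comp mf); meas.
  have mp : measT (fun z : R => poissonk s (y - z)).
    by apply: (measurableT_comp (@measurable_poissonk R s)); meas.
  by meas.
- by move=> z; rewrite lee_fin mulr_ge0.
Qed.

Lemma strip_Npois y w : `|strip K f y w| <= A * Npois s f w y.
Proof.
rewrite -lee_fin; have m := measurable_funM (mslice w y) mK.
apply: (le_trans (le_norm_Rintegral mu measurableT m)).
rewrite EFinM -poisson_average_Npois -intZ ?(ltW A0)//.
apply: le_int0 => z _ //; rewrite -EFinM lee_fin normrM mulrCA ler_wpM2l//.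
Qed.

Lemma strip_bound y w : `|strip K f y w| <= A * (pi * B).
Proof.
apply: le_trans (strip_Npois y w) _; rewrite ler_wpM2l ?(ltW A0)//.
by have /andP[] := Npois_bound s0 fB w y.
Qed.

Lemma strip_para_in X t : strip K f X.2 (X.1 - t) = para_in K (fun _ => 0) f X t.
Proof. by congr Rintegral; apply/funext => z; rewrite /para_arg/= mul0r subr0. Qed.

Lemma strip_fin X : (\int[mu]_t `|strip K f X.2 (X.1 - t)|%:E < +oo)%E.
Proof.
under eq_integral do rewrite strip_para_in.
by apply: (para_in_fin X nf mK _ KM); exact: measurable_cst.
Qed.

Lemma strip_fin0 y : (\int[mu]_w `|strip K f y w|%:E < +oo)%E.
Proof.
have := strip_fin (0, y).
rewrite -(@ge0_integral_reflect R 0 (fun w => `|strip K f y w|%:E))//.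
by have m := measurable_strip y; meas.
Qed.

(** Moving the shift u t^2 from f onto K, the difference is that of two translates of K, at most s
    |u| t^2 <= 1 widths apart; the Lipschitz bound of [regular_pair] applies. *)
Lemma para_in_strip X t : s * `|u X.1| * t ^+ 2 <= 1 ->
  `|para_in K u f X t - strip K f X.2 (X.1 - t)| <= A * (s * `|u X.1| * t ^+ 2) * Npois s f (X.1 - t) X.2.
Proof.
move=> h; set v := - (u X.1 * t ^+ 2).
have sv : `|s * v| = s * `|u X.1| * t ^+ 2.
  by rewrite /v normrM normrN normrM (gtr0_norm s0) (ger0_norm (sqr_ge0 t)) mulrA.
have ms := mslice (X.1 - t) X.2.
have mKv : measT (fun z : R => K (z + v)) by apply: (measurableT_comp mK); meas.
have -> : para_in K u f X t = \int[mu]_z (f (X.1 - t, X.2 - z) * K (z + v)).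
  have := @Rintegral_affine R 1 (- v) (fun z => f (X.1 - t, X.2 - z) * K (z + v)) (oner_neq0 _) (measurable_funM ms mKv).
  rewrite normr1 invr1 mul1r => <-; congr Rintegral; apply/funext => z.
  rewrite /para_arg/= /v; congr (f (_, _) * K _); ring.
have KvM z : `|K (z + v)| <= A * s by exact: KM.
have iK (h0 : R -> R) : measT h0 -> (forall z, `|h0 z| <= A * s) -> (\int[mu]_z `|h0 z|%:E < +oo)%E ->
    mu.-integrable setT (EFin \o (fun z => f (X.1 - t, X.2 - z) * h0 z)).
  move=> mh hM hi; have B0 : 0 <= B by exact: le_trans (normr_ge0 _) (fB (0, 0)).
  exact (@integrable_boundedM _ _ R mu (fun z => f (X.1 - t, X.2 - z)) h0 B B0 ms mh (fun z => fB (X.1 - t, X.2 - z)) hi).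
have Kvi : (\int[mu]_z `|K (z + v)|%:E < +oo)%E.
  rewrite (@ge0_integral_shift R v (fun z => `|K z|%:E))//.
  by apply/measurable_EFinP; apply: measurableT_comp => //; exact: normr_measurable.
rewrite /strip -RintegralB//; try by apply: iK.
have md : measT (fun z : R => f (X.1 - t, X.2 - z) * K (z + v) - f (X.1 - t, X.2 - z) * K z).
  by apply: measurable_funB; exact: measurable_funM.
rewrite -lee_fin; apply: (le_trans (le_norm_Rintegral mu measurableT md)).
have c0 : 0 <= A * (s * `|u X.1| * t ^+ 2) by rewrite mulr_ge0 ?(ltW A0)// mulr_ge0 ?sqr_ge0// mulr_ge0// ltW.
rewrite EFinM -poisson_average_Npois -intZ//.
apply: le_int0 => z _ //; rewrite -EFinM lee_fin -mulrBr normrM mulrCA ler_wpM2l// -sv.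
by case: rp => _; apply; rewrite sv.
Qed.

End Fixed.
End Small.

(** * Decomposition of the truncated Hilbert transform *)

Section HilbertReal.
Variable R : realType.
Local Notation mu := (leb1 R).
Local Notation mu2 := (sleb2 R).

Lemma hilb_trunc_reflect (f : R -> R) x r : measT f ->
  hilb_trunc f x r = \int[mu]_t (trunc_inv r t * f (x - t)).
Proof.
move=> mf; have mi := @measurable_invr R.
have m : measT (fun w : R => if r < `|x - w| then f w / (x - w) else 0) by meas.
have := @Rintegral_affine R (-1) x _ _ m.
rewrite oppr_eq0 oner_neq0 normrN1 invr1 mul1r /hilb_trunc => <- //.
congr Rintegral; apply/funext => t; rewrite mulN1r (addrC (- t)) opprB addrCA subrr addr0 /trunc_inv.
by case: ifPn => _; rewrite ?mul0r// mulrC.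
Qed.

Definition shell_inv (e r t : R) : R := if (e < `|t|) && (`|t| <= r) then t^-1 else 0.

Lemma measurable_shell_inv2 e (r : R * R -> R) : measT r ->
  measT (fun z : (R * R) * R => shell_inv e (r z.1) z.2).
Proof.
move=> mr; have mr1 : measT (fun z : (R * R) * R => r z.1) by exact: (measurableT_comp mr measurable_fst).
by rewrite /shell_inv; meas.
Qed.

Lemma measurable_shell_inv e r : measT (shell_inv e r).
Proof. by have mi := @measurable_invr R; rewrite /shell_inv; meas. Qed.

Lemma trunc_inv_split e r t : e <= r -> trunc_inv e t = trunc_inv r t + shell_inv e r t.
Proof.
move=> er; rewrite /trunc_inv /shell_inv; have [rt|tr] := ltP r `|t|.
  by rewrite (le_lt_trans er rt)/= addr0.
by rewrite andbT add0r.
Qed.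

Definition para_err (K u : R -> R) (s e : R) (f : R * R -> R) (X : R * R) : R :=
  if e < para_radius s u X.1 then
    \int[mu]_t (shell_inv e (para_radius s u X.1) t * (para_in K u f X t - strip K f X.2 (X.1 - t)))
  else 0.

Section Fixed.
Variables (A : R) (K J u : R -> R) (s B : R) (f : R * R -> R).
Hypotheses (A0 : 0 < A) (rp : regular_pair A K J s) (mu_ : measT u) (nf : nice f B).

Let s0 : 0 < s. Proof. by case: rp => -[]. Qed.
Let mK : measT K. Proof. by case: rp => -[_ cK _ _ _] _; exact: continuous_meas. Qed.
Let bK t : `|K t| <= A * poissonk s t. Proof. by case: rp => -[]. Qed.
Let KM t : `|K t| <= A * s. Proof. by apply: le_trans (bK t) _; rewrite ler_wpM2l ?(ltW A0)// poissonk_le. Qed.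
Let mf : measT f. Proof. by case: nf. Qed.
Let rho := para_radius s u.
Let mrho : measT rho. Proof. by rewrite /rho /para_radius; meas. Qed.

Let g X t := para_in K u f X t.
Let g0 (X : R * R) t := strip K f X.2 (X.1 - t).
Let mg X : measT (g X). Proof. exact: measurable_para_in. Qed.
Let mg0 X : measT (g0 X).
Proof. by have m := measurable_strip rp nf X.2; apply: (measurableT_comp m); meas. Qed.
Let gi X : (\int[mu]_t `|g X t|%:E < +oo)%E. Proof. exact: (para_in_fin X nf mK mu_ KM). Qed.
Let g0i X : (\int[mu]_t `|g0 X t|%:E < +oo)%E. Proof. exact: (strip_fin A0 rp nf X). Qed.

Let mul_integrable (m h : R -> R) (M : R) : 0 <= M -> measT m -> measT h ->
  (forall t, `|m t| <= M) -> (\int[mu]_t `|h t|%:E < +oo)%E -> mu.-integrable setT (EFin \o (fun t => m t * h t)).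
Proof. by move=> M0 mm mh mM hi; exact (@integrable_boundedM _ _ R mu m h M M0 mm mh mM hi). Qed.

Let shell_bound e r t : 0 < e -> `|shell_inv e r t| <= e^-1.
Proof.
move=> e0; rewrite /shell_inv; case: ifPn => [/andP[h _]|_]; last by rewrite normr0 invr_ge0 ltW.
by rewrite normfV lef_pV2 ?posrE//; [exact: ltW|exact: lt_trans h].
Qed.

Lemma para_trunc_iter X e : 0 < e -> para (trunc_inv e) K u f X = \int[mu]_t (trunc_inv e t * g X t).
Proof.
move=> e0; rewrite para_iter//; first exact: measurable_trunc_inv.
apply: (para_abs_nice (M := A * s) (N := e^-1) X nf) => //; first exact: measurable_trunc_inv.
by move=> t; exact: trunc_inv_bound.
Qed.

Lemma outer_large X : 0 < rho X.1 ->
  \int[mu]_t (trunc_inv (rho X.1) t * g X t) = para_large K s u 1 f X - para_large K s u (-1) f X.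
Proof.
move=> r0; set r := rho X.1; have mi := @measurable_invr R; have mgX := mg X.
have ri : 0 < r^-1 by rewrite invr_gt0.
have bd (c : R -> bool) t : (c t -> r < `|t|) -> `|if c t then t^-1 else 0| <= r^-1.
  move=> h; case: ifPn => [/h ct|_]; last by rewrite normr0 ltW.
  by rewrite normfV lef_pV2 ?posrE//; [exact: ltW|exact: lt_trans ct].
have i1 : mu.-integrable setT (EFin \o (fun t => (if r < t then t^-1 else 0) * g X t)).
  apply: (mul_integrable (M := r^-1)) => //; [exact: ltW|by meas|move=> t; apply: (bd (fun t => r < t)) => h].
  by apply: lt_le_trans h _; exact: ler_norm.
have i2 : mu.-integrable setT (EFin \o (fun t => (if t < - r then t^-1 else 0) * g X t)).
  apply: (mul_integrable (M := r^-1)) => //; [exact: ltW|by meas|move=> t; apply: (bd (fun t => t < - r)) => h].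
  by rewrite -normrN; apply: lt_le_trans (ler_norm _); rewrite ltrNr.
have -> : \int[mu]_t (trunc_inv r t * g X t) =
    \int[mu]_t ((if r < t then t^-1 else 0) * g X t + (if t < - r then t^-1 else 0) * g X t).
  congr Rintegral; apply/funext => t; rewrite -mulrDl; congr (_ * _); rewrite /trunc_inv.
  have [t0|t0] := leP 0 t.
    by rewrite ger0_norm// (_ : (t < - r) = false) ?addr0//; apply/negbTE; rewrite -leNgt; apply: le_trans t0; rewrite oppr_le0 ltW.
  by rewrite ltr0_norm// (_ : (r < t) = false) ?add0r ?(ltrNr r)//; apply/negbTE; rewrite -leNgt; apply: le_trans (ltW t0) (ltW r0).
rewrite RintegralD//; congr (_ + _).
  apply: (@Rintegral_except R r r); [by meas| |].
    have m1 : measT (fun t : R => g X (1 * t)) by apply: (measurableT_comp mgX); meas.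
    by rewrite /g in m1; meas.
  move=> t tr _; rewrite mul1r r0/= le_eqVlt eq_sym (negPf tr)/=.
  by case: ifPn => _; rewrite ?mul0r// mulrC.
have m2 : measT (fun t : R => (if t < - r then t^-1 else 0) * g X t) by meas.
have := @Rintegral_affine R (-1) 0 _ _ m2.
rewrite oppr_eq0 oner_neq0 normrN1 invr1 mul1r => <- //.
have m1 : measT (fun t : R => para_in K u f X (-1 * t)) by apply: (measurableT_comp mgX); meas.
have m3 : measT (fun t : R => if (0 < r) && (r <= t) then para_in K u f X (-1 * t) / t else 0) by meas.
rewrite /para_large -[RHS]mulN1r -Rintegral_scale//.
apply: (@Rintegral_except R r r).
- by apply: (measurableT_comp m2); meas.
- by apply: measurable_funM.
move=> t tr _; rewrite addr0 !mulN1r ltrN2 r0/= -/r (le_eqVlt r t) eq_sym (negPf tr)/=.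
by case: ifPn => _; rewrite ?mul0r ?oppr0// invrN mulNr mulrC.
Qed.

(** Beyond rho the two half-lines give the large parts. Between e and rho the parabola is exchanged
    for the line, at the price of [para_err], and the line integral over this shell is a difference
    of two truncated Hilbert transforms. For u = 0 the parabola is already the line. *)
Lemma hilb_decomp X e : 0 < e -> (u X.1 == 0) || (e < rho X.1) ->
  `|para (trunc_inv e) K u f X| <=
    (`|para_large K s u 1 f X| + `|para_large K s u (-1) f X|) + (`|para_err K u s e f X| +
    (`|hilb_trunc (strip K f X.2) X.1 e| + `|hilb_trunc (strip K f X.2) X.1 (Num.max e (rho X.1))|)).
Proof.
move=> e0 cond; have mst := measurable_strip rp nf X.2.
rewrite para_trunc_iter//.
have [u0|ux] := eqVneq (u X.1) 0.
  have -> : \int[mu]_t (trunc_inv e t * g X t) = hilb_trunc (strip K f X.2) X.1 e.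
    rewrite (hilb_trunc_reflect _ _ mst); congr Rintegral; apply/funext => t; congr (_ * _).
    by rewrite strip_para_in /g /para_in /para_arg u0.
  have aux (a b c d e1 : R) : 0 <= a -> 0 <= b -> 0 <= c -> 0 <= e1 -> d <= a + b + (c + (d + e1)) by lra.
  exact: aux.
have er : e < rho X.1 by move: cond; rewrite (negPf ux).
have r0 : 0 < rho X.1 by exact: lt_trans er.
have ei : 0 <= e^-1 by rewrite invr_ge0 ltW.
have mx : Num.max e (rho X.1) = rho X.1 by apply/max_idPr; exact: ltW.
have te t : `|trunc_inv e t| <= e^-1 by exact: trunc_inv_bound.
have tr t : `|trunc_inv (rho X.1) t| <= (rho X.1)^-1 by exact: trunc_inv_bound.
have ri : 0 <= (rho X.1)^-1 by rewrite invr_ge0 ltW.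
have ts t : `|shell_inv e (rho X.1) t| <= e^-1 by exact: shell_bound.
have mte := @measurable_trunc_inv R e; have mtr := @measurable_trunc_inv R (rho X.1).
have mts := measurable_shell_inv e (rho X.1).
have mgX := mg X; have mg0X := mg0 X; have giX := gi X; have g0iX := g0i X.
have E (h : R -> R) : measT h -> (\int[mu]_t `|h t|%:E < +oo)%E ->
    \int[mu]_t (trunc_inv e t * h t) = \int[mu]_t (trunc_inv (rho X.1) t * h t) + \int[mu]_t (shell_inv e (rho X.1) t * h t).
  move=> mh hi; rewrite -RintegralD//; [|exact: (mul_integrable ri)|exact: (mul_integrable ei)].
  by congr Rintegral; apply/funext => t; rewrite (trunc_inv_split _ (ltW er)) mulrDl.
have -> : \int[mu]_t (trunc_inv e t * g X t) =
    (para_large K s u 1 f X - para_large K s u (-1) f X) + (para_err K u s e f X +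
    (hilb_trunc (strip K f X.2) X.1 e - hilb_trunc (strip K f X.2) X.1 (rho X.1))).
  rewrite E// outer_large//; congr (_ + _).
  rewrite !hilb_trunc_reflect// -/(g0 X) (E (g0 X))// [X in X - _]addrC addrK /para_err er.
  rewrite -[LHS](subrK (\int[mu]_t (shell_inv e (rho X.1) t * g0 X t))); congr (_ + _).
  rewrite -RintegralB//; try exact: (mul_integrable ei).
  by congr Rintegral; apply/funext => t; rewrite -mulrBr.
rewrite mx; apply: le_trans (ler_normD _ _) _; apply: lerD; first exact: ler_normB.
by apply: le_trans (ler_normD _ _) _; rewrite lerD2l; exact: ler_normB.
Qed.

(** The relative error s |u| t^2 = t^2 / rho^2 against 1 / |t| is at most 1 / rho on |t| <= rho.
    Integrating over a ball of radius 2 rho costs 4 rho times the maximal function. *)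
Lemma para_err_bound X e : 0 < e ->
  `|para_err K u s e f X| <= 4 * A * HLr (fun w => Npois s f w X.2) X.1.
Proof.
move=> e0; rewrite /para_err; case: ifPn => [er|_]; last by rewrite normr0 !mulr_ge0 ?HLr_ge0// ltW.
rewrite -/(rho X.1) in er *; have r0 : 0 < rho X.1 by exact: lt_trans er.
have ux : u X.1 != 0 by rewrite -(para_radius_gt0 u X.1 s0).
have mts := measurable_shell_inv e (rho X.1); have mgX := mg X; have mg0X := mg0 X.
have md : measT (fun t => shell_inv e (rho X.1) t * (g X t - g0 X t)).
  by apply: measurable_funM => //; exact: measurable_funB.
have [_ fB _] := nf.
have mN : measT (fun w => Npois s f w X.2).
  by apply: (measurableT_comp (measurable_Npois s mf) (g := fun w : R => (w, X.2))); meas.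
have NB w : 0 <= Npois s f w X.2 <= pi * B by exact: Npois_bound.
have N0 w : 0 <= Npois s f w X.2 by case/andP: (NB w).
rewrite -lee_fin; apply: (le_trans (le_norm_Rintegral mu measurableT md)).
have sq := para_radius_sq s0 ux; rewrite -/(rho X.1) in sq.
have ri : 0 <= (rho X.1)^-1 by rewrite invr_ge0 ltW.
have su : s * `|u X.1| = (rho X.1)^-1 / rho X.1.
  by apply: (@mulIf _ (rho X.1 ^+ 2)); rewrite ?expf_neq0 ?gt_eqF// sq; field; rewrite gt_eqF.
have c0 : 0 <= A / rho X.1 by rewrite divr_ge0 ?ltW.
apply: (@le_trans _ _ (\int[mu]_t ((A / rho X.1)%:E * (if `|X.1 - (X.1 - t)| < 2 * rho X.1 then Npois s f (X.1 - t) X.2 else 0)%:E))%E).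
  apply: le_int0 => t _ //; rewrite -EFinM lee_fin opprB addrCA subrr addr0 normrM /shell_inv.
  case: ifPn => [/andP[et tr]|_]; last by rewrite normr0 mul0r mulr_ge0//; case: ifPn.
  rewrite ifT; last by lra.
  have t0 : 0 < `|t| by exact: lt_trans et.
  have st : s * `|u X.1| * t ^+ 2 <= 1.
    by rewrite -sq ler_wpM2l ?mulr_ge0 ?(ltW s0)// -(real_normK (num_real t)) lerXn2r ?nnegrE ?(ltW r0).
  apply: (@le_trans _ _ (`|t^-1| * (A * (s * `|u X.1| * t ^+ 2) * Npois s f (X.1 - t) X.2))).
    by rewrite ler_wpM2l//; exact: (para_in_strip A0 rp nf st).
  rewrite [leLHS]mulrA ler_wpM2r// normfV su -(real_normK (num_real t)).
  rewrite (_ : `|t|^-1 * (A * ((rho X.1)^-1 / rho X.1 * `|t| ^+ 2)) = A / rho X.1 * (`|t| / rho X.1)); last by field; rewrite !gt_eqF.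
  by rewrite ler_piMr// ler_pdivrMr// mul1r.
rewrite intZ//.
rewrite (@ge0_integral_reflect R X.1 (fun w => (if `|X.1 - w| < 2 * rho X.1 then Npois s f w X.2 else 0)%:E)).
- have h := HLr_avg X.1 mN NB (mulr_gt0 (ltr0n R 2) r0).
  apply: (@le_trans _ _ ((A / rho X.1)%:E * (2 * (2 * rho X.1) * HLr (fun w => Npois s f w X.2) X.1)%:E)%E).
    by apply: lee_wpmul2l; rewrite ?lee_fin.
  rewrite -EFinM lee_fin le_eqVlt; apply/orP; left; apply/eqP; field; rewrite gt_eqF//.
- by meas.
- by move=> w; rewrite lee_fin; case: ifPn.
Qed.

End Fixed.
End HilbertReal.

(** * Lp bound for truncations along parabolas *)

Lemma Lp_add_le d (T : measurableType d) (R : realType) (nu : {measure set T -> \bar R})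
    (p c1 c2 : R) (I : \bar R) (F G H : T -> R) :
  0 < p -> 0 <= c1 -> 0 <= c2 -> (0 <= I)%E -> measT G -> measT H ->
  (forall x, `|F x| <= `|G x| + `|H x|) ->
  (\int[nu]_x (`|G x| `^ p)%:E <= c1%:E * I)%E -> (\int[nu]_x (`|H x| `^ p)%:E <= c2%:E * I)%E ->
  (\int[nu]_x (`|F x| `^ p)%:E <= (2 `^ p * (c1 + c2))%:E * I)%E.
Proof.
move=> p0 c10 c20 I0 mG mH FGH IG IH.
have mG' : measT (fun x => `|G x|) by apply: measurableT_comp => //; exact: normr_measurable.
have mH' : measT (fun x => `|H x|) by apply: measurableT_comp => //; exact: normr_measurable.
have h x : `|F x| <= 1 * `|G x| + 1 * `|H x| by rewrite !mul1r.
apply: (le_trans (integral_powR_addr_le nu (ltW p0) ler01 ler01 mG' mH' (fun x => normr_ge0 _) (fun x => normr_ge0 _) h)).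
have t0 : 0 <= 2 `^ p :> R by exact: powR_ge0.
rewrite powR1 mulr1 mulrDr [in leRHS]EFinD ge0_muleDl ?lee_fin ?mulr_ge0// [in leRHS]EFinM [X in (_ + X * I)%E]EFinM -!muleA.
exact: (leeD (lee_wpmul2l _ IG) (lee_wpmul2l _ IH)).
Qed.

Section HilbertLp.
Variable R : realType.
Local Notation mu := (leb1 R).
Local Notation mu2 := (sleb2 R).

Lemma measurable_para_in2 (K u : R -> R) (f : R * R -> R) : measT K -> measT u ->
  measT f -> measT (fun z : (R * R) * R => para_in K u f z.1 z.2).
Proof.
move=> mK mu_ mf.
apply: (@meas_Rint _ _ _ _ _ mu (fun (z : (R * R) * R) t => f (para_arg u z.1 (z.2, t)) * K t)).
apply: measurable_funM; last exact: (measurableT_comp mK measurable_snd).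
by apply: (measurableT_comp mf); rewrite /para_arg; meas.
Qed.

Lemma measurable_strip2 (K : R -> R) (f : R * R -> R) : measT K ->
  measT f -> measT (fun z : R * R => strip K f z.1 z.2).
Proof.
move=> mK mf; apply: (@meas_Rint _ _ _ _ _ mu (fun (z : R * R) t => f (z.2, z.1 - t) * K t)).
apply: measurable_funM; last exact: (measurableT_comp mK measurable_snd).
by apply: (measurableT_comp mf); meas.
Qed.

Lemma measurable_para_large K s u sg (f : R * R -> R) : measT K -> measT u ->
  measT f -> measT (para_large K s u sg f).
Proof.
move=> mK mu_ mf; have mr : measT (para_radius s u) by rewrite /para_radius; meas.
have mp := measurable_para_in2 mK mu_ mf.
apply: (@meas_Rint _ _ _ _ _ mu (fun (X : R * R) t =>
  if (0 < para_radius s u X.1) && (para_radius s u X.1 <= t) then para_in K u f X (sg * t) / t else 0)).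
have mpg : measT (fun z : (R * R) * R => para_in K u f z.1 (sg * z.2)).
  by apply: (measurableT_comp mp (g := fun z : (R * R) * R => (z.1, sg * z.2))); meas.
have mrx : measT (fun z : (R * R) * R => para_radius s u z.1.1).
  by apply: (measurableT_comp mr (g := fun z : (R * R) * R => z.1.1)); meas.
by meas.
Qed.

Lemma measurable_para_err K s u e (f : R * R -> R) : measT K -> measT u ->
  measT f -> measT (para_err K u s e f).
Proof.
move=> mK mu_ mf; have mr : measT (para_radius s u) by rewrite /para_radius; meas.
have mp := measurable_para_in2 mK mu_ mf; have ms := measurable_strip2 mK mf.
have mI : measT (fun X : R * R => \int[mu]_t (shell_inv e (para_radius s u X.1) t *
    (para_in K u f X t - strip K f X.2 (X.1 - t)))).
  apply: (@meas_Rint _ _ _ _ _ mu (fun (X : R * R) t => shell_inv e (para_radius s u X.1) t *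
    (para_in K u f X t - strip K f X.2 (X.1 - t)))).
  apply: measurable_funM.
    apply: (@measurable_shell_inv2 R e (fun X => para_radius s u X.1)).
    exact: (measurableT_comp mr measurable_fst).
  apply: measurable_funB; first exact: mp.
  by apply: (measurableT_comp ms (g := fun z : (R * R) * R => (z.1.2, z.1.1 - z.2))); meas.
rewrite /para_err; apply: measurable_fun_ifT => //.
by apply: measurable_fun_ltr; [exact: measurable_cst|exact: (measurableT_comp mr measurable_fst)].
Qed.

Lemma measurable_strip_trunc K (r : R -> R) (f : R * R -> R) : measT K -> measT r ->
  measT f -> measT (fun X : R * R => hilb_trunc (strip K f X.2) X.1 (r X.1)).
Proof.
move=> mK mr mf; have ms := measurable_strip2 mK mf; have mi := @measurable_invr R.
apply: (@meas_Rint _ _ _ _ _ mu (fun (X : R * R) t =>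
  if r X.1 < `|X.1 - t| then strip K f X.2 t / (X.1 - t) else 0)).
have ms' : measT (fun z : (R * R) * R => strip K f z.1.2 z.2).
  by apply: (measurableT_comp ms (g := fun z : (R * R) * R => (z.1.2, z.2))); meas.
have mrx : measT (fun z : (R * R) * R => r z.1.1).
  by apply: (measurableT_comp mr (g := fun z : (R * R) * R => z.1.1)); meas.
by meas.
Qed.

(** [hilb_trunc_Lp] on each horizontal line, where the strip function is bounded and integrable;
    then |strip| <= A [Npois] is integrated in y. *)
Lemma strip_trunc_Lp (A p : R) : 0 < A -> 1 < p -> exists2 C : R, 0 < C &
  forall (K J : R -> R) (s e : R) (r : R -> R) (f : R * R -> R) (B : R),
  regular_pair A K J s -> nice f B -> measT r -> 0 < e -> (forall x, e <= r x) ->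
  (\int[mu2]_X (`|hilb_trunc (strip K f X.2) X.1 (r X.1)| `^ p)%:E <= C%:E * \int[mu2]_X (`|f X| `^ p)%:E)%E.
Proof.
move=> A0 p1; have [C C0 HC] := hilb_trunc_Lp p1.
have p0 : 0 < p by exact: lt_trans p1.
exists (C * (A `^ p * pi `^ p)); first by rewrite !mulr_gt0 ?powR_gt0// pi_gt0.
move=> K J s e r f B rp nf mr e0 er; have [[s0 cK _ bK _] _] := rp; have [mf fB fi] := nf.
have mK := continuous_meas cK; have mh := measurable_strip_trunc mK mr mf.
have powm (h : R * R -> R) : measT h -> measT (fun X => (`|h X| `^ p)%:E).
  move=> m; apply/measurable_EFinP; apply: (measurableT_comp (f := @powR R ^~ p)); first exact: measurable_powR.
  by apply: measurableT_comp; first exact: normr_measurable.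
rewrite sf_tonelli21; last 2 first.
- by apply/measurable_EFinP; apply: (measurableT_comp (f := @powR R ^~ p)); [exact: measurable_powR|apply: measurableT_comp; [exact: normr_measurable|exact: mh]].
- by move=> X; rewrite lee_fin powR_ge0.
have N0 x y : 0 <= Npois s f x y by case/andP: (Npois_bound s0 fB x y).
apply: (@le_trans _ _ (\int[mu]_y ((C * A `^ p)%:E * \int[mu]_x (Npois s f x y `^ p)%:E))%E).
  apply: le_int0 => y _; first by int_ge0.
  have h := HC _ _ e r (measurable_strip rp nf y) (strip_bound A0 rp nf y) (strip_fin0 A0 rp nf y) e0 er.
  apply: (le_trans h); rewrite EFinM -muleA; apply: lee_wpmul2l; first by rewrite lee_fin ltW.
  rewrite -intZ ?powR_ge0//.
  apply: le_int0 => x _; first by rewrite lee_fin powR_ge0.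
  rewrite -EFinM lee_fin -powRM ?(ltW A0)//.
  by rewrite ge0_ler_powR ?nnegrE ?mulr_ge0 ?(ltW p0) ?(ltW A0)//; exact: (strip_Npois A0 rp nf).
rewrite intZ//; last by rewrite mulr_ge0 ?powR_ge0// ltW.
rewrite mulrA [X in (_ <= X * _)%E]EFinM -muleA; apply: lee_wpmul2l; first by rewrite lee_fin mulr_ge0 ?powR_ge0// ltW.
exact: (Npois_Lp s0 mf fB p1).
Qed.

(** The five terms of [hilb_decomp] are summed. Points where the truncation e exceeds a positive
    critical radius are set to 0; they disappear as e tends to 0, so the bound stays uniform in
    e. *)
Lemma para_trunc_Lp (A p : R) : 0 < A -> 199 / 100 < p -> exists2 C : R, 0 < C &
  forall (K J : R -> R) (s e : R) (u : R -> R) (f : R * R -> R) (B : R),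
  regular_pair A K J s -> measT u -> nice f B -> 0 < e ->
  (\int[mu2]_X (`|if (u X.1 == 0) || (e < para_radius s u X.1) then para (trunc_inv e) K u f X else 0| `^ p)%:E
   <= C%:E * \int[mu2]_X (`|f X| `^ p)%:E)%E.
Proof.
move=> A0 p199; have p1 : 1 < p by lra.
have p0 : 0 < p by lra.
have [C1 C10 H1] := large_Lp A0 p199; have [C2 C20 H2] := strip_trunc_Lp A0 p1.
have [Ch Ch0 HCh] := HLr_strong p1.
pose C3 := (4 * A) `^ p * Ch * pi `^ p.
have C30 : 0 <= C3 by rewrite !mulr_ge0 ?powR_ge0// ltW.
pose a := 2 `^ p * (C1 + C1); pose b := 2 `^ p * (C2 + C2); pose c := 2 `^ p * (C3 + b).
have t0 : 0 <= 2 `^ p :> R by exact: powR_ge0.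
have a0 : 0 <= a by rewrite mulr_ge0// addr_ge0// ltW.
have b0 : 0 <= b by rewrite mulr_ge0// addr_ge0// ltW.
have c0 : 0 <= c by rewrite mulr_ge0// addr_ge0.
exists (2 `^ p * (a + c) + 1); first by rewrite ltr_wpDl// mulr_ge0// addr_ge0.
move=> K J s e u f B rp mu_ nf e0; have [kp _] := rp; have [s0 cK _ bK _] := kp; have [mf fB fi] := nf.
have mK := continuous_meas cK.
pose I := (\int[mu2]_X (`|f X| `^ p)%:E)%E.
have I0 : (0 <= I)%E by int_ge0.
have mr : measT (para_radius s u) by rewrite /para_radius; meas.
have mmax : measT (fun x => Num.max e (para_radius s u x)) by apply: measurable_maxr => //; exact: measurable_cst.
have mL sg := measurable_para_large s sg mK mu_ mf.
have mE := measurable_para_err s e mK mu_ mf.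
have mh1 := measurable_strip_trunc mK (measurable_cst e) mf.
have mh2 := measurable_strip_trunc mK mmax mf.
have IL sg : `|sg| = 1 -> (\int[mu2]_X (`|para_large K s u sg f X| `^ p)%:E <= C1%:E * I)%E.
  by move=> sg1; exact: (H1 K J s u sg f B kp mu_ sg1 nf).
have IE : (\int[mu2]_X (`|para_err K u s e f X| `^ p)%:E <= C3%:E * I)%E.
  have mE' : measT (fun X => `|para_err K u s e f X|) by apply: measurableT_comp => //; exact: normr_measurable.
  apply: (HL_Npois_Lp s0 mf fB p1 _ (ltW Ch0) HCh mE'); first by rewrite mulr_ge0// ltW.
  move=> x y; have h := para_err_bound u A0 rp nf (x, y) e0.
  apply/andP; split; [exact: normr_ge0|exact h].
have Ih1 := H2 K J s e (fun _ => e) f B rp nf (@measurable_cst _ _ _ _ setT e) e0 (fun _ => lexx e).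
have emax x : e <= Num.max e (para_radius s u x) by rewrite le_max lexx.
have Ih2 := H2 K J s e _ f B rp nf mmax e0 emax.
have nn (x y : R) : `| `|x| + `|y| | <= `|x| + `|y| by rewrite ger0_norm ?addr_ge0.
have madd (G H : R * R -> R) : measT G -> measT H -> measT (fun X => `|G X| + `|H X|).
  by move=> mG mH; apply: measurable_funD; apply: measurableT_comp => //; exact: normr_measurable.
have add (d1 d2 : R) (F G H : R * R -> R) : 0 <= d1 -> 0 <= d2 -> measT G -> measT H ->
    (forall X, `|F X| <= `|G X| + `|H X|) -> (\int[mu2]_X (`|G X| `^ p)%:E <= d1%:E * I)%E ->
    (\int[mu2]_X (`|H X| `^ p)%:E <= d2%:E * I)%E -> (\int[mu2]_X (`|F X| `^ p)%:E <= (2 `^ p * (d1 + d2))%:E * I)%E.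
  by move=> d10 d20 mG mH FGH IG IH; exact: (@Lp_add_le _ _ R mu2 p d1 d2 I F G H p0 d10 d20 I0 mG mH FGH IG IH).
pose L1 := para_large K s u 1 f; pose L2 := para_large K s u (-1) f; pose E := para_err K u s e f.
pose h1 X := hilb_trunc (strip K f X.2) X.1 e; pose h2 X := hilb_trunc (strip K f X.2) X.1 (Num.max e (para_radius s u X.1)).
pose Fa X := `|L1 X| + `|L2 X|; pose Fb X := `|h1 X| + `|h2 X|; pose Fc X := `|E X| + `|Fb X|.
have mFb : measT Fb := madd _ _ mh1 mh2.
have mFc : measT Fc := madd _ _ mE mFb.
have mFa : measT Fa := madd _ _ (mL 1) (mL (-1)).
have Ia := add C1 C1 Fa L1 L2 (ltW C10) (ltW C10) (mL 1) (mL (-1)) (fun X => nn _ _) (IL 1 (normr1 _)) (IL (-1) (normrN1 _)).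
have Ib := add C2 C2 Fb h1 h2 (ltW C20) (ltW C20) mh1 mh2 (fun X => nn _ _) Ih1 Ih2.
have Ic := add C3 b Fc E Fb C30 b0 mE mFb (fun X => nn _ _) IE Ib.
apply: (le_trans (add a c (fun X => if (u X.1 == 0) || (e < para_radius s u X.1) then para (trunc_inv e) K u f X else 0)
  Fa Fc a0 c0 mFa mFc _ Ia Ic)).
  move=> X; case: ifPn => [cond|_]; last by rewrite normr0 addr_ge0.
  have := hilb_decomp A0 rp mu_ nf e0 cond.
  rewrite -/(L1 X) -/(L2 X) -/(E X) -/(h1 X) -/(h2 X).
  by rewrite (ger0_norm (_ : 0 <= Fa X)) ?addr_ge0// (ger0_norm (_ : 0 <= Fc X)) ?addr_ge0// /Fc
    (ger0_norm (_ : 0 <= Fb X)) ?addr_ge0.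
by apply: lee_wpmul2r => //; rewrite lee_fin lerDl.
Qed.

End HilbertLp.

(** * Null sets and Borel versions *)

Section NullSets.
Import HBNNSimple.
Context d (T : measurableType d) (R : realType).
Variable nu : {measure set T -> \bar R}.

(** A simple function below f keeps its integral when it is erased on N, and is then below g. Being
    an argument on simple functions, it covers arbitrary f and g. *)
Lemma ge0_le_integral_null (N : set T) (f g : T -> \bar R) : measurable N -> nu N = 0%E ->
  (forall x, 0 <= f x)%E -> (forall x, 0 <= g x)%E -> (forall x, ~ N x -> f x <= g x)%E ->
  (\int[nu]_x f x <= \int[nu]_x g x)%E.
Proof.
move=> mN N0 f0 g0 fg; rewrite [leLHS]ge0_integralTE//; apply: ge_ereal_sup => _ [h hf <-].
rewrite -integralT_nnsfun (ge0_negligible_integral mN measurableT _ _ N0)//; last 2 first.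
- by apply/measurable_EFinP; exact: measurable_funPT.
- by move=> x _; rewrite lee_fin; exact: fun_ge0.
rewrite integral_mkcond; apply: le_int0 => x _; rewrite patchE; case: ifPn => //.
- by move=> _; rewrite lee_fin; exact: fun_ge0.
- by rewrite inE => -[_ Nx]; apply: le_trans (hf x) (fg x Nx).
Qed.

Lemma ge0_integral_null (N : set T) (f g : T -> \bar R) : measurable N -> nu N = 0%E ->
  (forall x, 0 <= f x)%E -> (forall x, 0 <= g x)%E -> (forall x, ~ N x -> f x = g x) ->
  (\int[nu]_x f x = \int[nu]_x g x)%E.
Proof.
move=> mN N0 f0 g0 fg; apply/eqP; rewrite eq_le; apply/andP; split; apply: (ge0_le_integral_null mN N0) => // x Nx;
  by rewrite fg.
Qed.

Lemma Rintegral_null (N : set T) (f g : T -> R) : measurable N -> nu N = 0%E ->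
  (forall x, ~ N x -> f x = g x) -> \int[nu]_x f x = \int[nu]_x g x.
Proof.
move=> mN N0 fg; rewrite /Rintegral integralE [in RHS]integralE; congr (fine (_ - _)).
  by apply: (ge0_integral_null mN N0) => [x|x|x Nx]; rewrite ?funepos_ge0// !funeposE fg.
by apply: (ge0_integral_null mN N0) => [x|x|x Nx]; rewrite ?funeneg_ge0// !funenegE fg.
Qed.

(** Sets that agree with a Borel set off a null set form a sigma-algebra, and the generators of the
    completion belong to it. *)
Lemma completed_measurable (E : set T) : (completed_algebra_gen nu).-sigma.-measurable E ->
  exists A N, [/\ measurable A, measurable N, nu N = 0%E & forall x, ~ N x -> (E x <-> A x)].
Proof.
pose S := [set E : set T | exists A N, [/\ measurable A, measurable N, nu N = 0%E & forall x, ~ N x -> (E x <-> A x)]].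
suff : <<s completed_algebra_gen nu >> `<=` S by exact.
apply: smallest_sub => /=.
  split => /=.
  - by exists set0, set0; split.
  - move=> B [A [N [mA mN N0 BA]]]; exists (~` A), N; split => //; first exact: measurableC.
    by move=> x /BA h; split => [[_ nB] Ax|nA]; [apply: nB; apply/h|split => // Bx; apply: nA; apply/h].
  - move=> B SB; have [A /choice[N H]] := choice SB.
    exists (\bigcup_n A n), (\bigcup_n N n); split.
    + by apply: bigcupT_measurable => n; have [] := H n.
    + by apply: bigcupT_measurable => n; have [] := H n.
    + apply/negligibleP; first by apply: bigcupT_measurable => n; have [] := H n.
      by apply: negligible_bigcup => n; have [_ mN N0 _] := H n; apply/negligibleP.
    + move=> x Nx; have h n : B n x <-> A n x.
        by have [_ _ _] := H n; apply => Nnx; apply: Nx; exists n.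
      by split => -[n _ /h ?]; exists n.
move=> _ [A mA [N [M [mM M0 NM]]] <-]; exists A, M; split => // x Mx.
by split => [[//|/NM]//|]; left.
Qed.

(** Each superlevel set at a rational height agrees with a Borel set off a null set. Off the union
    of these countably many null sets, and with value 0 on it, the function has Borel superlevel
    sets. *)
Lemma borel_version (f : T -> R) : lebesgue_measurable nu f ->
  exists (g : T -> R) (N : set T), [/\ measT g, measurable N, nu N = 0%E & forall x, ~ N x -> f x = g x].
Proof.
move=> mf; pose q (n : nat) : R := ratr (odflt 0 (@unpickle rat n)).
have H0 n : exists A N, [/\ measurable A, measurable N, nu N = 0%E & forall x, ~ N x -> (q n < f x <-> A x)].
  apply: completed_measurable.
  rewrite (_ : (fun x => _) = setT `&` f @^-1` `]q n, +oo[).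
    by apply: mf => //; exact: measurable_itv.
  by apply/seteqP; split => x /=; rewrite in_itv/= andbT; [by []|by case].
have [A /choice[N H]] := choice H0.
pose NN := \bigcup_n N n.
have mNN : measurable NN by apply: bigcupT_measurable => n; have [] := H n.
have NN0 : nu NN = 0%E.
  apply/negligibleP => //; apply: negligible_bigcup => n.
  by have [_ mN N0 _] := H n; apply/negligibleP.
exists (fun x => if x \in NN then 0 else f x), NN; split => //; last by move=> x Nx; rewrite memNset.
apply: (measurability _ (RGenOInfty.measurableE R)) => //.
move=> _ [_ [a ->] <-]; rewrite setTI.
rewrite (_ : _ @^-1` _ = ((\bigcup_n (if a <= q n then A n else set0)) `\` NN) `|` (if a < 0 then NN else set0)).
  apply: measurableU; last by case: ifPn.
  apply: measurableD => //; apply: bigcupT_measurable => n; case: ifPn => // _.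
  by have [] := H n.
apply/seteqP; split => x /=; rewrite in_itv/= andbT.
  case: ifPn => [|]; rewrite (inE, notin_setE) => Nx; first by move=> a0; right; rewrite a0.
  move=> afx; left; split => //; have [r] := rat_in_itvoo afx; rewrite in_itv/= => /andP[ar rf].
  exists (pickle r) => //; have qr : q (pickle r) = ratr r by rewrite /q pickleK.
  rewrite qr ltW//; have [_ _ _ h] := H (pickle r); apply/(h x); last by rewrite qr.
  by move=> Nr; apply: Nx; exists (pickle r).
move=> [[[n _]]|].
  case: ifPn => // aq Ax Nx; rewrite memNset//; apply: le_lt_trans aq _.
  by have [_ _ _ h] := H n; apply/h => // Nn; apply: Nx; exists n.
by case: ifPn => // a0 Nx; rewrite mem_set.
Qed.

End NullSets.

(** * Complex values and Schwartz functions *)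

Section Complex.
Variable R : realType.
Local Notation mu := (leb1 R).
Local Notation mu2 := (sleb2 R).

Lemma para_lin (a K1 K2 u : R -> R) (f1 f2 : R * R -> R) (c : R) X :
  measT a -> measT K1 -> measT K2 -> measT u ->
  measT f1 -> measT f2 ->
  (para_abs a K1 u f1 X < +oo)%E -> (para_abs a K2 u f2 X < +oo)%E ->
  \int[mu]_t (a t * \int[mu]_z (f1 (para_arg u X (t, z)) * K1 z + c * (f2 (para_arg u X (t, z)) * K2 z)))
  = para a K1 u f1 X + c * para a K2 u f2 X.
Proof.
move=> ma mK1 mK2 mu_ mf1 mf2 fin1 fin2.
have i1 := para_integrable ma mK1 mu_ mf1 fin1; have i2 := para_integrable ma mK2 mu_ mf2 fin2.
have m1 := measurable_para_fun_at ma mK1 mu_ mf1 X; have m2 := measurable_para_fun_at ma mK2 mu_ mf2 X.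
have i2c : mu2.-integrable setT (EFin \o (fun w => c * (a w.1 * (f2 (para_arg u X w) * K2 w.2)))).
  by have := integrableZl measurableT c i2; apply: eq_integrable.
pose F t z := a t * (f1 (para_arg u X (t, z)) * K1 z + c * (f2 (para_arg u X (t, z)) * K2 z)).
have iF : mu2.-integrable setT (EFin \o (fun w => F w.1 w.2)).
  have := integrableD measurableT i1 i2c; apply: eq_integrable => // -[t z] _ /=.
  by rewrite -EFinD /F; congr EFin; ring.
have mF : measT (fun w : R * R => F w.1 w.2).
  by have [m _] := integrableP _ _ _ iF; apply/measurable_EFinP.
rewrite /para -(Rintegral_scale mu2 c m2) -RintegralD//.
rewrite (_ : \int[mu2]_w _ = \int[mu2]_w F w.1 w.2); last first.
  by congr Rintegral; apply/funext => -[t z] /=; rewrite /F; ring.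
rewrite (@Rintegral_sfprod12 _ _ _ _ _ mu mu F mF).
  congr Rintegral; apply/funext => t; rewrite /F; apply/esym/Rintegral_scale.
  have ms (f : R * R -> R) : measT f -> measT (fun z : R => f (para_arg u X (t, z))).
    by move=> mf; apply: (measurableT_comp mf); rewrite /para_arg; meas.
  have n1 := ms _ mf1; have n2 := ms _ mf2; by meas.
have [_ h] := integrableP _ _ _ iF; move: h.
rewrite (@sf_tonelli12 _ _ _ _ _ mu mu (fun w => `|(EFin \o (fun w => F w.1 w.2)) w|%E))//.
by apply: measurableT_comp => //; exact/measurable_EFinP.
Qed.

(** The explicit coefficient -1, and 1 in [ImM], lets [para_lin] serve real and imaginary parts
    alike. *)
Lemma ReM (a b : R[i]) : complex.Re (a * b) = complex.Re a * complex.Re b + -1 * (complex.Im a * complex.Im b).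
Proof. by case: a => a1 a2; case: b => b1 b2 /=; rewrite mulN1r. Qed.

Lemma ImM (a b : R[i]) : complex.Im (a * b) = complex.Re a * complex.Im b + 1 * (complex.Im a * complex.Re b).
Proof. by case: a => a1 a2; case: b => b1 b2 /=; rewrite mul1r. Qed.

Lemma LPproj_Re (phi : R -> R) (k : int) (f : R * R -> R[i]) (z : R * R) :
  complex.Re (LPproj phi k f z) = \int[mu]_t (complex.Re (f (z.1, z.2 - t)) * complex.Re (LPkernel phi k t)
     + -1 * (complex.Im (f (z.1, z.2 - t)) * complex.Im (LPkernel phi k t))).
Proof.
transitivity (\int[mu]_t complex.Re (f (z.1, z.2 - t) * LPkernel phi k t)); first by [].
by under eq_Rintegral do rewrite ReM.
Qed.

Lemma LPproj_Im (phi : R -> R) (k : int) (f : R * R -> R[i]) (z : R * R) :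
  complex.Im (LPproj phi k f z) = \int[mu]_t (complex.Re (f (z.1, z.2 - t)) * complex.Im (LPkernel phi k t)
     + 1 * (complex.Im (f (z.1, z.2 - t)) * complex.Re (LPkernel phi k t))).
Proof.
transitivity (\int[mu]_t complex.Im (f (z.1, z.2 - t) * LPkernel phi k t)); first by [].
by under eq_Rintegral do rewrite ImM.
Qed.

Lemma Rintegral_indic (D : set R) (h : R -> R) :
  \int[mu]_(t in D) h t = \int[mu]_t (if t \in D then h t else 0).
Proof.
by rewrite /Rintegral integral_mkcond; congr fine; apply: eq_integral => t _; rewrite patchE; case: ifPn.
Qed.

Lemma Rintegral_box (c : R) (g : R -> R) : \int[mu]_(t in `[- c, c]) g t = \int[mu]_t (box c t * g t).
Proof.
rewrite Rintegral_indic; congr Rintegral; apply/funext => t.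
by rewrite mem_setE in_itv/= -ler_norml /box; case: ifPn => _; rewrite ?mul1r ?mul0r.
Qed.

Lemma cintegral_box (c : R) (h : R -> R[i]) :
  cintegral `[- c, c] h = Complex (\int[mu]_t (box c t * complex.Re (h t))) (\int[mu]_t (box c t * complex.Im (h t))).
Proof. by rewrite /cintegral !Rintegral_box. Qed.

Lemma Rintegral_trunc (e : R) (g : R -> R) :
  \int[mu]_(t in [set t : R | e < `|t|]) (g t / t) = \int[mu]_t (trunc_inv e t * g t).
Proof.
rewrite Rintegral_indic; congr Rintegral; apply/funext => t.
rewrite (_ : (t \in _) = (e < `|t|)); last by apply/idP/idP; rewrite inE.
by rewrite /trunc_inv; case: ifPn => _; rewrite ?mul0r// mulrC.
Qed.

Lemma cintegral_trunc (e : R) (h : R -> R[i]) :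
  cintegral [set t : R | e < `|t|] (fun t => h t * (t^-1)%:C%C) =
  Complex (\int[mu]_t (trunc_inv e t * complex.Re (h t))) (\int[mu]_t (trunc_inv e t * complex.Im (h t))).
Proof.
rewrite /cintegral -(Rintegral_trunc e (fun t => complex.Re (h t))) -(Rintegral_trunc e (fun t => complex.Im (h t))).
by under eq_Rintegral do rewrite ReM /= mulr0 mulr0 addr0; under [X in Complex _ X]eq_Rintegral do rewrite ImM /= mulr0 add0r mul1r.
Qed.

Lemma cabs_le (z : R[i]) : cabs z <= `|complex.Re z| + `|complex.Im z|.
Proof.
case: z => a b; rewrite /cabs /=.
have ab : 0 <= `|a| + `|b| by rewrite addr_ge0.
rewrite -[leRHS](ger0_norm ab) -sqrtr_sqr ler_wsqrtr// sqrrD !real_normK ?num_real//.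
by rewrite -addrA (addrC (_ *+ 2)) addrA lerDl mulrn_wge0// mulr_ge0.
Qed.

Lemma Re_le_cabs (z : R[i]) : `|complex.Re z| <= cabs z.
Proof. by case: z => a b; rewrite /cabs /= -sqrtr_sqr ler_wsqrtr// lerDl sqr_ge0. Qed.

Lemma Im_le_cabs (z : R[i]) : `|complex.Im z| <= cabs z.
Proof. by case: z => a b; rewrite /cabs /= -sqrtr_sqr ler_wsqrtr// lerDr sqr_ge0. Qed.

Lemma cabs_ge0 (z : R[i]) : 0 <= cabs z.
Proof. by case: z => a b; rewrite /cabs /= sqrtr_ge0. Qed.

(** Passage from integrals of p-th powers to norms, with the pointwise comparison made off a Borel
    null set; the maximal function and the principal value enter as [F]. *)
Lemma Lnorm_dominated (p c : R) (F G : R * R -> \bar R) (h : R * R -> R) (N : set (R * R)) :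
  0 < p -> 0 <= c -> (forall X, 0 <= F X)%E -> (forall X, 0 <= G X)%E -> (forall X, 0 <= h X) ->
  measurable N -> mu2 N = 0%E -> (forall X, ~ N X -> F X `^ p <= G X)%E ->
  (\int[mu2]_X G X <= c%:E * \int[mu2]_X (h X `^ p)%:E)%E ->
  ('N[leb2 R]_(p%:E)[F] <= (c `^ p^-1)%:E * 'N[leb2 R]_(p%:E)[EFin \o h])%E.
Proof.
move=> p0 c0 F0 G0 h0 mN N0 FG IG; rewrite unlock.
have pi0 : 0 <= p^-1 by rewrite invr_ge0 ltW.
have I0 : (0 <= \int[mu2]_X (h X `^ p)%:E)%E by int_ge0.
have -> : (\int[leb2 R]_X (`|F X| `^ p) = \int[mu2]_X (F X `^ p))%E.
  by apply: eq_integral => X _; rewrite gee0_abs.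
have -> : (\int[leb2 R]_X (`|(EFin \o h) X| `^ p) = \int[mu2]_X (h X `^ p)%:E)%E.
  by apply: eq_integral => X _; rewrite /= ger0_norm.
rewrite -poweR_EFin -poweRM ?lee_fin//.
apply: gt0_ler_poweR => //; rewrite ?in_itv/= ?leey ?andbT.
- by apply: integral_ge0 => X _; exact: poweR_ge0.
- by rewrite mule_ge0.
by apply: le_trans IG; apply: (@ge0_le_integral_null _ _ R mu2 N (fun X => F X `^ p)%E G mN N0) => // X; exact: poweR_ge0.
Qed.

Lemma schwartz_continuous (f : R * R -> R) : schwartz_real f -> continuous f.
Proof. by move=> [sm _]; have [] := sm [::]. Qed.

Lemma measurable_int_pair (e : R -> int) (F : int -> R -> R) : (forall j, measurable [set x | e x = j]) ->
  (forall j, measT (F j)) -> measT (fun X : R * R => F (e X.1) X.2).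
Proof.
move=> me mF _ Y mY; rewrite setTI.
pose S n : set (R * R) := if @unpickle int n is Some j then [set x | e x = j] `*` (F j @^-1` Y) else set0.
rewrite (_ : _ @^-1` _ = \bigcup_n S n).
  apply: bigcupT_measurable => n; rewrite /S; case: unpickle => // j.
  by apply: measurableX => //; rewrite -[X in measurable X]setTI; exact: mF.
apply/seteqP; split => [X /= YX|X [n _]]; rewrite ?/S.
  by exists (pickle (e X.1)); [|rewrite /S pickleK].
by case: unpickle => // j [/= <-].
Qed.

(** Measurability for the product sigma-algebra: f is the limit of its values at (floor(n x) / n,
    y), which on countably many strips are continuous functions of y. *)
Lemma continuous_measurable_prod (f : R * R -> R) : continuous f -> measT f.
Proof.
move=> cf; pose e n (x : R) := Num.floor (n.+1%:R * x).
pose g n X := f ((e n X.1)%:~R / n.+1%:R, X.2).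
have mg n : measT (g n).
  apply: (measurable_int_pair (e := e n) (F := fun j y => f (j%:~R / n.+1%:R, y))) => j.
    rewrite (_ : [set x | _] = (fun x : R => n.+1%:R * x) @^-1` `[j%:~R, (j + 1)%:~R[).
      by rewrite -[X in measurable X]setTI; apply: (mulrl_measurable).
    apply/seteqP; split => x /=; rewrite in_itv/= /e; first by move=> <-; exact: floor_itv.
    by move=> h; apply: floor_def.
  apply: continuous_meas => y; have cy : (fun z : R => (j%:~R / n.+1%:R : R, z)) z @[z --> y] --> (j%:~R / n.+1%:R : R, y).
    have c1 : (j%:~R / n.+1%:R : R) @[z --> y] --> (j%:~R / n.+1%:R : R) by exact: cvg_cst.
    have c2 : z @[z --> y] --> (y : R) by exact: cvg_id.
    exact: (cvg_pair c1 c2).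
  exact: (cvg_comp _ _ cy (cf _)).
apply: (measurable_fun_cvg mg) => X _; rewrite /g.
have -> : f X = f (X.1, X.2) by case: X.
suff c1 : ((e n X.1)%:~R / n.+1%:R : R) @[n --> \oo] --> (X.1 : R).
  have cn : (fun n : nat => ((e n X.1)%:~R / n.+1%:R : R, X.2)) n @[n --> \oo] --> (X.1, X.2).
    have c2 : X.2 @[n --> \oo] --> (X.2 : R) by exact: cvg_cst.
    exact: (cvg_pair c1 c2).
  exact: (cvg_comp _ _ cn (cf _)).
apply/cvgrPdist_le => /= eps e0; near=> n.
have n0 : 0 < n.+1%:R :> R by rewrite ltr0n.
have /andP[h1 h2] := floor_itv (n.+1%:R * X.1); rewrite -/(e n X.1) in h1 h2.
have en : n.+1%:R^-1 <= eps.
  rewrite invf_ple ?posrE//; apply: (@le_trans _ _ n%:R); last by rewrite ler_nat.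
  by near: n; exact: nbhs_infty_ger.
apply: le_trans en; rewrite (_ : X.1 - _ = (n.+1%:R * X.1 - (e n X.1)%:~R) / n.+1%:R); last by field; rewrite gt_eqF.
rewrite normrM normfV (gtr0_norm n0) ler_piMl ?invr_ge0 ?(ltW n0)//.
by rewrite rmorphD/= in h2; rewrite ger0_norm; lra.
Unshelve. all: by end_near. Qed.

(** The four weights 1, x^2, y^2 and x^2 y^2 add up to (1 + x^2)(1 + y^2), so f is dominated by a
    product of two Poisson kernels. *)
Lemma schwartz_nice (f : R * R -> R) : schwartz_real f -> exists B, nice f B.
Proof.
move=> sf; have cf := schwartz_continuous sf; have [_ bd] := sf.
have [B0 H00] := bd 0%N 0%N [::]; have [B1 H20] := bd 2%N 0%N [::].
have [B2 H02] := bd 0%N 2%N [::]; have [B3 H22] := bd 2%N 2%N [::].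
exists B0; have mf := continuous_measurable_prod cf.
split => //.
  by move=> X; have := H00 X; rewrite !expr0 !mul1r.
pose C := B0 + B1 + B2 + B3.
have fC X : `|f X| <= C * (poissonk 1 X.1 * poissonk 1 X.2).
  rewrite /poissonk !mul1r mulrA -!mulrA -invfM ler_pdivlMr; last first.
    by apply: mulr_gt0; rewrite ltr_pwDl ?sqr_ge0.
  have := H00 X; have := H20 X; have := H02 X; have := H22 X; rewrite /= !expr0 !mul1r !mulr1 !normrM.
  rewrite /C -(real_normK (num_real X.1)) -(real_normK (num_real X.2)).
  rewrite (_ : `|f X| * _ = `|f X| + `|X.1| * `|X.1| * `|f X| + `|X.2| * `|X.2| * `|f X|
    + `|X.1| * `|X.1| * (`|X.2| * `|X.2|) * `|f X|); last by ring.
  lra.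
have C0 : 0 <= C.
  have B_ge0 a b B : (forall z : R * R, `|z.1 ^+ a * z.2 ^+ b * iter_partial [::] f z| <= B) -> 0 <= B.
    by move=> /(_ (0, 0)); apply: le_trans.
  by rewrite /C !addr_ge0 ?(B_ge0 _ _ _ H00) ?(B_ge0 _ _ _ H20) ?(B_ge0 _ _ _ H02) ?(B_ge0 _ _ _ H22).
have p0 (t : R) : 0 <= poissonk 1 t by rewrite poissonk_ge0.
have mp := @measurable_poissonk R 1.
have mp1 : measT (fun X : R * R => poissonk 1 X.1) by exact: (measurableT_comp mp measurable_fst).
have mp2 : measT (fun X : R * R => poissonk 1 X.2) by exact: (measurableT_comp mp measurable_snd).
apply: (@le_lt_trans _ _ (\int[mu2]_X (C * (poissonk 1 X.1 * poissonk 1 X.2))%:E)%E).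
  by apply: le_int0 => X _ //; rewrite lee_fin.
have mP : measT (fun X : R * R => (C * (poissonk 1 X.1 * poissonk 1 X.2))%:E) by meas.
have P0 (X : R * R) : (0 <= (C * (poissonk 1 X.1 * poissonk 1 X.2))%:E)%E by rewrite lee_fin; apply: mulr_ge0 => //; exact: mulr_ge0.
rewrite (@sf_tonelli12 _ _ _ _ _ mu mu _ mP P0)/=.
have E (x : R) : (\int[mu]_y (C * (poissonk 1 x * poissonk 1 y))%:E = (C * pi)%:E * (poissonk 1 x)%:E)%E.
  have c0 : 0 <= C * poissonk 1 x by rewrite mulr_ge0.
  under eq_integral do rewrite mulrA EFinM.
  by rewrite (intZ mu setT _ c0) integral_poissonk// -!EFinM mulrAC.
under eq_integral do rewrite E.
have c0 : 0 <= C * pi by rewrite mulr_ge0// pi_ge0.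
by rewrite (intZ mu setT _ c0) integral_poissonk// -EFinM ltry.
Qed.

End Complex.

(** * Independence of the chosen versions *)

Section Versions.
Variable R : realType.
Local Notation mu := (leb1 R).
Local Notation mu2 := (sleb2 R).

Lemma null_slices (N : set (R * R)) : measurable N -> mu2 N = 0%E ->
  exists W : set R, [/\ measurable W, mu W = 0%E & forall x, ~ W x -> mu (xsection N x) = 0%E].
Proof.
move=> mN N0; have mS := measurable_fun_xsection mu mN.
have : (\int[mu]_x `|mu (xsection N x)| = 0)%E.
  by rewrite -[RHS]N0; apply: eq_integral => x _; rewrite gee0_abs.
move=> /(ae_eq_integral_abs mu measurableT mS) [W [mW W0 sW]].
exists W; split => // x Wx; apply: contrapT => h; apply: Wx; apply: sW => /= h1; apply: h.
exact: h1.
Qed.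

Lemma null_reflect (N : set R) (c : R) : measurable N -> mu N = 0%E ->
  measurable [set t : R | N (c - t)] /\ mu [set t : R | N (c - t)] = 0%E.
Proof.
move=> mN N0.
have mS : measurable [set t : R | N (c - t)].
  have m : measT (fun t : R => c - t) by meas.
  by rewrite -[X in measurable X]setTI; exact: m.
have E (A : set R) : measurable A -> mu A = (\int[mu]_x (\1_A x)%:E)%E.
  by move=> mA; rewrite integral_indic// -[in LHS](setIT A).
split => //; rewrite -N0 (E _ mS) (E _ mN).
rewrite -(@ge0_integral_reflect R c (fun x => (\1_N x)%:E))//.
by apply/measurable_EFinP; exact: measurable_indic.
Qed.

Lemma null_slab (N : set R) : measurable N -> mu N = 0%E ->
  measurable (N `*` [set: R]) /\ mu2 (N `*` [set: R]) = 0%E.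
Proof.
move=> mN N0; have mX : measurable (N `*` [set: R]) by apply: measurableX.
by split => //; transitivity (mu N * mu [set: R])%E; [exact: product_measure1E|rewrite N0 mul0e].
Qed.

(** This holds at every X: almost every vertical slice of N is null, and for fixed X the map (t, z)
    -> [para_arg] is a reflection in t followed, for each t, by a reflection in z. *)
Lemma Rintegral_para_null (a u : R -> R) (F F' : R * R -> R -> R) (N : set (R * R)) X :
  measurable N -> mu2 N = 0%E -> (forall Z t, ~ N Z -> F Z t = F' Z t) ->
  \int[mu]_t (a t * \int[mu]_z F (para_arg u X (t, z)) z) = \int[mu]_t (a t * \int[mu]_z F' (para_arg u X (t, z)) z).
Proof.
move=> mN N0 FF; have [W [mW W0 sW]] := null_slices mN N0.
have [mV V0] := null_reflect X.1 mW W0.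
apply: (@Rintegral_null _ _ R mu _ _ _ mV V0) => t nV; congr (_ * _).
have mS := @measurable_xsection _ _ _ _ N (X.1 - t) mN.
have [mU U0] := null_reflect (X.2 - u X.1 * t ^+ 2) mS (sW _ nV).
apply: (@Rintegral_null _ _ R mu _ _ _ mU U0) => z nU; apply: FF => NZ; apply: nU => /=.
by rewrite /xsection/= inE.
Qed.

Section Proj.
Variables (phi : R -> R) (k : int) (f : R * R -> R[i]) (fr fi : R * R -> R) (N : set (R * R)) (a u : R -> R) (X : R * R).
Let Kr t := complex.Re (LPkernel phi k t).
Let Ki t := complex.Im (LPkernel phi k t).
Hypothesis mKr : measT Kr.
Hypothesis mKi : measT Ki.
Hypothesis mfr : measT fr.
Hypothesis mfi : measT fi.
Hypothesis ma : measT a.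
Hypothesis mu_ : measT u.
Hypothesis mN : measurable N.
Hypothesis N0 : mu2 N = 0%E.
Hypothesis ffr : forall Z, ~ N Z -> complex.Re (f Z) = fr Z.
Hypothesis ffi : forall Z, ~ N Z -> complex.Im (f Z) = fi Z.

Lemma para_LPproj_Re : (para_abs a Kr u fr X < +oo)%E -> (para_abs a Ki u fi X < +oo)%E ->
  \int[mu]_t (a t * complex.Re (LPproj phi k f (X.1 - t, X.2 - u X.1 * t ^+ 2))) = para a Kr u fr X + -1 * para a Ki u fi X.
Proof.
move=> h1 h2; rewrite -(para_lin (-1) ma mKr mKi mu_ mfr mfi h1 h2).
under eq_Rintegral do rewrite LPproj_Re.
apply: (@Rintegral_para_null a u (fun Z z => complex.Re (f Z) * Kr z + -1 * (complex.Im (f Z) * Ki z))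
  (fun Z z => fr Z * Kr z + -1 * (fi Z * Ki z)) N X mN N0) => Z t nZ.
by rewrite ffr// ffi.
Qed.

Lemma para_LPproj_Im : (para_abs a Ki u fr X < +oo)%E -> (para_abs a Kr u fi X < +oo)%E ->
  \int[mu]_t (a t * complex.Im (LPproj phi k f (X.1 - t, X.2 - u X.1 * t ^+ 2))) = para a Ki u fr X + 1 * para a Kr u fi X.
Proof.
move=> h1 h2; rewrite -(para_lin 1 ma mKi mKr mu_ mfr mfi h1 h2).
under eq_Rintegral do rewrite LPproj_Im.
apply: (@Rintegral_para_null a u (fun Z z => complex.Re (f Z) * Ki z + 1 * (complex.Im (f Z) * Kr z))
  (fun Z z => fr Z * Ki z + 1 * (fi Z * Kr z)) N X mN N0) => Z t nZ.
by rewrite ffr// ffi.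
Qed.

End Proj.
End Versions.

(** * The two operators on complex functions *)

Lemma ereal_sup_poweR_le (R : realType) (I : choiceType) (i0 : I) (t : I -> R) (p : R) (b : \bar R) : 0 < p ->
  (forall i, 0 <= t i) -> (forall i, ((t i `^ p)%:E <= b)%E) -> (ereal_sup (range (fun i => (t i)%:E)) `^ p <= b)%E.
Proof.
move=> p0 t0; have tS i : ((t i)%:E <= ereal_sup (range (fun i => (t i)%:E)))%E by apply: ereal_sup_ubound; exists i.
case: b => [b||] H; last 2 first.
- exact: leey.
- by have := H i0.
have b0 : 0 <= b by have := H i0; rewrite lee_fin; apply: le_trans; exact: powR_ge0.
have Sb : (ereal_sup (range (fun i => (t i)%:E)) <= (b `^ p^-1)%:E)%E.
  apply: ge_ereal_sup => _ [i _ <-]; have <- : (t i `^ p) `^ p^-1 = t i by rewrite -powRrM mulfV ?gt_eqF// powRr1.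
  rewrite lee_fin.
  by apply: ge0_ler_powR; rewrite ?nnegrE ?powR_ge0 ?invr_ge0 ?(ltW p0)//; have := H i; rewrite lee_fin.
apply: (@le_trans _ _ ((b `^ p^-1)%:E `^ p)%E).
  apply: gt0_ler_poweR => //; rewrite ?in_itv/= ?leey ?andbT ?lee_fin ?powR_ge0//.
  - exact: ltW.
  - by apply: le_trans (tS i0); rewrite lee_fin.
by rewrite poweR_EFin lee_fin -powRrM mulVf ?gt_eqF// powRr1.
Qed.

Lemma powR_add4_le (R : realType) (a b c d p : R) : 0 <= a -> 0 <= b -> 0 <= c -> 0 <= d -> 0 <= p ->
  (a + b + (c + d)) `^ p <= 2 `^ p * 2 `^ p * (a `^ p + b `^ p + (c `^ p + d `^ p)).
Proof.
move=> a0 b0 c0 d0 p0; apply: (le_trans (powR_addr_le _ _ _)); rewrite ?addr_ge0//.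
by rewrite -mulrA ler_wpM2l ?powR_ge0// mulrDr lerD// powR_addr_le.
Qed.

Section MaxParabola.
Variable R : realType.
Local Notation mu := (leb1 R).
Local Notation mu2 := (sleb2 R).

Lemma max_parabola_ge0 u (g : R * R -> R[i]) X : (0 <= max_parabola u g X)%E.
Proof.
apply: le_trans (ereal_sup_ubound _); last by exists 0%Z.
by rewrite lee_fin mulr_ge0 ?cabs_ge0// invr_ge0 exprz_ge0.
Qed.

Lemma in_Lp2_fin (p : R) (f : R * R -> R[i]) : 0 < p -> in_Lp2 p f -> (\int[mu2]_X (cabs (f X) `^ p)%:E < +oo)%E.
Proof.
move=> p0 [_ _]; rewrite /Lpnorm2 unlock.
have -> : (\int[leb2 R]_X (`|(EFin \o (@cabs R \o f)) X| `^ p) = \int[mu2]_X (cabs (f X) `^ p)%:E)%E.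
  by apply: eq_integral => X _; rewrite /= ger0_norm ?cabs_ge0.
have : (0 <= \int[mu2]_X (cabs (f X) `^ p)%:E)%E by int_ge0.
move: (\int[mu2]_X (cabs (f X) `^ p)%:E)%E => [r||]//= _; first by move=> _; exact: ltry.
by rewrite invr_eq0 gt_eqF.
Qed.

(** After Borel versions of u and of both parts of f are chosen, each complex average is a
    combination of four real ones, and the sum of their four majorants dominates the p-th power for
    all j off one null set. A null set of x for u becomes a null slab in the plane. *)
Lemma max_parabola_Lp (A p : R) : 0 < A -> 199 / 100 < p -> exists2 C : R, 0 < C &
  forall (phi u : R -> R) (k : int) (f : R * R -> R[i]),
  (exists J, regular_pair A (fun t => complex.Re (LPkernel phi k t)) J (2 ^ k)) ->
  (exists J, regular_pair A (fun t => complex.Im (LPkernel phi k t)) J (2 ^ k)) ->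
  lebesgue_measurable mu u -> in_Lp2 p f ->
  ('N[leb2 R]_(p%:E)[max_parabola u (LPproj phi k f)] <= C%:E * Lpnorm2 p f)%E.
Proof.
move=> A0 p199; have [C C0 H] := max_para_Lp A0 p199.
have p0 : 0 < p by lra.
pose c := 2 `^ p * 2 `^ p : R; have c0 : 0 < c by rewrite mulr_gt0// powR_gt0.
pose D := c * (C + C + (C + C)); have D0 : 0 < D by rewrite mulr_gt0// !addr_gt0.
exists (D `^ p^-1); first exact: powR_gt0.
move=> phi u k f [Jr [kr _]] [Ji [ki _]] lu Lf; have If := in_Lp2_fin p0 Lf; have [lr li _] := Lf.
have [v [Nu [mv mNu Nu0 uv]]] := borel_version lu.
have [fr [Nr [mfr mNr Nr0 ffr]]] := @borel_version _ _ R mu2 _ lr.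
have [fi [Ni [mfi mNi Ni0 ffi]]] := @borel_version _ _ R mu2 _ li.
have mNf : measurable (Nr `|` Ni) by exact: measurableU.
have Nf0 : mu2 (Nr `|` Ni) = 0%E by rewrite measureU0.
have [_ cKr _ _ _] := kr; have [_ cKi _ _ _] := ki.
have mKr := continuous_meas cKr; have mKi := continuous_meas cKi.
pose I := (\int[mu2]_X (cabs (f X) `^ p)%:E)%E; rewrite -/I in If.
have Ile (g : R * R -> R) N : measurable N -> mu2 N = 0%E -> (forall X, ~ N X -> `|g X| <= cabs (f X)) ->
    (\int[mu2]_X (`|g X| `^ p)%:E <= I)%E.
  move=> mN N0 gf; apply: (@ge0_le_integral_null _ _ R mu2 N _ _ mN N0) => [X|X|X nX]; rewrite lee_fin ?powR_ge0//.
  by rewrite ge0_ler_powR ?nnegrE ?cabs_ge0 ?(ltW p0)// gf.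
have Ir : (\int[mu2]_X (`|fr X| `^ p)%:E <= I)%E by apply: (Ile _ _ mNr Nr0) => X nX; rewrite -ffr// Re_le_cabs.
have Ii : (\int[mu2]_X (`|fi X| `^ p)%:E <= I)%E by apply: (Ile _ _ mNi Ni0) => X nX; rewrite -ffi// Im_le_cabs.
have [G1 [mG1 G10 [M1 [mM1 M10 s1]] I1]] := H _ _ _ v fr kr mv mfr (le_lt_trans Ir If).
have [G2 [mG2 G20 [M2 [mM2 M20 s2]] I2]] := H _ _ _ v fi ki mv mfi (le_lt_trans Ii If).
have [G3 [mG3 G30 [M3 [mM3 M30 s3]] I3]] := H _ _ _ v fr ki mv mfr (le_lt_trans Ir If).
have [G4 [mG4 G40 [M4 [mM4 M40 s4]] I4]] := H _ _ _ v fi kr mv mfi (le_lt_trans Ii If).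
have [mS S0] := null_slab mNu Nu0.
pose G X := (c%:E * (G1 X + G2 X + (G3 X + G4 X)))%E.
pose Z := Nu `*` setT `|` (M1 `|` M2 `|` (M3 `|` M4)).
have mZ : measurable Z by apply: measurableU => //; apply: measurableU; exact: measurableU.
have Z0 : mu2 Z = 0%E.
  have n12 : mu2 (M1 `|` M2) = 0%E by rewrite measureU0.
  have n34 : mu2 (M3 `|` M4) = 0%E by rewrite measureU0.
  have n14 : mu2 (M1 `|` M2 `|` (M3 `|` M4)) = 0%E by rewrite measureU0//; exact: measurableU.
  by rewrite /Z measureU0//; apply: measurableU; exact: measurableU.
have G0 X : (0 <= G X)%E by apply: mule_ge0; [rewrite lee_fin ltW|rewrite !adde_ge0].
apply: (@Lnorm_dominated R p D _ G (@cabs R \o f) Z p0 (ltW D0) _ G0 _ mZ Z0).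
- by move=> X; exact: max_parabola_ge0.
- by move=> X; exact: cabs_ge0.
- move=> X nZ; rewrite /max_parabola; apply: (@ereal_sup_poweR_le R int 0%Z) => // j.
    by rewrite mulr_ge0 ?cabs_ge0// invr_ge0 exprz_ge0.
  have nu_ : ~ Nu X.1 by move=> h; apply: nZ; left.
  have n1 : ~ M1 X by move=> h; apply: nZ; right; left; left.
  have n2 : ~ M2 X by move=> h; apply: nZ; right; left; right.
  have n3 : ~ M3 X by move=> h; apply: nZ; right; right; left.
  have n4 : ~ M4 X by move=> h; apply: nZ; right; right; right.
  have get (P : Prop) (M : set (R * R)) (Q : set (R * R)) : ~` Q `<=` M -> ~ M X -> Q X by move=> QM nM; apply: contrapT => /QM.
  have [f1 b1] := get True _ _ s1 n1 j; have [f2 b2] := get True _ _ s2 n2 j.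
  have [f3 b3] := get True _ _ s3 n3 j; have [f4 b4] := get True _ _ s4 n4 j.
  rewrite cintegral_box (uv _ nu_).
  have nfr Y : ~ (Nr `|` Ni) Y -> complex.Re (f Y) = fr Y by move=> h; apply: ffr => h'; apply: h; left.
  have nfi Y : ~ (Nr `|` Ni) Y -> complex.Im (f Y) = fi Y by move=> h; apply: ffi => h'; apply: h; right.
  rewrite (para_LPproj_Re mKr mKi mfr mfi (@measurable_box R _) mv mNf Nf0 nfr nfi f1 f2).
  rewrite (para_LPproj_Im mKr mKi mfr mfi (@measurable_box R _) mv mNf Nf0 nfr nfi f3 f4).
  set P1 := para _ _ _ _ _ in b1 *; set P2 := para _ _ _ _ _ in b2 *.
  set P3 := para _ _ _ _ _ in b3 *; set P4 := para _ _ _ _ _ in b4 *.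
  set w := (2 ^ j)^-1 in b1 b2 b3 b4 *.
  have w0 : 0 <= w by rewrite invr_ge0 exprz_ge0.
  apply: (@le_trans _ _ (c * (`|w * P1| `^ p + `|w * P2| `^ p + (`|w * P3| `^ p + `|w * P4| `^ p)))%:E).
    rewrite lee_fin; apply: le_trans (powR_add4_le _ _ _ _ _); rewrite ?(ltW p0)//.
    apply: ge0_ler_powR; rewrite ?nnegrE ?(ltW p0)// ?addr_ge0 ?mulr_ge0 ?cabs_ge0//.
    apply: (@le_trans _ _ (w * (`|P1 + -1 * P2| + `|P3 + 1 * P4|))); first by rewrite ler_wpM2l// cabs_le.
    rewrite !normrM (ger0_norm w0) -!mulrDr ler_wpM2l// mulN1r mul1r lerD// ?ler_normD//.
    by apply: le_trans (ler_normD _ _) _; rewrite normrN.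
  have c0e : (0 <= c%:E)%E by rewrite lee_fin ltW.
  exact: (@lee_wpmul2l R c%:E c0e _ _ (leeD (leeD b1 b2) (leeD b3 b4))).
have e0 (g h : R * R -> \bar R) (b1 b2 : R) : measT g -> measT h ->
    (forall X, 0 <= g X)%E -> (forall X, 0 <= h X)%E -> 0 <= b1 -> 0 <= b2 -> (\int[mu2]_X g X <= b1%:E * I)%E ->
    (\int[mu2]_X h X <= b2%:E * I)%E -> (\int[mu2]_X (g X + h X) <= (b1 + b2)%:E * I)%E.
  move=> mg mh g0 h0 b10 b20 Ig Ih; rewrite ge0_integralD//.
  rewrite EFinD ge0_muleDl ?lee_fin//; exact: leeD.
have Cp (b : R) (g : R * R -> R) : 0 <= b -> (\int[mu2]_X (`|g X| `^ p)%:E <= I -> b%:E * \int[mu2]_X (`|g X| `^ p)%:E <= b%:E * I)%E.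
  by move=> b0 h; rewrite lee_wpmul2l ?lee_fin.
have m12 : measT (fun X => G1 X + G2 X)%E by exact: emeasurable_funD.
have m34 : measT (fun X => G3 X + G4 X)%E by exact: emeasurable_funD.
have i12 := e0 _ _ _ _ mG1 mG2 G10 G20 (ltW C0) (ltW C0) (le_trans I1 (Cp _ _ (ltW C0) Ir)) (le_trans I2 (Cp _ _ (ltW C0) Ii)).
have i34 := e0 _ _ _ _ mG3 mG4 G30 G40 (ltW C0) (ltW C0) (le_trans I3 (Cp _ _ (ltW C0) Ir)) (le_trans I4 (Cp _ _ (ltW C0) Ii)).
have CC : 0 <= C + C by rewrite addr_ge0// ltW.
have i := e0 _ _ _ _ m12 m34 (fun X => adde_ge0 (G10 X) (G20 X)) (fun X => adde_ge0 (G30 X) (G40 X)) CC CC i12 i34.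
rewrite (intZ mu2 setT _ (ltW c0)).
have -> : (D%:E = c%:E * (C + C + (C + C))%:E)%E by rewrite -EFinM.
rewrite -[leRHS]muleA; apply: lee_wpmul2l => //.
by rewrite lee_fin ltW.
Qed.

End MaxParabola.

Section HilbertParabola.
Variable R : realType.
Local Notation mu := (leb1 R).
Local Notation mu2 := (sleb2 R).

(** If the one-sided limit exists, it is reached along 1 / (n + 1). If not, [lim] takes the default
    value 0 and the zero sequence serves. *)
Lemma lim_right_approx (h : R -> R) (q : nat -> R) :
  (\forall n \near \oo, q n = h n.+1%:R^-1) ->
  exists x : nat -> R, (forall n, 0 <= x n <= `|q n|) /\ x n @[n --> \oo] --> `|lim (h e @[e --> (0 : R)^'+])|.
Proof.
move=> qh; have [ch|nh] := pselect (cvg (h e @[e --> (0 : R)^'+])); last first.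
  exists (fun _ => 0); split; first by move=> n; rewrite lexx normr_ge0.
  by rewrite (dvgP nh) /point/= normr0; exact: cvg_cst.
exists (fun n => `|q n|); split; first by move=> n; rewrite lexx normr_ge0.
apply: cvg_norm; apply: (@cvg_trans _ (h n.+1%:R^-1 @[n --> \oo])).
  by apply: near_eq_cvg; apply: filterS qh => n ->.
move: ch => /cvg_at_rightP; apply; split; first by move=> n; rewrite invr_gt0.
exact: cvg_harmonic.
Qed.

Lemma measurable_para (a K u : R -> R) (f : R * R -> R) : measT a -> measT K ->
  measT u -> measT f -> measT (para a K u f).
Proof.
move=> ma mK mu_ mf; apply: (@meas_Rint _ _ _ _ _ mu2 (fun X w => a w.1 * (f (para_arg u X w) * K w.2))).
exact: measurable_para_fun.
Qed.

(** The truncations at 1 / (n + 1) are uniformly bounded in Lp, and their lower limit dominates the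
    principal value, whether or not the limit exists; Fatou concludes. *)
Lemma hilbert_parabola_Lp (A p : R) : 0 < A -> 199 / 100 < p -> exists2 C : R, 0 < C &
  forall (phi u : R -> R) (k : int) (f : R * R -> R[i]),
  (exists J, regular_pair A (fun t => complex.Re (LPkernel phi k t)) J (2 ^ k)) ->
  (exists J, regular_pair A (fun t => complex.Im (LPkernel phi k t)) J (2 ^ k)) ->
  lebesgue_measurable mu u -> schwartz f ->
  (Lpnorm2 p (hilbert_parabola u (LPproj phi k f)) <= C%:E * Lpnorm2 p f)%E.
Proof.
move=> A0 p199; have [C C0 H] := para_trunc_Lp A0 p199.
have p0 : 0 < p by lra.
pose c := 2 `^ p : R; have c0 : 0 < c by rewrite powR_gt0.
pose D := c * (c * (C + C) + c * (C + C)); have D0 : 0 < D by rewrite !(mulr_gt0, addr_gt0).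
exists (D `^ p^-1); first exact: powR_gt0.
move=> phi u k f [Jr rr] [Ji ri] lu [sr si].
have [kr _] := rr; have [ki _] := ri.
have [v [Nu [mv mNu Nu0 uv]]] := borel_version lu.
pose fr z := complex.Re (f z); pose fi z := complex.Im (f z).
have [Br nr] : exists B, nice fr B by exact: schwartz_nice.
have [Bi ni] : exists B, nice fi B by exact: schwartz_nice.
have [mfr _ _] := nr; have [mfi _ _] := ni.
have [s0 cKr _ bKr _] := kr; have [_ cKi _ bKi _] := ki.
have mKr := continuous_meas cKr; have mKi := continuous_meas cKi.
pose s : R := 2 ^ k; rewrite -/s in s0 bKr bKi.
pose Kr t := complex.Re (LPkernel phi k t); pose Ki t := complex.Im (LPkernel phi k t).
have Kb (K : R -> R) : (forall t, `|K t| <= A * poissonk s t) -> forall t, `|K t| <= A * s.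
  by move=> h t; apply: le_trans (h t) _; rewrite ler_wpM2l ?(ltW A0)// poissonk_le.
have Krb := Kb Kr bKr; have Kib := Kb Ki bKi.
pose I := (\int[mu2]_X (cabs (f X) `^ p)%:E)%E.
have I0 : (0 <= I)%E by int_ge0.
have Ile (g : R * R -> R) : (forall X, `|g X| <= cabs (f X)) -> (\int[mu2]_X (`|g X| `^ p)%:E <= I)%E.
  move=> gf; apply: le_int0 => X; rewrite ?lee_fin ?powR_ge0//.
  by rewrite ge0_ler_powR ?nnegrE ?cabs_ge0 ?(ltW p0)// gf.
have Ir : (\int[mu2]_X (`|fr X| `^ p)%:E <= I)%E by apply: Ile => X; exact: Re_le_cabs.
have Ii : (\int[mu2]_X (`|fi X| `^ p)%:E <= I)%E by apply: Ile => X; exact: Im_le_cabs.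
pose r n : R := n.+1%:R^-1.
have r0 n : 0 < r n by rewrite invr_gt0.
(* At each X the cut-off condition is satisfied for all large n, so [T] is eventually the true
   truncation there ([cond] below). *)
pose T (K : R -> R) (g : R * R -> R) n X :=
  if (v X.1 == 0) || (r n < para_radius s v X.1) then para (trunc_inv (r n)) K v g X else 0.
have mrad : measT (fun X : R * R => para_radius s v X.1).
  by have mvX := measurableT_comp mv (@measurable_fst _ _ R R); rewrite /para_radius; meas.
have mT K g n : measT K -> measT g -> measT (T K g n).
  move=> mK mg; have mP := measurable_para (@measurable_trunc_inv R (r n)) mK mv mg.
  by have mvX := measurableT_comp mv (@measurable_fst _ _ R R); rewrite /T; meas.
have IT (K J : R -> R) g B n : regular_pair A K J s -> nice g B -> (\int[mu2]_X (`|g X| `^ p)%:E <= I)%E ->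
    (\int[mu2]_X (`|T K g n X| `^ p)%:E <= C%:E * I)%E.
  move=> rp ng Ig; apply: le_trans (H K J s (r n) v g B rp mv ng (r0 n)) _.
  by apply: lee_wpmul2l => //; rewrite lee_fin ltW.
pose a n X := T Kr fr n X + -1 * T Ki fi n X; pose b n X := T Ki fr n X + 1 * T Kr fi n X.
have ma n : measT (a n).
  have h1 := mT Kr fr n mKr mfr; have h2 := mT Ki fi n mKi mfi; by rewrite /a; meas.
have mb n : measT (b n).
  have h1 := mT Ki fr n mKi mfr; have h2 := mT Kr fi n mKr mfi; by rewrite /b; meas.
have C00 := ltW C0.
have Ia n : (\int[mu2]_X (`|a n X| `^ p)%:E <= (c * (C + C))%:E * I)%E.
  apply: (@Lp_add_le _ _ R mu2 p C C I _ (T Kr fr n) (T Ki fi n) p0 C00 C00 I0 (mT _ _ _ mKr mfr) (mT _ _ _ mKi mfi) _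
    (IT _ _ _ _ n rr nr Ir) (IT _ _ _ _ n ri ni Ii)) => X.
  by rewrite /a mulN1r; apply: le_trans (ler_normD _ _) _; rewrite normrN.
have Ib n : (\int[mu2]_X (`|b n X| `^ p)%:E <= (c * (C + C))%:E * I)%E.
  apply: (@Lp_add_le _ _ R mu2 p C C I _ (T Ki fr n) (T Kr fi n) p0 C00 C00 I0 (mT _ _ _ mKi mfr) (mT _ _ _ mKr mfi) _
    (IT _ _ _ _ n ri nr Ir) (IT _ _ _ _ n rr ni Ii)) => X.
  by rewrite /b mul1r; exact: ler_normD.
pose S n X := `|a n X| + `|b n X|.
have mS n : measT (S n).
  by apply: measurable_funD; apply: measurableT_comp => //; exact: normr_measurable.
have CC : 0 <= c * (C + C) by rewrite mulr_ge0 ?addr_ge0// ltW.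
have IS n : (\int[mu2]_X (`|S n X| `^ p)%:E <= D%:E * I)%E.
  apply: (@Lp_add_le _ _ R mu2 p _ _ I _ (a n) (b n) p0 CC CC I0 (ma n) (mb n) _ (Ia n) (Ib n)) => X.
  by rewrite /S ger0_norm ?addr_ge0.
have [mSl Sl0] := null_slab mNu Nu0.
pose G X := limn_einf (fun n => (`|S n X| `^ p)%:E).
have G0 X : (0 <= G X)%E by apply: limn_einf_ge; apply: nearW => n; rewrite lee_fin powR_ge0.
have IG : (\int[mu2]_X G X <= D%:E * I)%E.
  have mSp n : measT (fun X => (`|S n X| `^ p)%:E).
    by have mSn := mS n; apply/measurable_EFinP; meas.
  have S0 n X : (0 <= (`|S n X| `^ p)%:E)%E by rewrite lee_fin powR_ge0.
  exact: (@fatou_le _ _ R mu2 _ G _ mSp S0 IS G0 (fun X => lexx _)).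
pose hp := hilbert_parabola u (LPproj phi k f).
apply: (@Lnorm_dominated R p D (EFin \o (@cabs R \o hp)) G (@cabs R \o f) _ p0 (ltW D0) _ G0 _ mSl Sl0 _ IG).
- by move=> X; rewrite lee_fin cabs_ge0.
- by move=> X; exact: cabs_ge0.
move=> X nX; have nuX : ~ Nu X.1 by move=> h; apply: nX.
have trE e : 0 < e -> hilbert_trunc u (LPproj phi k f) X e =
    Complex (para (trunc_inv e) Kr v fr X + -1 * para (trunc_inv e) Ki v fi X)
            (para (trunc_inv e) Ki v fr X + 1 * para (trunc_inv e) Kr v fi X).
  move=> e0; have mt := @measurable_trunc_inv R e; have tb t := trunc_inv_bound t e0.
  rewrite /hilbert_trunc cintegral_trunc (uv _ nuX).
  have m0 : mu2 set0 = 0%E by exact: measure0.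
  rewrite (para_LPproj_Re mKr mKi mfr mfi mt mv (@measurable0 _ _) m0 (fun _ _ => erefl) (fun _ _ => erefl)
    (para_abs_nice X nr mt mKr mv tb Krb) (para_abs_nice X ni mt mKi mv tb Kib)).
  by rewrite (para_LPproj_Im mKr mKi mfr mfi mt mv (@measurable0 _ _) m0 (fun _ _ => erefl) (fun _ _ => erefl)
    (para_abs_nice X nr mt mKi mv tb Kib) (para_abs_nice X ni mt mKr mv tb Krb)).
have cond : \forall n \near \oo, (v X.1 == 0) || (r n < para_radius s v X.1).
  have [v0|v0] := boolP (v X.1 == 0); first exact: nearW.
  have rad : 0 < para_radius s v X.1 by rewrite para_radius_gt0.
  near=> n; apply/orP; right; near: n.
  by have := @cvg_harmonic R => /cvgr_lt /(_ _ rad).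
have [x [x0 xc]] : exists x : nat -> R, (forall n, 0 <= x n <= `|a n X|) /\ x n @[n --> \oo] --> `|complex.Re (hp X)|.
  apply: lim_right_approx; apply: filterS cond => n cn.
  by rewrite trE// /a /T cn.
have [y [y0 yc]] : exists x : nat -> R, (forall n, 0 <= x n <= `|b n X|) /\ x n @[n --> \oo] --> `|complex.Im (hp X)|.
  apply: lim_right_approx; apply: filterS cond => n cn.
  by rewrite trE// /b /T cn.
have -> : ((EFin \o (@cabs R \o hp)) X `^ p = (cabs (hp X) `^ p)%:E)%E by exact: poweR_EFin.
apply: (@le_trans _ _ ((`|complex.Re (hp X)| + `|complex.Im (hp X)|) `^ p)%:E).
  by rewrite lee_fin ge0_ler_powR ?nnegrE ?cabs_ge0 ?addr_ge0 ?(ltW p0)// cabs_le.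
have xy0 n : 0 <= x n + y n by have /andP[? _] := x0 n; have /andP[? _] := y0 n; rewrite addr_ge0.
apply: (le_trans (powR_limn_einf p0 _ xy0 (cvgD xc yc))); first by rewrite addr_ge0.
apply: lee_limn_einf => n; rewrite lee_fin ge0_ler_powR ?nnegrE ?(ltW p0)//.
have /andP[_ h1] := x0 n; have /andP[_ h2] := y0 n.
by rewrite /S ger0_norm ?addr_ge0// lerD.
Unshelve. all: by end_near. Qed.

End HilbertParabola.

Theorem theorem1p1 (R : realType) (phi0 : R -> R) (hphi0 : LPbump phi0) :
  exists p0 : R, 1 < p0 < 2 /\
  forall p : R, p0 < p ->
  exists C : R, 0 < C /\
  forall u : R -> R, lebesgue_measurable (leb1 R) u ->
  forall k : int,
    (forall f : R * R -> R[i], in_Lp2 p f ->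
       ('N[leb2 R]_(p%:E)[max_parabola u (LPproj phi0 k f)]
          <= C%:E * Lpnorm2 p f)%E) /\
    (forall f : R * R -> R[i], schwartz f ->
       (Lpnorm2 p (hilbert_parabola u (LPproj phi0 k f))
          <= C%:E * Lpnorm2 p f)%E).
Proof.
(* The threshold is the one under which the interpolation in [Top_Lp_lt2] keeps a negative power of
   lam. *)
exists (199 / 100); split; first by lra.
move=> p p199; have [A A0 HA] := LPkernel_regular hphi0.
have [C1 C10 H1] := max_parabola_Lp A0 p199; have [C2 C20 H2] := hilbert_parabola_Lp A0 p199.
exists (C1 + C2); split; first exact: addr_gt0.
move=> u lu k; have [Jr Ji] := HA k; split => f hf.
  apply: le_trans (H1 phi0 u k f Jr Ji lu hf) _.
  by apply: lee_wpmul2r; [exact: Lnorm_ge0|rewrite lee_fin lerDl ltW].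
apply: le_trans (H2 phi0 u k f Jr Ji lu hf) _.
by apply: lee_wpmul2r; [exact: Lnorm_ge0|rewrite lee_fin lerDr ltW].
Qed.
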